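(* Let $d\ge2$, let $\omega\subset\mathbb R^{d-1}$ be a bounded connected open set with Lipschitz boundary, and let $\Omega_\varepsilon=\omega\times(0,\varepsilon)$. Let $s_\varepsilon\in(0,1)$ with $s_\varepsilon\to s_0\in(1/2,1)$ as $\varepsilon\to0$. Then $$\Gamma\text{-}\lim_{\varepsilon\to0}\frac1{\varepsilon^{3-2s_\varepsilon}}\int_{\Omega_\varepsilon\times\Omega_\varepsilon}\frac{|u(x)-u(y)|^2}{|x-y|^{d+2s_\varepsilon}}\,dx\,dy=\frac1{1-s_0}K_{s_0,d}\int_\omega|\nabla'u|^2\,dx'$$ for all $u\in H^1(\omega)$, where the $\Gamma$-limit is computed with respect to the dimension-reduction convergence in $L^1_{\rm loc}$, and $$K_{s,d}=\frac1{(3-2s)(d-1)}\int_{\mathbb R^{d-1}}\frac{|\xi'|^2}{(1+|\xi'|^2)^{\frac d2+s}}\,d\xi' .$$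
   Context: Points of $\mathbb R^d$ are written $x=(x',x_d)$ with $x'\in\mathbb R^{d-1}$; $\nabla'$ is the gradient in $x'$. $H^s(\Omega)$, $s\in(0,1)$, is the set of $u\in L^2(\Omega)$ with $\int_{\Omega\times\Omega}\frac{|u(x)-u(y)|^2}{|x-y|^{d+2s}}dx\,dy<+\infty$; the functionals are defined on $H^{s_\varepsilon}(\Omega_\varepsilon)$. Dimension-reduction convergence in $L^1_{\rm loc}$: functions $u_\varepsilon$ on $\Omega_\varepsilon$ converge to $u$ defined on $\omega$ if the scaled functions $v_\varepsilon(x',x_d)=u_\varepsilon(x',\varepsilon x_d)$ converge in $L^1_{\rm loc}(\omega\times(0,1))$ to a function $v$ independent of $x_d$, with $u(x')=v(x')$. $\Gamma$-limit: $\Gamma$-$\lim_{\varepsilon\to0}G_\varepsilon=G$ at $u$ with respect to this convergence means that for every sequence $\varepsilon_j\to0^+$: (i) $G(u)\le\liminf_jG_{\varepsilon_j}(u_{\varepsilon_j})$ whenever $u_{\varepsilon_j}\in H^{s_{\varepsilon_j}}(\Omega_{\varepsilon_j})$ converge to $u$; (ii) there exist $u_{\varepsilon_j}\in H^{s_{\varepsilon_j}}(\Omega_{\varepsilon_j})$ converging to $u$ with $\limsup_jG_{\varepsilon_j}(u_{\varepsilon_j})\le G(u)$. *)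

(* Defs.v *)
From HB Require Import structures.
From mathcomp Require Import all_boot all_order all_algebra.
From mathcomp Require Import all_classical all_reals all_analysis.

Set Implicit Arguments.
Unset Strict Implicit.
Unset Printing Implicit Defensive.
Import Order.TTheory GRing.Theory Num.Theory.
Import numFieldNormedType.Exports.
Local Open Scope classical_set_scope.
Local Open Scope ring_scope.

(* The sigma-algebra on R^n generated by the coordinates (= Borel sets), as
   for n.-tuple. *)
Section measurable_rV.
Context {R : realType} {n : nat}.

Definition coord_rV (i : 'I_n) (x : 'rV[R]_n) : R := x ord0 i.

Let rV_set0 : g_sigma_preimage coord_rV set0.
Proof. exact: sigma_algebra0. Qed.

Let rV_setC A : g_sigma_preimage coord_rV A -> g_sigma_preimage coord_rV (~` A).
Proof. exact: sigma_algebraC. Qed.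

Let rV_bigcup (F : _^nat) : (forall i, g_sigma_preimage coord_rV (F i)) ->
  g_sigma_preimage coord_rV (\bigcup_i (F i)).
Proof. exact: sigma_algebra_bigcup. Qed.

HB.instance Definition _ :=
  @isMeasurable.Build (measure_tuple_display default_measure_display)
    'rV[R]_n (g_sigma_preimage coord_rV) rV_set0 rV_setC rV_bigcup.

End measurable_rV.

Section measurable_rV_theory.
Context {R : realType}.

Lemma measurable_coord_rV n (i : 'I_n) :
  measurable_fun [set: 'rV[R]_n] (coord_rV i).
Proof.
move=> _ Y mY; rewrite setTI; apply: sub_sigma_algebra => /=.
rewrite -bigcup_seq/=; exists i => /=; first by rewrite mem_index_enum.
by exists Y => //; rewrite setTI.
Qed.

Lemma measurable_fun_rVP d (T : measurableType d) n (f : T -> 'rV[R]_n) :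
  (forall i, measurable_fun [set: T] (coord_rV i \o f)) ->
  measurable_fun [set: T] f.
Proof.
move=> mf _ A mA; rewrite setTI.
suff : g_sigma_preimage (@coord_rV R n)
    `<=` [set B | measurable (f @^-1` B)] by exact.
apply: smallest_sub.
  split => /=.
  - by rewrite preimage_set0.
  - by move=> B mB; rewrite setTD preimage_setC; exact: measurableC.
  - by move=> F mF; rewrite preimage_bigcup; exact: bigcup_measurable.
elim/big_ind : _ => //; first by move=> B C hB hC D [/hB|/hC].
move=> i _ B [C mC <-] /=; rewrite setTI.
by have := mf i measurableT _ mC; rewrite setTI.
Qed.

(* (x', x_d) |-> x in R^(n+1). *)
Definition snoc_rV n (p : 'rV[R]_n * measurableTypeR R) : 'rV[R]_n.+1 :=
  \row_i oapp (p.1 ord0) p.2 (unlift ord_max i).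

Definition unsnoc_rV n (x : 'rV[R]_n.+1) : 'rV[R]_n * measurableTypeR R :=
  (\row_i x ord0 (lift ord_max i), x ord0 ord_max).

Lemma snoc_rVK n : cancel (@snoc_rV n) (@unsnoc_rV n).
Proof.
move=> [x t]; rewrite /unsnoc_rV /snoc_rV; congr pair.
  by apply/rowP => i; rewrite !mxE liftK.
by rewrite mxE unlift_none.
Qed.

Lemma unsnoc_rVK n : cancel (@unsnoc_rV n) (@snoc_rV n).
Proof.
move=> x; apply/rowP => i; rewrite /unsnoc_rV /snoc_rV !mxE.
by case: unliftP => [j ->|->] /=; rewrite ?mxE.
Qed.

Lemma measurable_snoc_rV n : measurable_fun setT (@snoc_rV n).
Proof.
apply: measurable_fun_rVP => i.
have -> : coord_rV i \o @snoc_rV n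
    = fun p => oapp (p.1 ord0) p.2 (unlift ord_max i).
  by apply/funext => p; rewrite /= /coord_rV mxE.
case: unlift => [j|] /=.
  exact: (measurableT_comp (measurable_coord_rV j) measurable_fst).
exact: measurable_snd.
Qed.

Lemma measurable_unsnoc_rV n : measurable_fun setT (@unsnoc_rV n).
Proof.
apply: measurable_fun_pair.
  apply: measurable_fun_rVP => i.
  have -> : coord_rV i \o (fun x : 'rV[R]_n.+1 => \row_i x ord0 (lift ord_max i))
      = coord_rV (lift ord_max i).
    by apply/funext => x; rewrite /= /coord_rV mxE.
  exact: measurable_coord_rV.
exact: (measurable_coord_rV ord_max).
Qed.

End measurable_rV_theory.

Lemma sigma_finite_product d1 d2 (T1 : measurableType d1)
    (T2 : measurableType d2) (R : realType)
    (m1 : {sigma_finite_measure set T1 -> \bar R})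
    (m2 : {sigma_finite_measure set T2 -> \bar R}) :
  sigma_finite setT (m1 \x m2)%E.
Proof.
have /sigma_finiteP[F [TF ndF Foo]] := sigma_finiteT m1.
have /sigma_finiteP[G [TG ndG Goo]] := sigma_finiteT m2.
exists (fun n => F n `*` G n).
  rewrite -setXTT TF TG predeqE => -[x y]; split.
    move=> [/= [n _ Fnx] [k _ Gky]]; exists (maxn n k) => //; split.
    - by move: x Fnx; exact/subsetPset/ndF/leq_maxl.
    - by move: y Gky; exact/subsetPset/ndG/leq_maxr.
  by move=> [n _ []/= ? ?]; split; exists n.
move=> k; have [? ?] := Foo k; have [? ?] := Goo k.
split; first exact: measurableX.
by rewrite product_measure1E// lte_mul_pinfty// ge0_fin_numE.
Qed.

Section sigma_finite_measure_of.
Context d (T : measurableType d) (R : realType) (mu : {measure set T -> \bar R}).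
Hypothesis sf : sigma_finite setT mu.

Let nu : set T -> \bar R := mu.
#[local] HB.instance Definition _ := Measure.on nu.
#[local] HB.instance Definition _ := @Measure_isSigmaFinite.Build _ _ _ nu sf.

Lemma sigma_finite_measure_of :
  {nu : {sigma_finite_measure set T -> \bar R} | (mu : set T -> \bar R) = nu}.
Proof. by exists nu. Qed.

End sigma_finite_measure_of.

(* Lebesgue measure on R^n, as the n-fold product of the one on R. *)
Section lebesgue_rV.
Context {R : realType}.

Fixpoint lebesgue_rV (n : nat) : set 'rV[R]_n -> \bar R :=
  match n return set 'rV[R]_n -> \bar R with
  | 0 => \d_(0 : 'rV[R]_0)
  | n'.+1 => pushforward (@lebesgue_rV n' \x @lebesgue_measure R)%E (@snoc_rV R n')
  end.
Arguments lebesgue_rV : clear implicits.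

Let lebesgue_rV_sigma_finite_measure n :
  {mu : {sigma_finite_measure set 'rV[R]_n -> \bar R} | lebesgue_rV n = mu}.
Proof.
elim: n => [|n [mu IHn]]; first by exists \d_(0 : 'rV[R]_0).
pose nu := (mu \x @lebesgue_measure R)%E.
pose m0 : {measure set 'rV[R]_n.+1 -> \bar R} :=
  measure_function_pushforward__canonical__measure_function_Measure
    nu (@measurable_snoc_rV R n).
pose m := pushforward nu (@snoc_rV R n).
have sf : sigma_finite setT m.
  have [F UF mF] := sigma_finite_product mu (@lebesgue_measure R).
  exists (fun k => @unsnoc_rV R n @^-1` F k).
    by rewrite -preimage_bigcup -UF preimage_setT.
  move=> k; have [mFk Fkoo] := mF k; split.
    by rewrite -[X in measurable X]setTI; exact: measurable_unsnoc_rV.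
  rewrite /m /pushforward -comp_preimage.
  suff -> : @unsnoc_rV R n \o @snoc_rV R n = id by [].
  by apply/funext => x; exact: snoc_rVK.
have [S mS] := sigma_finite_measure_of (mu := m0) sf.
by exists S; rewrite /= IHn -mS.
Qed.

Let lebesgue_rVE n : lebesgue_rV n = sval (lebesgue_rV_sigma_finite_measure n).
Proof. exact: (svalP (lebesgue_rV_sigma_finite_measure n)). Qed.

Let lebesgue_rV0 n : lebesgue_rV n set0 = 0%E.
Proof. by rewrite lebesgue_rVE measure0. Qed.

Let lebesgue_rV_ge0 n A : (0 <= lebesgue_rV n A)%E.
Proof. by rewrite lebesgue_rVE measure_ge0. Qed.

Let lebesgue_rV_semi_sigma_additive n : semi_sigma_additive (lebesgue_rV n).
Proof. by rewrite lebesgue_rVE; exact: measure_semi_sigma_additive. Qed.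

HB.instance Definition _ n := isMeasure.Build _ _ _ (lebesgue_rV n)
  (lebesgue_rV0 n) (@lebesgue_rV_ge0 n) (@lebesgue_rV_semi_sigma_additive n).

Let sigma_finite_lebesgue_rV n : sigma_finite setT (lebesgue_rV n).
Proof. by rewrite lebesgue_rVE; exact: sigma_finiteT. Qed.

HB.instance Definition _ n := @Measure_isSigmaFinite.Build _ _ _ (lebesgue_rV n)
  (sigma_finite_lebesgue_rV n).

End lebesgue_rV.
Arguments lebesgue_rV : clear implicits.

(* R^d as R^(d-1) x R, x = (x', x_d), meant for d >= 1; the last factor is the
   alias of R that carries lebesgue_measure. *)
Notation Rsplit R d := ('rV[R]_d.-1 * measurableTypeR R)%type.

Section lebesgue_split.
Context (R : realType) (d : nat).

Definition lebesgue_split : set (Rsplit R d) -> \bar R :=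
  (lebesgue_rV R d.-1 \x @lebesgue_measure R)%E.

HB.instance Definition _ := Measure.on lebesgue_split.

HB.instance Definition _ := @Measure_isSigmaFinite.Build _ _ _ lebesgue_split
  (sigma_finite_product (lebesgue_rV R d.-1) (@lebesgue_measure R)).

End lebesgue_split.
Arguments lebesgue_split : clear implicits.

(* The library norm on 'rV[R]_n and on products is the sup norm;
   |x| is Euclidean here. *)
Section euclidean.
Context {R : realType}.

Definition dot n (x y : 'rV[R]_n) : R := \sum_(i < n) x ord0 i * y ord0 i.

Definition enorm n (x : 'rV[R]_n) : R := Num.sqrt (dot x x).

Definition enorm_split d (z : Rsplit R d) : R :=
  Num.sqrt (dot z.1 z.1 + z.2 ^+ 2).

End euclidean.

Section function_spaces.
Context {d} {T : measurableType d} {R : realType}.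
Variables (mu : {measure set T -> \bar R}) (D : set T).

(* Only the restriction of u to D matters. *)
Definition L2 (u : T -> R) :=
  measurable_fun D u /\ (\int[mu]_(x in D) (u x ^+ 2)%:E < +oo)%E.

End function_spaces.

Section sobolev.
Context {R : realType} {n : nat}.
Implicit Types (omega : set 'rV[R]_n) (u phi : 'rV[R]_n -> R).
Implicit Types g : 'rV[R]_n -> 'rV[R]_n.

Definition partial (i : 'I_n) phi : 'rV[R]_n -> R :=
  fun x => 'D_(delta_mx ord0 i) phi x.

(* C^oo: all iterated partial derivatives exist and are continuous. *)
Definition smooth phi := forall s : seq 'I_n,
  continuous (foldr partial phi s) /\
  forall i x, derivable (foldr partial phi s) x (delta_mx ord0 i).

Definition test_function omega phi :=
  [/\ smooth phi, compact (closure [set x | phi x != 0]) &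
      closure [set x | phi x != 0] `<=` omega].

(* g is the distributional gradient of u on omega, and is square integrable. *)
Definition is_L2_gradient omega u g :=
  (forall i, L2 (lebesgue_rV R n) omega (fun x => g x ord0 i)) /\
  forall phi, test_function omega phi -> forall i,
    \int[lebesgue_rV R n]_(x in omega) (u x * partial i phi x) =
    - \int[lebesgue_rV R n]_(x in omega) (g x ord0 i * phi x).

Definition H1 omega u :=
  L2 (lebesgue_rV R n) omega u /\ exists g, is_L2_gradient omega u g.

(* Any representative: the gradient is unique almost everywhere on omega. *)
Definition weak_gradient omega u : 'rV[R]_n -> 'rV[R]_n :=
  get (is_L2_gradient omega u).

Definition dirichlet omega u : \bar R :=
  (\int[lebesgue_rV R n]_(x in omega)
     (enorm (weak_gradient omega u x) ^+ 2)%:E)%E.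

(* Near each boundary point, omega is, for some unit vector e, the strict
   epigraph in direction e of a Lipschitz function defined on the hyperplane
   orthogonal to e. *)
Definition lipschitz_boundary omega :=
  forall x0, (closure omega `\` omega°) x0 ->
  exists (e : 'rV[R]_n) (gamma : 'rV[R]_n -> R),
    [/\ enorm e = 1,
        [lipschitz gamma y | y in [set y | dot y e = 0]] &
        \forall x \near x0, omega x <-> gamma (x - dot x e *: e) < dot x e].

End sobolev.

Section fractional.
Context {R : realType} {d : nat}.
Let mu := lebesgue_split R d.
Implicit Types (Omega K : set (Rsplit R d)) (u v : Rsplit R d -> R) (s : R).

Definition gagliardo s Omega u : \bar R :=
  (\int[mu \x mu]_(p in Omega `*` Omega)
    (`|u p.1 - u p.2| ^+ 2 /
      enorm_split (p.1 - p.2) `^ (d%:R + 2 * s))%:E)%E.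

Definition Hs s Omega u := L2 mu Omega u /\ (gagliardo s Omega u < +oo)%E.

Definition L1loc Omega u := measurable_fun Omega u /\
  forall K, K `<=` Omega -> compact K -> (\int[mu]_(z in K) `|u z|%:E < +oo)%E.

Definition L1loc_cvg Omega (v_ : nat -> Rsplit R d -> R) v :=
  [/\ forall j, L1loc Omega (v_ j), L1loc Omega v &
    forall K, K `<=` Omega -> compact K ->
      (\int[mu]_(z in K) `|v_ j z - v z|%:E)%E @[j --> \oo] --> 0%E].

Definition thin (omega : set 'rV[R]_d.-1) (eps : R) : set (Rsplit R d) :=
  omega `*` `]0, eps[.

Definition rescale (eps : R) u : Rsplit R d -> R := fun z => u (z.1, eps * z.2).

Definition dimred_cvg (omega : set 'rV[R]_d.-1) (eps : nat -> R)
    (u_ : nat -> Rsplit R d -> R) (u : 'rV[R]_d.-1 -> R) :=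
  L1loc_cvg (thin omega 1) (fun j => rescale (eps j) (u_ j)) (fun z => u z.1).

End fractional.


Definition Kconst {R : realType} (s : R) (d : nat) : \bar R :=
  (((3 - 2 * s) * d.-1%:R)^-1%:E *
   \int[lebesgue_rV R d.-1]_xi
     (enorm xi ^+ 2 / (1 + enorm xi ^+ 2) `^ (d%:R / 2 + s))%:E)%E.

(* The Gamma-limit as eps -> 0^+ of the functionals G eps, defined on X eps, is
   l at u, for the convergence conv eps_ u_ u of u_ j in X (eps_ j) to u. *)
Definition gamma_limit_at {R : realType} {S T : Type} (X : R -> S -> Prop)
    (G : R -> S -> \bar R) (conv : (nat -> R) -> (nat -> S) -> T -> Prop)
    (u : T) (l : \bar R) :=
  forall eps : nat -> R, (forall j, 0 < eps j) -> eps j @[j --> \oo] --> 0 ->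
  (forall u_ : nat -> S, (forall j, X (eps j) (u_ j)) -> conv eps u_ u ->
     (l <= limn_einf (fun j => G (eps j) (u_ j)))%E) /\
  (exists u_ : nat -> S, [/\ forall j, X (eps j) (u_ j), conv eps u_ u &
     (limn_esup (fun j => G (eps j) (u_ j)) <= l)%E]).

(* Main.v *)
From HB Require Import structures.
Require Import Defs.
From mathcomp Require Import finmap.
From mathcomp Require Import all_boot all_order all_algebra.
From mathcomp Require Import all_classical all_reals all_analysis.
From mathcomp Require Import measurable_realfun perm ring lra.

Set Implicit Arguments.
Unset Strict Implicit.
Unset Printing Implicit Defensive.
Import Order.TTheory GRing.Theory Num.Theory.
Import numFieldNormedType.Exports.
Local Open Scope classical_set_scope.
Local Open Scope ring_scope.

(** Why the limit holds.  Write d = n + 1.  After the change of variables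
    x_d = eps t the energy is
      eps^(2s-1) int_0^1 int_0^1 E_(eps |t-u|) (v_t, v_u) dt du,
      E_r (a, b) = int_omega int_omega |a x - b y|^2 / (|x-y|^2 + r^2)^(d/2+s),
    where v_t is the slice of the function at height t ([energy_layer]).  When r
    is small the kernel lives at the scale |x-y| ~ r, it is isotropic, and its
    second moment is r^(1-2s) I(s) with I(s) = int |xi|^2/(1+|xi|^2)^(d/2+s).  So
    for a regular function w of x',
      E_r (w, w) ~ r^(1-2s) (I(s)/n) int |grad w|^2.
    With r = eps |t-u| the powers of eps cancel, and the heights contribute
      int_0^1 int_0^1 |t-u|^(1-2s) = 2 / ((2-2s)(3-2s)) = 1 / ((1-s)(3-2s)),
    which together with I(s)/n is K/(1-s).  The moments used are finite because
    s > 1/2, and this integral over the heights is finite because s < 1.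

    Lower bound.  Let Phi be a compactly supported smooth field and integrate
      |a x - b y|^2 >= 2 (a x - b y) p - p^2,   p = Phi(x).(x-y),
    against the kernel ([slice_ge_calib]).  The term in a vanishes because the
    kernel is even; Taylor expansion of Phi turns the term in b into the integral
    of - b div Phi, which is linear in b.  Convergence of the slices to u in L^1 on
    compact sets is therefore enough to reach
      - 2 int u div Phi - int |Phi|^2 = 2 int grad u . Phi - int |Phi|^2
    ([slice_lower], [energy_lower], [liminf_calib]).  Since the test functions are
    dense in L^2 ([approximable_L2]), the supremum over Phi is int |grad u|^2
    ([liminf_dirichlet]).

    Upper bound.  The recovery functions do not depend on the height.  For
    functions with a quadratic Taylor remainder, uniform up to the boundary, the
    asymptotics of E_r above holds as an upper bound ([energy_upper]), and such
    functions are dense in H^1 ([H1_approx_pair]): near a boundary point the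
    Lipschitz condition provides a cone of directions pointing into omega
    ([inward_cone_boundary]), and mollifying with a bump supported in that cone
    only uses values of u inside omega; cut-offs glue the local approximations.
    A diagonal choice concludes ([recovery_sequence]). *)

(** * Borel sets and Lebesgue measure on row vectors *)

Section rV_measure.
Context {R : realType}.
Implicit Types n : nat.

Lemma ler_coord_norm n (x : 'rV[R]_n) i : `|x ord0 i| <= `|x|.
Proof.
rewrite {2}/Num.norm /= mx_normrE.
exact: (le_bigmax_cond _ (fun i => `|x i.1 i.2|) (j := (ord0, i))).
Qed.

Lemma ltr_norm_rV n (x : 'rV[R]_n) (e : R) : 0 < e ->
  (`|x| < e) <-> (forall i, `|x ord0 i| < e).
Proof.
move=> e0; split=> [xe i|xe]; first exact: le_lt_trans (ler_coord_norm x i) xe.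
rewrite /Num.norm /= mx_normrE; apply/bigmax_ltP; split=> // -[i j] _ /=.
by rewrite ord1.
Qed.

Lemma ler_norm_rV n (x : 'rV[R]_n) (e : R) : 0 <= e ->
  (`|x| <= e) <-> (forall i, `|x ord0 i| <= e).
Proof.
move=> e0; split=> [xe i|xe]; first exact: le_trans (ler_coord_norm x i) xe.
rewrite /Num.norm /= mx_normrE; apply/bigmax_leP; split=> // -[i j] _ /=.
by rewrite ord1.
Qed.

Definition box n (A : 'I_n -> set R) : set 'rV[R]_n :=
  [set x | forall i, A i (x ord0 i)].

Lemma boxE n (A : 'I_n -> set R) :
  box A = \big[setI/setT]_(i < n) (@coord_rV R n i @^-1` A i).
Proof.
rewrite -bigcap_seq; apply/seteqP; split=> [x xA i _|x xA i]; first exact: xA.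
by apply: (xA i); rewrite /= mem_index_enum.
Qed.

Lemma measurable_box n (A : 'I_n -> set R) :
  (forall i, measurable (A i)) -> measurable (box A).
Proof.
move=> mA; rewrite boxE; apply: bigsetI_measurable => i _.
by rewrite -[X in measurable X]setTI; exact: measurable_coord_rV.
Qed.

(** Induction on the dimension, splitting off the last coordinate. *)
Lemma lebesgue_rV_box n (A : 'I_n -> set R) : (forall i, measurable (A i)) ->
  lebesgue_rV R n (box A) = (\prod_(i < n) lebesgue_measure (A i))%E.
Proof.
elim: n A => [|n IHn] A mA.
  by rewrite big_ord0 /= diracE mem_set// => -[].
rewrite big_ord_recr /= /pushforward.
have -> : @snoc_rV R n @^-1` box A =
    box (fun i => A (widen_ord (leqnSn n) i)) `*` A ord_max.
  apply/seteqP; split=> [[x t] /= xA|[x t] [/= xA tA]].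
    split; last by have := xA ord_max; rewrite /snoc_rV mxE unlift_none.
    move=> i; have := xA (lift ord_max i).
    rewrite /snoc_rV mxE liftK /=; congr (A _ _); apply: val_inj => /=.
    by rewrite /bump leqNgt ltn_ord.
  move=> i; rewrite /snoc_rV mxE; case: unliftP => [j ->|->] //=.
  have := xA j; congr (A _ _); apply: val_inj => /=.
  by rewrite /bump leqNgt ltn_ord.
rewrite product_measure1E//; first by congr (_ * _)%E; apply: IHn.
  by apply: measurable_box => i; exact: mA.
exact: mA.
Qed.

Lemma box_setI n (A B : 'I_n -> set R) :
  box A `&` box B = box (fun i => A i `&` B i).
Proof.
apply/seteqP; split=> [x [xA xB] i|x xAB]; first by split.
by split=> i; have [] := xAB i.
Qed.

Definition boxes n : set (set 'rV[R]_n) :=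
  [set B | exists2 A : 'I_n -> set R, (forall i, measurable (A i)) & B = box A].

Lemma setI_closed_boxes n : setI_closed (@boxes n).
Proof.
move=> _ _ [A mA ->] [B mB ->]; exists (fun i => A i `&` B i).
  by move=> i; exact: measurableI.
exact: box_setI.
Qed.

Lemma measurable_boxes n : @measurable _ 'rV[R]_n = <<s @boxes n >>.
Proof.
apply/seteqP; split; last first.
  apply: smallest_sub; first exact: sigma_algebra_measurable.
  by move=> _ [A mA ->]; exact: measurable_box.
apply: smallest_sub; first exact: smallest_sigma_algebra.
move=> B; rewrite -bigcup_seq /= => -[i _] [C mC <-] /=.
apply: sub_sigma_algebra; exists (fun j => if j == i then C else setT).
  by move=> j; case: ifP.
rewrite setTI; apply/seteqP; split=> [x xC j|x xC] /=.
  by case: eqVneq => // ->.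
by have := xC i; rewrite eqxx.
Qed.

(** The boxes form a pi-system that generates the sigma-algebra and exhausts the
    space by sets of finite measure. *)
Lemma rV_measure_unique n (m : {measure set 'rV[R]_n -> \bar R}) :
  (forall A : 'I_n -> set R, (forall i, measurable (A i)) ->
     m (box A) = \prod_(i < n) lebesgue_measure (A i))%E ->
  forall B, measurable B -> lebesgue_rV R n B = m B.
Proof.
move=> mE; pose g k := box (fun _ : 'I_n => `]- k%:R, k%:R]%classic : set R).
apply: (measure_unique (@boxes n) g) => //.
- exact: measurable_boxes.
- exact: setI_closed_boxes.
- by move=> k; exists (fun=> `]- k%:R, k%:R]%classic).
- apply/seteqP; split=> // x _.
  exists (Num.truncn (`|x|)).+1 => // i /=; rewrite in_itv /=.
  have xi : `|x ord0 i| < (Num.truncn `|x|).+1%:R.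
    exact: le_lt_trans (ler_coord_norm x i) (truncnS_gt _).
  by move: xi; rewrite ltr_norml => /andP[-> /ltW].
- by move=> _ [A mA ->]; rewrite mE//; exact: lebesgue_rV_box.
- move=> k; rewrite [X in (X < _)%E](lebesgue_rV_box (A := fun=> `]- k%:R, k%:R]%classic))//.
  rewrite (eq_bigr (fun=> (k%:R + k%:R)%:E)) => [|i _]; last first.
    by rewrite lebesgue_measure_itv/= lte_fin opprK -EFinD; case: ltP => // /(le_trans _) kk; congr EFin; apply/eqP; rewrite eq_le addr_ge0//= ; move: (kk k%:R (lexx _)) (ler0n R k); lra.
  by rewrite prodEFin ltry.
Qed.

Lemma ball_rVE n (x : 'rV[R]_n) (e : R) : 0 < e ->
  ball x e = box (fun i => ball (x ord0 i) e).
Proof.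
move=> e0; rewrite -ball_normE; apply/seteqP; split=> y /=.
  by move/(ltr_norm_rV _ e0) => xy i; have := xy i; rewrite !mxE -ball_normE.
by move=> xy; apply/(ltr_norm_rV _ e0) => i; have := xy i; rewrite !mxE -ball_normE.
Qed.

Lemma measurable_ball_rV n (x : 'rV[R]_n) (e : R) : measurable (ball x e).
Proof.
have [e0|e0] := ltP 0 e.
  by rewrite ball_rVE//; apply: measurable_box => i; exact: measurable_ball.
have -> : ball x e = set0; last exact: measurable0.
by apply/seteqP; split=> // y; rewrite -ball_normE /= => /(le_lt_trans (normr_ge0 _)); rewrite ltNge e0.
Qed.

Lemma rat_approx_rV n (x : 'rV[R]_n) (e : R) : 0 < e ->
  exists q : 'rV[rat]_n, ball x e (map_mx ratr q).
Proof.
move=> e0; have h i : exists q : rat, ball (x ord0 i) e (ratr q).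
  have [y [xy [q _ qE]]] := @dense_rat R (ball (x ord0 i) e)
    (ex_intro _ _ (ballxx _ e0)) (ball_open _ _).
  by exists q; rewrite qE.
pose q i := sval (cid (h i)); exists (\row_i q i).
by rewrite ball_rVE// => i; rewrite !mxE; exact: svalP (cid (h i)).
Qed.

(** Second countability in the form used for Borel sets: an open set is the
    countable union of the balls with centre in a countable dense family and
    radius 1/(k+1) that it contains. *)
Lemma open_countable_union (T : pseudoMetricType R) (I : countType)
    (c : I -> T) (M : set (set T)) (U : set T) :
    (forall x (e : R), 0 < e -> exists i, ball x e (c i)) ->
    (forall x (e : R), 0 < e -> M (ball x e)) -> M set0 ->
    (forall F : nat -> set T, (forall k, M (F k)) -> M (\bigcup_k F k)) ->
  open U -> M U.
Proof.
move=> dc Mb M0 MU oU.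
pose F k := if unpickle k is Some (i, m) then
  (if `[< ball (c i) (m.+1%:R^-1 : R) `<=` U >]
   then ball (c i) (m.+1%:R^-1 : R) else set0) else (set0 : set T).
have -> : U = \bigcup_k F k.
  apply/seteqP; split=> [x Ux|x [k _]]; last first.
    by rewrite /F; case: unpickle => // -[i m]; case: asboolP => // h; exact: h.
  have /nbhs_ballP[e /= e0 eU] := open_nbhs_nbhs (conj oU Ux).
  pose m := Num.truncn (e / 2)^-1.
  have me : (m.+1%:R^-1 : R) < e / 2.
    rewrite -[ltRHS]invrK ltf_pV2 ?posrE ?invr_gt0 ?divr_gt0//.
    exact: truncnS_gt.
  have m0 : 0 < (m.+1%:R^-1 : R) by rewrite invr_gt0.
  have [i xi] := dc x _ m0; exists (pickle (i, m)) => //.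
  rewrite /F pickleK; case: asboolP; first by move=> _; exact: ball_sym.
  case; move=> y iy; apply: eU.
  apply: (le_ball _ (ball_triangle xi iy)).
  by move: me; set z := m.+1%:R^-1; rewrite ltr_pdivlMr// mulr_natr mulr2n => /ltW.
apply: MU => k; rewrite /F; case: unpickle => // -[i m].
by case: asboolP => // _; apply: Mb; rewrite invr_gt0.
Qed.

Lemma open_measurable_rV n (U : set 'rV[R]_n) : open U -> measurable U.
Proof.
pose T : pseudoMetricType R := 'rV[R]_n.
apply: (@open_countable_union T 'rV[rat]_n (map_mx ratr)
  (@measurable _ 'rV[R]_n)) => //.
- exact: rat_approx_rV.
- by move=> x e _; exact: measurable_ball_rV.
- by move=> F mF; exact: bigcup_measurable.
Qed.

Lemma closed_measurable_rV n (U : set 'rV[R]_n) : closed U -> measurable U.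
Proof.
by move=> cU; rewrite -[U]setCK; apply: measurableC; apply: open_measurable_rV;
  exact: closed_openC.
Qed.

Lemma open_measurable_rVM n (U : set ('rV[R]_n * measurableTypeR R)) :
  open U -> measurable U.
Proof.
pose T : pseudoMetricType R := ('rV[R]_n * measurableTypeR R)%type.
apply: (@open_countable_union T ('rV[rat]_n * rat)%type (fun q => (map_mx ratr q.1, ratr q.2))
  (@measurable _ ('rV[R]_n * measurableTypeR R)%type)) => //.
- move=> [x t] e e0; have [q xq] := rat_approx_rV x e0.
  have [y [tr [r _ rE]]] := @dense_rat R (ball t e)
    (ex_intro _ _ (ballxx _ e0)) (ball_open _ _).
  by exists (q, r); split => //=; rewrite rE.
- move=> [x t] e _.
  have -> : ball (x, t) e = ball x e `*` (ball t e : set (measurableTypeR R)).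
    by apply/seteqP; split=> -[].
  by apply: measurableX; [exact: measurable_ball_rV|exact: measurable_ball].
- by move=> F mF; exact: bigcup_measurable.
Qed.

Lemma closed_measurable_rVM n (U : set ('rV[R]_n * measurableTypeR R)) :
  closed U -> measurable U.
Proof.
by move=> cU; rewrite -[U]setCK; apply: measurableC; apply: open_measurable_rVM;
  exact: closed_openC.
Qed.

Lemma continuous_measurable_rV n (f : 'rV[R]_n -> R) :
  continuous f -> measurable_fun setT f.
Proof.
move=> cf; apply: (measurability _ (RGenOInfty.measurableE R)) => //.
move=> _ [_ [a ->] <-]; rewrite setTI; apply: open_measurable_rV.
by apply: open_comp => [x _|]; [exact: cf|exact: rray_open].
Qed.

(** ** Affine changes of variables *)

Lemma lebesgue_measure_affine (a b : R) (A : set R) : a != 0 -> measurable A ->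
  lebesgue_measure ((fun t : measurableTypeR R => a * t + b) @^-1` A) =
  (`|a|^-1%:E * lebesgue_measure A)%E.
Proof.
have pos c : 0 < c -> measurable A ->
  lebesgue_measure ((fun t : measurableTypeR R => c * t + b) @^-1` A) =
  (c^-1%:E * lebesgue_measure A)%E.
  move=> c0 mA.
  pose f := fun t : measurableTypeR R => (c * t + b : measurableTypeR R).
  have mf : measurable_fun setT f.
    by apply: measurable_funD => //; apply: measurable_funM.
  pose c' := NngNum (ltW c0).
  pose m0 : {measure set (measurableTypeR R) -> \bar R} :=
    measure_function_pushforward__canonical__measure_function_Measure
      (@lebesgue_measure R) mf.
  rewrite (@lebesgue_measure_unique R (mscale c' m0) _ A)//=.
    by rewrite /mscale /= /pushforward muleA -EFinM mulVf ?gt_eqF// mul1e.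
  move=> _ [[x y] _ <-] /=; rewrite /mscale /= /pushforward.
  have -> : f @^-1` `]x, y] = `](x - b) / c, (y - b) / c]%classic.
    apply/seteqP; split=> t /=; rewrite !in_itv /= /f ltr_pdivrMr// ler_pdivlMr//;
      by move=> /andP[? ?]; apply/andP; split; rewrite ?(ltrBlDr,lerBrDr) mulrC// ; lra.
  rewrite !lebesgue_measure_itv /= !lte_fin ltr_pM2r ?invr_gt0// ltrD2r.
  case: ifP => // xy; last by rewrite mule0.
  by rewrite -!EFinD -EFinM; congr EFin; field; rewrite gt_eqF.
move=> a0 mA; have [ap|an] := ltP 0 a; first by rewrite pos// gtr0_norm.
have an' : a < 0 by rewrite lt_neqAle a0.
rewrite ltr0_norm// -pos// ?oppr_gt0// -[LHS]lebesgue_measureN//.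
  rewrite /pushforward; congr (lebesgue_measure _).
  by apply/seteqP; split=> t /=; rewrite mulNr mulrN.
rewrite -[X in measurable X]setTI.
by apply: (measurable_funD (measurable_funM _ _) _) => //.
Qed.

Definition affine_rV n (s : {perm 'I_n}) (a b : 'I_n -> R) (x : 'rV[R]_n) :
  'rV[R]_n := \row_i (a i * x ord0 (s i) + b i).

Lemma measurable_affine_rV n (s : {perm 'I_n}) (a b : 'I_n -> R) :
  measurable_fun setT (affine_rV s a b).
Proof.
apply: measurable_fun_rVP => i.
have -> : coord_rV i \o affine_rV s a b = fun x => a i * coord_rV (s i) x + b i.
  by apply/funext => x; rewrite /= /coord_rV mxE.
apply: measurable_funD => //; apply: measurable_funM => //.
exact: measurable_coord_rV.
Qed.

(** Both sides are measures in [A]; on a box the claim reduces to the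
    one-dimensional one. *)
Lemma lebesgue_affine_rV n (s : {perm 'I_n}) (a b : 'I_n -> R) (A : set 'rV[R]_n) :
  (forall i, a i != 0) -> measurable A ->
  lebesgue_rV R n (affine_rV s a b @^-1` A) =
  ((\prod_i `|a i|)^-1%:E * lebesgue_rV R n A)%E.
Proof.
move=> a0 mA; set p := \prod_i _.
have p0 : 0 < p by apply: prodr_gt0 => i _; rewrite normr_gt0.
pose p' := NngNum (ltW p0).
pose m0 : {measure set 'rV[R]_n -> \bar R} :=
    measure_function_pushforward__canonical__measure_function_Measure
      (lebesgue_rV R n) (measurable_affine_rV s a b).
rewrite (@rV_measure_unique n (mscale p' m0) _ A)//=.
  by rewrite /mscale /= /pushforward muleA -EFinM mulVf ?gt_eqF// mul1e.
move=> B mB; rewrite /mscale /= /pushforward.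
pose C j := (fun t => a ((s^-1)%g j) * t + b ((s^-1)%g j)) @^-1` B ((s^-1)%g j).
have mC j : measurable (C j).
  rewrite -[X in measurable X]setTI.
  by apply: (measurable_funD (measurable_funM _ _) _) => //.
have -> : affine_rV s a b @^-1` box B = box C.
  apply/seteqP; split=> x /= xB i.
    by have := xB ((s^-1)%g i); rewrite /C /= mxE permKV.
  by have := xB (s i); rewrite /C /= mxE permK.
rewrite lebesgue_rV_box// (reindex_inj (@perm_inj _ s)) /=.
have -> : (\prod_(j < n) lebesgue_measure (C (s j)) =
  \prod_(j < n) ((`|a j|^-1)%:E * lebesgue_measure (B j)))%E.
  by apply: eq_bigr => j _; rewrite /C permK lebesgue_measure_affine.
rewrite big_split /= prodEFin muleA -EFinM.
rewrite -/p /p -big_split /= big1 ?mul1e// => i _.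
by rewrite mulfV// normr_eq0.
Qed.

(** One change of variables for the translations, dilations, reflections and
    transpositions. *)
Lemma ge0_integral_affine_rV n (s : {perm 'I_n}) (a b : 'I_n -> R) (f : 'rV[R]_n -> \bar R) :
  (forall i, a i != 0) -> measurable_fun setT f -> (forall x, 0 <= f x)%E ->
  (\int[lebesgue_rV R n]_x f (affine_rV s a b x) =
   (\prod_i `|a i|)^-1%:E * \int[lebesgue_rV R n]_x f x)%E.
Proof.
move=> a0 mf f0.
rewrite -(@ge0_integral_pushforward _ _ _ _ _ _ (measurable_affine_rV s a b)
  (lebesgue_rV R n) setT f)//.
have p0 : 0 <= (\prod_i `|a i|)^-1 by rewrite invr_ge0 prodr_ge0.
transitivity (\int[mscale (NngNum p0) (lebesgue_rV R n)]_x f x)%E.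
  apply: eq_measure_integral => [|mas A mA _]; first exact: measurable_affine_rV.
  by rewrite /= /mscale /= -(lebesgue_affine_rV s b).
by rewrite ge0_integral_mscale.
Qed.
End rV_measure.

(** * Functions with a quadratic Taylor remainder *)

Section taylor.
Context {R : realType} {n : nat}.
Implicit Types (D : set 'rV[R]_n) (f g : 'rV[R]_n -> R).
Implicit Types (p q : 'I_n -> 'rV[R]_n -> R).

Definition lin (a : 'I_n -> R) (h : 'rV[R]_n) : R := \sum_i a i * h ord0 i.

Lemma linD a b h : lin (fun i => a i + b i) h = lin a h + lin b h.
Proof. by rewrite /lin -big_split; apply: eq_bigr => i _; rewrite mulrDl. Qed.

Lemma linZ c a h : lin (fun i => c * a i) h = c * lin a h.
Proof. by rewrite /lin big_distrr; apply: eq_bigr => i _; rewrite -mulrA. Qed.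

Lemma ler_lin (C : R) a h : (forall i, `|a i| <= C) ->
  `|lin a h| <= n%:R * C * `|h|.
Proof.
move=> aC; apply: le_trans (ler_norm_sum _ _ _) _.
have -> : n%:R * C * `|h| = \sum_(i < n) C * `|h|.
  by rewrite sumr_const card_ord -mulrA mulr_natl.
apply: ler_sum => i _; rewrite normrM ler_pM// ?normr_ge0//.
exact: ler_coord_norm.
Qed.

Definition taylor_rem D f p (C : R) := forall x y, D x -> D y ->
  `|f y - f x - lin (p^~ x) (y - x)| <= C * `|y - x| ^+ 2.

Definition taylor1 D f p := [/\ measurable_fun D f,
  forall i, measurable_fun D (p i) &
  exists2 C : R, 0 <= C & [/\ forall x i, D x -> `|p i x| <= C,
    forall x y, D x -> D y -> `|f y - f x| <= C * `|y - x| &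
    taylor_rem D f p C]].

Definition bounded_on D f := exists2 C : R, 0 <= C & forall x, D x -> `|f x| <= C.

(** Bounded functions with a bounded gradient and a remainder that is uniformly
    quadratic.  The remainder is estimated for all pairs in [D], even when the
    segment between them leaves [D]; this makes the class an algebra over any
    domain. *)
Definition taylor2 D f p := taylor1 D f p /\ bounded_on D f.

Lemma taylor2_measurable D f p : taylor2 D f p -> measurable_fun D f.
Proof. by case=> -[]. Qed.

Lemma taylor2W D E f p : measurable D -> E `<=` D -> taylor2 D f p ->
  measurable E -> taylor2 E f p.
Proof.
move=> mD ED [[mf mp [C C0 [h1 h2 h3]]] [B B0 hB]] mE; split.
  split; first exact: measurable_funS mf.
    by move=> i; exact: measurable_funS (mp i).
  exists C => //; split.
  - by move=> x i /ED; exact: h1.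
  - by move=> x y /ED Dx /ED Dy; exact: h2.
  - by move=> x y /ED Dx /ED Dy; exact: h3.
by exists B => // x /ED; exact: hB.
Qed.

Lemma taylor1_coord D i : measurable D ->
  taylor1 D (fun x => x ord0 i) (fun j _ => (j == i)%:R).
Proof.
move=> mD; split; first exact: (measurable_funTS (measurable_coord_rV i)).
  by move=> j; exact: measurable_cst.
exists 1 => //; split.
- by move=> x j _; case: eqP => _; rewrite ?normr1 ?normr0.
- by move=> x y _ _; rewrite mul1r; have := ler_coord_norm (y - x) i; rewrite !mxE.
- move=> x y _ _; rewrite /lin (bigD1 i)//= eqxx /= mul1r big1 => [|j /negPf ->].
    by rewrite addr0 !mxE mul1r subrr normr0 sqr_ge0.
  by rewrite mul0r.
Qed.

Lemma taylor2_cst D c : measurable D -> taylor2 D (fun=> c) (fun _ _ => 0).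
Proof.
move=> mD; split; last by exists `|c|.
split; first exact: measurable_cst.
  by move=> i; exact: measurable_cst.
exists 0 => //; split.
- by move=> x i _; rewrite normr0.
- by move=> x y _ _; rewrite subrr normr0 mul0r.
- by move=> x y _ _; rewrite /lin big1 ?subrr ?subr0 ?normr0 ?mul0r// => i _; rewrite mul0r.
Qed.

Lemma taylor1_add D f p g q : taylor1 D f p -> taylor1 D g q ->
  taylor1 D (fun x => f x + g x) (fun i x => p i x + q i x).
Proof.
move=> [mf mp [A A0 [pA lA rA]]] [mg mq [B B0 [qB lB rB]]]; split.
- exact: measurable_funD.
- by move=> i; exact: measurable_funD.
- exists (A + B); first exact: addr_ge0.
  split.
  + by move=> x i Dx; apply: le_trans (ler_normD _ _) _; rewrite lerD ?pA ?qB.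
  + move=> x y Dx Dy; rewrite opprD addrACA mulrDl.
    by apply: le_trans (ler_normD _ _) _; rewrite lerD ?lA ?lB.
  + move=> x y Dx Dy; rewrite linD mulrDl.
    have -> : f y + g y - (f x + g x) - (lin (p^~ x) (y - x) + lin (q^~ x) (y - x))
      = (f y - f x - lin (p^~ x) (y - x)) + (g y - g x - lin (q^~ x) (y - x)) by ring.
    by apply: le_trans (ler_normD _ _) _; rewrite lerD ?rA ?rB.
Qed.

Lemma taylor2_add D f p g q : taylor2 D f p -> taylor2 D g q ->
  taylor2 D (fun x => f x + g x) (fun i x => p i x + q i x).
Proof.
move=> [tf [A A0 fA]] [tg [B B0 gB]]; split; first exact: taylor1_add.
exists (A + B); first exact: addr_ge0.
by move=> x Dx; apply: le_trans (ler_normD _ _) _; rewrite lerD ?fA ?gB.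
Qed.

(** The remainder of a product is made of the two remainders and of the product
    of the two increments, which is itself quadratic. *)
Lemma taylor2_mul D f p g q : taylor2 D f p -> taylor2 D g q ->
  taylor2 D (fun x => f x * g x) (fun i x => f x * q i x + g x * p i x).
Proof.
move=> [[mf mp [A A0 [pA lA rA]]] [A' A'0 fA]] [[mg mq [B B0 [qB lB rB]]] [B' B'0 gB]].
have bnd (a b c d : R) : `|a| <= c -> `|b| <= d -> `|a * b| <= c * d.
  by move=> ac bd; rewrite normrM ler_pM.
split; last first.
  by exists (A' * B'); [exact: mulr_ge0|move=> x Dx; apply: bnd; [exact: fA|exact: gB]].
have C0 : 0 <= A' * B + B' * A by apply: addr_ge0; exact: mulr_ge0.
split.
- exact: measurable_funM.
- by move=> i; apply: measurable_funD; exact: measurable_funM.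
- exists (A' * B + B' * A + A * B); first by rewrite addr_ge0// mulr_ge0.
  split.
  + move=> x i Dx; apply: (@le_trans _ _ (A' * B + B' * A)).
      by apply: le_trans (ler_normD _ _) _; rewrite lerD// bnd ?fA ?gB ?pA ?qB.
    by rewrite lerDl mulr_ge0.
  + move=> x y Dx Dy.
    have -> : f y * g y - f x * g x = f y * (g y - g x) + g x * (f y - f x) by ring.
    apply: (@le_trans _ _ ((A' * B + B' * A) * `|y - x|)).
      apply: le_trans (ler_normD _ _) _; rewrite mulrDl -!mulrA.
      by rewrite lerD// bnd ?fA ?gB ?lA ?lB.
    by rewrite ler_wpM2r// lerDl mulr_ge0.
  + move=> x y Dx Dy; rewrite linD !linZ.
    have -> : f y * g y - f x * g x -
        (f x * lin (q^~ x) (y - x) + g x * lin (p^~ x) (y - x)) =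
      f x * (g y - g x - lin (q^~ x) (y - x)) +
      g x * (f y - f x - lin (p^~ x) (y - x)) + (f y - f x) * (g y - g x) by ring.
    have -> : (A' * B + B' * A + A * B) * `|y - x| ^+ 2 = A' * (B * `|y - x| ^+ 2) +
      B' * (A * `|y - x| ^+ 2) + A * `|y - x| * (B * `|y - x|) by ring.
    apply: le_trans (ler_normD _ _) _; apply: lerD.
      by apply: le_trans (ler_normD _ _) _; rewrite lerD// bnd ?fA ?gB ?rA ?rB.
    by apply: bnd; [exact: lA|exact: lB].
Qed.

(** For distant points, where the quadratic remainder is of no help, the
    Lipschitz estimate follows from the bound on [F]. *)
Lemma taylor2_comp D f p (F F' : R -> R) (C : R) : taylor1 D f p -> 0 <= C ->
  measurable_fun setT F -> measurable_fun setT F' ->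
  (forall x, D x -> `|F (f x)| <= C) -> (forall x, D x -> `|F' (f x)| <= C) ->
  (forall u v, `|F v - F u - F' u * (v - u)| <= C * (v - u) ^+ 2) ->
  taylor2 D (fun x => F (f x)) (fun i x => F' (f x) * p i x).
Proof.
move=> [mf mp [A A0 [pA lA rA]]] C0 mF mF' FC F'C FrC.
split; last by exists C.
have bnd (a b c d : R) : `|a| <= c -> `|b| <= d -> `|a * b| <= c * d.
  by move=> ac bd; rewrite normrM ler_pM.
have rem x y : D x -> D y ->
   `|F (f y) - F (f x) - lin (fun i => F' (f x) * p i x) (y - x)| <=
   (C * A ^+ 2 + C * A) * `|y - x| ^+ 2.
  move=> Dx Dy; rewrite linZ.
  have -> : F (f y) - F (f x) - F' (f x) * lin (p^~ x) (y - x) =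
    (F (f y) - F (f x) - F' (f x) * (f y - f x)) +
     F' (f x) * (f y - f x - lin (p^~ x) (y - x)) by ring.
  have -> : (C * A ^+ 2 + C * A) * `|y - x| ^+ 2 = C * (A * `|y - x|) ^+ 2 +
    C * (A * `|y - x| ^+ 2) by ring.
  apply: le_trans (ler_normD _ _) _; apply: lerD.
    apply: le_trans (FrC _ _) _; rewrite ler_wpM2l//.
    by rewrite -real_normK ?num_real// ler_sqr ?nnegrE ?mulr_ge0//; exact: lA.
  by apply: bnd; [exact: F'C|exact: rA].
have CA0 : 0 <= C * A ^+ 2 + C * A by rewrite addr_ge0// mulr_ge0// exprn_ge0.
split.
- exact: measurableT_comp.
- by move=> i; apply: measurable_funM => //; exact: measurableT_comp.
- have CA : 0 <= n%:R * (C * A) by rewrite !mulr_ge0.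
  exists (n%:R * (C * A) + (C * A ^+ 2 + C * A) + 2 * C).
    by rewrite !addr_ge0// ?mulr_ge0.
  split.
  + move=> x i Dx; apply: (@le_trans _ _ (C * A)); first by rewrite bnd ?F'C ?pA.
    by have := mulr_ge0 C0 (exprn_ge0 2 A0); move: CA C0; lra.
  + move=> x y Dx Dy.
    have [h1|h1] := leP `|y - x| 1.
      have -> : F (f y) - F (f x) =
        (F (f y) - F (f x) - lin (fun i => F' (f x) * p i x) (y - x)) +
        lin (fun i => F' (f x) * p i x) (y - x) by ring.
      apply: le_trans (ler_normD _ _) _.
      apply: (@le_trans _ _ ((C * A ^+ 2 + C * A) * `|y - x| + (n%:R * (C * A)) * `|y - x|)).
        apply: lerD.
          apply: le_trans (rem _ _ Dx Dy) _.
          by rewrite ler_wpM2l// expr2 ler_piMr.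
        by apply: ler_lin => i; rewrite bnd ?F'C ?pA.
      rewrite -mulrDl ler_wpM2r//; lra.
    apply: (@le_trans _ _ (2 * C)).
      apply: le_trans (ler_normB _ _) _; rewrite mulr_natl mulr2n lerD ?FC//.
    apply: (@le_trans _ _ (2 * C * `|y - x|)); first by rewrite ler_peMr ?mulr_ge0// ltW.
    rewrite ler_wpM2r//; lra.
  + move=> x y Dx Dy; apply: le_trans (rem x y Dx Dy) _.
    by rewrite ler_wpM2r ?exprn_ge0//; move: C0 CA; lra.
Qed.

Lemma taylor2_scale D f p c : measurable D -> taylor2 D f p ->
  taylor2 D (fun x => c * f x) (fun i x => c * p i x).
Proof.
move=> mD tf; have := taylor2_mul (taylor2_cst c mD) tf.
by congr taylor2; apply/funext => i; apply/funext => x; rewrite mulr0 addr0.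
Qed.

Lemma taylor2_derivable f p : taylor2 setT f p -> forall x i,
  derivable f x (delta_mx ord0 i) /\ partial i f x = p i x.
Proof.
move=> [[_ _ [C C0 [_ _ rC]]] _] x i; set v := delta_mx ord0 i.
have lv (h : R) : lin (p^~ x) (h *: v) = h * p i x.
  rewrite /lin (bigD1 i)//= big1 => [|j ji]; rewrite !mxE.
    by rewrite !eqxx addr0 mulr1 mulrC.
  by rewrite eqxx (negPf ji) !mulr0.
have vn : `|v| <= 1.
  by apply/ler_norm_rV => // j; rewrite !mxE; case: (_ && _); rewrite ?normr1 ?normr0.
have cv : (fun h : R => h^-1 *: ((f \o shift x) (h *: v) - f x) : R^o) @ (0:R)^' --> (p i x : R^o).
  apply/cvgrPdist_le => e e0; near=> h.
  have h0 : h != 0 by near: h; exact: nbhs_dnbhs_neq.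
  have := rC x (h *: v + x) I I; rewrite addrK lv => rh.
  have -> : p i x - h^-1 *: ((f \o shift x) (h *: v) - f x) =
     - h^-1 * (f (h *: v + x) - f x - h * p i x).
    by rewrite /= /GRing.scale /=; field.
  rewrite normrM normrN normfV mulrC ler_pdivrMr ?normr_gt0//.
  apply: le_trans rh _; rewrite normrZ.
  apply: (@le_trans _ _ (C * `|h| ^+ 2)).
    by rewrite ler_wpM2l// ler_sqr ?nnegrE ?mulr_ge0// ler_piMr.
  rewrite expr2 mulrA ler_wpM2r//.
  apply: (@le_trans _ _ ((C + 1) * `|h|)); first by rewrite ler_wpM2r// lerDl.
  rewrite mulrC -ler_pdivlMr ?ltr_wpDl//.
  near: h; apply: (@dnbhs0_le R R^o); by rewrite divr_gt0// ltr_wpDl.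
split; first by apply/cvg_ex; exists (p i x).
by apply: cvg_lim.
Unshelve. all: by end_near. Qed.

Lemma taylor2_continuous f p : taylor2 setT f p -> continuous f.
Proof.
move=> [[_ _ [C C0 [_ lC _]]] _] x.
have FF : Filter (nbhs x) := nbhs_filter x.
have C1 : 0 < C + 1 by rewrite ltr_wpDl.
apply/(@cvgrPdist_le _ R^o _ (nbhs x) FF) => e e0.
near=> y; rewrite distrC; apply: le_trans (lC x y I I) _.
have Ce : 0 < e / (C + 1) by rewrite divr_gt0// ltr_wpDl.
rewrite (distrC y x).
apply: (@le_trans _ _ ((C + 1) * `|x - y|)); first by rewrite ler_wpM2r// lerDl.
rewrite mulrC -ler_pdivlMr ?ltr_wpDl//.
near: y; apply/nbhs_ballP; exists (e / (C + 1)) => [|z] /=; first by rewrite divr_gt0.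
by rewrite -ball_normE /= => /ltW.
Unshelve. all: by end_near. Qed.
End taylor.

(** * Smooth functions from exp(-1/x) *)

Section flat.
Context {R : realType}.
Implicit Types P Q : {poly R}.

(** [P(1/x) exp(-1/x)] on the positive half-line, extended by 0.  With an arbitrary
    polynomial in front the family is stable under derivation, so that every
    derivative of [exp(-1/x)] is handled by the same lemmas. *)
Definition flat P (x : R) : R := if 0 < x then P.[x^-1] * expR (- x^-1) else 0.

Lemma exprn_le_fact_expR k (y : R) : 0 <= y -> y ^+ k <= k`!%:R * expR y.
Proof.
move=> y0; have f0 : 0 < (k`!%:R : R) by rewrite ltr0n fact_gt0.
rewrite mulrC -ler_pdivrMr//; case: k f0 => [|k] f0.
  by rewrite expr0 fact0 divr1; apply: le_trans (expR_ge1Dx y); rewrite lerDl.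
by apply: le_trans (expR_ge1Dxn k y0); rewrite lerDr.
Qed.

Lemma flat_bounded P : exists2 C, 0 <= C & forall x, `|flat P x| <= C.
Proof.
exists (\sum_(i < size P) `|P`_i| * i`!%:R).
  by apply: sumr_ge0 => i _; rewrite mulr_ge0.
move=> x; rewrite /flat; case: ifPn => [x0|_]; last first.
  by rewrite normr0; apply: sumr_ge0 => i _; rewrite mulr_ge0.
have y0 : 0 <= x^-1 by rewrite invr_ge0 ltW.
rewrite horner_coef mulr_suml; apply: le_trans (ler_norm_sum _ _ _) _.
apply: ler_sum => i _; rewrite -mulrA normrM ler_wpM2l// ger0_norm.
  by rewrite expRN ler_pdivrMr ?expR_gt0// exprn_le_fact_expR.
by rewrite mulr_ge0 ?exprn_ge0 ?expR_ge0.
Qed.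

(** Since the derivative of [P(1/x) exp(-1/x)] is
    [(1/x)^2 (P(1/x) - P'(1/x)) exp(-1/x)]. *)
Definition flat' P : {poly R} := 'X^2 * (P - P^`()).

Lemma is_derive_flat P (x : R) : is_derive x 1 (flat P) (flat (flat' P) x).
Proof.
case: (ltgtP 0 x) => x0.
- have xn0 : x != 0 by rewrite gt_eqF.
  have dV : is_derive x (1:R) (fun y : R => y^-1) (- x ^- 2).
    rewrite -[- _]mulr1; exact: is_deriveV.
  have dH : is_derive x^-1 (1:R) (horner P) (P^`()).[x^-1].
    rewrite derivE derive1E; apply: DeriveDef => //; exact: derivable_horner.
  have d1 := @is_derive1_comp _ (horner P) _ x _ _ dH dV.
  have dN : is_derive x (1:R) (fun y : R => - y^-1) (x ^- 2).
    by rewrite -[x ^- 2]opprK; exact: is_deriveN.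
  have d2 := @is_derive1_comp _ expR _ x _ _ (is_derive_expR _) dN.
  have d3 := is_deriveM d1 d2.
  have -> : flat (flat' P) x = (horner P \o (fun y => y^-1)) x *: (expR (- x^-1) * x ^- 2) +
      (expR \o (fun y => - y^-1)) x *: ((P^`()).[x^-1] * - x ^- 2).
    rewrite /flat x0 /flat' !hornerE /= /GRing.scale /=.
    by rewrite -exprVn; ring.
  apply: near_eq_is_derive d3.
  near=> y; rewrite /flat ifT//; near: y.
  exact: lt_nbhsr.
- have -> : flat (flat' P) x = 0 by rewrite /flat ltNge (ltW x0).
  apply: (@near_eq_is_derive _ _ _ (cst 0)) => //.
  near=> y; rewrite /flat ifF//; apply/negbTE; rewrite -leNgt.
  apply: ltW; near: y; apply: open_nbhs_nbhs; split; [exact: open_lt|exact: x0].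
- rewrite -x0; have -> : flat (flat' P) 0 = 0 by rewrite /flat ltxx.
  have [C C0 hC] := flat_bounded ('X^2 * P).
  have cv : (fun h : R => h^-1 *: ((flat P \o shift 0) (h *: 1) - flat P 0) : R^o) @ (0:R)^' --> (0 : R^o).
    apply/cvgrPdist_le => e e0; near=> h.
    have h0 : h != 0 by near: h; exact: nbhs_dnbhs_neq.
    have fE : flat P h = h ^+ 2 * flat ('X^2 * P) h.
      rewrite /flat; case: ifP => _; last by rewrite mulr0.
      by rewrite hornerM hornerXn; field.
    rewrite sub0r normrN /= /GRing.scale /= mulr1 addr0 [flat P 0]/flat ltxx subr0 fE.
    rewrite expr2 mulrA mulKf// normrM.
    apply: (@le_trans _ _ (`|h| * (C + 1))).
      by rewrite ler_wpM2l//; apply: le_trans (hC h) _; rewrite lerDl.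
    rewrite -ler_pdivlMr ?ltr_wpDl//.
    near: h; apply: (@dnbhs0_le R R^o); by rewrite divr_gt0// ltr_wpDl.
  split; first by apply/cvg_ex; exists 0.
  by apply: cvg_lim.
Unshelve. all: by end_near. Qed.

Lemma measurable_flat P : measurable_fun setT (flat P).
Proof.
apply: continuous_measurable_fun => x; apply: differentiable_continuous.
by apply/derivable1_diffP; have [] := is_derive_flat P x.
Qed.

Lemma flat_MVT P (u v : R) : exists2 w, `|w - u| <= `|v - u| &
  flat P v - flat P u = flat (flat' P) w * (v - u).
Proof.
have cont w : {for w, continuous (flat P)}.
  apply: differentiable_continuous.
  by apply/derivable1_diffP; have [] := is_derive_flat P w.
have [uv|vu|->] := ltgtP u v.
- have [|w] := @MVT _ (flat P) (flat (flat' P)) u v uv (fun x _ => is_derive_flat P x).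
    by apply: continuous_subspaceT => x; exact: cont.
  rewrite in_itv /= => /andP[uw wv] ->; exists w => //.
  by rewrite !ger0_norm ?subr_ge0 ?(ltW uw) ?(ltW uv)// lerD2r ltW.
- have [|w] := @MVT _ (flat P) (flat (flat' P)) v u vu (fun x _ => is_derive_flat P x).
    by apply: continuous_subspaceT => x; exact: cont.
  rewrite in_itv /= => /andP[vw wu] e; exists w.
    by rewrite !ler0_norm ?subr_le0 ?(ltW wu) ?(ltW vu)// !opprB lerD2l lerN2 ltW.
  by rewrite -opprB e -mulrN opprB.
- by exists v; rewrite ?subrr// mulr0.
Qed.

Lemma flat_rem P : exists2 C, 0 <= C & forall u v,
  `|flat P v - flat P u - flat (flat' P) u * (v - u)| <= C * (v - u) ^+ 2.
Proof.
have [C C0 hC] := flat_bounded (flat' (flat' P)).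
exists C => // u v; have [w wuv ->] := flat_MVT P u v.
rewrite -mulrBl normrM -[(v - u) ^+ 2]real_normK ?num_real// expr2 mulrA.
rewrite ler_wpM2r//; have [z _ ->] := flat_MVT (flat' P) u w.
by rewrite normrM ler_pM.
Qed.
End flat.

Section smooth_class.
Context {R : realType} {n : nat}.
Implicit Types (f g : 'rV[R]_n -> R).

(** The algebra generated by the constants and the one-variable functions
    [flat P (a * x_i + b)].  It is stable under partial derivatives, and all its
    members are bounded, hence so are all their derivatives. *)
Inductive Sm : ('rV[R]_n -> R) -> Prop :=
| Sm_flat i P a b : Sm (fun x => flat P (a * x ord0 i + b))
| Sm_cst c : Sm (fun=> c)
| Sm_add f g : Sm f -> Sm g -> Sm (fun x => f x + g x)
| Sm_mul f g : Sm f -> Sm g -> Sm (fun x => f x * g x).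

(** By induction on the generation; that the gradient stays in the class is what
    makes its members smooth. *)
Lemma Sm_grad f : Sm f -> exists2 p, taylor2 setT f p & forall i, Sm (p i).
Proof.
elim=> [i P a b|c|{}f g _ [p tp sp] _ [q tq sq]|{}f g sf [p tp sp] sg [q tq sq]].
- have t1 : taylor1 setT (fun x : 'rV[R]_n => a * x ord0 i + b)
      (fun j _ => a * (j == i)%:R).
    have [m1 m2 [C C0 [h1 h2 h3]]] := taylor1_coord i (@measurableT _ 'rV[R]_n).
    split.
    + by apply: measurable_funD => //; exact: measurable_funM.
    + by move=> j; exact: measurable_funM.
    + exists (`|a| * C); first by rewrite mulr_ge0.
      split.
      * by move=> x j _; rewrite normrM ler_wpM2l// (h1 x).
      * move=> x y _ _; rewrite opprD addrACA subrr addr0 -mulrBr normrM -mulrA.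
        by rewrite ler_wpM2l// h2.
      * move=> x y _ _; rewrite linZ opprD addrACA subrr addr0 -!mulrBr normrM -mulrA.
        by rewrite ler_wpM2l// h3.
  have [A A0 hA] := flat_bounded P; have [B B0 hB] := flat_bounded (flat' P).
  have [C C0 hC] := flat_rem P.
  have := @taylor2_comp _ _ _ _ _ _ _ _ t1 (addr_ge0 (addr_ge0 A0 B0) C0) (measurable_flat P)
    (measurable_flat (flat' P)).
  move=> t2; eexists; first apply: t2.
  + by move=> x _; apply: le_trans (hA _) _; rewrite -addrA lerDl addr_ge0.
  + by move=> x _; apply: le_trans (hB _) _; rewrite addrAC lerDr addr_ge0.
  + move=> u v; apply: le_trans (hC _ _) _.
    by rewrite ler_wpM2r ?sqr_ge0// lerDr addr_ge0.
  + by move=> j /=; apply: Sm_mul; [exact: Sm_flat|exact: Sm_cst].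
- by exists (fun _ _ => 0); [exact: taylor2_cst|move=> i; exact: Sm_cst].
- by eexists; [exact: taylor2_add tp tq|move=> i; exact: Sm_add].
- eexists; first exact: taylor2_mul tp tq.
  by move=> i; apply: Sm_add; apply: Sm_mul.
Qed.

Lemma Sm_taylor2 f : Sm f -> taylor2 setT f (fun i => partial i f).
Proof.
move=> /Sm_grad[p tp _]; rewrite (_ : (fun i => _) = p)//.
by apply/funext => i; apply/funext => x; have [_ ->] := taylor2_derivable tp x i.
Qed.

Lemma Sm_partial f i : Sm f -> Sm (partial i f).
Proof.
move=> /Sm_grad[p tp sp]; rewrite (_ : partial i f = p i)//.
by apply/funext => x; have [_ ->] := taylor2_derivable tp x i.
Qed.

Lemma Sm_smooth f : Sm f -> smooth f.
Proof.
move=> sf s; have : Sm (foldr partial f s).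
  by elim: s => [|i s IHs] //=; exact: Sm_partial.
move=> /Sm_taylor2 t2; split; first exact: taylor2_continuous t2.
by move=> i x; have [] := taylor2_derivable t2 x i.
Qed.

Lemma Sm_shift f c : Sm f -> Sm (fun x => f (x - c)).
Proof.
elim=> [i P a b|k|{}f g _ hf _ hg|{}f g _ hf _ hg].
- have -> : (fun x => flat P (a * (x - c) ord0 i + b)) =
      fun x : 'rV[R]_n => flat P (a * x ord0 i + (b - a * c ord0 i)).
    by apply/funext => x; rewrite !mxE; congr flat; ring.
  exact: Sm_flat.
- exact: Sm_cst.
- exact: Sm_add.
- exact: Sm_mul.
Qed.

Lemma Sm_exp f k : Sm f -> Sm (fun x => f x ^+ k).
Proof.
move=> sf; elim: k => [|k IHk].
  by rewrite (_ : (fun x => _) = fun=> 1); [exact: Sm_cst|apply/funext => x].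
rewrite (_ : (fun x => _) = fun x => f x * f x ^+ k); first exact: Sm_mul.
by apply/funext => x; rewrite exprS.
Qed.

Lemma Sm_prod (I : Type) (r : seq I) (F : I -> 'rV[R]_n -> R) :
  (forall i, Sm (F i)) -> Sm (fun x => \prod_(i <- r) F i x).
Proof.
move=> sF; elim: r => [|i r IHr].
  by rewrite (_ : (fun x => _) = fun=> 1); [exact: Sm_cst|apply/funext => x; rewrite big_nil].
rewrite (_ : (fun x => _) = fun x => F i x * \prod_(j <- r) F j x); first exact: Sm_mul.
by apply/funext => x; rewrite big_cons.
Qed.

Lemma Sm_scale f c : Sm f -> Sm (fun x => c * f x).
Proof. by move=> sf; apply: Sm_mul => //; exact: Sm_cst. Qed.

(** As k grows these increase to the indicator of the open box of corners
    [a] and [b]. *)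
Definition box_bump (a b : 'rV[R]_n) (k : nat) (x : 'rV[R]_n) : R :=
  \prod_(i < n) (1 - (1 - flat 1 (x ord0 i - a ord0 i) *
                          flat 1 (b ord0 i - x ord0 i)) ^+ k).

Definition obox (a b : 'rV[R]_n) : set 'rV[R]_n :=
  box (fun i => `]a ord0 i, b ord0 i[%classic).

Lemma Sm_box_bump a b k : Sm (box_bump a b k).
Proof.
apply: Sm_prod => i; apply: Sm_add; first exact: Sm_cst.
rewrite (_ : (fun x => _) = fun x : 'rV[R]_n => (-1) *
  (1 + (-1) * (flat 1 (1 * x ord0 i + - a ord0 i) * flat 1 (-1 * x ord0 i + b ord0 i))) ^+ k).
  apply: Sm_scale; apply: Sm_exp; apply: Sm_add; first exact: Sm_cst.
  by apply: Sm_scale; apply: Sm_mul; exact: Sm_flat.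
by apply/funext => x; rewrite !mulN1r mul1r [in - _ + b _ _]addrC.
Qed.

Lemma flat1_itv (x : R) : 0 <= flat 1 x <= 1.
Proof.
rewrite /flat; case: ifPn => [x0|_]; last by rewrite lexx ler01.
rewrite hornerE mul1r expR_ge0 /= -expR0 ler_expR.
by rewrite oppr_le0 invr_ge0 ltW.
Qed.

Lemma flat1_gt0 (x : R) : (0 < flat 1 x) = (0 < x).
Proof. by rewrite /flat; case: ifP => //; rewrite ?ltxx// hornerE mul1r expR_gt0. Qed.

Lemma flat_le0 P (x : R) : x <= 0 -> flat P x = 0.
Proof. by move=> x0; rewrite /flat ltNge x0. Qed.

Lemma box_bump_factor_itv (a b : 'rV[R]_n) k (x : 'rV[R]_n) i :
  0 <= 1 - (1 - flat 1 (x ord0 i - a ord0 i) * flat 1 (b ord0 i - x ord0 i)) ^+ k <= 1.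
Proof.
set u := flat 1 _; set v := flat 1 _.
have /andP[u0 u1] : 0 <= u <= 1 := flat1_itv _.
have /andP[v0 v1] : 0 <= v <= 1 := flat1_itv _.
have w0 : 0 <= 1 - u * v by rewrite subr_ge0 mulr_ile1.
have w1 : 1 - u * v <= 1 by rewrite gerBl mulr_ge0.
by rewrite subr_ge0 exprn_ile1//= gerBl exprn_ge0.
Qed.

Lemma box_bump_itv a b k x : 0 <= box_bump a b k x <= 1.
Proof.
apply/andP; split; first by apply: prodr_ge0 => i _; have /andP[] := box_bump_factor_itv a b k x i.
by apply: prodr_ile1 => i _; exact: box_bump_factor_itv.
Qed.

Lemma box_bump_out a b k x : ~ obox a b x -> box_bump a b k x = 0.
Proof.
move=> /existsNP[i] /= /negP; rewrite in_itv /= negb_and -!leNgt => h.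
rewrite /box_bump (bigD1 i)//= (_ : _ * flat 1 _ = 0) ?subr0 ?expr1n ?subrr ?mul0r//.
case/orP: h => h.
  by rewrite [X in X * _]flat_le0 ?mul0r// subr_le0.
by rewrite [X in _ * X]flat_le0 ?mulr0// subr_le0.
Qed.

Lemma box_bump_gt0 a b k x : obox a b x -> 0 < box_bump a b k.+1 x.
Proof.
move=> abx; apply: prodr_gt0 => i _.
have := abx i; rewrite /= in_itv /= => /andP[ax xb].
rewrite subr_gt0 exprn_ilt1//.
  have /andP[u0 u1] := flat1_itv (x ord0 i - a ord0 i).
  have /andP[v0 v1] := flat1_itv (b ord0 i - x ord0 i).
  by rewrite subr_ge0 mulr_ile1.
by rewrite gtrBl mulr_gt0// flat1_gt0 subr_gt0.
Qed.

Lemma box_bump_cvg a b x : box_bump a b k x @[k --> \oo] --> (\1_(obox a b) x : R).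
Proof.
have [abx|nabx] := pselect (obox a b x); last first.
  rewrite indicE memNset//; under eq_fun do rewrite box_bump_out//.
  exact: cvg_cst.
rewrite indicE mem_set//.
have -> : (true%:R : R) = \prod_(i < n) 1 by rewrite big1.
rewrite /box_bump; elim: (index_enum _) => [|i r IHr].
  by under eq_fun do rewrite big_nil; rewrite big_nil; exact: cvg_cst.
under eq_fun do rewrite big_cons; rewrite big_cons; apply: cvgM => //.
rewrite -[X in _ --> X]subr0; apply: cvgB; first exact: cvg_cst.
have := abx i; rewrite /= in_itv /= => /andP[ax xb].
have /andP[u0 u1] := flat1_itv (x ord0 i - a ord0 i).
have /andP[v0 v1] := flat1_itv (b ord0 i - x ord0 i).
apply: cvg_expr; rewrite ger0_norm ?subr_ge0 ?mulr_ile1//.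
by rewrite gtrBl mulr_gt0// flat1_gt0 subr_gt0.
Qed.
End smooth_class.

(** * Density of the test functions in L2 *)

Section test_functions.
Context {R : realType} {n : nat}.
Implicit Types (f g : 'rV[R]_n -> R) (V omega : set 'rV[R]_n).

Definition supported V f := exists K, [/\ compact K, K `<=` V &
  forall x, ~ K x -> f x = 0].

Definition Sm_test V f := Sm f /\ supported V f.

Lemma hausdorff_rV : hausdorff_space 'rV[R]_n.
Proof. exact: norm_hausdorff. Qed.

Lemma Sm_test_function V f : Sm_test V f -> test_function V f.
Proof.
move=> [sf [K [cK KV fK]]].
have cl : closure [set x | f x != 0] `<=` K.
  rewrite closureE; apply: smallest_sub; first exact: compact_closed cK.
  by move=> x /=; apply: contra_neqP => /fK.
split; first exact: Sm_smooth.
  by apply: (subclosed_compact _ cK cl); exact: closed_closure.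
exact: subset_trans KV.
Qed.

Lemma supported0 V : supported V (fun=> 0).
Proof. by exists set0; split => //; exact: compact0. Qed.

Lemma Sm_test0 V : Sm_test V (fun=> 0).
Proof. by split; [exact: Sm_cst|exact: supported0]. Qed.

Lemma Sm_test_add V f g : Sm_test V f -> Sm_test V g -> Sm_test V (fun x => f x + g x).
Proof.
move=> [sf [K [cK KV fK]]] [sg [L [cL LV gL]]]; split; first exact: Sm_add.
exists (K `|` L); split; first exact: compactU.
  by rewrite subUset.
by move=> x KLx; rewrite fK ?gL ?addr0// => ?; apply: KLx; [right|left].
Qed.

Lemma Sm_test_mul V f g : Sm f -> Sm_test V g -> Sm_test V (fun x => f x * g x).
Proof.
move=> sf [sg [L [cL LV gL]]]; split; first exact: Sm_mul.
by exists L; split => // x /gL ->; rewrite mulr0.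
Qed.

Lemma Sm_testW V W f : V `<=` W -> Sm_test V f -> Sm_test W f.
Proof. by move=> VW [sf [K [cK KV fK]]]; split => //; exists K; split => // x /KV/VW. Qed.

Lemma Sm_measurable f : Sm f -> measurable_fun setT f.
Proof. by move=> /Sm_taylor2/taylor2_measurable. Qed.

Lemma compact_ball_rV (x : 'rV[R]_n) (r : R) :
  compact [set y | `|x - y| <= r].
Proof.
apply: bounded_closed_compact.
  exists (`|x| + r); split; first exact: num_real.
  move=> M xM y /= xy; apply: le_trans (ltW xM).
  have -> : y = x - (x - y) by rewrite opprB addrC subrK.
  by apply: le_trans (ler_normB _ _) _; rewrite lerD2l.
rewrite [X in closed X](_ : _ = (fun y => `|x - y|) @^-1` [set t | t <= r])//.
apply: preimage_closed => [y _|]; last exact: closed_le.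
apply: continuous_comp; last exact: norm_continuous.
by apply: continuousB; [exact: cst_continuous|exact: cvg_id].
Qed.

(** An open set is exhausted by smooth functions compactly supported in it:
    it is a countable union of open balls whose closures it contains, and
    [1 - \prod (1 - box_bump)] over finitely many of them is such a function. *)
Lemma open_Sm_test_approx V : open V -> exists phi : nat -> 'rV[R]_n -> R,
  [/\ forall k, Sm_test V (phi k), forall k x, 0 <= phi k x <= 1 &
    forall x, phi k x @[k --> \oo] --> (\1_V x : R)].
Proof.
move=> oV.
pose rad (j : nat) : R := j.+1%:R^-1.
have rad0 j : 0 < rad j by rewrite invr_gt0.
pose qr (q : 'rV[rat]_n) : 'rV[R]_n := map_mx ratr q.
pose good (q : 'rV[rat]_n) (j : nat) := [set y | `|qr q - y| <= rad j] `<=` V.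
(* [F k] approximates the indicator of the k-th ball if its closure is in [V] *)
pose F (k m : nat) (x : 'rV[R]_n) := if unpickle k is Some (q, j) then
  (if `[< good q j >]
   then box_bump (\row_i (qr q ord0 i - rad j)) (\row_i (qr q ord0 i + rad j)) m x
   else 0) else 0.
have obE q (j : nat) x : obox (\row_i (qr q ord0 i - rad j))
    (\row_i (qr q ord0 i + rad j)) x <-> `|qr q - x| < rad j.
  split=> [h|/(ltr_norm_rV _ (rad0 j)) h].
    apply/(ltr_norm_rV _ (rad0 j)) => i; have := h i; rewrite /= in_itv /= !mxE ltr_norml.
    by move=> /andP[h1 h2]; apply/andP; split; move: h1 h2; lra.
  move=> i; rewrite /= in_itv /= !mxE; have := h i; rewrite !mxE ltr_norml.
  by move=> /andP[h1 h2]; apply/andP; split; move: h1 h2; lra.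
have F01 k m x : 0 <= F k m x <= 1.
  rewrite /F; case: unpickle => [[q j]|]; last by rewrite lexx ler01.
  by case: asboolP => _; [exact: box_bump_itv|rewrite lexx ler01].
have FT k m : Sm_test V (F k m).
  have [] : F k m = (fun=> 0) \/ exists q j, good q j /\ F k m = box_bump
      (\row_i (qr q ord0 i - rad j)) (\row_i (qr q ord0 i + rad j)) m.
  - rewrite /F; case: (unpickle k) => [[q j]|]; last by left; apply/funext.
    by case: asboolP => h; [right; exists q, j; split; last apply/funext|left; apply/funext].
  - by move=> ->; exact: Sm_test0.
  - move=> [q [j [gqj ->]]]; split; first exact: Sm_box_bump.
    exists [set y | `|qr q - y| <= rad j]; split => //.
      exact: compact_ball_rV.
    by move=> x xK; apply: box_bump_out => /obE/ltW.
(* one minus the product of the complements: a smooth union of m balls *)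
pose G (m : nat) (x : 'rV[R]_n) := 1 - \prod_(k < m) (1 - F k m x).
have G01 m x : 0 <= G m x <= 1.
  have h0 k : 0 <= 1 - F k m x <= 1.
    by have /andP[a b] := F01 k m x; rewrite subr_ge0 b gerBl.
  rewrite /G subr_ge0 gerBl prodr_ile1 ?prodr_ge0// => k _; by have /andP[] := h0 k.
exists G; split => //.
- suff h j m : Sm_test V (fun x => 1 - \prod_(k < j) (1 - F k m x)).
    by move=> m; exact: h.
  elim: j => [|j IHj].
    have -> : (fun x => 1 - \prod_(k < 0) (1 - F k m x)) = fun=> 0.
      by apply/funext => x; rewrite big_ord0 subrr.
    exact: Sm_test0.
  have -> : (fun x => 1 - \prod_(k < j.+1) (1 - F k m x)) =
     fun x => (1 - \prod_(k < j) (1 - F k m x)) +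
       (1 + (-1) * (1 - \prod_(k < j) (1 - F k m x))) * F j m x.
    by apply/funext => x; rewrite big_ord_recr /=; ring.
  apply: Sm_test_add => //; apply: Sm_test_mul => //.
  by apply: Sm_add; [exact: Sm_cst|apply: Sm_scale; exact: IHj.1].
- move=> x; rewrite indicE; have [Vx|Vx] := pselect (V x); last first.
    rewrite memNset//; under eq_fun => m.
      rewrite /G big1 ?subrr; last first.
        move=> k _; have [_ [K [_ KV FK]]] := FT k m.
        by rewrite FK ?subr0// => /KV.
      over.
    exact: cvg_cst.
  rewrite mem_set//.
  have /nbhs_ballP[e /= e0 eV] := open_nbhs_nbhs (conj oV Vx).
  pose j := Num.truncn (e / 2)^-1.
  have je : rad j < e / 2.
    rewrite -[ltRHS]invrK ltf_pV2 ?posrE ?invr_gt0 ?divr_gt0//.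
    exact: truncnS_gt.
  have [q xq] := rat_approx_rV x (rad0 j).
  have gqj : good q j.
    move=> y /= qy; apply: eV; rewrite -ball_normE /=.
    move: xq; rewrite -ball_normE /= -/(qr q) => xq.
    have -> : x - y = (x - qr q) + (qr q - y) by rewrite addrA subrK.
    apply: le_lt_trans (ler_normD _ _) _.
    have := lerD (ltW xq) qy; move: je; set w := _ + _.
    by move=> h1 h2; apply: le_lt_trans h2 _; move: h1; lra.
  pose k0 := pickle (q, j).
  have FE m : F k0 m x = box_bump (\row_i (qr q ord0 i - rad j))
      (\row_i (qr q ord0 i + rad j)) m x.
    by rewrite /F pickleK asboolT.
  have F1 : F k0 m x @[m --> \oo] --> (1 : R).
    under eq_fun do rewrite FE.
    have := @box_bump_cvg R n (\row_i (qr q ord0 i - rad j))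
      (\row_i (qr q ord0 i + rad j)) x; rewrite indicE mem_set//.
    by apply/obE; rewrite distrC; move: xq; rewrite -ball_normE.
  apply: (@squeeze_cvgr _ _ _ _ (fun m => F k0 m x) (fun=> 1)) => //; last exact: cvg_cst.
  near=> m; have k0m : (k0 < m)%N by near: m; exact: nbhs_infty_gt.
  have /andP[_ ->] := G01 m x; rewrite andbT /G (bigD1 (Ordinal k0m))//=.
  set P := \prod_(_ < _ | _) _.
  have P1 : P <= 1.
    apply: prodr_ile1 => i _; have /andP[a b] := F01 i m x.
    by rewrite subr_ge0 b gerBl a.
  have /andP[a b] := F01 k0 m x.
  rewrite lerBrDr -lerBrDl; apply: le_trans (ler_wpM2l _ P1) _; rewrite ?subr_ge0//.
  by rewrite mulr1.
Unshelve. all: by end_near. Qed.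

Definition opens_rV : set (set 'rV[R]_n) := [set U | open U].

Lemma measurable_opens_rV : @measurable _ 'rV[R]_n = <<s opens_rV >>.
Proof.
apply/seteqP; split; last first.
  apply: smallest_sub; first exact: sigma_algebra_measurable.
  by move=> U; exact: open_measurable_rV.
apply: smallest_sub; first exact: smallest_sigma_algebra.
move=> B; rewrite -bigcup_seq /= => -[i _] [C mC <-] /=; rewrite setTI.
pose T := g_sigma_algebraType opens_rV.
suff mf : measurable_fun [set: T] (@coord_rV R n i : T -> R).
  by have := mf measurableT _ mC; rewrite setTI.
apply: (measurability _ (RGenOInfty.measurableE R)) => //.
move=> _ [_ [a ->] <-]; rewrite setTI; apply: sub_sigma_algebra.
apply: open_comp => [x _|]; [exact: coord_continuous|exact: rray_open].
Qed.

End test_functions.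

Section density.
Context {R : realType} {n : nat} (omega : set 'rV[R]_n).
Hypothesis omega_open : open omega.
Hypothesis omega_fin : (lebesgue_rV R n omega < +oo)%E.
Implicit Types (f g h : 'rV[R]_n -> R).
Let mu := lebesgue_rV R n.
Let momega : measurable omega := open_measurable_rV omega_open.

Definition l2sq f g : \bar R := (\int[mu]_(x in omega) ((f x - g x) ^+ 2)%:E)%E.

Definition approximable f := measurable_fun omega f /\
  forall e : R, 0 < e -> exists2 phi, Sm_test omega phi & (l2sq f phi < e%:E)%E.

Lemma measurable_sqrB f g : measurable_fun omega f -> measurable_fun omega g ->
  measurable_fun omega (fun x => ((f x - g x) ^+ 2)%:E).
Proof.
by move=> mf mg; apply/measurable_EFinP; apply: measurable_funX; exact: measurable_funB.
Qed.

Lemma l2sq_ge0 f g : (0 <= l2sq f g)%E.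
Proof. by apply: integral_ge0 => x _; rewrite lee_fin sqr_ge0. Qed.

Lemma l2sq_triangle f g h : measurable_fun omega f -> measurable_fun omega g ->
  measurable_fun omega h -> (l2sq f h <= 2%:E * (l2sq f g + l2sq g h))%E.
Proof.
move=> mf mg mh; rewrite /l2sq -ge0_integralD//; last first.
- exact: measurable_sqrB.
- by move=> x _; rewrite lee_fin sqr_ge0.
- exact: measurable_sqrB.
- by move=> x _; rewrite lee_fin sqr_ge0.
rewrite -ge0_integralZl_EFin//; last first.
- by apply: emeasurable_funD; exact: measurable_sqrB.
- by move=> x _; rewrite adde_ge0// lee_fin sqr_ge0.
apply: ge0_le_integral => //.
- by move=> x _; rewrite lee_fin sqr_ge0.
- exact: measurable_sqrB.
- by apply: emeasurable_funM => //; apply: emeasurable_funD; exact: measurable_sqrB.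
- move=> x _; rewrite -EFinD -EFinM lee_fin.
  by have := sqr_ge0 (f x - 2 * g x + h x); move: (f x) (g x) (h x) => a b c; nra.
Qed.

Lemma approximable_lim f : measurable_fun omega f ->
  (forall e : R, 0 < e -> exists2 h, approximable h & (l2sq f h < e%:E)%E) ->
  approximable f.
Proof.
move=> mf fh; split => // e e0.
have e4 : 0 < e / 4 by rewrite divr_gt0.
have [h [mh ah] lfh] := fh _ e4; have [phi tphi lhphi] := ah _ e4.
exists phi => //; apply: (le_lt_trans (l2sq_triangle mf mh _)).
  by apply: measurable_funTS; apply: Sm_measurable; have [] := tphi.
have -> : e%:E = (2%:E * ((e / 4)%:E + (e / 4)%:E))%E.
  by rewrite -EFinD -EFinM; congr EFin; field.
by rewrite lte_pmul2l// lteD.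
Qed.

Lemma Sm_test_approximable phi : Sm_test omega phi -> approximable phi.
Proof.
move=> tphi; split; first by apply: measurable_funTS; apply: Sm_measurable; have [] := tphi.
move=> e e0; exists phi => //; rewrite /l2sq.
under eq_integral do rewrite subrr expr0n.
by rewrite integral0 lte_fin.
Qed.

Lemma approximable_add f g : approximable f -> approximable g ->
  approximable (fun x => f x + g x).
Proof.
move=> [mf af] [mg ag]; split; first exact: measurable_funD.
move=> e e0; have e4 : 0 < e / 4 by rewrite divr_gt0.
have [phi tphi lphi] := af _ e4; have [psi tpsi lpsi] := ag _ e4.
exists (fun x => phi x + psi x); first exact: Sm_test_add.
have mphi : measurable_fun omega phi.
  by apply: measurable_funTS; apply: Sm_measurable; have [] := tphi.
have mpsi : measurable_fun omega psi.
  by apply: measurable_funTS; apply: Sm_measurable; have [] := tpsi.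
apply: (le_lt_trans (l2sq_triangle (g := fun x => phi x + g x) _ _ _));
  [exact: measurable_funD..|].
have -> : l2sq (fun x => f x + g x) (fun x => phi x + g x) = l2sq f phi.
  by apply: eq_integral => x _; congr (_ ^+ 2)%:E; ring.
have -> : l2sq (fun x => phi x + g x) (fun x => phi x + psi x) = l2sq g psi.
  by apply: eq_integral => x _; congr (_ ^+ 2)%:E; ring.
have -> : e%:E = (2%:E * ((e / 4)%:E + (e / 4)%:E))%E.
  by rewrite -EFinD -EFinM; congr EFin; field.
by rewrite lte_pmul2l// lteD.
Qed.

Lemma approximable_scale f c : approximable f -> approximable (fun x => c * f x).
Proof.
move=> [mf af]; split; first exact: measurable_funM.
move=> e e0; have c1 : 0 < c ^+ 2 + 1 by rewrite ltr_wpDl// sqr_ge0.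
have ec : 0 < e / (c ^+ 2 + 1) by rewrite divr_gt0.
have [phi tphi lphi] := af _ ec.
have mphi : measurable_fun omega phi.
  by apply: measurable_funTS; apply: Sm_measurable; have [] := tphi.
exists (fun x => c * phi x); first by apply: Sm_test_mul => //; exact: Sm_cst.
have -> : l2sq (fun x => c * f x) (fun x => c * phi x) = ((c ^+ 2)%:E * l2sq f phi)%E.
  rewrite /l2sq -ge0_integralZl_EFin ?sqr_ge0//; last exact: measurable_sqrB.
    by apply: eq_integral => x _; rewrite -EFinM -mulrBr exprMn.
  by move=> x _; rewrite lee_fin sqr_ge0.
apply: (@le_lt_trans _ _ ((c ^+ 2 + 1)%:E * l2sq f phi)%E).
  by rewrite lee_wpmul2r ?l2sq_ge0// lee_fin lerDl.
by rewrite muleC -lte_pdivlMr// -EFinM.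
Qed.

Lemma approximable_dominated (f_ : nat -> 'rV[R]_n -> R) f (G : 'rV[R]_n -> R) :
  (forall k, approximable (f_ k)) -> measurable_fun omega f ->
  (forall x, omega x -> f_ k x @[k --> \oo] --> f x) ->
  mu.-integrable omega (EFin \o G) ->
  (forall k x, omega x -> (f x - f_ k x) ^+ 2 <= G x) -> approximable f.
Proof.
move=> af mf ff iG fG; apply: approximable_lim => // e e0.
have := @dominated_convergence _ _ _ mu omega momega
  (fun k x => ((f x - f_ k x) ^+ 2)%:E) (fun=> 0%E) (EFin \o G)
  (fun k => measurable_sqrB mf (af k).1) (measurable_cst _).
case=> //.
- apply: aeW => x ox; apply: cvg_EFin; first by near=> k.
  have -> : (0 : R) = (f x - f x) ^+ 2 by rewrite subrr expr0n.
  apply: cvgM; apply: cvgB; [exact: cvg_cst|exact: ff|exact: cvg_cst|exact: ff].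
- by apply: aeW => x k ox; rewrite lee_fin ger0_norm ?sqr_ge0// fG.
move=> _ _; rewrite integral0 => cv.
have : \forall k \near \oo, (l2sq f (f_ k) < e%:E)%E.
  have lt0e : (0 < e%:E)%E by rewrite lte_fin.
  exact: (cv _ (open_ereal_lt' lt0e)).
by case=> N _ /(_ N (leqnn N)) lN; exists (f_ N).
Unshelve. all: by end_near. Qed.

Lemma integrable_cst_omega (c : R) : mu.-integrable omega (EFin \o cst c).
Proof.
apply: measurable_bounded_integrable => //; exists `|c|; split; first exact: num_real.
by move=> M cM x _ /=; exact: ltW.
Qed.

(** The sets whose indicator is approximable form a lambda-system, and it contains
    the open sets by [open_Sm_test_approx]. *)
Lemma approximable_indic (A : set 'rV[R]_n) : measurable A -> approximable (\1_(A `&` omega)).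
Proof.
have ind_open U : open U -> approximable (\1_(U `&` omega)).
  move=> oU; have oUo : open (U `&` omega) by exact: openI.
  have [phi [tphi p01 pcv]] := open_Sm_test_approx oUo.
  apply: (@approximable_dominated phi _ (cst 1)) => //.
  - by move=> k; apply: Sm_test_approximable; apply: Sm_testW (tphi k); exact: subIsetr.
  - by apply: measurable_indic; apply: measurableI => //; exact: open_measurable_rV.
  - exact: integrable_cst_omega.
  - move=> k x _ /=; have /andP[a b] := p01 k x.
    by rewrite indicE; case: (_ \in _) => /=; nra.
move=> mA; rewrite measurable_opens_rV in mA.
apply: (@dynkin_induction _ _ (@opens_rV R n)
  (fun A => approximable (\1_(A `&` omega)))) mA.
- exact: measurable_opens_rV.
- by move=> U V; exact: openI.
- by apply: ind_open; exact: openT.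
- by move=> U; exact: ind_open.
- move=> S mS aS.
  have -> : \1_(~` S `&` omega) = (fun x => \1_(setT `&` omega) x + (-1) * \1_(S `&` omega) x) :> ('rV[R]_n -> R).
    apply/funext => x; rewrite !indicE !in_setI in_setT in_setC /=.
    by case: (x \in S); case: (x \in omega) => /=; lra.
  by apply: approximable_add; [apply: ind_open; exact: openT|exact: approximable_scale].
- move=> F mF tF aF.
  have sum1 k x j : omega x -> F j x -> (j < k)%N ->
      \sum_(i < k) \1_(F i `&` omega) x = 1 :> R.
    move=> ox Fjx jk; rewrite (bigD1 (Ordinal jk))//= indicE mem_set//.
    rewrite big1 ?addr0// => i /eqP ij; rewrite indicE memNset// => -[Fix _].
    by apply: ij; apply: val_inj => /=; exact: (tF i j I I (ex_intro _ x (conj Fix Fjx))).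
  apply: (@approximable_dominated (fun k x => \sum_(i < k) \1_(F i `&` omega) x) _ (cst 1)) => //.
  + elim=> [|k IHk].
      have -> : (fun x => \sum_(i < 0) \1_(F i `&` omega) x) = fun=> 0 :> R.
        by apply/funext => x; rewrite big_ord0.
      by apply: Sm_test_approximable; exact: Sm_test0.
    have -> : (fun x => \sum_(i < k.+1) \1_(F i `&` omega) x) =
       (fun x => \sum_(i < k) \1_(F i `&` omega) x + \1_(F k `&` omega) x :> R).
      by apply/funext => x; rewrite big_ord_recr.
    exact: approximable_add.
  + apply: measurable_indic; apply: measurableI => //.
    exact: bigcup_measurable.
  + move=> x ox; rewrite indicE in_setI (mem_set ox) andbT.
    have [[j _ Fjx]|nF] := pselect ((\bigcup_k F k) x).
      rewrite mem_set; last by exists j.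
      apply: cvg_near_cst; near=> k.
      have jk : (j < k)%N by near: k; exact: nbhs_infty_gt.
      exact: sum1 ox Fjx jk.
    rewrite memNset//; apply: cvg_near_cst; near=> k.
    apply: big1 => i _; rewrite indicE memNset// => -[Fix _]; apply: nF.
    by exists i.
  + exact: integrable_cst_omega.
  + move=> k x ox /=; rewrite indicE in_setI (mem_set ox) andbT.
    have [[j _ Fjx]|nF] := pselect ((\bigcup_k F k) x).
      rewrite mem_set; last by exists j.
      have [jk|kj] := ltnP j k; first by rewrite (sum1 _ _ _ ox Fjx jk) subrr expr0n.
      rewrite big1 ?subr0 ?expr1n// => i _; rewrite indicE memNset// => -[Fix _].
      have := tF i j I I (ex_intro _ x (conj Fix Fjx)) => ij.
      by move: (ltn_ord i); rewrite ij ltnNge kj.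
    rewrite memNset// big1 ?subrr ?expr0n// => i _; rewrite indicE memNset// => -[Fix _].
    by apply: nF; exists i.
Unshelve. all: by end_near. Qed.

Lemma approximable_eq f g : {in omega, f =1 g} -> approximable f -> approximable g.
Proof.
move=> fg [mf af]; split; first exact: eq_measurable_fun mf.
move=> e e0; have [phi tphi lphi] := af e e0; exists phi => //.
by rewrite (_ : l2sq g phi = l2sq f phi)//; apply: eq_integral => x ox; rewrite fg.
Qed.

Lemma approximable_sum (I : Type) (r : seq I) (F : I -> 'rV[R]_n -> R) :
  (forall i, approximable (F i)) -> approximable (fun x => \sum_(i <- r) F i x).
Proof.
move=> aF; elim: r => [|i r IHr].
  have -> : (fun x => \sum_(i <- [::]) F i x) = fun=> 0.
    by apply/funext => x; rewrite big_nil.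
  by apply: Sm_test_approximable; exact: Sm_test0.
have -> : (fun x => \sum_(j <- i :: r) F j x) = fun x => F i x + \sum_(j <- r) F j x.
  by apply/funext => x; rewrite big_cons.
exact: approximable_add.
Qed.

Import HBNNSimple.

(** Simple functions, dominated by [f] itself, reduce to indicators. *)
Lemma approximable_ge0 f : (forall x, omega x -> 0 <= f x) -> L2 mu omega f ->
  approximable f.
Proof.
move=> f0 [mf ff].
have mEf : measurable_fun omega (EFin \o f) by exact/measurable_EFinP.
pose h k := nnsfun_approx momega mEf k.
have hcv x : omega x -> (h k x : R) @[k --> \oo] --> f x.
  move=> ox; have := @cvg_nnsfun_approx _ _ _ _ momega _ mEf (fun x ox => f0 x ox) x ox.
  by move/fine_cvgP => [].
have h01 k x : omega x -> 0 <= h k x <= f x.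
  move=> ox; rewrite fun_ge0 /=; have hcvx := hcv x ox.
  rewrite -(cvg_lim _ hcvx)//; apply: (nondecreasing_cvgn_le (u_ := fun k => h k x)).
    by move=> a b ab; have /lefP := nd_nnsfun_approx momega mEf ab.
  by apply/cvg_ex; exists (f x).
apply: (@approximable_dominated (fun k => h k) _ (fun x => f x ^+ 2)) => //.
- move=> k.
  have hE x : h k x = \sum_(y <- fset_set (range (h k))) y * \1_(h k @^-1` [set y]) x.
    by rewrite fimfunE fsbig_finite.
  apply: (@approximable_eq (fun x => \sum_(y <- fset_set (range (h k)))
     (y * \1_(h k @^-1` [set y] `&` omega) x))).
    move=> x /set_mem ox; rewrite hE; apply: eq_bigr => y _.
    by rewrite !indicE in_setI (mem_set ox) andbT.
  apply: approximable_sum => y; apply: approximable_scale; apply: approximable_indic.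
  exact: measurable_funPTI.
- apply/integrableP; split; first by apply/measurable_EFinP; exact: measurable_funX.
  by rewrite (eq_integral (fun x => (f x ^+ 2)%:E))// => x _ /=; rewrite ger0_norm ?sqr_ge0.
- move=> k x ox; have /andP[a b] := h01 k x ox.
  by rewrite ler_sqr ?nnegrE ?subr_ge0 ?gerBl// (le_trans a b).
Qed.

(** The test functions are dense in L^2: split into positive and negative
    parts. *)
Lemma approximable_L2 f : L2 mu omega f -> approximable f.
Proof.
move=> [mf ff].
have sq g : measurable_fun omega g -> (forall x, omega x -> 0 <= g x <= `|f x|) ->
  (forall x, omega x -> 0 <= g x) /\ L2 mu omega g.
  move=> mg gf; split; first by move=> x /gf/andP[].
  split => //; apply: le_lt_trans ff; apply: ge0_le_integral => //.
  - by move=> x _; rewrite lee_fin sqr_ge0.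
  - by apply/measurable_EFinP; exact: measurable_funX.
  - by apply/measurable_EFinP; exact: measurable_funX.
  - move=> x /gf/andP[g0 gx]; rewrite lee_fin -(real_normK (num_real (f x))).
    by rewrite ler_sqr ?nnegrE.
have [p1 p2] : (forall x, omega x -> 0 <= Num.max (f x) 0) /\
    L2 mu omega (fun x => Num.max (f x) 0).
  apply: sq; first exact: measurable_maxr.
  by move=> x _; rewrite le_max lexx orbT ge_max ler_norm normr_ge0.
have [n1 n2] : (forall x, omega x -> 0 <= Num.max (- f x) 0) /\
    L2 mu omega (fun x => Num.max (- f x) 0).
  apply: sq; first by apply: measurable_maxr => //; exact: measurableT_comp.
  by move=> x _; rewrite le_max lexx orbT ge_max normr_ge0 -normrN ler_norm.
apply: (@approximable_eq (fun x => Num.max (f x) 0 + (-1) * Num.max (- f x) 0)).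
  move=> x _; have [fx|fx] := leP (f x) 0; have [gx|gx] := leP (- f x) 0; move: fx gx; lra.
by apply: approximable_add; [|apply: approximable_scale]; exact: approximable_ge0.
Qed.
End density.

(** * One-dimensional power integrals *)

Section power_integrals.
Context {R : realType}.
Local Notation leb := (@lebesgue_measure R).

Lemma ge0_integral_affine (a b : R) (f : R -> \bar R) :
  a != 0 -> measurable_fun setT f -> (forall x, 0 <= f x)%E ->
  (\int[leb]_x f (a * x + b)%R = `|a|^-1%:E * \int[leb]_x f x)%E.
Proof.
move=> a0 mf f0.
have mphi : measurable_fun setT (fun t : measurableTypeR R => (a * t + b : measurableTypeR R)).
  by apply: measurable_funD => //; apply: measurable_funM.
rewrite -(@ge0_integral_pushforward _ _ _ _ _ _ mphi leb setT f)//.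
have p0 : 0 <= `|a|^-1 by rewrite invr_ge0.
transitivity (\int[mscale (NngNum p0) leb]_x f x)%E.
  apply: eq_measure_integral => A mA _.
  by rewrite /= /mscale /= -(lebesgue_measure_affine b).
by rewrite ge0_integral_mscale.
Qed.

Lemma measurable_powRl (p : R) : measurable_fun setT (fun x : R => x `^ p).
Proof. exact: measurable_powR. Qed.

Lemma integral_powR_cc (c a b : R) : c != -1 -> 0 < a -> a < b ->
  (\int[leb]_(x in `[a, b]) (x `^ c)%:E =
   ((b `^ (c + 1) - a `^ (c + 1)) / (c + 1))%:E)%E.
Proof.
move=> c1 a0 ab; have c10 : c + 1 != 0 by rewrite addr_eq0.
have dF (x : R) : 0 < x -> is_derive x (1:R) (fun x : R => x `^ (c + 1) / (c + 1)) (x `^ c).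
  move=> x0; have d := is_derive1_powR (c + 1) x0.
  have := is_deriveM d (is_derive_cst ((c + 1)^-1) x 1).
  rewrite scaler0 add0r addrK /GRing.scale /= mulrA mulVf// mul1r.
  by apply: near_eq_is_derive; near=> y.
have cont (p x : R) : 0 < x -> {for x, continuous (fun x : R => x `^ p)}.
  move=> x0; apply: differentiable_continuous; apply/derivable1_diffP.
  by have [] := is_derive1_powR p x0.
have contF x : 0 < x -> {for x, continuous (fun x : R => x `^ (c + 1) / (c + 1))}.
  move=> x0; apply: differentiable_continuous; apply/derivable1_diffP.
  by have [] := dF x x0.
rewrite (continuous_FTC2 (F := fun x => x `^ (c + 1) / (c + 1)) ab).
- by rewrite -EFinB -mulrBl.
- apply: continuous_in_subspaceT => x /set_mem /=; rewrite in_itv /= => /andP[ax _].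
  exact: cont (lt_le_trans a0 ax).
- split.
  + move=> x; rewrite in_itv /= => /andP[ax _].
    by have [] := dF x (lt_trans a0 ax).
  + by apply: cvg_at_right_filter; exact: contF.
  + by apply: cvg_at_left_filter; apply: contF; exact: lt_trans ab.
- move=> x; rewrite in_itv /= => /andP[ax _]; rewrite derive1E.
  by have [_ ->] := dF x (lt_trans a0 ax).
Unshelve. all: by end_near. Qed.

Lemma integral_powR_0b (c b : R) : -1 < c -> 0 < b ->
  (\int[leb]_(x in `]0%R, b[) (x `^ c)%:E = (b `^ (c + 1) / (c + 1))%:E)%E.
Proof.
move=> c1 b0; have c10 : 0 < c + 1 by rewrite -ltrBlDr sub0r.
rewrite integral_itv_bndo_bndc; last first.
  by apply/measurable_EFinP; apply: measurable_funTS; exact: measurable_powRl.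
pose F (k : nat) := `[b / k.+2%:R, b]%classic : set R.
have UF : `]0, b]%classic = \bigcup_k F k.
  apply/seteqP; split=> x /=.
    rewrite in_itv /= => /andP[x0 xb]; exists (Num.truncn (b / x)) => //=.
    rewrite /F /= in_itv /= xb andbT ler_pdivrMr// mulrC -ler_pdivrMr//.
    by rewrite ltW// (lt_trans (truncnS_gt _))// ltr_nat.
  move=> [k _]; rewrite /F /= !in_itv /= => /andP[kx xb]; rewrite xb andbT.
  by apply: lt_le_trans kx; rewrite divr_gt0.
have mF : forall k, measurable (F k) by move=> k; exact: measurable_itv.
have ndF : nondecreasing_seq F.
  move=> k l kl; apply/subsetPset => x; rewrite /F /= !in_itv /= => /andP[h ->].
  rewrite andbT; apply: le_trans h; rewrite ler_pM2l// lef_pV2 ?posrE ?ltr0n//.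
  by rewrite ler_nat.
have cv1 : (\int[leb]_(x in F k) (x `^ c)%:E @[k --> \oo] --> \int[leb]_(x in \bigcup_k F k) (x `^ c)%:E)%E.
  apply: ge0_nondecreasing_set_cvg_integral => //.
  - by move=> k; apply/measurable_EFinP; apply: measurable_funTS; exact: measurable_powRl.
  - by move=> k x _; rewrite lee_fin powR_ge0.
rewrite UF; apply: (cvg_unique _ cv1) => //.
have -> : (fun k => \int[leb]_(x in F k) (x `^ c)%:E)%E =
   fun k => ((b `^ (c + 1) - (b / k.+2%:R) `^ (c + 1)) / (c + 1))%:E.
  apply/funext => k; rewrite /F integral_powR_cc ?divr_gt0//; first by rewrite gt_eqF.
  by rewrite ltr_pdivrMr// ltr_pMr// ltr1n.
apply: cvg_EFin; first by near=> k.
apply: cvgM; last exact: cvg_cst.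
rewrite -[X in _ --> X]subr0; apply: cvgB; first exact: cvg_cst.
have [+ _] := cvg_at_rightP (fun a : R => a `^ (c + 1)) 0 0.
move=> /(_ (powR_cvg0 c10) (fun k => b / k.+2%:R)); apply; split.
  by move=> k; rewrite divr_gt0.
rewrite -(mulr0 b); apply: cvgM; first exact: cvg_cst.
have := @cvg_harmonic R; rewrite -(cvg_shiftS (@harmonic R)); exact.
Unshelve. all: by end_near. Qed.

Lemma integral_powR_1y (c : R) : c < -1 ->
  (\int[leb]_(x in `[1%R, +oo[) (x `^ c)%:E < +oo)%E.
Proof.
move=> c1; have c10 : c + 1 < 0 by rewrite -ltrBrDr sub0r.
pose F (k : nat) := `[1, k.+2%:R]%classic : set R.
have UF : `[1, +oo[%classic = \bigcup_k F k.
  apply/seteqP; split=> x /=; last by move=> [k _]; rewrite /F /= !in_itv /= => /andP[->].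
  rewrite in_itv /= andbT => x1; exists (Num.truncn x) => //=.
  by rewrite /F /= in_itv /= x1 ltW// (lt_trans (truncnS_gt _))// ltr_nat.
have mF : forall k, measurable (F k) by move=> k; exact: measurable_itv.
have ndF : nondecreasing_seq F.
  move=> k l kl; apply/subsetPset => x; rewrite /F /= !in_itv /= => /andP[-> h] /=.
  by apply: le_trans h _; rewrite ler_nat.
have cv1 : (\int[leb]_(x in F k) (x `^ c)%:E @[k --> \oo] --> \int[leb]_(x in \bigcup_k F k) (x `^ c)%:E)%E.
  apply: ge0_nondecreasing_set_cvg_integral => //.
  - by move=> k; apply/measurable_EFinP; apply: measurable_funTS; exact: measurable_powRl.
  - by move=> k x _; rewrite lee_fin powR_ge0.
rewrite UF; apply: (@le_lt_trans _ _ (- (c + 1)^-1)%:E); last exact: ltry.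
rewrite -(cvg_lim _ cv1)//; apply: lime_le; first by apply/cvg_ex; eexists; exact: cv1.
near=> k; rewrite /F integral_powR_cc ?ltr1n ?lt_eqF// powR1 lee_fin.
by rewrite mulrBl mul1r gerDr pmulr_rle0 ?powR_gt0// invr_le0 ltW.
Unshelve. all: by end_near. Qed.

Lemma integral_itvoo_shift (a b : R) (f : R -> \bar R) :
  measurable_fun setT f -> (forall x, 0 <= f x)%E ->
  (\int[leb]_(t in `]a, b[) f (t - a)%R = \int[leb]_(t in `]0%R, (b - a)%R[) f t)%E.
Proof.
move=> mf f0; rewrite integral_mkcond [RHS]integral_mkcond.
have h := @ge0_integral_affine 1 (- a) (f \_ `]0, b - a[).
rewrite normr1 invr1 mul1e in h; rewrite -h ?oner_neq0//.
- apply: eq_integral => t _; rewrite !patchE mul1r.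
  have -> // : (t \in `]a, b[%classic) = (t - a \in `]0, b - a[%classic).
  by apply/idP/idP; rewrite !inE /= !in_itv /= subr_gt0 ltrD2r.
- by apply/(measurable_restrictT f) => //; exact: measurable_funTS.
- by move=> x; rewrite patchE; case: ifP.
Qed.

Lemma integral_itvoo_reflect (a b : R) (f : R -> \bar R) :
  measurable_fun setT f -> (forall x, 0 <= f x)%E ->
  (\int[leb]_(t in `]a, b[) f (b - t)%R = \int[leb]_(t in `]0%R, (b - a)%R[) f t)%E.
Proof.
move=> mf f0; rewrite integral_mkcond [RHS]integral_mkcond.
have h := @ge0_integral_affine (-1) b (f \_ `]0, b - a[).
rewrite normrN1 invr1 mul1e in h; rewrite -h ?oppr_eq0 ?oner_neq0//.
- apply: eq_integral => t _; rewrite !patchE mulN1r.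
  rewrite (addrC (- t) b).
  have -> // : (t \in `]a, b[%classic) = (b - t \in `]0, b - a[%classic).
  by apply/idP/idP; rewrite !inE /= !in_itv /= subr_gt0 ltrD2l ltrN2 andbC.
- by apply/(measurable_restrictT f) => //; exact: measurable_funTS.
- by move=> x; rewrite patchE; case: ifP.
Qed.

Lemma measurable_powR_EFin (c : R) : measurable_fun setT (fun x : R => (x `^ c)%:E).
Proof. by apply/measurable_EFinP; exact: measurable_powRl. Qed.

Lemma powR_EFin_ge0 (c x : R) : (0 <= (x `^ c)%:E)%E.
Proof. by rewrite lee_fin powR_ge0. Qed.

Lemma measurable_dist_powR (c tau : R) :
  measurable_fun setT (fun t : R => (`|t - tau| `^ c)%:E).
Proof.
apply/measurable_EFinP; apply: (measurableT_comp (measurable_powRl c)).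
by apply: measurableT_comp => //; exact: measurable_funB.
Qed.

Lemma integral_dist_powR (a b c tau : R) : -1 < c -> a < tau -> tau < b ->
  (\int[leb]_(t in `]a, b[) (`|t - tau| `^ c)%:E =
   (((tau - a) `^ (c + 1) + (b - tau) `^ (c + 1)) / (c + 1))%:E)%E.
Proof.
move=> c1 atau taub.
have -> : `]a, b[%classic = `]a, tau[ `|` `[tau, b[ :> set R.
  by rewrite -itv_bndbnd_setU// bnd_simp ltW.
rewrite ge0_integral_setU//=; last 2 first.
- exact: (measurable_funS measurableT _ (measurable_dist_powR c tau)).
- apply/disj_setPLR => x /=; rewrite !in_itv /= => /andP[_ xt] /andP[].
  by rewrite leNgt xt.
rewrite -integral_itv_obnd_cbnd; last first.
  by apply: measurable_funTS; exact: measurable_dist_powR.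
have -> : (\int[leb]_(t in `]a, tau[) (`|t - tau| `^ c)%:E =
    \int[leb]_(t in `]a, tau[) (((tau - t) `^ c)%R)%:E)%E.
  apply: eq_integral => t; rewrite inE /= in_itv /= => /andP[_ tt].
  by rewrite ltr0_norm ?subr_lt0// opprB.
have -> : (\int[leb]_(t in `]tau, b[) (`|t - tau| `^ c)%:E =
    \int[leb]_(t in `]tau, b[) (((t - tau) `^ c)%R)%:E)%E.
  apply: eq_integral => t; rewrite inE /= in_itv /= => /andP[tt _].
  by rewrite gtr0_norm ?subr_gt0.
rewrite (integral_itvoo_reflect a tau (measurable_powR_EFin c) (powR_EFin_ge0 c)).
rewrite (integral_itvoo_shift tau b (measurable_powR_EFin c) (powR_EFin_ge0 c)).
by rewrite !integral_powR_0b ?subr_gt0// -EFinD mulrDl.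
Qed.

(** The contribution of the pairs of heights to the limit, for [c = 1 - 2 s] and
    the interval from 0 to 1. *)
Lemma integral2_dist_powR (a b c : R) : -1 < c -> a < b ->
  (\int[leb]_(tau in `]a, b[) \int[leb]_(t in `]a, b[) (`|t - tau| `^ c)%:E =
   (2 * (b - a) `^ (c + 2) / ((c + 1) * (c + 2)))%:E)%E.
Proof.
move=> c1 ab; have c10 : 0 < c + 1 by rewrite -ltrBlDr sub0r.
have c20 : 0 < c + 2 by move: c10; lra.
have -> : (\int[leb]_(tau in `]a, b[) \int[leb]_(t in `]a, b[) (`|t - tau| `^ c)%:E =
   \int[leb]_(tau in `]a, b[) ((c + 1)^-1%:E * ((((tau - a) `^ (c + 1))%R)%:E + (((b - tau) `^ (c + 1))%R)%:E)))%E.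
  apply: eq_integral => tau; rewrite inE /= in_itv /= => /andP[at_ tb].
  by rewrite integral_dist_powR// -EFinD -EFinM mulrC.
have m1 : measurable_fun `]a, b[ (fun tau : R => (((tau - a) `^ (c + 1))%R)%:E).
  apply: measurable_funTS; apply/measurable_EFinP.
  by apply: (measurableT_comp (measurable_powRl _)); exact: measurable_funB.
have m2 : measurable_fun `]a, b[ (fun tau : R => (((b - tau) `^ (c + 1))%R)%:E).
  apply: measurable_funTS; apply/measurable_EFinP.
  by apply: (measurableT_comp (measurable_powRl _)); exact: measurable_funB.
rewrite ge0_integralZl_EFin//=; last 3 first.
- by move=> x _; rewrite adde_ge0// powR_EFin_ge0.
- exact: emeasurable_funD.
- by rewrite invr_ge0 ltW.
rewrite ge0_integralD//=; last 2 first.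
- by move=> x _; exact: powR_EFin_ge0.
- by move=> x _; exact: powR_EFin_ge0.
rewrite (integral_itvoo_reflect a b (measurable_powR_EFin _) (powR_EFin_ge0 _)).
rewrite (integral_itvoo_shift a b (measurable_powR_EFin _) (powR_EFin_ge0 _)).
rewrite !integral_powR_0b ?subr_gt0//; last by move: c10; lra.
rewrite -EFinD -EFinM; congr EFin.
have -> : c + 1 + 1 = c + 2 by ring.
by field; rewrite !gt_eqF.
Qed.

Lemma integral_dist_powR_le (a b c tau : R) : -1 < c -> a < tau < b -> b - a <= 1 ->
  (\int[leb]_(t in `]a, b[) (`|t - tau| `^ c)%:E <= (2 / (c + 1))%:E)%E.
Proof.
move=> c1 /andP[at_ tb] ba; have c10 : 0 < c + 1 by rewrite -ltrBlDr sub0r.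
rewrite integral_dist_powR// lee_fin ler_pM2r ?invr_gt0//.
have le1 (x : R) : 0 < x -> x <= 1 -> x `^ (c + 1) <= 1.
  move=> x0 x1; rewrite -[leRHS](powRr0 x); apply: ger_powR; last exact: ltW.
  by rewrite x0 x1.
by rewrite -[leRHS]/(1 + 1) lerD// le1 ?subr_gt0//; lra.
Qed.

(** Comparison with the indicator of [-1, 1] plus [|t|^(-2c)] on either
    half-line. *)
Lemma integral_japanese1 (c : R) : 2^-1 < c ->
  (\int[leb]_t ((1 + t ^+ 2) `^ (- c))%:E < +oo)%E.
Proof.
move=> c2; have c20 : - (2 * c) < -1 by lra.
pose g : R -> \bar R := (fun x => (x `^ (- (2 * c)))%:E) \_ `[1, +oo[.
have g0 x : (0 <= g x)%E by rewrite /g patchE; case: ifP => // _; exact: powR_EFin_ge0.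
have mg : measurable_fun setT g.
  apply/(measurable_restrictT (fun x : R => (x `^ (- (2 * c)))%:E)) => //.
  by apply: measurable_funTS; exact: measurable_powR_EFin.
have mgN : measurable_fun setT (fun t : R => g (-1 * t + 0)%R).
  by apply: measurableT_comp => //; apply: measurable_funD => //; exact: measurable_funM.
have gfin : (\int[leb]_t g t < +oo)%E.
  by rewrite /g -integral_mkcond; exact: integral_powR_1y.
have mI : measurable_fun setT (fun t : R => (\1_(`[-1, 1]%classic : set R) t : R)%:E).
  by apply/measurable_EFinP; exact: measurable_indic.
apply: (@le_lt_trans _ _ (\int[leb]_t ((\1_(`[-1, 1]%classic : set R) t : R)%:E + (g t + g (-1 * t + 0)%R)))%E).
  apply: ge0_le_integral => //.
  - by move=> x _; exact: powR_EFin_ge0.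
  - apply: measurable_funTS; apply/measurable_EFinP.
    apply: (measurableT_comp (measurable_powRl _)); apply: measurable_funD => //.
  - by apply: emeasurable_funD => //; exact: emeasurable_funD.
  - move=> t _; have t1 : 1 <= 1 + t ^+ 2 by rewrite lerDl sqr_ge0.
    have [tn|tn] := leP `|t| 1.
      rewrite indicE mem_set; last by rewrite /= in_itv /= -ler_norml.
      rewrite -[leLHS]adde0; apply: leeD; last by rewrite adde_ge0.
      rewrite lee_fin.
      apply: (@le_trans _ _ ((1 + t ^+ 2) `^ 0)); last by rewrite powRr0.
      by rewrite ler_powR//; move: c2; lra.
    have bnd : (1 + t ^+ 2) `^ (- c) <= `|t| `^ (- (2 * c)).
      rewrite -mulrN powRrM powR_mulrn// real_normK ?num_real// !powRN.
      rewrite lef_pV2 ?posrE ?powR_gt0//; last 2 first.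
      - by move: t1; lra.
      - by rewrite -real_normK ?num_real// exprn_gt0// (lt_trans _ tn).
      by rewrite ge0_ler_powR ?nnegrE ?sqr_ge0//; move: t1; lra.
    have [t0|t0] := leP 0 t.
      have gt_ : g t = (`|t| `^ (- (2 * c)))%:E.
        by rewrite /g patchE mem_set ?ger0_norm//= in_itv /= andbT ltW// -(ger0_norm t0).
      rewrite gt_ addeCA; apply: (@le_trans _ _ (`|t| `^ (- (2 * c)))%:E); first by rewrite lee_fin.
      by rewrite leeDl// adde_ge0// lee_fin.
    have gt_ : g (-1 * t + 0) = (`|t| `^ (- (2 * c)))%:E.
      rewrite addr0 mulN1r /g patchE mem_set ?ltr0_norm//= in_itv /= andbT ltW//.
      by rewrite -(ltr0_norm t0).
    rewrite gt_ addeA; apply: (@le_trans _ _ (`|t| `^ (- (2 * c)))%:E); first by rewrite lee_fin.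
    by rewrite leeDr// adde_ge0// lee_fin.
rewrite ge0_integralD//; last 2 first.
- by move=> x _; rewrite adde_ge0.
- exact: emeasurable_funD.
rewrite ge0_integralD// (ge0_integral_affine 0)//.
rewrite normrN1 invr1 mul1e integral_indic// setIT lte_add_pinfty//.
  have : (leb (`[(-1)%R, 1%R]%classic : set R) < +oo)%E.
    by rewrite lebesgue_measure_itv /= lte_fin; case: ifP => _; rewrite ltry.
  exact.
by rewrite lte_add_pinfty.
Qed.
End power_integrals.

(** * Moments of the kernel *)

Section kernel.
Context {R : realType}.
Implicit Types n : nat.

Lemma powR_add (x r s : R) : 0 < x -> x `^ (r + s) = x `^ r * x `^ s.
Proof. by move=> x0; apply: powRD; rewrite (gt_eqF x0) implybT. Qed.

Lemma dot_ge0 n (x : 'rV[R]_n) : 0 <= dot x x.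
Proof. by apply: sumr_ge0 => i _; rewrite -expr2 sqr_ge0. Qed.

Lemma ler_norm_dot n (x : 'rV[R]_n) : `|x| ^+ 2 <= dot x x.
Proof.
rewrite -[leRHS]sqr_sqrtr ?dot_ge0// ler_sqr ?nnegrE ?sqrtr_ge0//.
apply/ler_norm_rV; first exact: sqrtr_ge0.
move=> i; rewrite -sqrtr_sqr ler_sqrt ?dot_ge0// expr2 /dot (bigD1 i)//=.
by rewrite lerDl; apply: sumr_ge0 => j _; rewrite -expr2 sqr_ge0.
Qed.

Lemma dotZ n (r : R) (x : 'rV[R]_n) : dot (r *: x) (r *: x) = r ^+ 2 * dot x x.
Proof. by rewrite /dot big_distrr /=; apply: eq_bigr => i _; rewrite !mxE; ring. Qed.

Lemma measurable_dot n : measurable_fun setT (fun x : 'rV[R]_n => dot x x).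
Proof.
apply: measurable_sum => i; apply: measurable_funM; exact: measurable_coord_rV.
Qed.

(** [sg] is the exponent (d + 2 s) / 2 and [r] the vertical distance. *)
Definition ker n (sg r : R) (h : 'rV[R]_n) : R := ((dot h h + r ^+ 2) `^ sg)^-1.

Lemma ker_ge0 n sg r (h : 'rV[R]_n) : 0 <= ker sg r h.
Proof. by rewrite invr_ge0 powR_ge0. Qed.

Lemma measurable_ker n sg r : measurable_fun setT (@ker n sg r).
Proof.
rewrite (_ : @ker n sg r = fun h => (dot h h + r ^+ 2) `^ (- sg)); last first.
  by apply/funext => h; rewrite powRN.
apply: (measurableT_comp (measurable_powRl _)).
by apply: measurable_funD => //; exact: measurable_dot.
Qed.

Lemma ker_le n sg r (h : 'rV[R]_n) : 0 <= sg -> 0 < r -> ker sg r h <= ((r ^+ 2) `^ sg)^-1.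
Proof.
move=> sg0 r0; have r20 : 0 < r ^+ 2 by rewrite exprn_gt0.
have p0 : 0 < dot h h + r ^+ 2 by rewrite ltr_wpDl// dot_ge0.
rewrite lef_pV2 ?posrE ?powR_gt0// ge0_ler_powR ?nnegrE ?(ltW p0) ?(ltW r20)//.
by rewrite lerDr dot_ge0.
Qed.

Lemma kerN n sg r (h : 'rV[R]_n) : ker sg r (- h) = ker sg r h.
Proof. by rewrite /ker -scaleN1r dotZ sqrrN expr1n mul1r. Qed.

Lemma ker_scale n sg r (h : 'rV[R]_n) : 0 < r ->
  ker sg r (r *: h) = r `^ (- (2 * sg)) * ker sg 1 h.
Proof.
move=> r0; rewrite /ker dotZ expr1n.
have -> : r ^+ 2 * dot h h + r ^+ 2 = r ^+ 2 * (dot h h + 1) by ring.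
rewrite powRM ?sqr_ge0 ?addr_ge0 ?dot_ge0// invfM; congr (_ * _).
by rewrite powRN -(powR_mulrn 2 (ltW r0)) -powRrM.
Qed.

Lemma ge0_integral_dilation n (r : R) (f : 'rV[R]_n -> \bar R) : 0 < r ->
  measurable_fun setT f -> (forall x, 0 <= f x)%E ->
  (\int[lebesgue_rV R n]_x f x =
   (r ^+ n)%:E * \int[lebesgue_rV R n]_x f (r *: x))%E.
Proof.
move=> r0 mf f0.
have := @ge0_integral_affine_rV R n 1%g (fun=> r) (fun=> 0) f (fun=> lt0r_neq0 r0) mf f0.
rewrite prodr_const card_ord gtr0_norm//.
have -> : (fun x => f (affine_rV 1%g (fun=> r) (fun=> 0) x)) = fun x => f (r *: x).
  by apply/funext => x; congr f; apply/rowP => i; rewrite !mxE perm1 addr0.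
by move=> ->; rewrite muleA -EFinM mulfV ?mul1e// expf_neq0// gt_eqF.
Qed.

(** Positive and negative parts are transformed separately, so that this also
    covers the odd integrands. *)
Lemma integral_isometry_rV n (s : {perm 'I_n}) (a b : 'I_n -> R) (f : 'rV[R]_n -> \bar R) :
  (forall i, `|a i| = 1) -> measurable_fun setT f ->
  (\int[lebesgue_rV R n]_x f (affine_rV s a b x) = \int[lebesgue_rV R n]_x f x)%E.
Proof.
move=> a1 mf.
have a0 i : a i != 0 by rewrite -normr_eq0 a1 oner_neq0.
have h (g : 'rV[R]_n -> \bar R) : measurable_fun setT g -> (forall x, 0 <= g x)%E ->
  (\int[lebesgue_rV R n]_x g (affine_rV s a b x) = \int[lebesgue_rV R n]_x g x)%E.
  move=> mg g0; rewrite (ge0_integral_affine_rV s b a0 mg g0).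
  by rewrite big1 ?invr1 ?mul1e.
have hp := h (f^\+)%E (measurable_funepos mf) (funepos_ge0 f).
have hn := h (f^\-)%E (measurable_funeneg mf) (funeneg_ge0 f).
rewrite integralE [RHS]integralE; congr (_ - _)%E.
  by rewrite -hp; apply: eq_integral => x _; rewrite !funeposE.
by rewrite -hn; apply: eq_integral => x _; rewrite !funenegE.
Qed.

(** Substitute [r *: h] for [h]; both factors are homogeneous. *)
Lemma scaling_moment n (sg r a : R) (F : 'rV[R]_n -> R) : 0 < r ->
  measurable_fun setT F -> (forall h, 0 <= F h) ->
  (forall h, F (r *: h) = r `^ a * F h) ->
  (\int[lebesgue_rV R n]_h (F h * ker sg r h)%:E =
   (r `^ (n%:R + a - 2 * sg))%:E * \int[lebesgue_rV R n]_h (F h * ker sg 1 h)%:E)%E.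
Proof.
move=> r0 mF F0 hF.
have mK t : measurable_fun setT (fun h => (F h * ker sg t h)%:E).
  by apply/measurable_EFinP; apply: measurable_funM => //; exact: measurable_ker.
have K0 h : (0 <= (F h * ker sg r h)%:E)%E by rewrite lee_fin mulr_ge0// ker_ge0.
rewrite (ge0_integral_dilation r0 (mK r) K0).
have -> : (fun h => (F (r *: h) * ker sg r (r *: h))%:E) =
   fun h => ((r `^ (a - 2 * sg))%:E * (F h * ker sg 1 h)%:E)%E.
  apply/funext => h; rewrite hF ker_scale// -EFinM; congr EFin.
  by rewrite powR_add//; ring.
rewrite ge0_integralZl_EFin ?powR_ge0//; last by move=> h _; rewrite lee_fin mulr_ge0// ker_ge0.
rewrite muleA -EFinM -(powR_mulrn n (ltW r0)) -powR_add// addrA.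
by [].
Qed.

Lemma integral_rVS n (f : 'rV[R]_n.+1 -> \bar R) :
  measurable_fun setT f -> (forall x, 0 <= f x)%E ->
  (\int[lebesgue_rV R n.+1]_x f x =
   \int[lebesgue_rV R n]_x \int[@lebesgue_measure R]_t f (snoc_rV (x, t)))%E.
Proof.
move=> mf f0.
have -> : (\int[lebesgue_rV R n.+1]_x f x =
   \int[lebesgue_rV R n \x @lebesgue_measure R]_p f (snoc_rV p))%E.
  rewrite -(@ge0_integral_pushforward _ _ _ _ _ _ (@measurable_snoc_rV R n)
    (lebesgue_rV R n \x @lebesgue_measure R)%E setT f)//.
rewrite fubini_tonelli1//.
by apply: measurableT_comp => //; exact: measurable_snoc_rV.
Qed.

Lemma integral_rV_prod n (w : R -> R) : measurable_fun setT w -> (forall t, 0 <= w t) ->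
  (\int[lebesgue_rV R n]_x (\prod_(i < n) w (x ord0 i))%:E =
   \prod_(i < n) \int[@lebesgue_measure R]_t (w t)%:E)%E.
Proof.
move=> mw w0; have mp k : measurable_fun setT (fun x : 'rV[R]_k => (\prod_(i < k) w (x ord0 i))%:E).
  apply/measurable_EFinP; apply: measurable_prod => i _.
  by apply: (measurableT_comp mw); exact: measurable_coord_rV.
have p0 k (x : 'rV[R]_k) : (0 <= (\prod_(i < k) w (x ord0 i))%:E)%E.
  by rewrite lee_fin; apply: prodr_ge0.
elim: n => [|n IHn].
  rewrite big_ord0 /= integral_dirac//=.
    by rewrite diracE mem_set// mul1e big_ord0.
  exact: mp.
rewrite integral_rVS//.
have -> : (\prod_(i < n.+1) \int[@lebesgue_measure R]_t (w t)%:E =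
  (\prod_(i < n) \int[@lebesgue_measure R]_t (w t)%:E) * \int[@lebesgue_measure R]_t (w t)%:E)%E.
  by rewrite big_ord_recr.
have I0 : (0 <= \int[@lebesgue_measure R]_t (w t)%:E)%E.
  by apply: integral_ge0 => t _; rewrite lee_fin.
rewrite -IHn -(ge0_integralZr (lebesgue_rV R n) measurableT (mp n) (fun x _ => p0 n x) I0).
apply: eq_integral => x _; rewrite -ge0_integralZl_EFin//; last first.
- exact: prodr_ge0.
- exact/measurable_EFinP.
- by move=> t _; rewrite lee_fin.
apply: eq_integral => t _; rewrite -EFinM big_ord_recr /=; congr (_ * _)%:E.
  apply: eq_bigr => i _; rewrite /snoc_rV mxE.
  have -> : widen_ord (leqnSn n) i = lift ord_max i.
    by apply: val_inj => /=; rewrite /bump leqNgt ltn_ord.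
  by rewrite liftK.
by rewrite /snoc_rV mxE unlift_none.
Qed.

(** [(1 + |x|^2)^n] dominates the product of the [1 + x_i^2], so that the integral
    is bounded by a product of one-dimensional ones. *)
Lemma japanese_fin n (c : R) : n%:R / 2 < c ->
  (\int[lebesgue_rV R n]_x ((1 + dot x x) `^ (- c))%:E < +oo)%E.
Proof.
move=> nc; have c0 : 0 < c by apply: le_lt_trans nc; rewrite divr_ge0.
pose w (t : R) := (1 + t ^+ 2) `^ (- (c / n%:R)).
have mw : measurable_fun setT w.
  apply: (measurableT_comp (measurable_powRl _)); apply: measurable_funD => //.
have w0 t : 0 <= w t by exact: powR_ge0.
apply: (@le_lt_trans _ _ (\int[lebesgue_rV R n]_x (\prod_(i < n) w (x ord0 i))%:E)%E).
  apply: ge0_le_integral => //.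
  - by move=> x _; rewrite lee_fin powR_ge0.
  - apply/measurable_EFinP; apply: (measurableT_comp (measurable_powRl _)).
    by apply: measurable_funD => //; exact: measurable_dot.
  - apply/measurable_EFinP; apply: measurable_prod => i _.
    by apply: (measurableT_comp mw); exact: measurable_coord_rV.
  - move=> x _; rewrite lee_fin.
    have x1 : 1 <= 1 + dot x x by rewrite lerDl dot_ge0.
    have [n0|n0] := posnP n.
      rewrite big1 => [|i _]; last by exfalso; have := ltn_ord i; rewrite [X in (_ < X)%N]n0.
      rewrite -[leRHS](powRr0 (1 + dot x x)) ler_powR// oppr_le0; exact: ltW.
    have nR : (n%:R : R) != 0 by rewrite pnatr_eq0 -lt0n.
    have -> : - c = - (c / n%:R) * n%:R by rewrite mulNr divfK.
    rewrite powRrM powR_mulrn ?powR_ge0// -[X in _ ^+ X]card_ord -prodr_const.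
    apply: ler_prod => i _; rewrite powR_ge0 /= /w !powRN.
    have xi : 1 <= 1 + x ord0 i ^+ 2 by rewrite lerDl sqr_ge0.
    rewrite lef_pV2 ?posrE ?powR_gt0 ?(lt_le_trans ltr01)//.
    rewrite ge0_ler_powR ?nnegrE ?(le_trans ler01 x1) ?(le_trans ler01 xi) ?divr_ge0 ?(ltW c0)//.
    rewrite lerD2l /dot (bigD1 i)//= -expr2 lerDl; apply: sumr_ge0 => j _.
    by rewrite -expr2 sqr_ge0.
rewrite integral_rV_prod//; have [n0|n0] := posnP n.
  rewrite big1 ?ltry// => i _; exfalso; have := ltn_ord i.
  by rewrite [X in (_ < X)%N]n0.
set I := (\int[_]_t _)%E.
have Ifin : (I < +oo)%E.
  apply: integral_japanese1; rewrite ltr_pdivlMr ?ltr0n//.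
  by rewrite mulrC.
have I0 : (0 <= I)%E by apply: integral_ge0 => t _; rewrite lee_fin.
rewrite (eq_bigr (fun=> (fine I)%:E)) => [|i _].
  by rewrite prodEFin ltry.
by rewrite fineK// ge0_fin_numE.
Qed.

(** ** Moments *)

(** For [beta = 1] and [sg = (n + 1) / 2 + s] this is the integral that defines the
    constant K of the limit in dimension [n + 1]. *)
Definition mom n (beta sg : R) : \bar R :=
  (\int[lebesgue_rV R n]_h (dot h h `^ beta * ker sg 1 h)%:E)%E.

Lemma measurable_dot_powR n beta : measurable_fun setT (fun h : 'rV[R]_n => dot h h `^ beta).
Proof. by apply: (measurableT_comp (measurable_powRl _)); exact: measurable_dot. Qed.

Lemma measurable_mom n beta sg r :
  measurable_fun setT (fun h : 'rV[R]_n => (dot h h `^ beta * ker sg r h)%:E).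
Proof.
apply/measurable_EFinP; apply: measurable_funM; first exact: measurable_dot_powR.
exact: measurable_ker.
Qed.

Lemma mom_integrand_ge0 n beta sg r (h : 'rV[R]_n) : 0 <= dot h h `^ beta * ker sg r h.
Proof. by rewrite mulr_ge0 ?powR_ge0 ?ker_ge0. Qed.

Lemma mom_ge0 n beta sg : (0 <= mom n beta sg)%E.
Proof. by apply: integral_ge0 => h _; rewrite lee_fin mom_integrand_ge0. Qed.

Lemma mom_fin n beta sg : 0 <= beta -> n%:R / 2 + beta < sg -> (mom n beta sg < +oo)%E.
Proof.
move=> b0 nb; apply: le_lt_trans (@japanese_fin n (sg - beta) _); last by lra.
apply: ge0_le_integral => //.
- by move=> h _; rewrite lee_fin mom_integrand_ge0.
- exact: measurable_mom.
- apply/measurable_EFinP; apply: (measurableT_comp (measurable_powRl _)).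
  by apply: measurable_funD => //; exact: measurable_dot.
- move=> h _; rewrite lee_fin /ker expr1n (addrC (dot h h)) opprB.
  have h1 : 0 < 1 + dot h h by rewrite ltr_wpDr ?dot_ge0.
  rewrite powR_add// powRN.
  rewrite ler_wpM2r ?invr_ge0 ?powR_ge0// ge0_ler_powR ?nnegrE ?dot_ge0// ?(ltW h1)//.
  by rewrite lerDr.
Qed.

Lemma ker1_anti n sg1 sg (h : 'rV[R]_n) : sg1 <= sg -> ker sg 1 h <= ker sg1 1 h.
Proof.
move=> s1s; rewrite /ker expr1n.
have h1 : 1 <= dot h h + 1 by rewrite lerDr dot_ge0.
by rewrite lef_pV2 ?posrE ?powR_gt0 ?(lt_le_trans ltr01)// ler_powR.
Qed.

Lemma mom_anti n beta sg1 sg : sg1 <= sg -> (mom n beta sg <= mom n beta sg1)%E.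
Proof.
move=> s1s; apply: ge0_le_integral => //.
- by move=> h _; rewrite lee_fin mom_integrand_ge0.
- exact: measurable_mom.
- exact: measurable_mom.
- by move=> h _; rewrite lee_fin ler_wpM2l ?powR_ge0 ?ker1_anti.
Qed.

Lemma mom_scale n beta sg r : 0 < r ->
  (\int[lebesgue_rV R n]_h (dot h h `^ beta * ker sg r h)%:E =
   (r `^ (n%:R + 2 * beta - 2 * sg))%:E * mom n beta sg)%E.
Proof.
move=> r0; rewrite (@scaling_moment n sg r (2 * beta) (fun h => dot h h `^ beta))//.
- exact: measurable_dot_powR.
- by move=> h; exact: powR_ge0.
- move=> h; rewrite dotZ powRM ?sqr_ge0 ?dot_ge0//; congr (_ * _).
  by rewrite -(powR_mulrn 2 (ltW r0)) -powRrM.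
Qed.

(** Dominated convergence: the kernel decreases with the exponent, so one exponent
    slightly below the limit dominates. *)
Lemma mom_cvg n (beta : R) (sg : nat -> R) (sg0 : R) : 0 <= beta -> n%:R / 2 + beta < sg0 ->
  sg j @[j --> \oo] --> sg0 -> mom n beta (sg j) @[j --> \oo] --> mom n beta sg0.
Proof.
move=> b0 nb sgcv; pose sg1 := (n%:R / 2 + beta + sg0) / 2.
have nb1 : n%:R / 2 + beta < sg1 by rewrite /sg1; lra.
have sg10 : sg1 < sg0 by rewrite /sg1; lra.
(* truncated from below, all the exponents share one dominating function *)
pose tg j := Num.max (sg j) sg1.
have near_eq : \forall j \near \oo, tg j = sg j.
  have h : \forall j \near \oo, sg1 < sg j by exact: (cvgr_gt sg0).
  by near=> j; rewrite /tg max_l// ltW//; near: j.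
have tgcv : tg j @[j --> \oo] --> sg0.
  by apply: cvg_trans sgcv; apply: near_eq_cvg; apply: filterS near_eq => j ->.
suff : mom n beta (tg j) @[j --> \oo] --> mom n beta sg0.
  by apply: cvg_trans; apply: near_eq_cvg; apply: filterS near_eq => j ->.
have := @dominated_convergence _ _ _ (lebesgue_rV R n) setT measurableT
  (fun j h => (dot h h `^ beta * ker (tg j) 1 h)%:E)
  (fun h => (dot h h `^ beta * ker sg0 1 h)%:E)
  (fun h => (dot h h `^ beta * ker sg1 1 h)%:E)
  (fun j => @measurable_mom n beta (tg j) 1) (@measurable_mom n beta sg0 1).
case=> //.
- apply: aeW => h _; apply: cvg_EFin; first by near=> j.
  apply: cvgM; first exact: cvg_cst.
  have h0 : 0 < dot h h + 1 ^+ 2 by rewrite expr1n ltr_wpDl ?dot_ge0.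
  apply: cvgV; first by rewrite gt_eqF// powR_gt0.
  rewrite /powR gt_eqF//.
  apply: continuous_cvg; first exact: continuous_expR.
  by apply: cvgM => //; exact: cvg_cst.
- apply/integrableP; split; first exact: measurable_mom.
  rewrite (eq_integral (fun h => (dot h h `^ beta * ker sg1 1 h)%:E)); first exact: mom_fin.
  by move=> h _; rewrite /= ger0_norm// mom_integrand_ge0.
- apply: aeW => h j _; rewrite /= lee_fin ger0_norm ?mom_integrand_ge0//.
  by rewrite ler_wpM2l ?powR_ge0// ker1_anti// le_max lexx orbT.
Unshelve. all: by end_near. Qed.

Lemma mom_integrable n beta sg r : 0 <= beta -> n%:R / 2 + beta < sg -> 0 < r ->
  (lebesgue_rV R n).-integrable setT (fun h => (dot h h `^ beta * ker sg r h)%:E).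
Proof.
move=> b0 nb r0; apply/integrableP; split; first exact: measurable_mom.
rewrite (eq_integral (fun h => (dot h h `^ beta * ker sg r h)%:E)); last first.
  by move=> h _; rewrite /= ger0_norm// mom_integrand_ge0.
by rewrite mom_scale// lte_mul_pinfty ?lee_fin ?powR_ge0// mom_fin.
Qed.

Lemma dot_affine_perm n (s : {perm 'I_n}) (a : 'I_n -> R) (h : 'rV[R]_n) :
  (forall i, `|a i| = 1) ->
  dot (affine_rV s a (fun=> 0) h) (affine_rV s a (fun=> 0) h) = dot h h.
Proof.
move=> a1; rewrite [RHS](reindex_inj (@perm_inj _ s)) /=; apply: eq_bigr => i _.
rewrite !mxE addr0; have a2 : a i * a i = 1.
  by rewrite -expr2 -real_normK ?num_real// a1 expr1n.
by rewrite mulrACA a2 mul1r.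
Qed.

Lemma ler_coord_dot n (h : 'rV[R]_n) i j : `|h ord0 i * h ord0 j| <= dot h h.
Proof.
rewrite normrM; apply: le_trans (ler_norm_dot h).
by rewrite expr2 ler_pM// ler_coord_norm.
Qed.

Lemma coord_moment_integrable n (i j : 'I_n) (sg r : R) :
  n%:R / 2 + 1 < sg -> 0 < r -> (lebesgue_rV R n).-integrable setT
    (fun h => (h ord0 i * h ord0 j * ker sg r h)%:E).
Proof.
move=> nsg r0; apply: le_integrable (mom_integrable ler01 nsg r0) => //.
  apply/measurable_EFinP; apply: measurable_funM; last exact: measurable_ker.
  by apply: measurable_funM; exact: measurable_coord_rV.
move=> h _; rewrite /= lee_fin normrM [leRHS]normrM (ger0_norm (ker_ge0 _ _ _)).
by rewrite ler_wpM2r ?ker_ge0// powRr1 ?dot_ge0// (ger0_norm (dot_ge0 h)) ler_coord_dot.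
Qed.

(** Reflecting one coordinate kills the mixed moments, and exchanging two
    coordinates shows that the pure ones agree. *)
Lemma coord_moment n (i j : 'I_n) (sg r : R) : n%:R / 2 + 1 < sg -> 0 < r ->
  (\int[lebesgue_rV R n]_h (h ord0 i * h ord0 j * ker sg r h)%:E =
   ((i == j)%:R / n%:R)%:E * \int[lebesgue_rV R n]_h (dot h h * ker sg r h)%:E)%E.
Proof.
move=> nsg r0.
have mf k l : measurable_fun setT
    (fun h : 'rV[R]_n => (h ord0 k * h ord0 l * ker sg r h)%:E).
  apply/measurable_EFinP; apply: measurable_funM; last exact: measurable_ker.
  by apply: measurable_funM; exact: measurable_coord_rV.
have fin k l := integrable_fin_num measurableT (coord_moment_integrable k l nsg r0).
have [<-|ij] := eqVneq i j; last first.
  (* reflecting the i-th coordinate changes the sign of the integrand *)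
  rewrite mul0r mul0e; pose a k : R := if k == i then -1 else 1.
  have a1 k : `|a k| = 1 by rewrite /a; case: ifP; rewrite ?normrN1 ?normr1.
  have := integral_isometry_rV 1%g (fun=> 0) a1 (mf i j).
  rewrite (eq_integral (fun h : 'rV[R]_n => - (h ord0 i * h ord0 j * ker sg r h)%:E)%E); last first.
    move=> h _; rewrite -EFinN; congr EFin.
    rewrite /ker dot_affine_perm// !mxE !perm1 /a eqxx eq_sym (negPf ij).
    by rewrite !addr0 mul1r mulN1r !mulNr.
  rewrite integralN; last exact: integrable_add_def (coord_moment_integrable i j nsg r0).
  move: (fin i j); case: (\int[_]_h _)%E => // x _ [xx]; congr EFin.
  by apply/eqP; move: xx => /eqP; rewrite eq_sym -subr_eq0 opprK -mulr2n mulrn_eq0.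
have sym k : (\int[lebesgue_rV R n]_h (h ord0 k * h ord0 k * ker sg r h)%:E =
    \int[lebesgue_rV R n]_h (h ord0 i * h ord0 i * ker sg r h)%:E)%E.
  rewrite -(integral_isometry_rV (tperm k i) (fun=> 0) (fun=> normr1 _) (mf k k)).
  apply: eq_integral => h _; congr EFin.
  rewrite /ker dot_affine_perm; last by move=> l; exact: normr1.
  by rewrite !mxE tpermL !addr0 !mul1r.
have -> : (\int[lebesgue_rV R n]_h (dot h h * ker sg r h)%:E =
   n%:R%:E * \int[lebesgue_rV R n]_h (h ord0 i * h ord0 i * ker sg r h)%:E)%E.
  have -> : (\int[lebesgue_rV R n]_h (dot h h * ker sg r h)%:E =
    \int[lebesgue_rV R n]_h (\sum_(k < n) (h ord0 k * h ord0 k * ker sg r h)%:E))%E.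
    by apply: eq_integral => h _; rewrite sumEFin /dot mulr_suml.
  rewrite integral_sum//; last by move=> k; exact: coord_moment_integrable.
  rewrite (eq_bigr _ (fun k _ => sym k)).
  move: (fin i i); case: (\int[_]_h _)%E => // x _.
  by rewrite sumEFin sumr_const card_ord -EFinM mulr_natl.
rewrite muleA -EFinM mul1r mulVf ?mul1e// pnatr_eq0.
by apply/eqP => n0; have := ltn_ord i; rewrite [X in (_ < X)%N]n0.
Qed.

(** The kernel is isotropic: a quadratic form is averaged to its trace. *)
Lemma quad_moment n (A : 'I_n -> 'I_n -> R) (sg r : R) :
  n%:R / 2 + 1 < sg -> 0 < r ->
  (\int[lebesgue_rV R n]_h ((\sum_i \sum_j A i j * (h ord0 i * h ord0 j)) * ker sg r h)%:E =
   ((\sum_i A i i) / n%:R)%:E * \int[lebesgue_rV R n]_h (dot h h * ker sg r h)%:E)%E.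
Proof.
move=> nsg r0.
have iA i j : (lebesgue_rV R n).-integrable setT
    (fun h => (A i j)%:E * (h ord0 i * h ord0 j * ker sg r h)%:E)%E.
  by apply: integrableZl => //; exact: coord_moment_integrable.
have -> : (\int[lebesgue_rV R n]_h ((\sum_i \sum_j A i j * (h ord0 i * h ord0 j)) * ker sg r h)%:E =
  \int[lebesgue_rV R n]_h \sum_(i < n) \sum_(j < n) ((A i j)%:E * (h ord0 i * h ord0 j * ker sg r h)%:E))%E.
  apply: eq_integral => h _; rewrite mulr_suml -sumEFin; apply: eq_bigr => i _.
  by rewrite mulr_suml -sumEFin; apply: eq_bigr => j _; rewrite -EFinM !mulrA.
rewrite integral_sum//; last by move=> i; exact: integrable_sum.
under eq_bigr => i _.
  rewrite integral_sum//.
  under eq_bigr => j _.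
    rewrite integralZl//; last exact: coord_moment_integrable.
    rewrite coord_moment//.
    over.
  rewrite (bigD1 i)//= eqxx big1 ?adde0; last first.
    by move=> j ji; rewrite eq_sym (negPf ji) mul0r mul0e mule0.
  over.
have fin : (\int[lebesgue_rV R n]_h (dot h h * ker sg r h)%:E)%E \is a fin_num.
  have := integrable_fin_num measurableT (mom_integrable ler01 nsg r0).
  by under eq_integral do rewrite powRr1 ?dot_ge0//.
move: fin; case: (\int[_]_h _)%E => // x _.
rewrite (eq_bigr (fun i => (A i i * (1 / n%:R * x))%:E)); last by move=> i _; rewrite -!EFinM.
by rewrite sumEFin -EFinM -mulr_suml; congr EFin; rewrite mul1r mulrA.
Qed.
End kernel.

(** * The energy as an integral over horizontal slices *)

Section slices.
Context {R : realType} {n : nat}.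
Local Notation leb := (@lebesgue_measure R).
Local Notation lam := (lebesgue_rV R n).
Local Notation space := (Rsplit R n.+1).
Implicit Types (omega : set 'rV[R]_n) (a b : 'rV[R]_n -> R) (v w : space -> R).

(** Interaction between the horizontal planes at distance [r] of a function with
    traces [a] and [b]. *)
Definition slice omega (sg r : R) a b : \bar R :=
  (\int[lam]_(x in omega) \int[lam]_(y in omega)
     ((a x - b y) ^+ 2 * ker sg r (x - y))%:E)%E.

Lemma slice_integrand_ge0 sg r a b x y :
  (0 <= ((a x - b y) ^+ 2 * ker sg r (x - y : 'rV[R]_n))%:E)%E.
Proof. by rewrite lee_fin mulr_ge0 ?sqr_ge0 ?ker_ge0. Qed.

Lemma slice_ge0 omega sg r a b : (0 <= slice omega sg r a b)%E.
Proof.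
by apply: integral_ge0 => x _; apply: integral_ge0 => y _; exact: slice_integrand_ge0.
Qed.

Lemma eq_slice omega sg r a b a' b' : {in omega, a =1 a'} -> {in omega, b =1 b'} ->
  slice omega sg r a b = slice omega sg r a' b'.
Proof.
move=> aa bb; apply: eq_integral => x ox; apply: eq_integral => y oy.
by rewrite aa// bb.
Qed.

Lemma measurable_fun_addrV d (T : measurableType d) (f g : T -> 'rV[R]_n) :
  measurable_fun setT f -> measurable_fun setT g ->
  measurable_fun setT (fun z => f z + g z).
Proof.
move=> mf mg; apply: measurable_fun_rVP => i.
have -> : coord_rV i \o (fun z => f z + g z) =
   fun z => coord_rV i (f z) + coord_rV i (g z).
  by apply/funext => z; rewrite /= /coord_rV mxE.
apply: measurable_funD; [exact: (measurableT_comp (measurable_coord_rV i) mf)|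
  exact: (measurableT_comp (measurable_coord_rV i) mg)].
Qed.

Lemma measurable_fun_opprV d (T : measurableType d) (f : T -> 'rV[R]_n) :
  measurable_fun setT f -> measurable_fun setT (fun z => - f z).
Proof.
move=> mf; apply: measurable_fun_rVP => i.
have -> : coord_rV i \o (fun z => - f z) = fun z => - coord_rV i (f z).
  by apply/funext => z; rewrite /= /coord_rV mxE.
by apply: measurableT_comp => //; exact: (measurableT_comp (measurable_coord_rV i) mf).
Qed.

Lemma measurable_ker_comp d (T : measurableType d) sg (r : T -> R) (h : T -> 'rV[R]_n) :
  measurable_fun setT r -> measurable_fun setT h ->
  measurable_fun setT (fun z => ker sg (r z) (h z)).
Proof.
move=> mr mh; rewrite /ker (_ : (fun z => _) = fun z =>
    (dot (h z) (h z) + r z ^+ 2) `^ (- sg)); last first.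
  by apply/funext => z; rewrite powRN.
apply: (measurableT_comp (measurable_powRl _)); apply: measurable_funD.
  exact: (measurableT_comp (@measurable_dot R n) mh).
exact: measurable_funX.
Qed.

Lemma measurable_indic_comp d d' (T : measurableType d) (T' : measurableType d')
    (A : set T') (h : T -> T') : measurable A -> measurable_fun setT h ->
  measurable_fun setT (fun z => (\1_A (h z) : R)%:E).
Proof.
move=> mA mh; apply/measurable_EFinP.
have m1 : measurable_fun setT (\1_A : T' -> R) by exact: measurable_indic.
exact: (measurableT_comp m1 mh).
Qed.

Lemma measurable_slice_integrand sg r (a b : 'rV[R]_n -> R) x :
  measurable_fun setT b ->
  measurable_fun setT (fun y => ((a x - b y) ^+ 2 * ker sg r (x - y))%:E).
Proof.
move=> mb; apply/measurable_EFinP; apply: measurable_funM.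
  by apply: measurable_funX; exact: measurable_funB.
apply: (measurableT_comp (measurable_ker sg r)); apply: measurable_fun_addrV => //.
exact: measurable_fun_opprV.
Qed.

Lemma measurable_slice_inner omega sg r (a b : 'rV[R]_n -> R) :
  measurable omega -> measurable_fun setT a -> measurable_fun setT b ->
  measurable_fun setT (fun x =>
    \int[lam]_(y in omega) ((a x - b y) ^+ 2 * ker sg r (x - y))%:E)%E.
Proof.
move=> momega ma mb; pose g (p : 'rV[R]_n * 'rV[R]_n) : \bar R :=
  (((a p.1 - b p.2) ^+ 2 * ker sg r (p.1 - p.2))%:E * (\1_omega p.2 : R)%:E)%E.
have mg : measurable_fun setT g.
  apply: emeasurable_funM; last by apply: (measurable_indic_comp momega); exact: measurable_snd.
  apply/measurable_EFinP; apply: measurable_funM.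
    apply: measurable_funX; apply: measurable_funB.
      exact: (measurableT_comp ma measurable_fst).
    exact: (measurableT_comp mb measurable_snd).
  apply: (measurableT_comp (measurable_ker sg r)); apply: measurable_fun_addrV.
    exact: measurable_fst.
  by apply: measurable_fun_opprV; exact: measurable_snd.
have g0 q : (0 <= g q)%E by rewrite mule_ge0 ?slice_integrand_ge0// lee_fin.
have := measurable_fun_fubini_tonelli_F g mg g0 (m2 := lam).
congr measurable_fun; apply/funext => x; rewrite [RHS]integral_mkcond.
apply: eq_integral => y _; rewrite patchE /g indicE.
by case: ifP; rewrite ?mule1 ?mule0.
Qed.

Lemma measurable_slice omega sg (e : R) v : measurable omega -> measurable_fun setT v ->
  measurable_fun setT (fun p : measurableTypeR R * measurableTypeR R =>
    slice omega sg (e * (p.1 - p.2)) (fun x => v (x, p.1)) (fun x => v (x, p.2))).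
Proof.
move=> mo mv.
pose T2 := (measurableTypeR R * measurableTypeR R)%type.
pose f (z : (T2 * 'rV[R]_n) * 'rV[R]_n) : \bar R :=
  ((v (z.1.2, z.1.1.1) - v (z.2, z.1.1.2)) ^+ 2 *
    ker sg (e * (z.1.1.1 - z.1.1.2)) (z.1.2 - z.2))%:E.
have mf : measurable_fun setT f.
  have m1 : measurable_fun setT (fun z : (T2 * 'rV[R]_n) * 'rV[R]_n => z.1.1.1).
    by do 2! apply: (measurableT_comp measurable_fst); exact: measurable_fst.
  have m2 : measurable_fun setT (fun z : (T2 * 'rV[R]_n) * 'rV[R]_n => z.1.1.2).
    apply: (measurableT_comp measurable_snd); apply: (measurableT_comp measurable_fst).
    exact: measurable_fst.
  have m3 : measurable_fun setT (fun z : (T2 * 'rV[R]_n) * 'rV[R]_n => z.1.2).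
    by apply: (measurableT_comp measurable_snd); exact: measurable_fst.
  have m4 : measurable_fun setT (fun z : (T2 * 'rV[R]_n) * 'rV[R]_n => z.2).
    exact: measurable_snd.
  apply/measurable_EFinP; apply: measurable_funM.
    apply: measurable_funX; apply: measurable_funB.
      by apply: (measurableT_comp mv); exact: measurable_fun_pair.
    by apply: (measurableT_comp mv); exact: measurable_fun_pair.
  apply: measurable_ker_comp.
    by apply: measurable_funM => //; exact: measurable_funB.
  by apply: measurable_fun_addrV => //; exact: measurable_fun_opprV.
have f0 z : (0 <= f z)%E by rewrite /f lee_fin mulr_ge0 ?sqr_ge0 ?ker_ge0.
(* the constraints x, y in omega are turned into indicator functions *)
pose g (z : (T2 * 'rV[R]_n) * 'rV[R]_n) : \bar R := (f z * (\1_omega z.2 : R)%:E)%E.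
have mg : measurable_fun setT g by apply: emeasurable_funM => //; apply: (measurable_indic_comp mo); exact: measurable_snd.
have g0 z : (0 <= g z)%E by rewrite mule_ge0// lee_fin.
have mG := measurable_fun_fubini_tonelli_F g mg g0 (m2 := lam).
pose G (z : T2 * 'rV[R]_n) : \bar R := (fubini_F lam g z * (\1_omega z.2 : R)%:E)%E.
have mG' : measurable_fun setT G by apply: emeasurable_funM => //; apply: (measurable_indic_comp mo); exact: measurable_snd.
have G0 z : (0 <= G z)%E.
  by rewrite mule_ge0 ?lee_fin//; apply: integral_ge0.
have := measurable_fun_fubini_tonelli_F G mG' G0 (m2 := lam).
congr measurable_fun; apply/funext => p; rewrite /slice integral_mkcond.
apply: eq_integral => x _; rewrite patchE /G indicE.
case: ifP => ox; last by rewrite mule0.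
rewrite mule1 [RHS]integral_mkcond; apply: eq_integral => y _.
by rewrite patchE /g indicE; case: ifP => oy; rewrite ?mule1 ?mule0.
Qed.

Lemma measurable_slice1 omega sg (e t : R) v : measurable omega -> measurable_fun setT v ->
  measurable_fun setT (fun u : measurableTypeR R =>
    slice omega sg (e * (t - u)) (fun x => v (x, t)) (fun x => v (x, u))).
Proof.
move=> mo mv; have := measurable_slice sg e mo mv.
move=> /(measurableT_comp (g := fun u : measurableTypeR R => (t, u))); apply.
exact: measurable_pair1.
Qed.

Lemma measurable_int_slice omega sg (e : R) v (I : set (measurableTypeR R)) :
  measurable I -> measurable omega -> measurable_fun setT v ->
  measurable_fun setT (fun t : measurableTypeR R =>
    \int[leb]_(u in I) slice omega sg (e * (t - u)) (fun x => v (x, t)) (fun x => v (x, u)))%E.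
Proof.
move=> mI mo mv; have ms := measurable_slice sg e mo mv.
pose g (p : measurableTypeR R * measurableTypeR R) : \bar R :=
  (slice omega sg (e * (p.1 - p.2)) (fun x => v (x, p.1)) (fun x => v (x, p.2)) *
   (\1_I p.2 : R)%:E)%E.
have mg : measurable_fun setT g.
  by apply: emeasurable_funM => //; apply: (measurable_indic_comp mI); exact: measurable_snd.
have g0 p : (0 <= g p)%E by rewrite mule_ge0 ?slice_ge0// lee_fin.
have := measurable_fun_fubini_tonelli_F g mg g0 (m2 := leb).
congr measurable_fun; apply/funext => t; rewrite [RHS]integral_mkcond.
apply: eq_integral => u _; rewrite patchE /g indicE.
by case: ifP; rewrite ?mule1 ?mule0.
Qed.

Lemma integral_split (f : space -> \bar R) : measurable_fun setT f ->
  (forall z, 0 <= f z)%E ->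
  (\int[lebesgue_split R n.+1]_z f z = \int[leb]_t \int[lam]_x f (x, t))%E.
Proof. by move=> mf f0; rewrite -fubini_tonelli2. Qed.

Lemma measurable_thin omega (e : R) : measurable omega ->
  measurable (@thin R n.+1 omega e).
Proof. by move=> mo; apply: measurableX => //; exact: measurable_itv. Qed.

Lemma integral_thin omega (e : R) (f : space -> \bar R) : measurable omega ->
  measurable_fun setT f -> (forall z, 0 <= f z)%E ->
  (\int[lebesgue_split R n.+1]_(z in @thin R n.+1 omega e) f z =
   \int[leb]_(t in `]0%R, e[) \int[lam]_(x in omega) f (x, t))%E.
Proof.
move=> mo mf f0; rewrite integral_mkcond integral_split.
- rewrite [RHS]integral_mkcond; apply: eq_integral => t _; rewrite [RHS]patchE.
  case: ifP => te.
    rewrite [RHS]integral_mkcond; apply: eq_integral => x _; rewrite !patchE.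
    by rewrite in_setX /= te andbT.
  by apply: integral0_eq => x _; rewrite patchE in_setX /= te andbF.
- apply/(measurable_restrictT f); last exact: measurable_funTS.
  exact: measurable_thin.
- by move=> z; rewrite patchE; case: ifP.
Qed.

Lemma enorm_split_ker (s : R) (x y : 'rV[R]_n) (t u : R) :
  (enorm_split (((x, t) : space) - (y, u)) `^ (n.+1%:R + 2 * s))^-1 =
  ker (n.+1%:R / 2 + s) (t - u) (x - y).
Proof.
rewrite /enorm_split /ker /= -powR12_sqrt ?addr_ge0 ?dot_ge0 ?sqr_ge0//.
by rewrite -powRrM; congr ((_ `^ _)^-1); field.
Qed.

Lemma measurable_gagliardo_integrand (s : R) w : measurable_fun setT w ->
  measurable_fun setT (fun p : space * space => (`|w p.1 - w p.2| ^+ 2 /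
      enorm_split (p.1 - p.2) `^ (n.+1%:R + 2 * s))%:E).
Proof.
move=> mw; rewrite (_ : (fun p => _) = fun p : space * space => ((w p.1 - w p.2) ^+ 2 *
   ker (n.+1%:R / 2 + s) (p.1.2 - p.2.2) (p.1.1 - p.2.1))%:E); last first.
  by apply/funext => -[[x t] [y u]] /=; rewrite enorm_split_ker real_normK// num_real.
have m1 : measurable_fun setT (fun p : space * space => p.1.2).
  by apply: (measurableT_comp measurable_snd); exact: measurable_fst.
have m2 : measurable_fun setT (fun p : space * space => p.2.2).
  by apply: (measurableT_comp measurable_snd); exact: measurable_snd.
have m3 : measurable_fun setT (fun p : space * space => p.1.1).
  by apply: (measurableT_comp measurable_fst); exact: measurable_fst.
have m4 : measurable_fun setT (fun p : space * space => p.2.1).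
  by apply: (measurableT_comp measurable_fst); exact: measurable_snd.
apply/measurable_EFinP; apply: measurable_funM.
  apply: measurable_funX; apply: measurable_funB.
    by apply: (measurableT_comp mw); exact: measurable_fst.
  by apply: (measurableT_comp mw); exact: measurable_snd.
apply: measurable_ker_comp; first exact: measurable_funB.
by apply: measurable_fun_addrV => //; exact: measurable_fun_opprV.
Qed.

(** Tonelli, after the four variables have been reordered so that the two heights
    come first. *)
Lemma gagliardo_slices omega (s e : R) w : measurable omega -> measurable_fun setT w ->
  (gagliardo s (@thin R n.+1 omega e) w =
   \int[leb]_(t in `]0%R, e[) \int[leb]_(u in `]0%R, e[)
     slice omega (n.+1%:R / 2 + s) (1 * (t - u)) (fun x => w (x, t)) (fun x => w (x, u)))%E.
Proof.
move=> mo mw; set Om := @thin R n.+1 omega e.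
pose F (p : space * space) : \bar R := (`|w p.1 - w p.2| ^+ 2 /
      enorm_split (p.1 - p.2) `^ (n.+1%:R + 2 * s))%:E.
have mF : measurable_fun setT F by exact: measurable_gagliardo_integrand.
have F0 p : (0 <= F p)%E.
  by rewrite lee_fin divr_ge0 ?powR_ge0 ?sqr_ge0// exprn_ge0.
have mOm : measurable Om by exact: measurable_thin.
have FE x t y u : F ((x, t), (y, u)) =
    ((w (x, t) - w (y, u)) ^+ 2 * ker (n.+1%:R / 2 + s) (1 * (t - u)) (x - y))%:E.
  by rewrite /F mul1r -enorm_split_ker real_normK// num_real.
have -> : gagliardo s Om w = (\int[lebesgue_split R n.+1]_(X in Om)
    \int[lebesgue_split R n.+1]_(Y in Om) F (X, Y))%E.
  rewrite /gagliardo integral_mkcond fubini_tonelli1.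
  - rewrite [RHS]integral_mkcond; apply: eq_integral => X _; rewrite [RHS]patchE.
    case: ifP => XO.
      by rewrite [RHS]integral_mkcond; apply: eq_integral => Y _; rewrite !patchE in_setX XO.
    by apply: integral0_eq => Y _; rewrite patchE in_setX XO.
  - apply/(measurable_restrictT F); last exact: measurable_funTS.
    exact: measurableX.
  - by move=> p; rewrite patchE; case: ifP => // _; exact: F0.
(* the constraint on the inner variable as an indicator function *)
pose F1 (p : space * space) : \bar R := (F p * (\1_Om p.2 : R)%:E)%E.
have mF1 : measurable_fun setT F1.
  by apply: emeasurable_funM => //; apply: (measurable_indic_comp mOm); exact: measurable_snd.
have F10 p : (0 <= F1 p)%E by rewrite mule_ge0// lee_fin.
have mG := measurable_fun_fubini_tonelli_F F1 mF1 F10 (m2 := lebesgue_split R n.+1).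
have GE X : fubini_F (lebesgue_split R n.+1) F1 X =
    (\int[lebesgue_split R n.+1]_(Y in Om) F (X, Y))%E.
  rewrite [RHS]integral_mkcond; apply: eq_integral => Y _.
  by rewrite patchE /F1 indicE; case: ifP => _; rewrite ?mule1 ?mule0.
rewrite -(eq_integral _ _ (fun X _ => GE X)).
rewrite integral_thin//; last by move=> X; exact: integral_ge0.
apply: eq_integral => t _.
under eq_integral => x _.
  rewrite GE integral_thin//; last exact: measurableT_comp.
  over.
(* exchange the integrals in x and u *)
pose H (p : 'rV[R]_n * measurableTypeR R) : \bar R :=
  (\int[lam]_(y in omega) F ((p.1, t), (y, p.2)))%E.
have mH : measurable_fun setT H.
  pose h (q : ('rV[R]_n * measurableTypeR R) * 'rV[R]_n) : \bar R :=
    (F ((q.1.1, t), (q.2, q.1.2)) * (\1_omega q.2 : R)%:E)%E.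
  have mh : measurable_fun setT h.
    apply: emeasurable_funM; last by apply: (measurable_indic_comp mo); exact: measurable_snd.
    apply: (measurableT_comp mF); apply: measurable_fun_pair.
      apply: measurable_fun_pair => //; apply: (measurableT_comp measurable_fst).
      exact: measurable_fst.
    apply: measurable_fun_pair; first exact: measurable_snd.
    by apply: (measurableT_comp measurable_snd); exact: measurable_fst.
  have h0 q : (0 <= h q)%E by rewrite mule_ge0// lee_fin.
  have := measurable_fun_fubini_tonelli_F h mh h0 (m2 := lam).
  congr measurable_fun; apply/funext => p; rewrite [RHS]integral_mkcond.
  apply: eq_integral => y _; rewrite patchE /h indicE.
  by case: ifP; rewrite ?mule1 ?mule0.
have H0 p : (0 <= H p)%E by apply: integral_ge0.
pose H1 (p : 'rV[R]_n * measurableTypeR R) : \bar R :=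
  (H p * (\1_omega p.1 : R)%:E * (\1_(`]0, e[%classic : set (measurableTypeR R)) p.2 : R)%:E)%E.
have mH1 : measurable_fun setT H1.
  apply: emeasurable_funM; last first.
    by apply: (measurable_indic_comp (measurable_itv _)); exact: measurable_snd.
  by apply: emeasurable_funM => //; apply: (measurable_indic_comp mo); exact: measurable_fst.
have H10 p : (0 <= H1 p)%E by rewrite !mule_ge0// lee_fin.
transitivity (\int[lam]_x \int[leb]_u H1 (x, u))%E.
  rewrite integral_mkcond; apply: eq_integral => x _; rewrite patchE /H1 /= indicE.
  case: ifP => ox; last by rewrite integral0_eq// => u _; rewrite mule0 mul0e.
  rewrite integral_mkcond; apply: eq_integral => u _; rewrite patchE mule1 indicE.
  by case: ifP => _; rewrite ?mule1 ?mule0.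
rewrite (fubini_tonelli H1 mH1 H10) [RHS]integral_mkcond; apply: eq_integral => u _.
rewrite patchE /H1 /= indicE; case: ifP => uI; last first.
  by rewrite integral0_eq// => x _; rewrite mule0.
rewrite /slice [RHS]integral_mkcond; apply: eq_integral => x _; rewrite patchE mule1 indicE.
case: ifP => ox; last by rewrite mule0.
by rewrite mule1; apply: eq_integral => y _; rewrite FE.
Qed.

Lemma rescale_itv (e : R) (f : R -> \bar R) : 0 < e -> measurable_fun setT f ->
  (forall t, 0 <= f t)%E ->
  (\int[leb]_(t in `]0%R, e[) f t = e%:E * \int[leb]_(t in `]0%R, 1%R[) f (e * t)%R)%E.
Proof.
move=> e0 mf f0; rewrite integral_mkcond [X in (_ * X)%E]integral_mkcond.
have h := @ge0_integral_affine R e 0 (f \_ `]0, e[) (lt0r_neq0 e0).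
have -> : (\int[leb]_t ((fun t => f (e * t)%R) \_ `]0%R, 1%R[) t =
    \int[leb]_t (f \_ `]0%R, e[) (e * t + 0)%R)%E.
  apply: eq_integral => t _; rewrite !patchE addr0.
  have -> // : (t \in `]0, 1[%classic) = (e * t \in `]0, e[%classic).
  by apply/idP/idP; rewrite !inE /= !in_itv /= pmulr_rgt0// gtr_pMr.
rewrite h ?gtr0_norm//.
- by rewrite muleA -EFinM mulfV ?gt_eqF// mul1e.
- by apply/(measurable_restrictT f) => //; exact: measurable_funTS.
- by move=> x; rewrite patchE; case: ifP.
Qed.

(** Extended by 0 outside the layer of height 1, so as to be measurable on the
    whole space. *)
Definition layer omega (e : R) w : space -> R :=
  (rescale e w) \_ (@thin R n.+1 omega 1).

Lemma measurable_layer omega (e : R) w : measurable omega ->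
  measurable_fun (@thin R n.+1 omega 1) (rescale e w) ->
  measurable_fun setT (layer omega e w).
Proof.
move=> mo mw; apply/(measurable_restrictT (rescale e w)) => //.
exact: measurable_thin.
Qed.

(** Stretching the two heights gives the factor [e ^ 2] that turns the power
    [2 s - 3] into [2 s - 1]; the kernel still sees the true vertical distance
    [e * (t - u)]. *)
Lemma energy_layer omega (s e : R) w : 0 < e -> measurable omega ->
  measurable_fun (@thin R n.+1 omega e) w ->
  ((e `^ (3 - 2 * s))^-1%:E * gagliardo s (@thin R n.+1 omega e) w =
   (e `^ (2 * s - 1))%:E * \int[leb]_(t in `]0%R, 1%R[) \int[leb]_(u in `]0%R, 1%R[)
     slice omega (n.+1%:R / 2 + s) (e * (t - u))
       (fun x => layer omega e w (x, t)) (fun x => layer omega e w (x, u)))%E.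
Proof.
move=> e0 mo mw; pose w' := w \_ (@thin R n.+1 omega e).
have mw' : measurable_fun setT w'.
  by apply/(measurable_restrictT w) => //; exact: measurable_thin.
have -> : gagliardo s (@thin R n.+1 omega e) w = gagliardo s (@thin R n.+1 omega e) w'.
  apply: eq_integral => p; rewrite in_setX => /andP[p1 p2].
  by rewrite /w' !patchE p1 p2.
rewrite (gagliardo_slices s e mo mw').
pose L t u := slice omega (n.+1%:R / 2 + s) (1 * (t - u)) (fun x => w' (x, t)) (fun x => w' (x, u)).
have L0 t u : (0 <= L t u)%E by exact: slice_ge0.
have mL t : measurable_fun setT (L t : measurableTypeR R -> \bar R).
  exact: measurable_slice1.
have mIL : measurable_fun setT (fun t : measurableTypeR R => \int[leb]_(u in `]0%R, e[) L t u)%E.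
  exact: (measurable_int_slice _ _ (measurable_itv _) mo mw').
have IL0 t : (0 <= \int[leb]_(u in `]0%R, e[) L t u)%E by apply: integral_ge0 => u _; exact: L0.
rewrite (rescale_itv e0 mIL IL0).
have lw x t : t \in (`]0, 1[%classic : set R) -> x \in omega ->
    w' (x, e * t) = layer omega e w (x, t).
  move=> t1 xo; rewrite /w' /layer !patchE /rescale /= !in_setX /= xo t1.
  suff -> : (e * t)%R \in (`]0, e[%classic : set R) by [].
  by move: t1; rewrite !inE /= !in_itv /= pmulr_rgt0// gtr_pMr.
have ml : measurable_fun setT (layer omega e w).
  rewrite (_ : layer omega e w = (fun z => w' (z.1, e * z.2)) \_ (@thin R n.+1 omega 1)).
    apply/(measurable_restrictT (fun z => w' (z.1, e * z.2))).
      exact: measurable_thin.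
    apply: measurable_funTS; apply: (measurableT_comp mw').
    apply: measurable_fun_pair => //=; apply: measurable_funM => //.
  apply/funext => -[x t]; rewrite [RHS]patchE; case: ifP => xt; last first.
    by rewrite /layer patchE xt.
  by move: (xt); rewrite in_setX /= => /andP[xo t1]; rewrite lw.
pose J t := (\int[leb]_(u in `]0%R, 1%R[) slice omega (n.+1%:R / 2 + s) (e * (t - u))
       (fun x => layer omega e w (x, t)) (fun x => layer omega e w (x, u)))%E.
have mJ : measurable_fun setT J by apply: measurable_int_slice => //; exact: measurable_itv.
have J0 t : (0 <= J t)%E by apply: integral_ge0 => u _; exact: slice_ge0.
have JE t : t \in (`]0, 1[%classic : set R) ->
    (\int[leb]_(u in `]0%R, 1%R[) L (e * t)%R (e * u)%R = J t)%E.
  move=> t1; rewrite /J; apply: eq_integral => u u1.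
  have E : 1 * (e * t - e * u) = e * (t - u) by ring.
  rewrite /L E.
  by apply: eq_slice => x xo; exact: lw.
have ILE t : t \in (`]0, 1[%classic : set R) ->
    (\int[leb]_(u in `]0%R, e[) L (e * t)%R u = e%:E * J t)%E.
  by move=> t1; rewrite (rescale_itv e0 (mL _) (L0 _)) JE.
transitivity ((e `^ (3 - 2 * s))^-1%:E * (e%:E *
    \int[leb]_(t in `]0%R, 1%R[) (e%:E * J t)))%E.
  by under eq_integral => t t1 do rewrite (ILE t t1).
rewrite (@ge0_integralZl_EFin _ _ _ leb _ (measurable_itv _) J (fun t _ => J0 t)
  (measurable_funTS mJ) e (ltW e0)).
rewrite !muleA -!EFinM; congr (_%:E * _)%E.
rewrite -mulrA -expr2 -powRN -(powR_mulrn 2 (ltW e0)) -powR_add//; congr (_ `^ _); ring.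
Qed.

End slices.

(** * Lower bound for the energy of a pair of slices *)

Section integral_tools.
Context d (T : measurableType d) (R : realType) (mu : {measure set T -> \bar R}).

Lemma EFin_Rintegral D (f : T -> R) : measurable D -> mu.-integrable D (EFin \o f) ->
  ((\int[mu]_(x in D) f x)%:E = \int[mu]_(x in D) (f x)%:E)%E.
Proof. by move=> mD fi; rewrite /Rintegral fineK//; exact: integrable_fin_num. Qed.

Lemma le_ge0_integral D (f : T -> R) (g : T -> \bar R) : measurable D ->
  mu.-integrable D (EFin \o f) -> measurable_fun D g ->
  (forall x, D x -> 0 <= g x)%E -> (forall x, D x -> (f x)%:E <= g x)%E ->
  ((\int[mu]_(x in D) f x)%:E <= \int[mu]_(x in D) g x)%E.
Proof.
move=> mD fi mg g0 fg; rewrite EFin_Rintegral//.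
have [->|gfin] := eqVneq (\int[mu]_(x in D) g x)%E +oo%E; first exact: leey.
have gi : mu.-integrable D g; last by apply: le_integral => // x; rewrite inE => /fg.
apply/integrableP; split => //; rewrite (eq_integral g); first by rewrite ltey.
by move=> x; rewrite inE => Dx; rewrite gee0_abs// g0.
Qed.

Lemma bounded_integrable D (f : T -> R) (C : R) : measurable D -> (mu D < +oo)%E ->
  measurable_fun D f -> (forall x, D x -> `|f x| <= C) -> mu.-integrable D (EFin \o f).
Proof.
move=> mD Dfin mf fC; apply: measurable_bounded_integrable => //.
exists C; split; first exact: num_real.
by move=> M CM x /fC fx; apply: le_trans (ltW CM).
Qed.

Lemma integrable_le_real D (f g : T -> R) : measurable D -> measurable_fun D f ->
  (forall x, D x -> `|f x| <= g x) -> mu.-integrable D (EFin \o g) ->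
  mu.-integrable D (EFin \o f).
Proof.
move=> mD mf fg gi; apply: le_integrable gi => //; first exact/measurable_EFinP.
by move=> x Dx /=; rewrite lee_fin; apply: le_trans (fg x Dx) (ler_norm _).
Qed.

Lemma integrable_mulr_cst D (f : T -> R) (c : R) : measurable D ->
  mu.-integrable D (EFin \o f) -> mu.-integrable D (EFin \o (fun x => c * f x)).
Proof.
move=> mD fi; have := integrableZl mD c fi.
by congr integrable; apply/funext => x; rewrite /= EFinM.
Qed.

Lemma integrable_addr D (f g : T -> R) : measurable D -> mu.-integrable D (EFin \o f) ->
  mu.-integrable D (EFin \o g) -> mu.-integrable D (EFin \o (fun x => f x + g x)).
Proof.
move=> mD fi gi; have := integrableD mD fi gi.
by congr integrable; apply/funext => x; rewrite /= EFinD.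
Qed.

Lemma integrable_subr D (f g : T -> R) : measurable D -> mu.-integrable D (EFin \o f) ->
  mu.-integrable D (EFin \o g) -> mu.-integrable D (EFin \o (fun x => f x - g x)).
Proof.
move=> mD fi gi; have := integrableB mD fi gi.
by congr integrable; apply/funext => x; rewrite /= EFinB.
Qed.

Lemma integrable_sumr D (I : Type) (s : seq I) (f : I -> T -> R) : measurable D ->
  (forall i, mu.-integrable D (EFin \o f i)) ->
  mu.-integrable D (EFin \o (fun x => \sum_(i <- s) f i x)).
Proof.
move=> mD fi; have := integrable_sum mD s (fun i _ => fi i).
move=> /(_ xpredT).
by congr integrable; apply/funext => x; rewrite /= sumEFin.
Qed.

Lemma patch_supp D (f : T -> R) : (forall x, ~ D x -> f x = 0) -> f \_ D = f.
Proof.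
move=> f0; apply/funext => x; rewrite patchE; case: ifPn => //.
by rewrite notin_setE => /f0 ->.
Qed.

Lemma EFin_patch D (f : T -> R) : (EFin \o f) \_ D = EFin \o (f \_ D).
Proof. by apply/funext => x; rewrite /= !patchE; case: ifP. Qed.

Lemma bounded_supp_integrable D (f : T -> R) (C : R) : measurable D -> (mu D < +oo)%E ->
  measurable_fun setT f -> (forall x, D x -> `|f x| <= C) -> (forall x, ~ D x -> f x = 0) ->
  mu.-integrable setT (EFin \o f).
Proof.
move=> mD Dfin mf fC f0; rewrite -(patch_supp f0) -EFin_patch.
apply/(integrable_mkcond (EFin \o f) mD).
by apply: (bounded_integrable mD Dfin _ fC); exact: measurable_funTS.
Qed.

End integral_tools.

Section thicken.
Context {R : realType} {n : nat}.
Local Notation lam := (lebesgue_rV R n).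

Lemma compact_lebesgue_fin (K : set 'rV[R]_n) : compact K -> (lam K < +oo)%E.
Proof.
move=> cK; have [M [_ hM]] := compact_bounded cK.
pose B := `|M| + 1.
have KB x : K x -> `|x| <= B by apply: hM; rewrite /B ltr_pwDr// ler_norm.
have mBox : forall i : 'I_n, measurable (`[(- B), B]%classic : set R) by move=> i.
apply: (@le_lt_trans _ _ (lam (box (fun=> `[(- B), B]%classic)))).
  apply: le_measure; rewrite ?inE.
  - by apply: closed_measurable_rV; exact: compact_closed (@hausdorff_rV R n) cK.
  - exact: measurable_box.
  move=> x /KB xB i /=; rewrite in_itv /= -ler_norml.
  exact: le_trans (ler_coord_norm _ _) xB.
rewrite lebesgue_rV_box// ltey_eq; apply/orP; left.
elim/big_ind : _ => //; first by move=> x y; exact: fin_numM.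
by move=> i _; rewrite lebesgue_measure_itv /=; case: ifP => _; rewrite -?EFinB.
Qed.

(** Room in [omega] for the mass that a kernel of small support carries away from
    the support of a field. *)
Lemma compact_thicken (K0 omega : set 'rV[R]_n) : compact K0 -> open omega ->
  K0 `<=` omega -> exists2 eta : R, 0 < eta <= 1 & exists K, [/\ compact K, K `<=` omega &
    forall x y, K0 x -> `|x - y| < eta -> K y].
Proof.
move=> cK oo K0o.
have := cK; rewrite compact_near_coveringP => /(_ _ (0^'+ : set_system R)
  (fun e x => forall y : 'rV[R]_n, `|x - y| <= e -> omega y)).
have H : forall x, K0 x -> \forall x' \near x & e \near 0^'+,
    forall y : 'rV[R]_n, `|x' - y| <= e -> omega y.
  move=> x /K0o ox; have [e /= e0 be] := open_subball oo ox.
  exists (ball x (e / 4), [set t | t < e / 4]) => /=.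
    split; first by apply: nbhsx_ballx; rewrite divr_gt0.
    by apply: nbhs_right_lt; rewrite divr_gt0.
  move=> [x' t] /= [xx' te] y x'y; apply: (be (e / 2)) => /=.
  - by rewrite sub0r normrN gtr0_norm ?divr_gt0//; lra.
  - by rewrite divr_gt0.
  - rewrite -ball_normE /= in xx' *.
    have := ler_normD (x - x') (x' - y); rewrite addrA subrK; lra.
move=> /(_ _ H) {}H.
have H2 : \forall e \near 0^'+, [/\ 0 < e, e < 1 & K0 `<=` (fun x => forall y : 'rV[R]_n, `|x - y| <= e -> omega y)].
  near=> e; split; first by near: e; exact: nbhs_right_gt.
    by near: e; exact: nbhs_right_lt.
  by near: e.
have [eta [eta0 eta1 Heta]] := filter_ex H2.
exists eta; first by rewrite eta0 ltW.
exists ((fun p : 'rV[R]_n * 'rV[R]_n => p.1 - p.2) @` (K0 `*` [set y | `|0 - y| <= eta])); split.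
- apply: continuous_compact; last by apply: compact_setX => //; exact: compact_ball_rV.
  by apply: continuous_subspaceT => p; apply: cvgB; [exact: cvg_fst|exact: cvg_snd].
- move=> z [[x y] /= [xK ye] <-]; apply: (Heta x xK).
  by rewrite opprB addrC subrK; rewrite sub0r normrN in ye.
- move=> x y xK xy; exists (x, x - y) => /=; last by rewrite opprB addrC subrK.
  by split => //; rewrite sub0r normrN ltW.
Unshelve. all: by end_near.
Qed.

Lemma supported_partial (f : 'rV[R]_n -> R) K : closed K ->
  (forall x, ~ K x -> f x = 0) -> forall i x, ~ K x -> partial i f x = 0.
Proof.
move=> clK fK i x Kx; rewrite /partial (@near_eq_derive _ _ _ _ (cst 0)) ?derive_cst//.
have oK : open (~` K) by exact: closed_openC.
have : nbhs x (~` K) by exact: open_nbhs_nbhs.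
by apply: filterS => y /fK.
Qed.

End thicken.

Section moment_bounds.
Context {R : realType} {n : nat}.
Implicit Types (h : 'rV[R]_n) (theta eta : R).

(** One moment of order [2 + theta], which is finite when [theta < 2 s - 1], has to
    control the cubic Taylor remainders near the origin and the quadratic terms far
    from it. *)
Lemma norm3_le_dot_powR theta h : 0 < theta <= 1 -> `|h| <= 1 ->
  `|h| ^+ 3 <= dot h h `^ (1 + theta / 2).
Proof.
move=> /andP[t0 t1] h1.
apply: (@le_trans _ _ ((`|h| ^+ 2) `^ (1 + theta / 2))); last first.
  rewrite ge0_ler_powR ?nnegrE ?dot_ge0 ?sqr_ge0 ?ler_norm_dot//; lra.
have [->|h0] := eqVneq h 0.
  by rewrite normr0 expr0n /= powR_ge0.
have hp : 0 < `|h| by rewrite normr_gt0.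
rewrite -(powR_mulrn 2)// -powRrM -(powR_mulrn 3)//.
by apply: ger_powR; [rewrite hp|lra].
Qed.

Lemma far_dot_powR theta eta h : 0 < theta <= 1 -> 0 < eta -> eta <= `|h| ->
  dot h h <= eta `^ (- theta) * dot h h `^ (1 + theta / 2).
Proof.
move=> /andP[t0 t1] e0 eh.
have de : eta ^+ 2 <= dot h h.
  apply: le_trans (ler_norm_dot h); rewrite ler_sqr ?nnegrE//; exact: ltW.
have d0 : 0 < dot h h by apply: lt_le_trans de; rewrite exprn_gt0.
rewrite powR_add// powRr1; last exact: ltW.
rewrite mulrCA; apply: ler_peMr; first exact: ltW.
rewrite powRN -ler_pdivrMl ?invr_gt0 ?powR_gt0// invrK mulr1.
apply: (@le_trans _ _ ((eta ^+ 2) `^ (theta / 2))).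
  by rewrite -(powR_mulrn 2 (ltW e0)) -powRrM mulrCA mulfV// mulr1.
apply: ge0_ler_powR => //; rewrite ?nnegrE ?sqr_ge0 ?dot_ge0//.
by apply: divr_ge0 => //; exact: ltW.
Qed.

End moment_bounds.

Section reflections.
Context {R : realType} {n : nat}.
Local Notation lam := (lebesgue_rV R n).
Implicit Types G : 'rV[R]_n -> R.

Lemma Rintegral_reflection G (c : 'rV[R]_n) : measurable_fun setT G ->
  \int[lam]_x G (c - x) = \int[lam]_h G h.
Proof.
move=> mG; have mEG : measurable_fun setT (EFin \o G) by exact/measurable_EFinP.
rewrite /Rintegral -(@integral_isometry_rV R n 1%g (fun=> -1) (fun i => c ord0 i) (EFin \o G)
  (fun i => normrN1 R) mEG).
congr fine; apply: eq_integral => x _; congr (EFin (G _)).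
by apply/rowP => i; rewrite !mxE perm1 mulN1r addrC.
Qed.

Lemma integrable_reflection G (c : 'rV[R]_n) : lam.-integrable setT (EFin \o G) ->
  lam.-integrable setT (EFin \o (fun x : 'rV[R]_n => G (c - x))).
Proof.
move=> /integrableP[mEG Gfin].
have cE x : affine_rV 1%g (fun=> -1) (fun i => c ord0 i) x = c - x.
  by apply/rowP => i; rewrite !mxE perm1 mulN1r addrC.
have mc : measurable_fun setT (fun x : 'rV[R]_n => c - x).
  by apply: measurable_fun_addrV => //; exact: measurable_fun_opprV.
apply/integrableP; split; first exact: (measurableT_comp mEG mc).
have maG : measurable_fun setT (fun h => `|(EFin \o G) h|%E) by exact: measurableT_comp.
move: Gfin; rewrite -(@integral_isometry_rV R n 1%g (fun=> -1) (fun i => c ord0 i) _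
  (fun i => normrN1 R) maG).
by under eq_integral do rewrite cE.
Qed.

Lemma Rintegral_translation G (c : 'rV[R]_n) : measurable_fun setT G ->
  \int[lam]_x G (x - c) = \int[lam]_h G h.
Proof.
move=> mG; have mEG : measurable_fun setT (EFin \o G) by exact/measurable_EFinP.
rewrite /Rintegral -(@integral_isometry_rV R n 1%g (fun=> 1) (fun i => - c ord0 i) (EFin \o G)
  (fun i => normr1 R) mEG).
congr fine; apply: eq_integral => x _; congr (EFin (G _)).
by apply/rowP => i; rewrite !mxE perm1 mul1r.
Qed.

Lemma Rintegral_odd G : lam.-integrable setT (EFin \o G) ->
  (forall h, G (- h) = - G h) -> \int[lam]_h G h = 0.
Proof.
move=> iG GN; have mG : measurable_fun setT G.
  by apply/measurable_EFinP; case/integrableP: iG.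
have := Rintegral_reflection 0 mG.
under eq_Rintegral do rewrite sub0r GN -mulN1r.
rewrite RintegralZl// mulN1r => /eqP; rewrite -subr_eq0 -opprD oppr_eq0 -mulr2n.
by rewrite mulrn_eq0 /= => /eqP.
Qed.

End reflections.

(** A compactly supported field [Phi] yields the calibration Phi(x).(x - y), to be
    integrated against a kernel cut off at distance [eta].  [K0] is the support of
    [Phi], and [K] contains its [eta]-neighbourhood, so that its
    product with the kernel vanishes outside [K0 `*` K]. *)
Section field.
Context {R : realType} {n : nat}.
Local Notation lam := (lebesgue_rV R n).
Variables (K0 K : set 'rV[R]_n) (eta : R) (Phi : 'I_n -> 'rV[R]_n -> R) (C : R).
Hypothesis cK0 : compact K0.
Hypothesis cK : compact K.
Hypothesis eta01 : 0 < eta <= 1.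
Hypothesis K0K : forall x y, K0 x -> `|x - y| < eta -> K y.
Hypothesis mPhi : forall i, measurable_fun setT (Phi i).
Hypothesis mdPhi : forall i j, measurable_fun setT (partial j (Phi i)).
Hypothesis Phi0 : forall i x, ~ K0 x -> Phi i x = 0.
Hypothesis C0 : 0 <= C.
Hypothesis PhiC : forall i x, `|Phi i x| <= C.
Hypothesis dPhiC : forall i j x, `|partial j (Phi i) x| <= C.
Hypothesis PhiT : forall i x h,
  `|Phi i (x + h) - Phi i x - \sum_j partial j (Phi i) x * h ord0 j| <= C * `|h| ^+ 2.

Definition divergence x : R := \sum_i partial i (Phi i) x.
Definition cut_ker sg r (h : 'rV[R]_n) : R := \1_[set h | `|h| < eta] h * ker sg r h.

Let eta0 : 0 < eta. Proof. by have /andP[] := eta01. Qed.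

Let mK0 : measurable K0.
Proof. by apply: closed_measurable_rV; exact: compact_closed (@hausdorff_rV R n) cK0. Qed.

Let mK : measurable K.
Proof. by apply: closed_measurable_rV; exact: compact_closed (@hausdorff_rV R n) cK. Qed.

Let K0sub : K0 `<=` K.
Proof. by move=> x /K0K; apply; rewrite subrr normr0. Qed.

Lemma measurable_cut_ker sg r : measurable_fun setT (cut_ker sg r).
Proof.
apply: measurable_funM; last exact: measurable_ker.
apply: measurable_indic; rewrite (_ : [set h | _] = ball (0 : 'rV[R]_n) eta).
  by apply: open_measurable_rV; exact: ball_open.
by rewrite -ball_normE; apply/seteqP; split => h /=; rewrite sub0r normrN.
Qed.

Lemma cut_kerE sg r h : cut_ker sg r h = if `|h| < eta then ker sg r h else 0.
Proof.
rewrite /cut_ker indicE; case: ifPn => he; first by rewrite mem_set// mul1r.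
by rewrite memNset ?mul0r//; exact/negP.
Qed.

Lemma cut_kerN sg r h : cut_ker sg r (- h) = cut_ker sg r h.
Proof. by rewrite !cut_kerE kerN normrN. Qed.

Lemma cut_ker_ge0 sg r h : 0 <= cut_ker sg r h.
Proof. by rewrite mulr_ge0 ?ker_ge0. Qed.

Lemma cut_ker_le sg r h : cut_ker sg r h <= ker sg r h.
Proof. by rewrite ler_piMl ?ker_ge0// indicE lern1 leq_b1. Qed.

Lemma cut_ker_out sg r h : ~ `|h| < eta -> cut_ker sg r h = 0.
Proof. by move=> h1; rewrite /cut_ker indicE memNset ?mul0r. Qed.

Lemma measurable_addl (y : 'rV[R]_n) : measurable_fun setT (fun h : 'rV[R]_n => y + h).
Proof. exact: measurable_fun_addrV. Qed.

(** The calibration integrated against the kernel in [x], at fixed [y = x - h]; close to a multiple of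
    the divergence of [Phi] at [y]. *)
Definition field_mean sg r y : R :=
  \int[lam]_h (\sum_i Phi i (y + h) * h ord0 i * cut_ker sg r h).

Variables (sg r theta : R).
Hypothesis r0 : 0 < r.
Hypothesis theta01 : 0 < theta <= 1.
Hypothesis sgn : n%:R / 2 + (1 + theta / 2) < sg.

Let sgn1 : n%:R / 2 + 1 < sg.
Proof. by have /andP[t0 _] := theta01; have := sgn; lra. Qed.

Definition rem_cst : R := n%:R * C + n%:R * (n%:R * C) * eta `^ (- theta).

Lemma rem_cst_ge0 : 0 <= rem_cst.
Proof. by rewrite addr_ge0// ?mulr_ge0// powR_ge0. Qed.

Let quad y (h : 'rV[R]_n) : R :=
  \sum_i \sum_j partial j (Phi i) y * (h ord0 i * h ord0 j).

Lemma field_rem y h :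
  `|\sum_i Phi i (y + h) * h ord0 i * cut_ker sg r h
    - \sum_i Phi i y * h ord0 i * cut_ker sg r h - quad y h * ker sg r h|
  <= rem_cst * (dot h h `^ (1 + theta / 2) * ker sg r h).
Proof.
rewrite mulrA -sumrB.
have -> : \sum_i (Phi i (y + h) * h ord0 i * cut_ker sg r h -
     Phi i y * h ord0 i * cut_ker sg r h) - quad y h * ker sg r h =
   (\sum_i (((Phi i (y + h) - Phi i y) * \1_[set h | `|h| < eta] h
     - \sum_j partial j (Phi i) y * h ord0 j) * h ord0 i)) * ker sg r h.
  rewrite /quad [X in _ - X]mulr_suml [RHS]mulr_suml -sumrB; apply: eq_bigr => i _.
  have -> : (\sum_j partial j (Phi i) y * (h ord0 i * h ord0 j)) * ker sg r h =
     (\sum_j partial j (Phi i) y * h ord0 j) * h ord0 i * ker sg r h.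
    by congr (_ * _); rewrite mulr_suml; apply: eq_bigr => j _; ring.
  by rewrite /cut_ker; ring.
rewrite normrM (ger0_norm (ker_ge0 _ _ _)) ler_wpM2r ?ker_ge0//.
apply: le_trans (ler_norm_sum _ _ _) _.
have dp0 : 0 <= dot h h `^ (1 + theta / 2) by exact: powR_ge0.
have -> : rem_cst * dot h h `^ (1 + theta / 2) =
    \sum_(i < n) (C * dot h h `^ (1 + theta / 2) +
      n%:R * C * eta `^ (- theta) * dot h h `^ (1 + theta / 2)).
  by rewrite sumr_const card_ord -mulr_natl /rem_cst; ring.
apply: ler_sum => i _; rewrite normrM indicE.
have hi := ler_coord_norm h i.
have [heta|heta] := ltP `|h| eta.
  rewrite mem_set// mulr1.
  apply: (@le_trans _ _ (C * `|h| ^+ 2 * `|h|)); first by rewrite ler_pM.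
  rewrite -mulrA -exprSr; apply: ler_wpDr.
    by rewrite !mulr_ge0// powR_ge0.
  rewrite ler_wpM2l// norm3_le_dot_powR//.
  by apply: le_trans (ltW heta) _; have /andP[] := eta01.
rewrite memNset ?mulr0 ?sub0r ?normrN; last by apply/negP; rewrite -leNgt.
apply: ler_wpDl; first by rewrite mulr_ge0.
rewrite -[leRHS]mulrA.
apply: (@le_trans _ _ (n%:R * C * dot h h)); last first.
  by rewrite ler_wpM2l ?mulr_ge0// far_dot_powR.
apply: (@le_trans _ _ (n%:R * C * `|h| * `|h|)).
  by rewrite ler_pM//; exact: (ler_lin _ (fun j => dPhiC i j y)).
by rewrite -mulrA ler_wpM2l ?mulr_ge0// -expr2 ler_norm_dot.
Qed.

Lemma field_integrable (G : 'rV[R]_n -> R) (A : R) : measurable_fun setT G ->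
  (forall h, `|G h| <= A) -> lam.-integrable setT (EFin \o (fun h => G h * cut_ker sg r h)).
Proof.
move=> mG GA; have A0 : 0 <= A by apply: le_trans (GA 0).
pose B := [set h : 'rV[R]_n | `|0 - h| <= eta].
have cB : compact B by exact: compact_ball_rV.
have mB : measurable B.
  by apply: closed_measurable_rV; exact: compact_closed (@hausdorff_rV R n) cB.
have mGk : measurable_fun setT (fun h => G h * cut_ker sg r h).
  by apply: measurable_funM => //; exact: measurable_cut_ker.
apply: (@bounded_supp_integrable _ _ _ _ B _ (A * ((r ^+ 2) `^ sg)^-1)) => //.
- exact: compact_lebesgue_fin.
- move=> h _; rewrite normrM ler_pM// (ger0_norm (cut_ker_ge0 _ _ _)).
  apply: le_trans (cut_ker_le _ _ _) _; apply: ker_le => //.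
  have /andP[t0 _] := theta01; have : (0 : R) <= n%:R by []; have := sgn; lra.
- move=> h Bh; rewrite cut_ker_out ?mulr0// => he; apply: Bh.
  by rewrite /B /= sub0r normrN ltW.
Qed.

Let sg0 : 0 <= sg.
Proof. by have /andP[t0 _] := theta01; have : (0 : R) <= n%:R by []; have := sgn; lra. Qed.

Definition mom2 : R := \int[lam]_h (dot h h * ker sg r h).
Definition mom3 : R := \int[lam]_h (dot h h `^ (1 + theta / 2) * ker sg r h).

Let i_mom2 : lam.-integrable setT (EFin \o (fun h : 'rV[R]_n => dot h h * ker sg r h)).
Proof.
have := mom_integrable ler01 sgn1 r0.
by congr integrable; apply/funext => h; rewrite /= powRr1 ?dot_ge0.
Qed.

Let i_mom3 : lam.-integrable setT
  (EFin \o (fun h : 'rV[R]_n => dot h h `^ (1 + theta / 2) * ker sg r h)).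
Proof.
by apply: (mom_integrable _ sgn r0); have /andP[t0 _] := theta01; lra.
Qed.

Let i_quad (A : 'I_n -> 'I_n -> R) : lam.-integrable setT (EFin \o
  (fun h : 'rV[R]_n => (\sum_i \sum_j A i j * (h ord0 i * h ord0 j)) * ker sg r h)).
Proof.
rewrite (_ : (fun h : 'rV[R]_n => _) = fun h : 'rV[R]_n =>
    \sum_i \sum_j A i j * (h ord0 i * h ord0 j * ker sg r h)); last first.
  apply/funext => h; rewrite mulr_suml; apply: eq_bigr => i _.
  by rewrite mulr_suml; apply: eq_bigr => j _; rewrite !mulrA.
do 2! (apply: integrable_sumr => // ?).
apply: integrable_mulr_cst => //; exact: coord_moment_integrable.
Qed.

Lemma Rquad_moment (A : 'I_n -> 'I_n -> R) :
  \int[lam]_h ((\sum_i \sum_j A i j * (h ord0 i * h ord0 j)) * ker sg r h) =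
  (\sum_i A i i) / n%:R * mom2.
Proof.
apply: EFin_inj; rewrite (EFin_Rintegral measurableT (i_quad A)).
by rewrite quad_moment// [RHS]EFinM /mom2 (EFin_Rintegral measurableT i_mom2).
Qed.

Let measurable_coordPhi y i :
  measurable_fun setT (fun h : 'rV[R]_n => Phi i (y + h)).
Proof. by apply: (measurableT_comp (mPhi i)); exact: measurable_addl. Qed.

(** The coordinates are unbounded, but the cut-off makes them harmless. *)
Let i_coord (G : 'rV[R]_n -> R) i : measurable_fun setT G ->
  (forall h, `|G h| <= C) ->
  lam.-integrable setT (EFin \o (fun h => G h * h ord0 i * cut_ker sg r h)).
Proof.
move=> mG GC.
have := @field_integrable (fun h => G h * (Num.max (- eta) (Num.min eta (h ord0 i)))) (C * eta).
have -> : (fun h => G h * Num.max (- eta) (Num.min eta (h ord0 i)) * cut_ker sg r h) =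
    fun h => G h * h ord0 i * cut_ker sg r h.
  apply/funext => h; rewrite cut_kerE; case: ifPn => he; last by rewrite !mulr0.
  have : `|h ord0 i| < eta by apply: le_lt_trans he; exact: ler_coord_norm.
  rewrite ltr_norml => /andP[h1 h2].
  by rewrite min_r ?max_r// ltW.
apply.
- apply: measurable_funM => //; apply: measurable_maxr => //; apply: measurable_minr => //.
  exact: measurable_coord_rV.
- move=> h; rewrite normrM ler_pM// ler_norml le_max ge_max ge_min lexx /= lexx.
  by rewrite ge0_cp// ltW.
Qed.

(** Taylor expansion of [Phi] at [y]: the constant term is odd in [h], the linear
    one averages to the divergence by isotropy, and the remainder costs a moment of
    order [2 + theta]. *)
Lemma field_mean_approx y :
  `|field_mean sg r y - divergence y / n%:R * mom2| <= rem_cst * mom3.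
Proof.
have i1 : lam.-integrable setT (EFin \o
    (fun h => \sum_i Phi i (y + h) * h ord0 i * cut_ker sg r h)).
  by apply: integrable_sumr => // i; apply: i_coord.
have i2 : lam.-integrable setT (EFin \o
    (fun h : 'rV[R]_n => \sum_i Phi i y * h ord0 i * cut_ker sg r h)).
  by apply: integrable_sumr => // i; apply: (i_coord (G := fun=> Phi i y)).
have o2 : \int[lam]_h (\sum_i Phi i y * h ord0 i * cut_ker sg r h) = 0.
  apply: Rintegral_odd => // h; rewrite -sumrN; apply: eq_bigr => i _.
  by rewrite cut_kerN mxE mulrN mulNr.
have -> : field_mean sg r y - divergence y / n%:R * mom2 =
   \int[lam]_h (\sum_i Phi i (y + h) * h ord0 i * cut_ker sg r h
    - \sum_i Phi i y * h ord0 i * cut_ker sg r h - quad y h * ker sg r h).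
  rewrite RintegralB//; last 2 first.
  - exact: integrable_subr.
  - exact: i_quad.
  by rewrite RintegralB// o2 subr0 Rquad_moment.
have i3 : lam.-integrable setT (EFin \o (fun h =>
    \sum_i Phi i (y + h) * h ord0 i * cut_ker sg r h
    - \sum_i Phi i y * h ord0 i * cut_ker sg r h - quad y h * ker sg r h)).
  by apply: integrable_subr => //; [exact: integrable_subr|exact: i_quad].
apply: le_trans (le_normr_Rintegral _ _) _ => //.
rewrite /mom3 -RintegralZl//; apply: le_Rintegral => //.
- exact: (integrable_norm i3).
- exact: integrable_mulr_cst.
- by move=> h _; exact: field_rem.
Qed.

Definition calib x y : R := \sum_i Phi i x * (x - y) ord0 i * cut_ker sg r (x - y).

Let cb : R := n%:R * (C * eta) * ((r ^+ 2) `^ sg)^-1.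

Let cb0 : 0 <= cb.
Proof. by rewrite !mulr_ge0 ?invr_ge0 ?powR_ge0// ltW. Qed.

Let calib_out x y : ~ (K0 x /\ K y) -> calib x y = 0.
Proof.
move=> xy; rewrite /calib big1// => i _; rewrite cut_kerE; case: ifPn => h; last by rewrite mulr0.
rewrite Phi0 ?mul0r// => K0x; apply: xy; split => //; exact: K0K h.
Qed.

Let calib_le x y : `|calib x y| <= cb * \1_K x * \1_K y.
Proof.
have [[K0x Ky]|xy] := pselect (K0 x /\ K y); last first.
  rewrite calib_out// normr0; apply: mulr_ge0; last by rewrite indicE.
  by apply: mulr_ge0 => //; rewrite indicE.
rewrite !indicE mem_set; last exact: K0sub.
rewrite mem_set// !mulr1 /calib /cb.
apply: le_trans (ler_norm_sum _ _ _) _.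
have -> : n%:R * (C * eta) * ((r ^+ 2) `^ sg)^-1 =
    \sum_(i < n) C * eta * ((r ^+ 2) `^ sg)^-1.
  by rewrite sumr_const card_ord -mulrA mulr_natl.
apply: ler_sum => i _; rewrite cut_kerE; case: ifPn => he; last first.
  by rewrite mulr0 normr0 !mulr_ge0 ?invr_ge0 ?powR_ge0// ltW.
rewrite normrM ler_pM// ?(ger0_norm (ker_ge0 _ _ _)); last exact: ker_le.
rewrite normrM ler_pM//; apply: le_trans (ler_coord_norm _ _) _; exact: ltW.
Qed.

Lemma measurable_calib : measurable_fun setT (fun p : 'rV[R]_n * 'rV[R]_n => calib p.1 p.2).
Proof.
have md : measurable_fun setT (fun p : 'rV[R]_n * 'rV[R]_n => p.1 - p.2).
  apply: measurable_fun_addrV; first exact: measurable_fst.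
  by apply: measurable_fun_opprV; exact: measurable_snd.
apply: measurable_sum => i; apply: measurable_funM.
  apply: measurable_funM; first exact: (measurableT_comp (mPhi i) measurable_fst).
  exact: (measurableT_comp (measurable_coord_rV i) md).
exact: (measurableT_comp (measurable_cut_ker sg r) md).
Qed.

Let measurable_calib1 x : measurable_fun setT (calib x).
Proof. exact: (measurableT_comp measurable_calib (measurable_pair1 x)). Qed.

Let measurable_calib2 y : measurable_fun setT (calib^~ y).
Proof. exact: (measurableT_comp measurable_calib (measurable_pair2 y)). Qed.

Let Kfin : (lam K < +oo)%E. Proof. exact: compact_lebesgue_fin. Qed.

Let i_calib1 x : lam.-integrable setT (EFin \o calib x).
Proof.
apply: (@bounded_supp_integrable _ _ _ _ K _ cb) => //.
- move=> y _; apply: le_trans (calib_le x y) _.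
  by rewrite -mulrA ler_piMr// mulr_ile1 ?indicE ?lern1 ?leq_b1.
- by move=> y Ky; apply: calib_out => -[].
Qed.

Let i_calib2 y : lam.-integrable setT (EFin \o calib^~ y).
Proof.
apply: (@bounded_supp_integrable _ _ _ _ K _ cb) => //.
- move=> x _; apply: le_trans (calib_le x y) _.
  by rewrite -mulrA ler_piMr// mulr_ile1 ?indicE ?lern1 ?leq_b1.
- by move=> x Kx; apply: calib_out => -[/K0sub].
Qed.

(** The integrand is odd in [x - y]. *)
Lemma integral_calib1 x : \int[lam]_y calib x y = 0.
Proof.
pose G (h : 'rV[R]_n) : R := \sum_i Phi i x * h ord0 i * cut_ker sg r h.
have iG : lam.-integrable setT (EFin \o G).
  by apply: integrable_sumr => // i; apply: (i_coord (G := fun=> Phi i x)).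
have mG : measurable_fun setT G by apply/measurable_EFinP; case/integrableP: iG.
rewrite (Rintegral_reflection x mG); apply: Rintegral_odd => // h.
by rewrite /G -sumrN; apply: eq_bigr => i _; rewrite cut_kerN mxE mulrN mulNr.
Qed.

Lemma integral_calib2 y : \int[lam]_x calib x y = field_mean sg r y.
Proof.
have mG : measurable_fun setT
    (fun h => \sum_i Phi i (y + h) * h ord0 i * cut_ker sg r h).
  apply: measurable_sum => i; apply: measurable_funM; last exact: measurable_cut_ker.
  apply: measurable_funM => //; exact: measurable_coord_rV.
rewrite /field_mean -(Rintegral_translation y mG); apply: eq_Rintegral => x _.
by apply: eq_bigr => i _; congr (Phi i _ * _ * _); rewrite addrC subrK.
Qed.

Variable omega : set 'rV[R]_n.
Hypothesis momega : measurable omega.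
Hypothesis Komega : K `<=` omega.

Definition sqPhi x : R := \sum_i Phi i x ^+ 2.

Let phidot x (h : 'rV[R]_n) : R := \sum_i Phi i x * h ord0 i.

Let phidot_sq x h : phidot x h ^+ 2 =
  \sum_i \sum_j Phi i x * Phi j x * (h ord0 i * h ord0 j).
Proof.
rewrite expr2 {1}/phidot mulr_suml; apply: eq_bigr => i _.
by rewrite mulr_sumr; apply: eq_bigr => j _; ring.
Qed.

Let calibE x y : calib x y = phidot x (x - y) * cut_ker sg r (x - y).
Proof. by rewrite /calib -mulr_suml. Qed.

Let i_quadPhi x : lam.-integrable setT (EFin \o (fun h => phidot x h ^+ 2 * ker sg r h)).
Proof.
have := i_quad (fun i j => Phi i x * Phi j x).
by congr integrable; apply/funext => h; rewrite /= phidot_sq.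
Qed.

Let int_quadPhi x :
  \int[lam]_y (phidot x (x - y) ^+ 2 * ker sg r (x - y)) = sqPhi x / n%:R * mom2.
Proof.
have mG : measurable_fun setT (fun h => phidot x h ^+ 2 * ker sg r h).
  by apply/measurable_EFinP; case/integrableP: (i_quadPhi x).
rewrite (Rintegral_reflection x mG); under eq_Rintegral do rewrite phidot_sq.
by rewrite Rquad_moment.
Qed.

Let i_quadPhi2 x : lam.-integrable setT
  (EFin \o (fun y => phidot x (x - y) ^+ 2 * ker sg r (x - y))).
Proof.
exact: (integrable_reflection x (i_quadPhi x)).
Qed.

Section pair.
Variables a b : 'rV[R]_n -> R.
Hypothesis ma : measurable_fun setT a.
Hypothesis mb : measurable_fun setT b.
Hypothesis ib : lam.-integrable K (EFin \o b).

Let b' := b \_ K.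

Let ib' : lam.-integrable setT (EFin \o b').
Proof. by have /(integrable_mkcond _ mK) := ib; rewrite EFin_patch. Qed.

Let mb' : measurable_fun setT b'.
Proof. by apply/measurable_EFinP; case/integrableP: ib'. Qed.

Let B (p : 'rV[R]_n * 'rV[R]_n) : \bar R := (b' p.2 * calib p.1 p.2)%:E.

Let mB : measurable_fun setT B.
Proof.
apply/measurable_EFinP; apply: measurable_funM; last exact: measurable_calib.
exact: (measurableT_comp mb' measurable_snd).
Qed.

Let B_le x y : `|b' y * calib x y| <= cb * \1_K x * `|b' y|.
Proof.
rewrite normrM mulrC ler_wpM2r//; apply: le_trans (calib_le x y) _.
by apply: ler_piMr; [apply: mulr_ge0 => //; rewrite indicE|rewrite indicE lern1 leq_b1].
Qed.

Let i_absb : lam.-integrable setT (EFin \o (fun y => `|b' y|)).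
Proof. exact: (integrable_norm ib'). Qed.

Let i_B1 x : lam.-integrable setT (EFin \o (fun y => b' y * calib x y)).
Proof.
apply: (integrable_le_real measurableT _ (fun y _ => B_le x y)).
  exact: measurable_funM.
exact: integrable_mulr_cst.
Qed.

Let iB : (lam \x lam)%E.-integrable setT B.
Proof.
apply/(integrable12ltyP _ _ mB).
apply: (@le_lt_trans _ _ (\int[lam]_x ((cb * \int[lam]_y `|b' y|) * \1_K x)%:E)%E).
  apply: ge0_le_integral => //.
  - by move=> x _; apply: integral_ge0.
  - apply: (measurable_fun_fubini_tonelli_F (fun p => `|B p|%E)) => //.
    exact: measurableT_comp.
  - apply/measurable_EFinP; apply: measurable_funM => //; exact: measurable_indic.
  move=> x _.
  rewrite -mulrA [X in (_ * X)%R]mulrC mulrA -RintegralZl//.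
  rewrite EFin_Rintegral//; last exact: integrable_mulr_cst.
  apply: ge0_le_integral => //.
  - have mBx : measurable_fun setT (fun y => B (x, y)).
      exact: (measurableT_comp mB (measurable_pair1 x)).
    exact: (measurableT_comp (@abse_measurable R setT) mBx).
  - by apply/measurable_EFinP; apply: measurable_funM => //; exact: measurableT_comp.
  - by move=> y _; rewrite lee_fin B_le.
apply: integrable_lty => //.
apply: (@bounded_supp_integrable _ _ _ _ K _ (cb * \int[lam]_y `|b' y|)) => //.
- by apply: measurable_funM => //; exact: measurable_indic.
- by move=> x Kx; rewrite indicE mem_set// mulr1 ger0_norm// mulr_ge0// Rintegral_ge0.
- by move=> x Kx; rewrite indicE memNset// mulr0.
Qed.

Let m x : R := \int[lam]_y (b' y * calib x y).

Let mE x : ((m x)%:E = fubini_F lam B x)%E.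
Proof. by rewrite /m (EFin_Rintegral measurableT (i_B1 x)). Qed.

Let im : lam.-integrable setT (EFin \o m).
Proof.
have := integrable_fubini_F iB; congr integrable.
by apply/funext => x; rewrite /= mE.
Qed.

Let int_m : \int[lam]_x m x = \int[lam]_(y in K) (b y * field_mean sg r y).
Proof.
rewrite /Rintegral; congr fine.
under eq_integral do rewrite mE.
rewrite (Fubini iB) [RHS]integral_mkcond; apply: eq_integral => y _.
rewrite patchE (_ : (fun x => B (x, y)) = fun x => ((b' y)%:E * (calib x y)%:E)%E); last first.
  by apply/funext => x; rewrite -EFinM.
have i2 : lam.-integrable setT (EFin \o calib^~ y) by exact: i_calib2.
rewrite integralZl// -(EFin_Rintegral measurableT i2) integral_calib2.
by rewrite /b' patchE; case: ifP => _; rewrite ?mul0e// -EFinM.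
Qed.

Lemma measurable_mul_field_mean : measurable_fun K (fun y => b y * field_mean sg r y).
Proof.
have mG := measurable_fubini_G iB.
apply/measurable_EFinP; apply/(measurable_restrictT _ mK).
move: mG; congr measurable_fun; apply/funext => y.
rewrite patchE /fubini_G (_ : (fun x => B (x, y)) = fun x => ((b' y)%:E * (calib x y)%:E)%E); last first.
  by apply/funext => x; rewrite -EFinM.
have i2 : lam.-integrable setT (EFin \o calib^~ y) by exact: i_calib2.
rewrite (integralZl measurableT i2) -(EFin_Rintegral measurableT i2) integral_calib2.
by rewrite /b' patchE; case: ifP => _; rewrite ?mul0e// -EFinM.
Qed.

Let m_out x : ~ K0 x -> m x = 0.
Proof.
move=> K0x; rewrite /m (_ : (fun y => _) = fun=> 0); last first.
  by apply/funext => y; rewrite calib_out ?mulr0// => -[].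
by rewrite /Rintegral integral0.
Qed.

(** Integrate [(a x - b y)^2 >= 2 (a x - b y) p - p^2], where [p] is the
    calibration: the term in [a] vanishes by [integral_calib1], the term in [b] is
    computed by Fubini and [integral_calib2], and [p^2] averages to [sqPhi]. *)
Lemma slice_ge_calib :
  ((- (2 * \int[lam]_(y in K) (b y * field_mean sg r y)) -
    mom2 / n%:R * \int[lam]_x sqPhi x)%:E <= slice omega sg r a b)%E.
Proof.
have slice_x x : omega x -> ((- (2 * m x) - mom2 / n%:R * sqPhi x)%:E <=
    \int[lam]_(y in omega) ((a x - b y) ^+ 2 * ker sg r (x - y))%:E)%E.
  move=> ox; rewrite integral_mkcond.
  pose f y := 2 * a x * calib x y - 2 * (b' y * calib x y)
     - phidot x (x - y) ^+ 2 * ker sg r (x - y).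
  have i1 : lam.-integrable setT (EFin \o (fun y => 2 * a x * calib x y)).
    exact: (integrable_mulr_cst _ measurableT (i_calib1 x)).
  have i2 : lam.-integrable setT (EFin \o (fun y => 2 * (b' y * calib x y))).
    exact: (integrable_mulr_cst 2 measurableT (i_B1 x)).
  have i12 : lam.-integrable setT
      (EFin \o (fun y => 2 * a x * calib x y - 2 * (b' y * calib x y))).
    exact: (integrable_subr measurableT i1 i2).
  have i3 := i_quadPhi2 x.
  have -> : - (2 * m x) - mom2 / n%:R * sqPhi x = \int[lam]_y f y.
    rewrite /f (RintegralB measurableT i12 i3) (RintegralB measurableT i1 i2).
    rewrite (RintegralZl (2 * a x) measurableT (i_calib1 x)).
    rewrite (RintegralZl 2 measurableT (i_B1 x)).
    rewrite integral_calib1 int_quadPhi mulr0 sub0r -/(m x); congr (_ - _); ring.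
  have mg : measurable_fun setT (fun y => ((a x - b y) ^+ 2 * ker sg r (x - y))%:E).
    exact: measurable_slice_integrand.
  apply: le_ge0_integral => //.
  - by apply: integrable_subr.
  - by apply/(measurable_restrictT _ momega); exact: measurable_funTS.
  - by move=> y _; rewrite patchE; case: ifP => // _; exact: slice_integrand_ge0.
  move=> y _; rewrite patchE /f.
  have k0 := ker_ge0 sg r (x - y).
  case: ifPn => oy.
    rewrite lee_fin; have [[K0x Ky]|xy] := pselect (K0 x /\ K y); last first.
      rewrite (calib_out xy) !mulr0 subr0 sub0r (@le_trans _ _ 0)//.
        by rewrite oppr_le0 mulr_ge0 ?sqr_ge0.
      by rewrite mulr_ge0 ?sqr_ge0.
    rewrite {1}/b' patchE mem_set// calibE cut_kerE; case: ifPn => _; last first.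
      rewrite !mulr0 subr0 sub0r (@le_trans _ _ 0)//.
        by rewrite oppr_le0 mulr_ge0 ?sqr_ge0.
      by rewrite mulr_ge0 ?sqr_ge0.
    rewrite -subr_ge0; have -> : forall p k : R, (a x - b y) ^+ 2 * k -
      (2 * a x * (p * k) - 2 * (b y * (p * k)) - p ^+ 2 * k) =
      (a x - b y - p) ^+ 2 * k by move=> p k; ring.
    by rewrite mulr_ge0 ?sqr_ge0.
  rewrite lee_fin calib_out; last first.
    by move=> [_ /Komega yo]; move: oy; rewrite notin_setE.
  by rewrite !mulr0 subr0 sub0r oppr_le0 mulr_ge0 ?sqr_ge0.
have msq : measurable_fun setT sqPhi.
  by apply: measurable_sum => i; exact: measurable_funX.
have isq : lam.-integrable setT (EFin \o sqPhi).
  apply: (@bounded_supp_integrable _ _ _ _ K _ (n%:R * C ^+ 2)) => //.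
    move=> x _; rewrite ger0_norm; last by apply: sumr_ge0 => i _; exact: sqr_ge0.
    have -> : n%:R * C ^+ 2 = \sum_(i < n) C ^+ 2.
      by rewrite sumr_const card_ord mulr_natl.
    apply: ler_sum => i _; rewrite -real_normK ?num_real// ler_sqr ?nnegrE//.
  move=> x Kx; rewrite /sqPhi big1// => i _; rewrite Phi0 ?expr0n//.
  by move=> /K0sub.
have ic : lam.-integrable setT (EFin \o (fun x => mom2 / n%:R * sqPhi x)).
  exact: integrable_mulr_cst.
have i2m : lam.-integrable setT (EFin \o (fun x => 2 * m x)).
  exact: integrable_mulr_cst.
have i2m' : lam.-integrable setT (EFin \o (fun x => - (2 * m x))).
  have := integrable_mulr_cst (-1) measurableT i2m.
  by congr integrable; apply/funext => x; rewrite /= mulN1r.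
have -> : - (2 * \int[lam]_(y in K) (b y * field_mean sg r y)) -
    mom2 / n%:R * \int[lam]_x sqPhi x =
    \int[lam]_x (- (2 * m x) - mom2 / n%:R * sqPhi x).
  rewrite RintegralB// RintegralZl//; congr (_ - _).
  under [RHS]eq_Rintegral do rewrite -mulNr.
  by rewrite RintegralZl// int_m mulNr.
rewrite /slice integral_mkcond; apply: le_ge0_integral => //.
- exact: integrable_subr.
- apply/(measurable_restrictT _ momega); apply: measurable_funTS.
  exact: (measurable_slice_inner sg r momega ma mb).
- move=> x _; rewrite patchE; case: ifP => // _.
  by apply: integral_ge0 => y _; exact: slice_integrand_ge0.
- move=> x _; rewrite patchE; case: ifPn => [|xo]; first by rewrite inE => /slice_x.
  have K0x : ~ K0 x by move=> /K0sub/Komega xo'; move: xo; rewrite notin_setE.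
  rewrite lee_fin m_out// mulr0 oppr0 sub0r oppr_le0 mulr_ge0//.
    by rewrite divr_ge0// /mom2 Rintegral_ge0// => h _; rewrite mulr_ge0 ?dot_ge0 ?ker_ge0.
  by apply: sumr_ge0 => i _; exact: sqr_ge0.
Qed.
End pair.
End field.

Section slice_lower.
Context {R : realType} {n : nat}.
Local Notation lam := (lebesgue_rV R n).
Variables (omega : set 'rV[R]_n) (Phi : 'I_n -> 'rV[R]_n -> R).
Hypothesis omega_open : open omega.
Hypothesis tPhi : forall i, Sm_test omega (Phi i).

Lemma test_field_support : exists K0, [/\ compact K0, K0 `<=` omega &
  forall i x, ~ K0 x -> Phi i x = 0].
Proof.
have /choice [K hK] : forall i, exists K, [/\ compact K, K `<=` omega &
    forall x, ~ K x -> Phi i x = 0] by move=> i; have [] := tPhi i.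
exists (\big[setU/set0]_(i < n) K i); split.
- by apply: bigsetU_compact => i _; have [] := hK i.
- by elim/big_ind : _ => // [A B AO BO|i _]; [rewrite subUset|have [] := hK i].
- move=> i x Kx; have [_ _] := hK i; apply => Kix; apply: Kx.
  by rewrite (bigD1 i)//=; left.
Qed.

Lemma test_field_bound : exists2 C : R, 0 <= C & [/\ forall i x, `|Phi i x| <= C,
  forall i j x, `|partial j (Phi i) x| <= C &
  forall i x h, `|Phi i (x + h) - Phi i x - \sum_j partial j (Phi i) x * h ord0 j|
    <= C * `|h| ^+ 2].
Proof.
have /choice [C hC] : forall i, exists C : R, 0 <= C /\ [/\ forall x, `|Phi i x| <= C,
    forall j x, `|partial j (Phi i) x| <= C &
    forall x h, `|Phi i (x + h) - Phi i x - \sum_j partial j (Phi i) x * h ord0 j|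
      <= C * `|h| ^+ 2].
  move=> i; have [/Sm_taylor2[[_ _ [C C0 [c1 c2 c3]]] [B B0 hB]] _] := tPhi i.
  exists (C + B); split; first exact: addr_ge0.
  split.
  - by move=> x; apply: le_trans (hB x I) _; rewrite lerDr.
  - by move=> j x; apply: le_trans (c1 x j I) _; rewrite lerDl.
  - move=> x h; have := c3 x (x + h) I I; rewrite (addrC x h) addrK => h1.
    by apply: le_trans h1 _; rewrite ler_wpM2r ?sqr_ge0// lerDl.
have Cle i : C i <= \sum_i C i.
  by rewrite (bigD1 i)//= lerDl; apply: sumr_ge0 => j _; have [] := hC j.
exists (\sum_i C i); first by apply: sumr_ge0 => j _; have [] := hC j.
split.
- by move=> i x; apply: le_trans (Cle i); have [_ []] := hC i.
- by move=> i j x; apply: le_trans (Cle i); have [_ []] := hC i.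
- move=> i x h; have [_ [_ _]] := hC i => /(_ x h) h1; apply: le_trans h1 _.
  by rewrite ler_wpM2r ?sqr_ge0.
Qed.

Lemma le_card_div (A : R) : 0 <= A -> n%:R * A / n%:R <= A.
Proof.
move=> A0; have [->|n0] := eqVneq (n%:R : R) 0; first by rewrite !mul0r.
by rewrite mulrC mulrA mulVf// mul1r.
Qed.

Lemma mom2E (sg r : R) : 0 < r -> n%:R / 2 + 1 < sg ->
  mom2 (n := n) sg r = r `^ (n%:R + 2 - 2 * sg) * fine (mom n 1 sg).
Proof.
move=> r0 sgn; have f1 : mom n 1 sg \is a fin_num.
  by rewrite ge0_fin_numE ?mom_ge0// mom_fin.
have E := mom_scale n 1 sg r0; rewrite mulr1 in E.
rewrite /mom2 /Rintegral; under eq_integral => h _ do rewrite -(powRr1 (dot_ge0 h)).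
by rewrite E fineM.
Qed.

Lemma mom3E (sg r theta : R) : 0 < r -> 0 < theta -> n%:R / 2 + (1 + theta / 2) < sg ->
  mom3 (n := n) sg r theta =
  r `^ (n%:R + 2 - 2 * sg) * (r `^ theta * fine (mom n (1 + theta / 2) sg)).
Proof.
move=> r0 th0 sgn; have f1 : mom n (1 + theta / 2) sg \is a fin_num.
  by rewrite ge0_fin_numE ?mom_ge0// mom_fin//; lra.
have E := mom_scale n (1 + theta / 2) sg r0.
rewrite /mom3 /Rintegral E fineM// mulrA -(powR_add _ _ r0).
by congr (_ `^ _ * _); lra.
Qed.

Lemma error_le (C rem U I1 I2 p r' D' : R) : 0 <= C -> 0 <= rem -> 0 <= U ->
  0 <= I1 -> 0 <= I2 -> 0 <= p -> 0 <= r' -> 0 <= D' ->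
  2 * (p * ((C + rem) * (I1 + I2)) * D' + p * (r' * (rem * I2)) * U) <=
  (2 * (C + rem) * (1 + U) + 1) * (1 + I1 + I2) * p * (r' + D').
Proof.
move=> C0 rem0 U0 I10 I20 p0 r'0 D'0.
have h1 : 2 * ((C + rem) * (I1 + I2)) <= (2 * (C + rem) * (1 + U) + 1) * (1 + I1 + I2).
  rewrite mulrA ler_pM ?mulr_ge0 ?addr_ge0//; last by lra.
  have : 0 <= (C + rem) * U by rewrite mulr_ge0// addr_ge0.
  lra.
have h2 : 2 * (rem * I2) * U <= (2 * (C + rem) * (1 + U) + 1) * (1 + I1 + I2).
  have -> : 2 * (rem * I2) * U = 2 * (rem * U) * I2 by ring.
  rewrite ler_pM ?mulr_ge0//; last by lra.
  have : 0 <= C * U by rewrite mulr_ge0.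
  lra.
have -> : 2 * (p * ((C + rem) * (I1 + I2)) * D' + p * (r' * (rem * I2)) * U) = p * D' * (2 * ((C + rem) * (I1 + I2))) +
    p * r' * (2 * (rem * I2) * U) by ring.
have -> : (2 * (C + rem) * (1 + U) + 1) * (1 + I1 + I2) * p * (r' + D') =
    p * D' * ((2 * (C + rem) * (1 + U) + 1) * (1 + I1 + I2)) + p * r' * ((2 * (C + rem) * (1 + U) + 1) * (1 + I1 + I2)) by ring.
by apply: lerD; rewrite ler_wpM2l ?mulr_ge0//.
Qed.

(** The concave functional of [Phi] dual to the Dirichlet integral: over the test
    fields, its supremum is the integral of the squared gradient of [u]. *)
Definition calib_value (u : 'rV[R]_n -> R) : R :=
  - (2 * \int[lam]_(x in omega) (u x * divergence Phi x)) -
  \int[lam]_(x in omega) sqPhi Phi x.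

(** [slice_ge_calib] with [b] replaced by [u] and [field_mean] by the divergence.
    Both errors have the order in [r] of the main term, with a factor that is small
    with [r] and with the L^1 distance from [b] to [u] on [K].  The dependence on
    [sg] is explicit because the exponent varies along the sequence. *)
Lemma slice_lower (u : 'rV[R]_n -> R) (theta : R) :
  lam.-integrable omega (EFin \o u) -> 0 < theta <= 1 ->
  exists K, exists C : R, [/\ compact K, K `<=` omega, 0 < C &
    forall sg r a b, 0 < r <= 1 -> n%:R / 2 + (1 + theta / 2) < sg ->
    measurable_fun setT a -> measurable_fun setT b ->
    ((r `^ (n%:R + 2 - 2 * sg) * (fine (mom n 1 sg) / n%:R * calib_value u))%:E <=
     slice omega sg r a b +
     (C * (1 + fine (mom n 1 sg) + fine (mom n (1 + theta / 2) sg)) *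
        r `^ (n%:R + 2 - 2 * sg))%:E *
     ((r `^ theta)%:E + \int[lam]_(x in K) `|b x - u x|%:E))%E].
Proof.
move=> iu th01; have /andP[th0 th1] := th01.
have momega : measurable omega by exact: open_measurable_rV.
have [K0 [cK0 K0o PhiK0]] := test_field_support.
have [eta eta01 [K [cK Ko K0K]]] := compact_thicken cK0 omega_open K0o.
have [C C0 [PhiC dPhiC PhiT]] := test_field_bound.
have mPhi i : measurable_fun setT (Phi i) by apply: Sm_measurable; have [] := tPhi i.
have mdPhi i j : measurable_fun setT (partial j (Phi i)).
  by apply: Sm_measurable; have [] := tPhi i => sf _; exact: Sm_partial.
have clK0 : closed K0 by exact: compact_closed (@hausdorff_rV R n) cK0.
have mK : measurable K by apply: closed_measurable_rV; exact: compact_closed (@hausdorff_rV R n) cK.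
have Kfin : (lam K < +oo)%E by exact: compact_lebesgue_fin.
have eta0 : 0 < eta by have /andP[] := eta01.
have K0sub : K0 `<=` K by move=> x /K0K; apply; rewrite subrr normr0.
have iuK : lam.-integrable K (EFin \o u) by exact: integrableS iu.
set U := \int[lam]_(x in K) `|u x|.
have U0 : 0 <= U by rewrite /U Rintegral_ge0.
pose rem := rem_cst eta C theta (n := n).
have rem0 : 0 <= rem by exact: rem_cst_ge0.
exists K, (2 * (C + rem) * (1 + U) + 1); split => //.
  by rewrite ltr_wpDl// !mulr_ge0// addr_ge0.
move=> sg r a b /andP[r0 r1] sgn ma mb.
set p := r `^ (n%:R + 2 - 2 * sg).
set I1 := fine (mom n 1 sg); set I2 := fine (mom n (1 + theta / 2) sg).
have sgn1 : n%:R / 2 + 1 < sg by lra.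
have f1 : mom n 1 sg \is a fin_num by rewrite ge0_fin_numE ?mom_ge0// mom_fin.
have f2 : mom n (1 + theta / 2) sg \is a fin_num.
  by rewrite ge0_fin_numE ?mom_ge0// mom_fin//; lra.
have I10 : 0 <= I1 by rewrite fine_ge0// mom_ge0.
have I20 : 0 <= I2 by rewrite fine_ge0// mom_ge0.
have p0 : 0 < p by rewrite powR_gt0.
have rt0 : 0 < r `^ theta by rewrite powR_gt0.
have rt1 : r `^ theta <= 1.
  by rewrite -[leRHS](powRr0 r); apply: ger_powR; [rewrite r0|exact: ltW].
have m2E : mom2 (n := n) sg r = p * I1.
  exact: mom2E.
have m3E : mom3 (n := n) sg r theta = p * (r `^ theta * I2).
  exact: mom3E.
clearbody p I1 I2.
set D := (\int[lam]_(x in K) `|b x - u x|%:E)%E.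
have D0 : (0 <= D)%E by apply: integral_ge0 => x _; rewrite lee_fin.
set cst := (2 * (C + rem) * (1 + U) + 1).
have cst0 : 0 < cst by rewrite ltr_wpDl// !mulr_ge0// addr_ge0.
have I120 : 0 < 1 + I1 + I2 by lra.
have cI0 : 0 < cst * (1 + I1 + I2) * p by apply: mulr_gt0 => //; exact: mulr_gt0.
have [Doo|Dfin] := eqVneq D +oo%E.
  rewrite Doo addey// gt0_muley ?lte_fin// addey ?leey//.
  by rewrite -ltNye; apply: lt_le_trans (slice_ge0 _ _ _ _ _).
have mu : measurable_fun K u by apply/measurable_EFinP; case/integrableP: iuK.
have mbK : measurable_fun K b by exact: measurable_funTS.
have ibu : lam.-integrable K (EFin \o (fun x => b x - u x)).
  apply/integrableP; split; first by apply/measurable_EFinP; exact: measurable_funB.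
  by rewrite (eq_integral (fun x => `|b x - u x|%:E)) ?ltey.
have ib : lam.-integrable K (EFin \o b).
  have := integrable_addr mK ibu iuK.
  by congr integrable; apply/funext => x; rewrite /= subrK.
have low := slice_ge_calib cK eta01 K0K mPhi PhiK0 C0 PhiC r0 th01 sgn momega Ko ma mb ib.
have happ := field_mean_approx eta01 mPhi C0 PhiC dPhiC PhiT r0 th01 sgn.
rewrite -/rem in happ; clearbody rem.
have divC x : `|divergence Phi x| <= n%:R * C.
  apply: le_trans (ler_norm_sum _ _ _) _.
  have -> : n%:R * C = \sum_(i < n) C by rewrite sumr_const card_ord mulr_natl.
  exact: ler_sum.
have mdiv : measurable_fun setT (divergence Phi) by exact: measurable_sum.
have pI10 : 0 <= p * I1 by apply: mulr_ge0 => //; exact: ltW.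
have n'0 : 0 <= (n%:R : R)^-1 by rewrite invr_ge0.
have Mle y : `|field_mean eta Phi sg r y| <= p * ((C + rem) * (I1 + I2)).
  rewrite -[X in `|X|](subrK (divergence Phi y / n%:R * mom2 (n := n) sg r)) addrC.
  apply: le_trans (ler_normD _ _) _.
  apply: (@le_trans _ _ (C * (p * I1) + rem * (p * I2))).
    rewrite lerD//.
      rewrite m2E normrM (ger0_norm pI10); apply: (ler_wpM2r pI10).
      rewrite normrM (ger0_norm n'0).
      by apply: le_trans (le_card_div C0); apply: (ler_wpM2r n'0).
    apply: le_trans (happ y) _; rewrite ler_wpM2l// m3E ler_wpM2l ?(ltW p0)//.
    by rewrite ler_piMl.
  have : 0 <= p * C * I2 by rewrite !mulr_ge0// ltW.
  have : 0 <= p * rem * I1 by rewrite !mulr_ge0// ltW.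
  lra.
pose c := p * I1 / n%:R.
have c0 : 0 <= c by rewrite divr_ge0// mulr_ge0// ltW.
pose D' := \int[lam]_(x in K) `|b x - u x|.
have DE : D = D'%:E by rewrite /D' EFin_Rintegral//; exact: (integrable_norm ibu).
have D'0 : 0 <= D' by rewrite -lee_fin -DE.
pose V := \int[lam]_(x in K) (u x * divergence Phi x).
pose T := \int[lam]_(x in K) (b x * field_mean eta Phi sg r x).
have mbM : measurable_fun K (fun y => b y * field_mean eta Phi sg r y).
  exact: (measurable_mul_field_mean cK eta01 K0K mPhi PhiK0 C0 PhiC r0 th01 sgn ib).
have iab : lam.-integrable K (EFin \o (fun x => `|b x|)) := integrable_norm ib.
have iau : lam.-integrable K (EFin \o (fun x => `|u x|)) := integrable_norm iuK.
have iabu : lam.-integrable K (EFin \o (fun x => `|b x - u x|)) := integrable_norm ibu.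
have iT : lam.-integrable K (EFin \o (fun y => b y * field_mean eta Phi sg r y)).
  apply: (integrable_le_real mK mbM _ (integrable_mulr_cst (p * ((C + rem) * (I1 + I2))) mK iab)).
  by move=> y _; rewrite normrM mulrC ler_wpM2r.
have iV : lam.-integrable K (EFin \o (fun x => u x * divergence Phi x)).
  apply: (integrable_le_real mK _ _ (integrable_mulr_cst (n%:R * C) mK iau)).
    by apply: measurable_funM => //; exact: measurable_funTS.
  by move=> y _; rewrite normrM mulrC ler_wpM2r.
have icV := integrable_mulr_cst c mK iV.
pose X := p * ((C + rem) * (I1 + I2)) * D' + p * (r `^ theta * (rem * I2)) * U.
have TV : T - c * V <= X.
  rewrite /T /V -RintegralZl// -RintegralB//.
  rewrite /X /D' /U -(RintegralZl _ mK iabu) -(RintegralZl _ mK iau).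
  have i1 := integrable_mulr_cst (p * ((C + rem) * (I1 + I2))) mK iabu.
  have i2 := integrable_mulr_cst (p * (r `^ theta * (rem * I2))) mK iau.
  rewrite -(RintegralD mK i1 i2).
  apply: (le_Rintegral mK (integrable_subr mK iT icV) (integrable_addr mK i1 i2)).
  move=> y _; have := happ y; rewrite m2E m3E => hy.
  apply: le_trans (ler_norm _) _.
  have -> : b y * field_mean eta Phi sg r y - c * (u y * divergence Phi y) =
    field_mean eta Phi sg r y * (b y - u y) +
    (field_mean eta Phi sg r y - divergence Phi y / n%:R * (p * I1)) * u y.
    by rewrite /c; ring.
  apply: le_trans (ler_normD _ _) _; rewrite !normrM lerD//.
    by rewrite ler_wpM2r.
  rewrite ler_wpM2r//; apply: le_trans hy _; rewrite le_eqVlt; apply/orP; left.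
  by apply/eqP; rewrite -/rem; ring.
have VE : \int[lam]_(x in omega) (u x * divergence Phi x) = V.
  rewrite Rintegral_mkcond [RHS]Rintegral_mkcond; apply: eq_Rintegral => x _.
  rewrite !patchE; case: ifPn => xo.
    case: ifPn => // xK; rewrite /divergence big1 ?mulr0// => i _.
    apply: (supported_partial clK0 (PhiK0 i)) => /K0sub; move: xK.
    by rewrite notin_setE.
  case: ifPn => //; rewrite inE => /Ko; move: xo; by rewrite notin_setE.
have SE : \int[lam]_(x in omega) sqPhi Phi x = \int[lam]_x sqPhi Phi x.
  rewrite Rintegral_mkcond; apply: eq_Rintegral => x _; rewrite patchE.
  case: ifPn => // xo; rewrite /sqPhi big1// => i _; rewrite PhiK0 ?expr0n//.
  by move=> /K0o; move: xo; rewrite notin_setE.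
have X_le : 2 * X <= cst * (1 + I1 + I2) * p * (r `^ theta + D').
  by apply: error_le => //; exact: ltW.
rewrite DE -EFinD -EFinM; apply: le_trans (_ : _ <= ((- (2 * T) -
  mom2 (n := n) sg r / n%:R * \int[lam]_x sqPhi Phi x)%:E +
  (cst * (1 + I1 + I2) * p * (r `^ theta + D'))%:E))%E _; last exact: leeD2r.
rewrite -EFinD lee_fin m2E /calib_value VE SE -/c.
set S := \int[lam]_x _; have := TV; have := X_le.
have -> : p * (I1 / n%:R * (- (2 * V) - S)) = c * (- (2 * V) - S) by rewrite /c; ring.
lra.
Qed.
End slice_lower.

(** * Lower bound for the rescaled energy *)

Section energy_lower.
Context {R : realType} {n : nat}.
Local Notation leb := (@lebesgue_measure R).
Local Notation lam := (lebesgue_rV R n).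
Local Notation space := (Rsplit R n.+1).
Local Notation R2 := (measurableTypeR R * measurableTypeR R)%type.

Lemma integral_prod_set1 (J : set (measurableTypeR R)) (f : R2 -> \bar R) : measurable J ->
  measurable_fun setT f -> (forall p, 0 <= f p)%E ->
  (\int[leb \x leb]_(p in J `*` J) f p = \int[leb]_(t in J) \int[leb]_(u in J) f (t, u))%E.
Proof.
move=> mJ mf f0; have mJJ : measurable (J `*` J) by exact: measurableX.
rewrite integral_mkcond (fubini_tonelli1 (f \_ (J `*` J))); last 2 first.
- by apply/(measurable_restrictT f mJJ); exact: measurable_funTS.
- by move=> p; rewrite patchE; case: ifP.
rewrite [RHS]integral_mkcond; apply: eq_integral => t _; rewrite [RHS]patchE /fubini_F.
case: ifP => tJ.
  rewrite [RHS]integral_mkcond; apply: eq_integral => u _.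
  by rewrite !patchE in_setX /= tJ.
by apply: integral0_eq => u _; rewrite patchE in_setX /= tJ.
Qed.

Lemma integral_prod_set2 (J : set (measurableTypeR R)) (f : R2 -> \bar R) : measurable J ->
  measurable_fun setT f -> (forall p, 0 <= f p)%E ->
  (\int[leb \x leb]_(p in J `*` J) f p = \int[leb]_(u in J) \int[leb]_(t in J) f (t, u))%E.
Proof.
move=> mJ mf f0; have mJJ : measurable (J `*` J) by exact: measurableX.
rewrite integral_mkcond (fubini_tonelli2 (f \_ (J `*` J))); last 2 first.
- by apply/(measurable_restrictT f mJJ); exact: measurable_funTS.
- by move=> p; rewrite patchE; case: ifP.
rewrite [RHS]integral_mkcond; apply: eq_integral => u _; rewrite [RHS]patchE /fubini_G.
case: ifP => uJ.
  rewrite [RHS]integral_mkcond; apply: eq_integral => t _.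
  by rewrite !patchE in_setX /= uJ andbT.
by apply: integral0_eq => t _; rewrite patchE in_setX /= uJ andbF.
Qed.

Lemma measurable_int_set2 (J : set (measurableTypeR R)) (f : R2 -> \bar R) : measurable J ->
  measurable_fun setT f -> (forall p, 0 <= f p)%E ->
  measurable_fun setT (fun u : measurableTypeR R => \int[leb]_(t in J) f (t, u))%E.
Proof.
move=> mJ mf f0; pose g (p : R2) : \bar R := (f p * (\1_J p.1 : R)%:E)%E.
have mg : measurable_fun setT g.
  by apply: emeasurable_funM => //; apply: (measurable_indic_comp mJ); exact: measurable_fst.
have g0 p : (0 <= g p)%E by rewrite mule_ge0// lee_fin.
have := measurable_fun_fubini_tonelli_G g mg g0 (m1 := leb).
congr measurable_fun; apply/funext => u; rewrite [RHS]integral_mkcond.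
apply: eq_integral => t _; rewrite patchE /g indicE.
by case: ifP; rewrite ?mule1 ?mule0.
Qed.

Lemma rescale_ineq (E rc q A k rt et : R) (X Y : \bar R) : 0 <= E -> 0 <= A * rc ->
  E * rc = k -> 0 <= rt -> rt <= et -> (0 <= X)%E -> (0 <= Y)%E ->
  ((rc * q)%:E <= X + (A * rc)%:E * (rt%:E + Y))%E ->
  ((q * k)%:E <= E%:E * X + (A * k)%:E * (et%:E + Y))%E.
Proof.
move=> E0 Arc0 <- rt0 rtet X0 Y0 h.
have E0' : (0 <= E%:E)%E by rewrite lee_fin.
have := lee_wpmul2l E0' h; rewrite -EFinM (_ : E * (rc * q) = q * (E * rc)); last by ring.
move=> /le_trans; apply.
apply: (@le_trans _ _ (E%:E * (X + (A * rc)%:E * (et%:E + Y)))%E).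
  apply: lee_wpmul2l => //; apply: leeD => //; apply: lee_wpmul2l; first by rewrite lee_fin.
  by apply: leeD => //; rewrite lee_fin.
rewrite le_eqVlt; apply/orP; left; apply/eqP.
have eY0 : (0 <= et%:E + Y)%E by rewrite adde_ge0// lee_fin (le_trans rt0).
rewrite ge0_muleDr//; last by rewrite mule_ge0// lee_fin.
by rewrite muleA -EFinM mulrCA.
Qed.

Lemma slice_abs omega sg (r : R) a b :
  slice omega sg r a b = @slice R n omega sg `|r| a b.
Proof.
apply: eq_integral => x _; apply: eq_integral => y _.
by rewrite /ker real_normK// num_real.
Qed.

Definition slice_dist (K : set 'rV[R]_n) (v : space -> R) (f : 'rV[R]_n -> R) (t : R) : \bar R :=
  (\int[lam]_(x in K) `|v (x, t) - f x|%:E)%E.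

Lemma slice_dist_ge0 K v f t : (0 <= slice_dist K v f t)%E.
Proof. by apply: integral_ge0 => x _; rewrite lee_fin. Qed.

Lemma measurable_slice_dist K v f : measurable K -> measurable_fun setT v ->
  measurable_fun K f ->
  measurable_fun setT (slice_dist K v f : measurableTypeR R -> \bar R).
Proof.
move=> mK mv mf; have mf' : measurable_fun setT (f \_ K).
  by apply/(measurable_restrictT f mK).
pose g (z : measurableTypeR R * 'rV[R]_n) : \bar R :=
  (`|v (z.2, z.1) - (f \_ K) z.2|%:E * (\1_K z.2 : R)%:E)%E.
have mg : measurable_fun setT g.
  apply: emeasurable_funM; last by apply: (measurable_indic_comp mK); exact: measurable_snd.
  apply/measurable_EFinP; apply: measurableT_comp => //; apply: measurable_funB.
    apply: (measurableT_comp mv); apply: measurable_fun_pair; first exact: measurable_snd.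
    exact: measurable_fst.
  by apply: (measurableT_comp mf'); exact: measurable_snd.
have g0 z : (0 <= g z)%E by rewrite mule_ge0// lee_fin.
have := measurable_fun_fubini_tonelli_F g mg g0 (m2 := lam).
congr measurable_fun; apply/funext => t; rewrite /slice_dist [RHS]integral_mkcond.
apply: eq_integral => x _; rewrite patchE /g /= indicE patchE.
by case: ifP => _; rewrite ?mule1 ?mule0.
Qed.

(** Integrate the bound for a pair of slices over the heights between [kappa] and
    [1 - kappa], where convergence of the slices is available.  With
    [r = e * |t - u|] the powers of [e] cancel. *)
Lemma energy_lower omega K (v : space -> R) (f : 'rV[R]_n -> R) (sg s e theta A q kappa : R) :
  measurable omega -> measurable K -> measurable_fun setT v -> measurable_fun K f ->
  0 < kappa < 2^-1 -> 0 < e <= 1 -> 2^-1 < s < 1 -> 0 < theta -> 0 <= A -> 0 <= q ->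
  (forall r a b, 0 < r <= 1 -> measurable_fun setT a -> measurable_fun setT b ->
    ((r `^ (1 - 2 * s) * q)%:E <= slice omega sg r a b + (A * r `^ (1 - 2 * s))%:E *
      ((r `^ theta)%:E + \int[lam]_(x in K) `|b x - f x|%:E))%E) ->
  ((2 * (1 - 2 * kappa) `^ (3 - 2 * s) / ((2 - 2 * s) * (3 - 2 * s)) * q)%:E <=
   (e `^ (2 * s - 1))%:E * \int[leb]_(t in `]0%R, 1%R[) \int[leb]_(u in `]0%R, 1%R[)
     slice omega sg (e * (t - u)) (fun x => v (x, t)) (fun x => v (x, u)) +
   (A * (2 / (2 - 2 * s)))%:E * ((e `^ theta)%:E +
     \int[leb]_(u in `]kappa, (1 - kappa)%R[) slice_dist K v f u))%E.
Proof.
move=> mo mK mv mf /andP[k0 k2] /andP[e0 e1] /andP[s2 s1] th0 A0 q0 H.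
pose c : R := 1 - 2 * s.
have c1 : -1 < c by rewrite /c; lra.
have c0 : c != 0 by rewrite /c; lra.
pose J : set (measurableTypeR R) := `]kappa, 1 - kappa[%classic.
pose I1 : set (measurableTypeR R) := `]0, 1[%classic.
have mJ : measurable J by exact: measurable_itv.
have mI1 : measurable I1 by exact: measurable_itv.
pose kern (p : R2) : R := `|p.1 - p.2| `^ c.
have mkern : measurable_fun setT kern.
  apply: (measurableT_comp (measurable_powRl c)); apply: measurableT_comp => //.
  by apply: measurable_funB; [exact: measurable_fst|exact: measurable_snd].
have kern0 p : 0 <= kern p by exact: powR_ge0.
have kernE t u : kern (t, u) = `|t - u| `^ c by [].
clearbody kern.
pose S (p : R2) : \bar R :=
  slice omega sg (e * (p.1 - p.2)) (fun x => v (x, p.1)) (fun x => v (x, p.2)).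
have mS : measurable_fun setT S by exact: measurable_slice.
have S0 p : (0 <= S p)%E by exact: slice_ge0.
have SE' t u : S (t, u) = slice omega sg (e * (t - u)) (fun x => v (x, t)) (fun x => v (x, u)) by [].
clearbody S.
pose D := slice_dist K v f.
have mD : measurable_fun setT (D : measurableTypeR R -> \bar R) by exact: measurable_slice_dist.
have D0 t : (0 <= D t)%E by exact: slice_dist_ge0.
have DE t : D t = (\int[lam]_(x in K) `|v (x, t) - f x|%:E)%E by [].
have D_int : (\int[leb]_(u in `]kappa, (1 - kappa)%R[) slice_dist K v f u =
  \int[leb]_(u in `]kappa, (1 - kappa)%R[) D u)%E by [].
rewrite D_int; clearbody D.
pose g2 (p : R2) : \bar R := ((A * kern p)%:E * ((e `^ theta)%:E + D p.2))%E.
have mg2 : measurable_fun setT g2.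
  apply: emeasurable_funM; first by apply/measurable_EFinP; exact: measurable_funM.
  apply: emeasurable_funD => //; exact: (measurableT_comp mD measurable_snd).
have g20 p : (0 <= g2 p)%E.
  by rewrite mule_ge0 ?lee_fin ?mulr_ge0// adde_ge0 ?lee_fin ?powR_ge0.
pose g1 (p : R2) : \bar R := ((e `^ (2 * s - 1))%:E * S p)%E.
have mg1 : measurable_fun setT g1 by exact: emeasurable_funM.
have g10 p : (0 <= g1 p)%E by rewrite mule_ge0 ?lee_fin ?powR_ge0.
have mqk : measurable_fun setT (fun p => (q * kern p)%:E).
  by apply/measurable_EFinP; exact: measurable_funM.
have qk0 p : (0 <= (q * kern p)%:E)%E by rewrite lee_fin mulr_ge0.
have ptw p : (J `*` J) p -> ((q * kern p)%:E <= g1 p + g2 p)%E.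
  move: p => [t u] [/= tJ uJ].
  have [tu|tu] := eqVneq t u.
    rewrite kernE /= tu subrr normr0 powR0// mulr0; exact: adde_ge0.
  have tu0 : 0 < `|t - u| by rewrite normr_gt0 subr_eq0.
  have tu1 : `|t - u| <= 1.
    move: tJ uJ; rewrite /J /= !in_itv /= => /andP[a1 a2] /andP[b1 b2].
    rewrite ler_norml; lra.
  have r0 : 0 < e * `|t - u| by rewrite mulr_gt0.
  have r1 : e * `|t - u| <= 1 by rewrite mulr_ile1// ltW.
  have mvt w : measurable_fun setT (fun x => v (x, w)).
    exact: (measurableT_comp mv (measurable_pair2 w)).
  have := H (e * `|t - u|) (fun x => v (x, t)) (fun x => v (x, u)).
  rewrite r0 r1 => /(_ isT (mvt t) (mvt u)); rewrite -DE => h.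
  have SE : S (t, u) = slice omega sg (e * `|t - u|) (fun x => v (x, t)) (fun x => v (x, u)).
    by rewrite SE' slice_abs normrM (gtr0_norm e0).
  have rE : e `^ (2 * s - 1) * (e * `|t - u|) `^ (1 - 2 * s) = kern (t, u).
    rewrite powRM//; last exact: ltW.
    rewrite mulrA -powR_add// (_ : 2 * s - 1 + (1 - 2 * s) = 0); last by lra.
    by rewrite powRr0 mul1r kernE.
  rewrite /g1 SE; apply: (rescale_ineq _ _ rE _ _ _ (D0 u) h).
  - exact: powR_ge0.
  - by rewrite mulr_ge0// powR_ge0.
  - exact: powR_ge0.
  - apply: ge0_ler_powR; rewrite ?nnegrE; [exact: ltW|exact: ltW|exact: ltW|].
    by apply: ler_piMr; first exact: ltW.
  - exact: slice_ge0.
have mJJ : measurable (J `*` J) by exact: measurableX.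
have mII : measurable (I1 `*` I1) by exact: measurableX.
have lhs : (\int[leb \x leb]_(p in J `*` J) (q * kern p)%:E =
    (2 * (1 - 2 * kappa) `^ (3 - 2 * s) / ((2 - 2 * s) * (3 - 2 * s)) * q)%:E)%E.
  under eq_integral do rewrite EFinM.
  rewrite (ge0_integralZl_EFin _ mJJ) //; last 2 first.
  - by move=> p _; rewrite lee_fin.
  - by apply/measurable_EFinP; exact: measurable_funTS.
  have mEk : measurable_fun setT (fun p => (kern p)%:E) by apply/measurable_EFinP.
  have Ek0 p : (0 <= (kern p)%:E)%E by rewrite lee_fin.
  rewrite (integral_prod_set2 mJ mEk Ek0).
  under eq_integral => u _ do under eq_integral => t _ do rewrite kernE.
  rewrite (integral2_dist_powR c1); last by lra.
  rewrite (_ : 1 - kappa - kappa = 1 - 2 * kappa); last by lra.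
  rewrite (_ : c + 2 = 3 - 2 * s); last by rewrite /c; lra.
  rewrite (_ : c + 1 = 2 - 2 * s); last by rewrite /c; lra.
  by rewrite -EFinM mulrC.
rewrite -lhs; apply: (@le_trans _ _ (\int[leb \x leb]_(p in J `*` J) (g1 p + g2 p))%E).
  apply: ge0_le_integral => //.
  - exact: measurable_funTS.
  - by apply: measurable_funTS; exact: emeasurable_funD.
rewrite ge0_integralD//; last 2 first.
- exact: measurable_funTS.
- exact: measurable_funTS.
apply: leeD.
  rewrite /g1 (ge0_integralZl_EFin _ mJJ) ?powR_ge0//; last exact: measurable_funTS.
  apply: lee_wpmul2l; first by rewrite lee_fin powR_ge0.
  have -> : (\int[leb]_(t in `]0%R, 1%R[) \int[leb]_(u in `]0%R, 1%R[)
     slice omega sg (e * (t - u)) (fun x => v (x, t)) (fun x => v (x, u)) =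
     \int[leb \x leb]_(p in I1 `*` I1) S p)%E.
    rewrite (integral_prod_set1 mI1 mS S0); apply: eq_integral => t _.
    by apply: eq_integral => u _; rewrite SE'.
  apply: ge0_subset_integral => //; first exact: measurable_funTS.
  have JI t : J t -> I1 t.
    by rewrite /J /I1 /= !in_itv /= => /andP[a1 a2]; apply/andP; split; lra.
  by move=> p [/JI p1 /JI p2].
rewrite integral_prod_set2//.
set W := (A * (2 / (2 - 2 * s)))%:E.
have W0 : (0 <= W)%E by rewrite lee_fin mulr_ge0// divr_ge0//; lra.
apply: (@le_trans _ _ (\int[leb]_(u in J) (W * ((e `^ theta)%:E + D u)))%E).
  apply: ge0_le_integral => //.
  - by move=> u _; apply: integral_ge0.
  - by apply: measurable_funTS; exact: measurable_int_set2.
  - apply: measurable_funTS; apply: emeasurable_funM => //; exact: emeasurable_funD.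
  move=> u uJ; rewrite /g2 /=.
  have e0D : (0 <= (e `^ theta)%:E + D u)%E by rewrite adde_ge0// lee_fin powR_ge0.
  rewrite ge0_integralZr//; last 2 first.
  - apply: measurable_funTS; apply/measurable_EFinP; apply: measurable_funM => //.
    exact: (measurableT_comp mkern (measurable_pair2 u)).
  - by move=> t _; rewrite lee_fin mulr_ge0.
  apply: lee_wpmul2r => //.
  under eq_integral do rewrite kernE EFinM.
  rewrite ge0_integralZl_EFin//; last first.
    by apply: measurable_funTS; exact: measurable_dist_powR.
  rewrite /W EFinM; apply: lee_wpmul2l; first by rewrite lee_fin.
  have := integral_dist_powR_le (tau := u) c1 _ (_ : 1 - kappa - kappa <= 1).
  rewrite (_ : c + 1 = 2 - 2 * s); last by rewrite /c; lra.
  apply; last by lra.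
  by move: uJ; rewrite /J /= in_itv.
rewrite ge0_integralZl//; last 2 first.
- by apply: measurable_funTS; exact: emeasurable_funD.
- by move=> u _; rewrite adde_ge0// lee_fin powR_ge0.
apply: lee_wpmul2l => //.
rewrite ge0_integralD//; last 2 first.
- by move=> u _; rewrite lee_fin powR_ge0.
- exact: measurable_funTS.
rewrite leeD2r// integral_cst//= lebesgue_measure_itv /= lte_fin.
case: ifP => _; last by rewrite mule0 lee_fin powR_ge0.
rewrite -EFinB -EFinM lee_fin ler_piMr ?powR_ge0//; lra.
Qed.

End energy_lower.

(** * The liminf inequality *)

Section liminf_tools.
Context {R : realType}.

Lemma limn_einf_ge (l : \bar R) (G : nat -> \bar R) :
  (\forall j \near \oo, (l <= G j)%E) -> (l <= limn_einf G)%E.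
Proof.
move=> [N _ h]; rewrite limn_einf_lim; apply: lime_ge; first exact: is_cvg_einfs.
exists N => // k /= Nk; apply: le_ereal_inf_tmp => _ [j /= kj <-].
by apply: h => /=; exact: leq_trans kj.
Qed.

Lemma EFin_le_lim (x_ : nat -> R) (x : R) (l : \bar R) : x_ k @[k --> \oo] --> x ->
  (forall k, ((x_ k)%:E <= l)%E) -> (x%:E <= l)%E.
Proof.
move=> xx xl; have cv : (x_ k)%:E @[k --> \oo] --> x%:E by apply: cvg_EFin; [exact: nearW|exact: xx].
have <- : limn (fun k => (x_ k)%:E) = x%:E by exact/cvg_lim.
by apply: lime_le; [apply/cvg_ex; exists x%:E|exact: nearW].
Qed.

Lemma cvg_powR_base (eps : nat -> R) (theta : R) : (forall j, 0 < eps j) -> 0 < theta ->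
  eps j @[j --> \oo] --> 0 -> eps j `^ theta @[j --> \oo] --> 0.
Proof.
move=> e0 t0 ecv; apply/cvgrPdist_lt => d d0; near=> j.
rewrite sub0r normrN ger0_norm ?powR_ge0//.
have -> : d = (d `^ theta^-1) `^ theta.
  by rewrite -powRrM mulVf ?gt_eqF// powRr1// ltW.
rewrite gt0_ltr_powR ?nnegrE ?powR_ge0 ?ltW//.
near: j; apply: (cvgr_lt 0) => //; exact: powR_gt0.
Unshelve. all: by end_near.
Qed.

Lemma cvg_powR_exp (s_ : nat -> R) (s a : R) : 0 < a ->
  s_ j @[j --> \oo] --> s -> a `^ s_ j @[j --> \oo] --> a `^ s.
Proof.
move=> a0 scv; rewrite /powR gt_eqF//.
have : s_ j * ln a @[j --> \oo] --> s * ln a by apply: cvgM => //; exact: cvg_cst.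
by apply: continuous_cvg; exact: continuous_expR.
Qed.

Lemma fine_mom_cvg n (beta : R) (sg : nat -> R) (sg0 : R) : 0 <= beta -> n%:R / 2 + beta < sg0 ->
  sg j @[j --> \oo] --> sg0 ->
  fine (mom n beta (sg j)) @[j --> \oo] --> fine (mom n beta sg0).
Proof.
move=> b0 nb sgcv; apply: fine_cvg; rewrite fineK.
  exact: mom_cvg.
by rewrite ge0_fin_numE ?mom_ge0// mom_fin.
Qed.

Lemma fine_mom_anti n (beta sg1 sg : R) : 0 <= beta -> n%:R / 2 + beta < sg1 -> sg1 <= sg ->
  fine (mom n beta sg) <= fine (mom n beta sg1).
Proof.
move=> b0 nb s1s; have f sg' : sg1 <= sg' -> mom n beta sg' \is a fin_num.
  by move=> h; rewrite ge0_fin_numE ?mom_ge0// mom_fin// (lt_le_trans nb).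
by apply: fine_le; [exact: f|exact: f|exact: mom_anti].
Qed.

Lemma coef_le (C s0 s I1 I2 J1 J2 : R) : 0 < C -> 0 <= I1 -> 0 <= I2 -> I1 <= J1 ->
  I2 <= J2 -> s < (1 + s0) / 2 -> s0 < 1 ->
  C * (1 + I1 + I2) * (2 / (2 - 2 * s)) <= C * (1 + J1 + J2) * (2 / (1 - s0)).
Proof.
move=> C0 I10 I20 IJ1 IJ2 ss0 s01; apply: ler_pM.
- by rewrite mulr_ge0 ?(ltW C0)//; lra.
- by rewrite divr_ge0//; lra.
- by rewrite ler_pM2l//; lra.
- by rewrite ler_pM2l// lef_pV2 ?posrE; lra.
Qed.

Lemma height_exponent n (s : R) : n%:R + 2 - 2 * (n.+1%:R / 2 + s) = 1 - 2 * s.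
Proof. by rewrite -[n.+1%:R]natr1; lra. Qed.

End liminf_tools.

Section L2_integrable.
Context d (T : measurableType d) (R : realType) (mu : {measure set T -> \bar R}).

Lemma L2_integrable_sqr D (h : T -> R) : measurable D -> L2 mu D h ->
  mu.-integrable D (EFin \o (fun x => h x ^+ 2)).
Proof.
move=> mD [mh hfin]; apply/integrableP; split.
  by apply/measurable_EFinP; exact: measurable_funX.
rewrite (eq_integral (fun x => (h x ^+ 2)%:E))// => x _ /=.
by rewrite ger0_norm ?sqr_ge0.
Qed.

Lemma L2_integrable D (h : T -> R) : measurable D -> (mu D < +oo)%E -> L2 mu D h ->
  mu.-integrable D (EFin \o h).
Proof.
move=> mD Dfin L2h; have mh := L2h.1.
have i1 : mu.-integrable D (EFin \o (fun=> 1)).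
  by apply: (@bounded_integrable _ _ _ _ _ _ 1) => // x _; rewrite normr1.
apply: (integrable_le_real mD mh _ (integrable_addr mD i1 (L2_integrable_sqr mD L2h))).
move=> x _; rewrite -(real_normK (num_real (h x))).
have := normr_ge0 (h x); set y := `|h x|; have := sqr_ge0 (y - 1); nra.
Qed.

Lemma Rintegral_sum D (I : Type) (s : seq I) (h : I -> T -> R) : measurable D ->
  (forall i, mu.-integrable D (EFin \o h i)) ->
  \int[mu]_(x in D) (\sum_(i <- s) h i x) = \sum_(i <- s) \int[mu]_(x in D) h i x.
Proof.
move=> mD ih; elim: s => [|i s IHs].
  under eq_Rintegral do rewrite big_nil.
  by rewrite big_nil /Rintegral integral0.
under eq_Rintegral do rewrite big_cons.
by rewrite big_cons RintegralD// ?IHs//; exact: integrable_sumr.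
Qed.

End L2_integrable.

Section liminf.
Context {R : realType} {n : nat}.
Local Notation leb := (@lebesgue_measure R).
Local Notation lam := (lebesgue_rV R n).
Local Notation space := (Rsplit R n.+1).
Variables (omega : set 'rV[R]_n).
Hypothesis omega_open : open omega.

Definition layer_energy (e s : R) (v : space -> R) : \bar R :=
  ((e `^ (2 * s - 1))%:E * \int[leb]_(t in `]0%R, 1%R[) \int[leb]_(u in `]0%R, 1%R[)
     slice omega (n.+1%:R / 2 + s) (e * (t - u)) (fun x => v (x, t)) (fun x => v (x, u)))%E.

Lemma layer_energy_ge0 e s v : (0 <= layer_energy e s v)%E.
Proof.
apply: mule_ge0; first by rewrite lee_fin powR_ge0.
by apply: integral_ge0 => t _; apply: integral_ge0 => u _; exact: slice_ge0.
Qed.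

Variables (eps s_ : nat -> R) (s0 : R) (v_ : nat -> space -> R) (f : 'rV[R]_n -> R).
Hypothesis eps0 : forall j, 0 < eps j.
Hypothesis eps_cvg : eps j @[j --> \oo] --> 0.
Hypothesis s0_itv : 2^-1 < s0 < 1.
Hypothesis s_cvg : s_ j @[j --> \oo] --> s0.
Hypothesis mv : forall j, measurable_fun setT (v_ j).
Hypothesis intf : lam.-integrable omega (EFin \o f).
Hypothesis v_cvg : forall K (kappa : R), compact K -> K `<=` omega -> 0 < kappa ->
  (\int[leb]_(t in `]kappa, (1 - kappa)%R[) slice_dist K (v_ j) f t)%E @[j --> \oo] --> 0%E.

Let momega : measurable omega := open_measurable_rV omega_open.

Definition moment1 (s : R) : R := fine (mom n 1 (n.+1%:R / 2 + s)).

(** [energy_lower] along the sequence: its error terms vanish in the limit and its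
    constants converge with the exponents. *)
Lemma liminf_calib (Phi : 'I_n -> 'rV[R]_n -> R) (kappa : R) : (forall i, Sm_test omega (Phi i)) ->
  0 <= calib_value omega Phi f -> 0 < kappa < 2^-1 ->
  ((2 * (1 - 2 * kappa) `^ (3 - 2 * s0) / ((2 - 2 * s0) * (3 - 2 * s0)) *
     (moment1 s0 / n%:R * calib_value omega Phi f))%:E
   <= limn_einf (fun j => layer_energy (eps j) (s_ j) (v_ j)))%E.
Proof.
move=> tPhi Q0 kap; have /andP[kap0 kap2] := kap; have /andP[s02 s01] := s0_itv.
pose theta := s0 - 2^-1.
have th01 : 0 < theta <= 1 by rewrite /theta; apply/andP; split; lra.
have th0 : 0 < theta by have /andP[] := th01.
have [K [C [cK Ko C0 low]]] := slice_lower omega_open tPhi intf th01.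
have mK : measurable K by apply: closed_measurable_rV; exact: compact_closed (@hausdorff_rV R n) cK.
set Q := calib_value omega Phi f in Q0 low *.
(* an admissible exponent below the s_j; the moments decrease in the exponent,
   so the constants at [sig] bound those at all s_j *)
pose sig : R := 3 / 4 * s0 + 8^-1.
have sig0 : sig < s0 by rewrite /sig; lra.
have sigt : 2^-1 + theta / 2 < sig by rewrite /sig /theta; lra.
have s2sig : 2^-1 < sig by lra.
pose sgs : R := n.+1%:R / 2 + sig.
have sgsn : n%:R / 2 + (1 + theta / 2) < sgs by rewrite /sgs -[n.+1%:R]natr1; lra.
have sgsn1 : n%:R / 2 + 1 < sgs by rewrite /sgs -[n.+1%:R]natr1; lra.
have th20 : 0 <= 1 + theta / 2 by lra.
pose Abar : R := C * (1 + fine (mom n 1 sgs) + fine (mom n (1 + theta / 2) sgs)).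
pose W : R := Abar * (2 / (1 - s0)).
have W0 : 0 <= W.
  rewrite /W /Abar mulr_ge0 ?divr_ge0//; last by lra.
  by rewrite mulr_ge0 ?(ltW C0)// !addr_ge0// fine_ge0// mom_ge0.
pose c_ (s : R) : R := 2 * (1 - 2 * kappa) `^ (3 - 2 * s) / ((2 - 2 * s) * (3 - 2 * s)) *
  (moment1 s / n%:R * Q).
have c_cvg : c_ (s_ j) @[j --> \oo] --> c_ s0.
  have sc k : k * s_ j @[j --> \oo] --> k * s0 by apply: cvgM => //; exact: cvg_cst.
  apply: cvgM; last first.
    apply: cvgM; last exact: cvg_cst.
    apply: cvgM; last exact: cvg_cst.
    apply: fine_mom_cvg => //; first by rewrite -[n.+1%:R]natr1; lra.
    by apply: cvgD => //; exact: cvg_cst.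
  apply: cvgM.
    apply: cvgM; first exact: cvg_cst.
    apply: cvg_powR_exp; first by lra.
    by apply: cvgB => //; exact: cvg_cst.
  apply: cvgV; first by rewrite mulf_neq0//; lra.
  by apply: cvgM; apply: cvgB => //; exact: cvg_cst.
have est : \forall j \near \oo, ((c_ (s_ j))%:E <= layer_energy (eps j) (s_ j) (v_ j) +
    W%:E * ((eps j `^ theta)%:E +
     \int[leb]_(t in `]kappa, (1 - kappa)%R[) slice_dist K (v_ j) f t))%E.
  near=> j.
  have sj1 : sig < s_ j by near: j; exact: (cvgr_gt s0).
  have sj2 : s_ j < (1 + s0) / 2 by near: j; apply: (cvgr_lt s0) => //; lra.
  have ej1 : eps j <= 1.
    by apply: ltW; near: j; apply: (cvgr_lt 0) => //; exact: ltr01.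
  have sj3 : 2^-1 < s_ j < 1.
    rewrite (lt_trans s2sig sj1)/=; apply: lt_trans sj2 _.
    by rewrite ltr_pdivrMr// mul1r; apply: (ler_ltD _ s01); exact: lexx.
  pose A : R := C * (1 + moment1 (s_ j) + fine (mom n (1 + theta / 2) (n.+1%:R / 2 + s_ j))).
  have A0 : 0 <= A.
    by rewrite /A mulr_ge0 ?(ltW C0)// !addr_ge0// fine_ge0// mom_ge0.
  have q0 : 0 <= moment1 (s_ j) / n%:R * Q.
    by rewrite mulr_ge0// divr_ge0// fine_ge0// mom_ge0.
  have mf : measurable_fun K f.
    by apply: measurable_funS momega Ko _; apply/measurable_EFinP; case/integrableP: intf.
  have ej : 0 < eps j <= 1 by rewrite eps0.
  have H r a b : 0 < r <= 1 -> measurable_fun setT a -> measurable_fun setT b ->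
    ((r `^ (1 - 2 * s_ j) * (moment1 (s_ j) / n%:R * Q))%:E <=
       slice omega (n.+1%:R / 2 + s_ j) r a b + (A * r `^ (1 - 2 * s_ j))%:E *
      ((r `^ theta)%:E + \int[lam]_(x in K) `|b x - f x|%:E))%E.
    move=> r01 ma mb; have := low (n.+1%:R / 2 + s_ j) r a b r01 _ ma mb.
    rewrite height_exponent.
    by apply; apply: (lt_trans sgsn); rewrite ltrD2l.
  apply: le_trans (energy_lower momega mK (mv j) mf kap ej sj3 th0 A0 q0 H) _.
  apply: leeD; first exact: lexx.
  apply: lee_wpmul2r.
    rewrite adde_ge0 ?lee_fin ?powR_ge0//; apply: integral_ge0 => t _; exact: slice_dist_ge0.
  rewrite lee_fin; apply: (coef_le C0 _ _ _ _ sj2 s01).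
  - exact: fine_ge0 (mom_ge0 _ _ _).
  - exact: fine_ge0 (mom_ge0 _ _ _).
  - by apply: (fine_mom_anti ler01 sgsn1); rewrite lerD2l ltW.
  - by apply: (fine_mom_anti th20 sgsn); rewrite lerD2l ltW.
have lim0 : (W%:E * ((eps j `^ theta)%:E +
     \int[leb]_(t in `]kappa, (1 - kappa)%R[) slice_dist K (v_ j) f t))%E @[j --> \oo] --> 0%E.
  rewrite -[X in _ --> X](mule0 W%:E); apply: cvgeZl => //.
  rewrite -[X in _ --> X](adde0 0%E); apply: cvgeD => //.
    by apply: cvg_EFin; [exact: nearW|exact: cvg_powR_base].
  exact: v_cvg.
have /EFin_le_lim : c_ s0 - k.+1%:R^-1 @[k --> \oo] --> c_ s0.
  rewrite -[X in _ --> X]subr0; apply: cvgB; first exact: cvg_cst.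
  exact: cvg_harmonic.
apply => k; apply: limn_einf_ge.
pose d : R := k.+1%:R^-1; have d0 : 0 < d by rewrite invr_gt0.
have d20 : (0%:E < (d / 2)%:E)%E by rewrite lte_fin divr_gt0.
near=> j.
have e1 : c_ s0 - d / 2 < c_ (s_ j) by near: j; apply: (cvgr_gt (c_ s0)) => //; lra.
have e2 : (W%:E * ((eps j `^ theta)%:E +
     \int[leb]_(t in `]kappa, (1 - kappa)%R[) slice_dist K (v_ j) f t) < (d / 2)%:E)%E.
  by near: j; exact: lim0 _ (open_ereal_lt' d20).
have e3 : ((c_ (s_ j))%:E <= layer_energy (eps j) (s_ j) (v_ j) +
    W%:E * ((eps j `^ theta)%:E +
     \int[leb]_(t in `]kappa, (1 - kappa)%R[) slice_dist K (v_ j) f t))%E.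
  by near: j; exact: est.
have := le_trans e3 (leeD (lexx _) (ltW e2)).
rewrite -/d; clearbody d; move: (c_ (s_ j)) (c_ s0) e1 => c1 c0 e1; case: (layer_energy _ _ _) => [x||]; first by rewrite -EFinD !lee_fin; lra.
  by move=> _; rewrite leey.
by rewrite addNye leeNy_eq.
Unshelve. all: by end_near.
Qed.

Hypothesis omega_fin : (lam omega < +oo)%E.
Variable g : 'rV[R]_n -> 'rV[R]_n.
Hypothesis L2f : L2 lam omega f.
Hypothesis gradf : is_L2_gradient omega f g.

(** The integral of [|t - u| ^ (1 - 2 s)] over the unit square of heights. *)
Definition height_cst (s : R) : R := 2 / ((2 - 2 * s) * (3 - 2 * s)).

(** The heights close to the two faces carry a vanishing share as [kappa] tends to 0. *)
Lemma liminf_calib0 (Phi : 'I_n -> 'rV[R]_n -> R) : (forall i, Sm_test omega (Phi i)) ->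
  0 <= calib_value omega Phi f ->
  ((height_cst s0 * (moment1 s0 / n%:R * calib_value omega Phi f))%:E
   <= limn_einf (fun j => layer_energy (eps j) (s_ j) (v_ j)))%E.
Proof.
move=> tPhi Q0; have /andP[s02 s01] := s0_itv.
set Q := calib_value _ _ _ in Q0 *.
pose kap (k : nat) : R := 3^-1 * k.+1%:R^-1.
have kap0 : kap k @[k --> \oo] --> 0.
  by rewrite -[X in _ --> X](mulr0 3^-1); apply: cvgM; [exact: cvg_cst|exact: cvg_harmonic].
have kap_itv k : 0 < kap k < 2^-1.
  have k1 : 0 < (k.+1%:R : R)^-1 <= 1 by rewrite invr_gt0 ltr0n/= invf_le1// ler1n.
  move: k1; rewrite /kap; set x := _^-1 => /andP[x0 x1]; apply/andP; split; lra.
have powcv : (1 - 2 * kap k) `^ (3 - 2 * s0) @[k --> \oo] --> (1 : R).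
  have c1 : 1 - 2 * kap k @[k --> \oo] --> (1 : R).
    rewrite -[X in _ --> X]subr0; apply: cvgB; first exact: cvg_cst.
    by rewrite -[X in _ --> X](mulr0 2); apply: cvgM => //; exact: cvg_cst.
  apply: (squeeze_cvgr (f := fun k => (1 - 2 * kap k) ^+ 2) (h := fun=> 1)).
  - apply: nearW => k; have /andP[k0 k2] := kap_itv k.
    have h1 : 0 < 1 - 2 * kap k <= 1 by apply/andP; split; lra.
    have h0 : 0 <= 1 - 2 * kap k by lra.
    rewrite -(powR_mulrn 2 h0); apply/andP; split.
      by apply: ger_powR => //; lra.
    by rewrite -[leRHS](powRr0 (1 - 2 * kap k)); apply: ger_powR => //; lra.
  - rewrite -[X in _ --> X](expr1n _ 2); apply: (cvgM c1 c1).
  - exact: cvg_cst.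
apply: (EFin_le_lim (x_ := fun k => 2 * (1 - 2 * kap k) `^ (3 - 2 * s0) /
   ((2 - 2 * s0) * (3 - 2 * s0)) * (moment1 s0 / n%:R * Q))); last first.
  by move=> k; exact: liminf_calib.
apply: cvgM; last exact: cvg_cst.
apply: cvgM; last exact: cvg_cst.
by rewrite -[X in _ --> X]mulr1; apply: cvgM => //; exact: cvg_cst.
Qed.

Definition grad_sq : R := \sum_i \int[lam]_(x in omega) (g x ord0 i ^+ 2).

(** Integrating by parts, [calib_value] is the integral of [|g|^2 - |g - Phi|^2]. *)
Lemma calib_value_ge (Phi : 'I_n -> 'rV[R]_n -> R) (d : R) : (forall i, Sm_test omega (Phi i)) ->
  (forall i, l2sq omega (fun x => g x ord0 i) (Phi i) <= d%:E)%E ->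
  grad_sq - n%:R * d <= calib_value omega Phi f.
Proof.
move=> tPhi dPhi.
have [C C0 [PhiC dPhiC _]] := test_field_bound tPhi.
have mPhi i : measurable_fun omega (Phi i).
  by apply: measurable_funTS; apply: Sm_measurable; have [] := tPhi i.
have mdPhi i j : measurable_fun omega (partial j (Phi i)).
  apply: measurable_funTS; apply: Sm_measurable.
  by have [] := tPhi i => sf _; exact: Sm_partial.
have L2g i := gradf.1 i.
have mg i : measurable_fun omega (fun x => g x ord0 i) := (L2g i).1.
have ig2 i : lam.-integrable omega (EFin \o (fun x => g x ord0 i ^+ 2)).
  exact: L2_integrable_sqr (L2g i).
have ig i : lam.-integrable omega (EFin \o (fun x => g x ord0 i)).
  exact: L2_integrable (L2g i).
have mulb (h k : 'rV[R]_n -> R) : lam.-integrable omega (EFin \o h) ->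
    measurable_fun omega k -> (forall x, `|k x| <= C) ->
    lam.-integrable omega (EFin \o (fun x => h x * k x)).
  move=> ih mk kC; apply: (integrable_le_real momega _ _
    (integrable_mulr_cst C momega (integrable_norm ih))).
    by apply: measurable_funM => //; apply/measurable_EFinP; case/integrableP: ih.
  by move=> x _; rewrite normrM mulrC ler_wpM2r.
have iPhi i : lam.-integrable omega (EFin \o Phi i).
  by apply: bounded_integrable (fun x _ => PhiC i x).
have iPhi2 i : lam.-integrable omega (EFin \o (fun x => Phi i x ^+ 2)) by exact: mulb.
have igPhi i : lam.-integrable omega (EFin \o (fun x => g x ord0 i * Phi i x)) by exact: mulb.
have ifd i : lam.-integrable omega (EFin \o (fun x => f x * partial i (Phi i) x)).
  by apply: mulb => //; exact: dPhiC.
have divE : \int[lam]_(x in omega) (f x * divergence Phi x) =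
    - \sum_i \int[lam]_(x in omega) (g x ord0 i * Phi i x).
  under eq_Rintegral do rewrite /divergence mulr_sumr.
  rewrite Rintegral_sum// -sumrN; apply: eq_bigr => i _.
  by apply: gradf.2; exact: Sm_test_function.
rewrite /calib_value divE /sqPhi Rintegral_sum// mulrN opprK /grad_sq mulr_sumr -sumrB.
have -> : n%:R * d = \sum_(i < n) d by rewrite sumr_const card_ord mulr_natl.
rewrite -sumrB; apply: ler_sum => i _.
have igd : lam.-integrable omega (EFin \o (fun x => (g x ord0 i - Phi i x) ^+ 2)).
  have := integrable_addr momega (integrable_subr momega (ig2 i)
    (integrable_mulr_cst 2 momega (igPhi i))) (iPhi2 i).
  by congr integrable; apply/funext => x /=; congr EFin; ring.
have := dPhi i; rewrite /l2sq -(EFin_Rintegral momega igd) lee_fin.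
have -> : \int[lam]_(x in omega) ((g x ord0 i - Phi i x) ^+ 2) =
    \int[lam]_(x in omega) (g x ord0 i ^+ 2) - 2 * \int[lam]_(x in omega) (g x ord0 i * Phi i x)
    + \int[lam]_(x in omega) (Phi i x ^+ 2).
  rewrite -RintegralZl// -RintegralB//; last exact: integrable_mulr_cst.
  rewrite -RintegralD//; last by apply: integrable_subr => //; exact: integrable_mulr_cst.
  by apply: eq_Rintegral => x _; ring.
lra.
Qed.

(** The components of the gradient are approximated by test functions. *)
Lemma liminf_dirichlet :
  ((height_cst s0 * (moment1 s0 / n%:R * grad_sq))%:E
   <= limn_einf (fun j => layer_energy (eps j) (s_ j) (v_ j)))%E.
Proof.
have /andP[s02 s01] := s0_itv.
have h0 : 0 <= height_cst s0 by rewrite divr_ge0// mulr_ge0//; lra.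
have m0 : 0 <= moment1 s0 / n%:R by rewrite divr_ge0// fine_ge0// mom_ge0.
have G0 : (0 <= limn_einf (fun j => layer_energy (eps j) (s_ j) (v_ j)))%E.
  by apply: limn_einf_ge; apply: nearW => j; exact: layer_energy_ge0.
have hm : 0 <= height_cst s0 * (moment1 s0 / n%:R) by exact: mulr_ge0.
apply: (EFin_le_lim (x_ := fun k => height_cst s0 * (moment1 s0 / n%:R *
    (grad_sq - n%:R * k.+1%:R^-1)))).
  apply: cvgM; first exact: cvg_cst.
  apply: cvgM; first exact: cvg_cst.
  rewrite -[X in _ --> X]subr0; apply: cvgB; first exact: cvg_cst.
  rewrite -[X in _ --> X](mulr0 n%:R); apply: cvgM; first exact: cvg_cst.
  exact: cvg_harmonic.
move=> k; have k0 : 0 < (k.+1%:R : R)^-1 by rewrite invr_gt0.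
have /choice [Phi hPhi] : forall i, exists phi, Sm_test omega phi /\
    (l2sq omega (fun x => g x ord0 i) phi <= (k.+1%:R^-1)%:E)%E.
  move=> i; have [_ /(_ _ k0)[phi tphi /ltW lphi]] :=
    approximable_L2 omega_open omega_fin (gradf.1 i).
  by exists phi.
have tPhi i : Sm_test omega (Phi i) by have [] := hPhi i.
have Qge := calib_value_ge tPhi (fun i => (hPhi i).2).
have [Q0|Q0] := leP 0 (calib_value omega Phi f).
  apply: le_trans (liminf_calib0 tPhi Q0); rewrite lee_fin.
  by apply: ler_wpM2l => //; apply: ler_wpM2l.
apply: le_trans G0; rewrite lee_fin mulrA; apply: mulr_ge0_le0 => //.
by apply: le_trans Qge _; exact: ltW.
Qed.
End liminf.

(** * Upper bound for functions that do not depend on the height *)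

Section energy_upper.
Context {R : realType} {n : nat}.
Local Notation leb := (@lebesgue_measure R).
Local Notation lam := (lebesgue_rV R n).
Local Notation space := (Rsplit R n.+1).
Variables (omega : set 'rV[R]_n) (w : 'rV[R]_n -> R) (p : 'I_n -> 'rV[R]_n -> R) (theta : R).
Hypothesis momega : measurable omega.
Hypothesis omega_fin : (lam omega < +oo)%E.
Hypothesis tw : taylor2 omega w p.
Hypothesis theta01 : 0 < theta <= 1.

Definition grad_int : R := \int[lam]_(x in omega) (\sum_i p i x ^+ 2).

Lemma lin_sq x h : lin (p^~ x) h ^+ 2 =
  \sum_i \sum_j p i x * p j x * (h ord0 i * h ord0 j).
Proof.
rewrite expr2 {1}/lin mulr_suml; apply: eq_bigr => i _.
by rewrite /lin mulr_sumr; apply: eq_bigr => j _; ring.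
Qed.

(** The error in the square of the Taylor expansion is cubic near the diagonal and
    quadratic far from it, hence of order [2 + theta] everywhere. *)
Lemma taylor_sq_le : exists2 C : R, 0 <= C & forall x y, omega x -> omega y ->
  (w x - w y) ^+ 2 <= lin (p^~ x) (x - y) ^+ 2 + C * dot (x - y) (x - y) `^ (1 + theta / 2).
Proof.
have [[_ _ [C C0 [pC wC rC]]] _] := tw.
exists (C ^+ 2 * (1 + n%:R)); first by rewrite mulr_ge0 ?sqr_ge0// addr_ge0.
move=> x y ox oy; set h := x - y.
have hN : y - x = - h by rewrite /h opprB.
have A1 : `|w x - w y| <= C * `|h| by apply: wC.
have B1 : `|lin (p^~ x) h| <= n%:R * C * `|h| by apply: ler_lin => i; exact: pC.
have linN : lin (p^~ x) (- h) = - lin (p^~ x) h.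
  by rewrite /lin -sumrN; apply: eq_bigr => i _; rewrite mxE mulrN.
have AB : `|w x - w y - lin (p^~ x) h| <= C * `|h| ^+ 2.
  have := rC x y ox oy; rewrite hN linN normrN.
  by rewrite (_ : w x - w y - _ = - (w y - w x - - lin (p^~ x) h)) ?normrN//; ring.
set P := dot h h `^ _.
have P0 : 0 <= P by exact: powR_ge0.
have n0 : (0 : R) <= n%:R by [].
have [h1|h1] := leP `|h| 1.
  have h3 := norm3_le_dot_powR theta01 h1.
  rewrite -lerBlDl.
  have -> : (w x - w y) ^+ 2 - lin (p^~ x) h ^+ 2 =
    (w x - w y - lin (p^~ x) h) * ((w x - w y) + lin (p^~ x) h) by ring.
  apply: le_trans (ler_norm _) _; rewrite normrM.
  apply: (@le_trans _ _ (C * `|h| ^+ 2 * (C * `|h| + n%:R * C * `|h|))).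
    by apply: ler_pM => //; apply: le_trans (ler_normD _ _) _; exact: lerD.
  rewrite (_ : C * `|h| ^+ 2 * _ = C ^+ 2 * (1 + n%:R) * `|h| ^+ 3); last by ring.
  by rewrite ler_wpM2l// mulr_ge0 ?sqr_ge0// addr_ge0.
have h3 := far_dot_powR theta01 ltr01 (ltW h1); rewrite powR1 mul1r in h3.
apply: ler_wpDl; first exact: sqr_ge0.
rewrite -(real_normK (num_real (w x - w y))).
apply: (@le_trans _ _ ((C * `|h|) ^+ 2)).
  by rewrite ler_sqr ?nnegrE ?mulr_ge0.
rewrite exprMn -mulrA ler_wpM2l ?sqr_ge0//.
apply: le_trans (ler_norm_dot h) _; apply: le_trans h3 _.
by rewrite ler_peMl// lerDl.
Qed.

(** For an upper bound the inner integral may be extended from [omega] to the whole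
    space, where the moments are known exactly. *)
Lemma slice_upper : exists2 C : R, 0 <= C & forall sg r, 0 < r ->
  n%:R / 2 + (1 + theta / 2) < sg ->
  (slice omega sg r w w <=
    (grad_int / n%:R * mom2 (n := n) sg r + C * mom3 (n := n) sg r theta)%:E)%E.
Proof.
have [C C0 hC] := taylor_sq_le.
have [[mw mp [Cp Cp0 [pC _ _]]] _] := tw.
have th0 : 0 < theta by have /andP[] := theta01.
set vol := fine (lam omega).
have volE : lam omega = vol%:E.
  by rewrite /vol fineK// ge0_fin_numE ?measure_ge0.
have vol0 : 0 <= vol by rewrite fine_ge0// measure_ge0.
exists (C * vol) => [|sg r r0 sgn]; first exact: mulr_ge0.
have sgn1 : n%:R / 2 + 1 < sg by lra.
pose F x (h : 'rV[R]_n) : R := lin (p^~ x) h ^+ 2 + C * dot h h `^ (1 + theta / 2).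
have i3 : lam.-integrable setT
    (EFin \o (fun h : 'rV[R]_n => dot h h `^ (1 + theta / 2) * ker sg r h)).
  by apply: mom_integrable => //; lra.
have iq x : lam.-integrable setT (EFin \o (fun h : 'rV[R]_n => lin (p^~ x) h ^+ 2 * ker sg r h)).
  rewrite (_ : (fun h : 'rV[R]_n => _) = fun h : 'rV[R]_n =>
    \sum_i \sum_j p i x * p j x * (h ord0 i * h ord0 j * ker sg r h)); last first.
    apply/funext => h; rewrite lin_sq mulr_suml; apply: eq_bigr => i _.
    by rewrite mulr_suml; apply: eq_bigr => j _; rewrite !mulrA.
  do 2! (apply: integrable_sumr => // ?).
  apply: integrable_mulr_cst => //; exact: coord_moment_integrable.
have iF x : lam.-integrable setT (EFin \o (fun h => F x h * ker sg r h)).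
  have := integrable_addr measurableT (iq x) (integrable_mulr_cst C measurableT i3).
  by congr integrable; apply/funext => h; rewrite /F /= mulrDl mulrA.
have intF x : \int[lam]_y (F x (x - y) * ker sg r (x - y)) =
    (\sum_i p i x ^+ 2) / n%:R * mom2 (n := n) sg r + C * mom3 (n := n) sg r theta.
  have mF : measurable_fun setT (fun h => F x h * ker sg r h).
    by apply/measurable_EFinP; case/integrableP: (iF x).
  rewrite (Rintegral_reflection x mF).
  under eq_Rintegral do rewrite /F mulrDl -mulrA.
  rewrite RintegralD//; last exact: integrable_mulr_cst.
  rewrite RintegralZl//; congr (_ + _).
  under eq_Rintegral do rewrite lin_sq.
  by rewrite (Rquad_moment r0 theta01 sgn).
have m20 : 0 <= mom2 (n := n) sg r.
  by apply: Rintegral_ge0 => h _; rewrite mulr_ge0 ?dot_ge0 ?ker_ge0.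
have m30 : 0 <= mom3 (n := n) sg r theta.
  by apply: Rintegral_ge0 => h _; rewrite mulr_ge0 ?powR_ge0 ?ker_ge0.
pose w' := w \_ omega.
have mw' : measurable_fun setT w' by apply/(measurable_restrictT w momega).
have ww' : {in omega, w =1 w'} by move=> x xo; rewrite /w' patchE xo.
rewrite (eq_slice sg r ww' ww').
apply: (@le_trans _ _ (\int[lam]_(x in omega)
   ((\sum_i p i x ^+ 2) / n%:R * mom2 (n := n) sg r + C * mom3 (n := n) sg r theta)%:E)%E).
  apply: ge0_le_integral => //.
  - by move=> x _; apply: integral_ge0 => y _; exact: slice_integrand_ge0.
  - by apply: measurable_funTS; exact: (measurable_slice_inner sg r momega mw' mw').
  - apply/measurable_EFinP; apply: measurable_funD => //; apply: measurable_funM => //.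
    apply: measurable_funM => //; apply: measurable_sum => i; exact: measurable_funX.
  move=> x ox; rewrite -intF.
  have iFx := integrable_reflection x (iF x).
  rewrite (EFin_Rintegral measurableT iFx).
  rewrite [X in (X <= _)%E]integral_mkcond.
  apply: (@ge0_le_integral _ _ _ lam setT measurableT).
  - by move=> y _; rewrite patchE; case: ifP => // _; exact: slice_integrand_ge0.
  - apply/(measurable_restrictT _ momega); apply: measurable_funTS.
    exact: measurable_slice_integrand.
  - by case/integrableP: iFx.
  move=> y _; rewrite patchE; case: ifPn => [|_].
    rewrite inE => oy; rewrite -!ww' ?inE// lee_fin ler_wpM2r ?ker_ge0//; exact: hC.
  by rewrite lee_fin mulr_ge0 ?ker_ge0// addr_ge0 ?sqr_ge0// mulr_ge0// powR_ge0.
have ip : lam.-integrable omega (EFin \o (fun x => \sum_i p i x ^+ 2)).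
  apply: integrable_sumr => // i; apply: (@bounded_integrable _ _ _ _ _ _ (Cp ^+ 2)) => //.
    exact: measurable_funX.
  by move=> x ox; rewrite ger0_norm ?sqr_ge0// -real_normK ?num_real// ler_sqr ?nnegrE// pC.
have ic : lam.-integrable omega (EFin \o (fun=> C * mom3 (n := n) sg r theta)).
  by apply: (@bounded_integrable _ _ _ _ _ _ (C * mom3 (n := n) sg r theta)) => // x _; rewrite ger0_norm ?mulr_ge0.
have ip2 := integrable_mulr_cst (mom2 (n := n) sg r / n%:R) momega ip.
rewrite -EFin_Rintegral//; last first.
  have := integrable_addr momega ip2 ic.
  by congr integrable; apply/funext => x /=; congr EFin; ring.
have -> : \int[lam]_(x in omega) ((\sum_i p i x ^+ 2) / n%:R * mom2 (n := n) sg r +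
    C * mom3 (n := n) sg r theta) = \int[lam]_(x in omega)
    (mom2 (n := n) sg r / n%:R * (\sum_i p i x ^+ 2) + C * mom3 (n := n) sg r theta).
  by apply: eq_Rintegral => x _; ring.
rewrite RintegralD// RintegralZl// Rintegral_cst//.
by rewrite lee_fin /grad_int -/vol le_eqVlt; apply/orP; left; apply/eqP; ring.
Qed.

(** The powers of [e] cancel as in the lower bound.  The pairs with [t = u], at
    which [slice_upper] says nothing, are negligible. *)
Lemma energy_upper : exists2 C : R, 0 <= C & forall e s, 0 < e <= 1 ->
  2^-1 + theta / 2 < s -> s < 1 ->
  (layer_energy omega e s (fun z : space => w z.1) <=
    (height_cst s * (moment1 (n := n) s / n%:R * grad_int +
       C * e `^ theta * fine (mom n (1 + theta / 2) (n.+1%:R / 2 + s))))%:E)%E.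
Proof.
have [C C0 hC] := slice_upper; exists C => // e s /andP[e0 e1] ths s1.
have th0 : 0 < theta by have /andP[] := theta01.
pose sg : R := n.+1%:R / 2 + s.
have sgn : n%:R / 2 + (1 + theta / 2) < sg by rewrite /sg -[n.+1%:R]natr1; lra.
have sgn1 : n%:R / 2 + 1 < sg by lra.
have s2 : 2^-1 < s by lra.
pose c : R := 1 - 2 * s.
have c1 : -1 < c by rewrite /c; lra.
set M3 := fine (mom n (1 + theta / 2) _).
have M30 : 0 <= M3 by rewrite fine_ge0// mom_ge0.
have M3E : fine (mom n (1 + theta / 2) sg) = M3 by [].
clearbody M3.
have M10 : 0 <= moment1 (n := n) s by rewrite fine_ge0// mom_ge0.
have G0 : 0 <= grad_int.
  by apply: Rintegral_ge0 => x _; apply: sumr_ge0 => i _; exact: sqr_ge0.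
pose B : R := moment1 (n := n) s / n%:R * grad_int + C * e `^ theta * M3.
have B0 : 0 <= B by rewrite addr_ge0// !mulr_ge0// ?powR_ge0// divr_ge0.
pose w' := w \_ omega.
have mw' : measurable_fun setT w' by apply/(measurable_restrictT w momega); exact: taylor2_measurable tw.
have ww' : {in omega, w =1 w'} by move=> x xo; rewrite /w' patchE xo.
pose v (z : space) := w' z.1.
have mv : measurable_fun setT v by exact: (measurableT_comp mw' measurable_fst).
have vE t u : slice omega sg (e * (t - u)) (fun x => w x) (fun x => w x) =
    slice omega sg (e * (t - u)) (fun x => v (x, t)) (fun x => v (x, u)).
  exact: eq_slice.
have bnd t u : t != u -> `|t - u| <= 1 ->
    (slice omega sg (e * (t - u)) (fun x => w x) (fun x => w x) <=
      (e `^ c * B * `|t - u| `^ c)%:E)%E.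
  move=> tu tu1; have tu0 : 0 < `|t - u| by rewrite normr_gt0 subr_eq0.
  have r0 : 0 < e * `|t - u| by rewrite mulr_gt0.
  rewrite slice_abs normrM (gtr0_norm e0); apply: le_trans (hC _ _ r0 sgn) _.
  rewrite lee_fin (mom2E r0 sgn1) (mom3E r0 th0 sgn) M3E /sg height_exponent -/c.
  rewrite -/(moment1 (n := n) s).
  have rc : (e * `|t - u|) `^ c = e `^ c * `|t - u| `^ c.
    by rewrite powRM//; exact: ltW.
  have rt : (e * `|t - u|) `^ theta <= e `^ theta.
    apply: ge0_ler_powR; rewrite ?nnegrE; [exact: ltW|exact: ltW|exact: ltW|].
    by apply: ler_piMr; first exact: ltW.
  rewrite rc /B; set P := e `^ c * _.
  have P0 : 0 <= P by rewrite mulr_ge0 ?powR_ge0.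
  have -> : grad_int / n%:R * (P * moment1 (n := n) s) + C * (P * ((e * `|t - u|) `^ theta * M3)) =
    P * (moment1 (n := n) s / n%:R * grad_int + C * (e * `|t - u|) `^ theta * M3) by ring.
  rewrite [leRHS]mulrAC -/P; apply: ler_wpM2l => //; rewrite lerD2l.
  by apply: ler_wpM2r => //; exact: ler_wpM2l.
rewrite /layer_energy /=.
pose I1 : set (measurableTypeR R) := `]0, 1[%classic.
have mI1 : measurable I1 by exact: measurable_itv.
have eB0 : 0 <= e `^ c * B by rewrite mulr_ge0 ?powR_ge0.
have mdist t : measurable_fun setT (fun u : measurableTypeR R => (`|t - u| `^ c)%:E).
  have := measurable_dist_powR c t; congr measurable_fun; apply/funext => u.
  by rewrite distrC.
have mint : measurable_fun setT (fun t : measurableTypeR R => \int[leb]_(u in I1) (`|t - u| `^ c)%:E)%E.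
  apply: (measurable_int_set2 (f := fun q => (`|q.2 - q.1| `^ c)%:E)) => //.
  apply/measurable_EFinP; apply: (measurableT_comp (measurable_powRl c)).
  apply: measurableT_comp => //.
  by apply: measurable_funB; [exact: measurable_snd|exact: measurable_fst].
have inner t : I1 t -> (\int[leb]_(u in I1)
    slice omega sg (e * (t - u)) (fun x => w x) (fun x => w x) <=
    (e `^ c * B)%:E * \int[leb]_(u in I1) (`|t - u| `^ c)%:E)%E.
  move=> tI; rewrite -ge0_integralZl_EFin//; last exact: measurable_funTS.
  apply: ae_ge0_le_integral => //.
  - by move=> u _; exact: slice_ge0.
  - rewrite (_ : (fun u => _) = (fun u => slice omega sg (e * (t - u))
      (fun x => v (x, t)) (fun x => v (x, u)))); last by apply/funext => u; exact: vE.
    by apply: measurable_funTS; exact: measurable_slice1.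
  - by move=> u _; rewrite mule_ge0// lee_fin ?powR_ge0.
  - by apply: measurable_funTS; apply: emeasurable_funM.
  exists [set t]; split; [exact: measurable_set1|exact: lebesgue_measure_set1|].
  move=> u /= /not_implyP[uI]; apply: contra_notP => tu.
  rewrite -EFinM; apply: bnd; first by apply/eqP => tu'; apply: tu; rewrite tu'.
  move: tI uI; rewrite /I1 /= !in_itv /= => /andP[a1 a2] /andP[b1 b2].
  rewrite ler_norml; lra.
apply: (@le_trans _ _ ((e `^ (2 * s - 1))%:E * \int[leb]_(t in I1)
   ((e `^ c * B)%:E * \int[leb]_(u in I1) (`|t - u| `^ c)%:E))%E).
  apply: lee_wpmul2l; first by rewrite lee_fin powR_ge0.
  apply: ge0_le_integral => //.
  - by move=> t _; apply: integral_ge0 => u _; exact: slice_ge0.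
  - have -> : (fun t => \int[leb]_(u in I1) slice omega sg (e * (t - u)) (fun x => w x) (fun x => w x))%E =
      (fun t => \int[leb]_(u in I1) slice omega sg (e * (t - u)) (fun x => v (x, t)) (fun x => v (x, u)))%E.
      by apply/funext => t; apply: eq_integral => u _; exact: vE.
    by apply: measurable_funTS; exact: measurable_int_slice.
  - by apply: measurable_funTS; exact: emeasurable_funM.
rewrite ge0_integralZl_EFin//; last 2 first.
- by move=> t _; apply: integral_ge0 => u _; rewrite lee_fin powR_ge0.
- exact: measurable_funTS.
have -> : (\int[leb]_(t in I1) \int[leb]_(u in I1) (`|t - u| `^ c)%:E = (height_cst s)%:E)%E.
  under eq_integral => t _ do under eq_integral => u _ do rewrite distrC.
  rewrite (integral2_dist_powR c1 ltr01) subr0 powR1 mulr1 /height_cst.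
  by congr (EFin (_ / (_ * _))); rewrite /c; lra.
have ec : e `^ (2 * s - 1) * e `^ c = 1.
  by rewrite -powR_add// (_ : 2 * s - 1 + c = 0) ?powRr0//; rewrite /c; lra.
rewrite -!EFinM lee_fin mulrA (mulrA (e `^ (2 * s - 1))) ec mul1r mulrC.
exact: lexx.
Qed.

End energy_upper.

(** * Smoothing by off-centre mollifiers *)

Section mollifier.
Context {R : realType} {n : nat}.
Local Notation lam := (lebesgue_rV R n).
Implicit Types (k f g : 'rV[R]_n -> R) (c : 'rV[R]_n).

(** Centred at an arbitrary point [c], so as to be able to look only into
    [omega]. *)
Definition mollifier c (rho : R) k := [/\ Sm k, forall x, 0 <= k x,
  forall x, rho < `|x - c| -> k x = 0 & \int[lam]_x k x = 1].

Lemma Sm_bound k : Sm k -> exists2 C : R, 0 <= C & [/\ forall x, `|k x| <= C,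
  forall i x, `|partial i k x| <= C,
  forall x y, `|k y - k x| <= C * `|y - x| &
  forall x y, `|k y - k x - lin ((fun i => partial i k)^~ x) (y - x)| <= C * `|y - x| ^+ 2].
Proof.
move=> /Sm_taylor2 [[_ _ [C C0 [c1 c2 c3]]] [B B0 hB]].
exists (C + B); first exact: addr_ge0.
split.
- by move=> x; apply: le_trans (hB x I) _; rewrite lerDr.
- by move=> i x; apply: le_trans (c1 x i I) _; rewrite lerDl.
- by move=> x y; apply: le_trans (c2 x y I I) _; rewrite ler_wpM2r// lerDl.
- by move=> x y; apply: le_trans (c3 x y I I) _; rewrite ler_wpM2r ?sqr_ge0// lerDl.
Qed.

Lemma closed_ball_measurable c (rho : R) : measurable [set x : 'rV[R]_n | `|c - x| <= rho].
Proof.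
apply: closed_measurable_rV; apply: compact_closed; first exact: hausdorff_rV.
exact: compact_ball_rV.
Qed.

Lemma mollifier_integrable c rho k : mollifier c rho k -> lam.-integrable setT (EFin \o k).
Proof.
move=> [sk k0 kout _]; have [C C0 [kC _ _ _]] := Sm_bound sk.
apply: (@bounded_supp_integrable _ _ _ _ [set x : 'rV[R]_n | `|c - x| <= rho] _ C).
- exact: closed_ball_measurable.
- by apply: compact_lebesgue_fin; exact: compact_ball_rV.
- exact: Sm_measurable.
- by move=> x _.
- by move=> x /= /negP; rewrite -ltNge distrC => /kout.
Qed.

Lemma mollifier_exists c (rho : R) : 0 < rho -> exists k, mollifier c rho k.
Proof.
move=> rho0; pose a := \row_i (c ord0 i - rho); pose b := \row_i (c ord0 i + rho).
pose k := box_bump a b 1.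
have sk : Sm k by exact: Sm_box_bump.
have k01 x : 0 <= k x <= 1 by exact: box_bump_itv.
have k0 x : 0 <= k x by have /andP[] := k01 x.
have kout x : rho < `|x - c| -> k x = 0.
  move=> h; apply: box_bump_out => xab; move: h; rewrite ltNge => /negP; apply.
  apply/(ler_norm_rV _ (ltW rho0)) => i; have := xab i; rewrite /= in_itv /= !mxE.
  by move=> /andP[h1 h2]; rewrite ler_norml; apply/andP; split; lra.
have obE : obox a b = ball c rho.
  rewrite ball_rVE//; apply: eq_set => x; apply/propext; split => h i.
    have := h i; rewrite /= in_itv /= !mxE -ball_normE /= => /andP[h1 h2].
    by rewrite ltr_norml; apply/andP; split; lra.
  have := h i; rewrite /= in_itv /= !mxE -ball_normE /= ltr_norml => /andP[h1 h2].
  by apply/andP; split; lra.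
have ik : lam.-integrable setT (EFin \o k).
  apply: (@bounded_supp_integrable _ _ _ _ [set x : 'rV[R]_n | `|c - x| <= rho] _ 1).
  - exact: closed_ball_measurable.
  - by apply: compact_lebesgue_fin; exact: compact_ball_rV.
  - exact: Sm_measurable.
  - by move=> x _; rewrite ger0_norm//; have /andP[] := k01 x.
  - by move=> x /= /negP; rewrite -ltNge distrC => /kout.
pose m := \int[lam]_x k x.
have m0 : 0 < m.
  rewrite lt_neqAle Rintegral_ge0 ?andbT; last by [].
  apply/eqP => m0.
  have E : (\int[lam]_x (k x)%:E = 0)%E by rewrite -(EFin_Rintegral measurableT ik) -/m -m0.
  have mk : measurable_fun setT (fun x => (k x)%:E).
    by apply/measurable_EFinP; exact: Sm_measurable.
  have ae0 : {ae lam, forall x, setT x -> (k x)%:E = 0%E}.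
    apply/(ae_eq_integral_abs lam measurableT mk); rewrite -[RHS]E.
    by apply: eq_integral => x _; rewrite gee0_abs// lee_fin.
  have [N [mN N0 hN]] := ae0.
  have sub : ball c rho `<=` N.
    move=> x xb; apply: hN => /= /(_ I) [] kx0.
    have : obox a b x by rewrite obE.
    by move=> /(box_bump_gt0 0); rewrite -/k -/(k x) kx0 ltxx.
  have mb : measurable (ball c rho) by apply: open_measurable_rV; exact: ball_open.
  have : (lam (ball c rho) <= 0)%E by rewrite -N0; apply: le_measure => //; rewrite inE.
  rewrite -obE lebesgue_rV_box//.
  rewrite (eq_bigr (fun=> (2 * rho)%:E)); last first.
    move=> i _; rewrite lebesgue_measure_itv /= !mxE lte_fin -EFinB.
    have -> : c ord0 i - rho < c ord0 i + rho by lra.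
    by rewrite (_ : _ - _ = 2 * rho)//; lra.
  by rewrite prodEFin lee_fin leNgt; apply/negP; rewrite negbK prodr_gt0// mulr_gt0.
exists (fun x => m^-1 * k x); split.
- exact: Sm_scale.
- by move=> x; rewrite mulr_ge0 ?invr_ge0 ?(ltW m0).
- by move=> x /kout ->; rewrite mulr0.
- by rewrite RintegralZl// mulVf// gt_eqF.
Qed.

(** With [k (z - x)] and not [k (x - z)]: a kernel centred at [c] averages the
    values of [f] near [x + c]. *)
Definition mollify k f (x : 'rV[R]_n) : R := \int[lam]_z (k (z - x) * f z).

Lemma measurable_addr (c : 'rV[R]_n) : measurable_fun setT (fun z : 'rV[R]_n => z - c).
Proof. by apply: measurable_fun_addrV. Qed.

Lemma mollify_integrable k f x : Sm k -> lam.-integrable setT (EFin \o f) ->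
  lam.-integrable setT (EFin \o (fun z => k (z - x) * f z)).
Proof.
move=> sk fi; have [C C0 [kC _ _ _]] := Sm_bound sk.
apply: (integrable_le_real measurableT _ _
  (integrable_mulr_cst C measurableT (integrable_norm fi))).
  apply: measurable_funM; last by apply/measurable_EFinP; case/integrableP: fi.
  exact: (measurableT_comp (Sm_measurable sk) (measurable_addr x)).
by move=> z _; rewrite normrM ler_wpM2r.
Qed.

Lemma mollify_lipschitz k f : Sm k -> lam.-integrable setT (EFin \o f) ->
  exists2 C : R, 0 <= C & (forall x, `|mollify k f x| <= C) /\
    (forall x y, `|mollify k f y - mollify k f x| <= C * `|y - x|).
Proof.
move=> sk fi; have [C C0 [kC _ kL _]] := Sm_bound sk.
have afi : lam.-integrable setT (EFin \o (fun z => `|f z|)) := integrable_norm fi.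
set A := \int[lam]_z `|f z|; have A0 : 0 <= A by exact: Rintegral_ge0.
exists (C * A); first exact: mulr_ge0.
split=> [x|x y].
  apply: le_trans (le_normr_Rintegral measurableT (mollify_integrable x sk fi)) _.
  rewrite -RintegralZl//; apply: le_Rintegral => //.
  - exact: (integrable_norm (mollify_integrable x sk fi)).
  - exact: integrable_mulr_cst.
  - by move=> z _; rewrite normrM ler_wpM2r.
have id := integrable_subr measurableT (mollify_integrable y sk fi) (mollify_integrable x sk fi).
rewrite /mollify -RintegralB//; try exact: mollify_integrable.
apply: le_trans (le_normr_Rintegral measurableT id) _.
rewrite mulrAC -RintegralZl//; apply: le_Rintegral => //.
- exact: (integrable_norm id).
- exact: integrable_mulr_cst.
- move=> z _; rewrite -mulrBl normrM ler_wpM2r//.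
  apply: le_trans (kL _ _) _; rewrite opprB addrC addrA subrK -normrN opprB.
  by rewrite addrC.
Qed.

Lemma lipschitz_measurable f (C : R) : 0 <= C ->
  (forall x y, `|f y - f x| <= C * `|y - x|) -> measurable_fun setT f.
Proof.
move=> C0 fL; apply: continuous_measurable_rV => x.
have FF : Filter (nbhs x) := nbhs_filter x.
have C1 : 0 < C + 1 by rewrite ltr_wpDl.
apply/(@cvgrPdist_le _ R^o _ (nbhs x) FF) => e e0.
near=> y; rewrite distrC; apply: le_trans (fL x y) _.
rewrite (distrC y x).
apply: (@le_trans _ _ ((C + 1) * `|x - y|)); first by rewrite ler_wpM2r// lerDl.
rewrite mulrC -ler_pdivlMr ?ltr_wpDl//.
near: y; apply/nbhs_ballP; exists (e / (C + 1)) => [|z] /=; first by rewrite divr_gt0.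
by rewrite -ball_normE /= => /ltW.
Unshelve. all: by end_near.
Qed.

(** All the increments fall on [k], whose Taylor remainder is uniform. *)
Lemma mollify_taylor2 k f : Sm k -> lam.-integrable setT (EFin \o f) ->
  taylor2 setT (mollify k f) (fun j x => - mollify (partial j k) f x).
Proof.
move=> sk fi; have [C C0 [kC kD kL kT]] := Sm_bound sk.
have afi : lam.-integrable setT (EFin \o (fun z => `|f z|)) := integrable_norm fi.
have [B B0 [cB cL]] := mollify_lipschitz sk fi.
have /choice [D hD] : forall j, exists D : R, 0 <= D /\ ((forall x, `|mollify (partial j k) f x| <= D) /\
    (forall x y, `|mollify (partial j k) f y - mollify (partial j k) f x| <= D * `|y - x|)).
  by move=> j; have [D D0 hD] := mollify_lipschitz (Sm_partial j sk) fi; exists D.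
have Dle i : D i <= \sum_i D i.
  by rewrite (bigD1 i)//= lerDl; apply: sumr_ge0 => j _; have [] := hD j.
have sD0 : 0 <= \sum_i D i by apply: sumr_ge0 => j _; have [] := hD j.
set A := \int[lam]_z `|f z|; have A0 : 0 <= A by exact: Rintegral_ge0.
have CA0 : 0 <= C * A by exact: mulr_ge0.
split; last by exists B => // x _.
split.
- exact: lipschitz_measurable cL.
- move=> j; apply: measurableT_comp => //.
  by have [D0 [_ DL]] := hD j; exact: lipschitz_measurable DL.
exists (B + \sum_i D i + C * A); first by rewrite !addr_ge0.
split.
- move=> x i _; rewrite normrN; have [_ [h _]] := hD i.
  by apply: le_trans (h x) _; apply: le_trans (Dle i) _; rewrite -addrA addrCA lerDl addr_ge0.
- move=> x y _ _; apply: le_trans (cL x y) _; rewrite ler_wpM2r// -addrA lerDl addr_ge0//.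
move=> x y _ _; set h := y - x.
pose L z := lin ((fun i => partial i k)^~ (z - x)) (- h) * f z.
have iLj j : lam.-integrable setT
    (EFin \o (fun z => partial j k (z - x) * (- h) ord0 j * f z)).
  have := integrable_mulr_cst ((- h) ord0 j) measurableT (mollify_integrable x (Sm_partial j sk) fi).
  by congr integrable; apply/funext => z /=; congr EFin; ring.
have iL : lam.-integrable setT (EFin \o L).
  have := integrable_sumr (index_enum _) measurableT iLj.
  by congr integrable; apply/funext => z; rewrite /L /lin /= mulr_suml.
have iD : lam.-integrable setT (EFin \o (fun z =>
    (k (z - y) - k (z - x) - lin ((fun i => partial i k)^~ (z - x)) (- h)) * f z)).
  have := integrable_subr measurableT (integrable_subr measurableT (mollify_integrable y sk fi)
    (mollify_integrable x sk fi)) iL.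
  by congr integrable; apply/funext => z /=; rewrite /L; congr EFin; ring.
have -> : mollify k f y - mollify k f x - lin ((fun j x => - mollify (partial j k) f x)^~ x) h =
  \int[lam]_z ((k (z - y) - k (z - x) - lin ((fun i => partial i k)^~ (z - x)) (- h)) * f z).
  rewrite /mollify -RintegralB//; try exact: mollify_integrable.
  have -> : lin ((fun j x => - mollify (partial j k) f x)^~ x) h = \int[lam]_z L z.
    rewrite /L; under [RHS]eq_Rintegral do rewrite /lin mulr_suml.
    rewrite (Rintegral_sum _ measurableT iLj).
    apply: eq_bigr => j _; rewrite mulNr -mulrN -[- h ord0 j](_ : (- h) ord0 j = _); last by rewrite mxE.
    rewrite mulrC /mollify -RintegralZl//; last by apply: mollify_integrable => //; exact: Sm_partial.
    by apply: eq_Rintegral => z _; ring.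
  rewrite -RintegralB//; last first.
    by apply: integrable_subr => //; exact: mollify_integrable.
  by apply: eq_Rintegral => z _; rewrite /L; ring.
apply: le_trans (le_normr_Rintegral measurableT iD) _.
apply: (@le_trans _ _ (C * A * `|h| ^+ 2)); last first.
  by rewrite ler_wpM2r ?sqr_ge0// lerDr addr_ge0.
rewrite mulrAC -RintegralZl//; apply: le_Rintegral => //.
- exact: (integrable_norm iD).
- exact: integrable_mulr_cst.
- move=> z _; rewrite normrM ler_wpM2r//.
  have := kT (z - x) (z - y); rewrite (_ : z - y - (z - x) = - h) ?normrN//.
  by rewrite /h opprB opprB addrC addrA subrK.
Qed.

Lemma mollifier_shift_int c rho k x : mollifier c rho k -> \int[lam]_z k (z - x) = 1.
Proof. by move=> [sk _ _ <-]; rewrite (Rintegral_translation x (Sm_measurable sk)). Qed.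

Lemma mollifier_reflect_int c rho k z : mollifier c rho k ->
  (\int[lam]_x (k (z - x))%:E = 1)%E.
Proof.
move=> mk; have [sk _ _ k1] := mk.
have ik := integrable_reflection z (mollifier_integrable mk).
by rewrite -(EFin_Rintegral measurableT ik) (Rintegral_reflection z (Sm_measurable sk)) k1.
Qed.

Lemma mollifier_shift_integrable c rho k x : mollifier c rho k ->
  lam.-integrable setT (EFin \o (fun z => k (z - x))).
Proof.
move=> mk; have := integrable_reflection x (integrable_reflection 0 (mollifier_integrable mk)).
congr integrable; apply/funext => z /=; congr (EFin (k _)).
by rewrite sub0r opprB.
Qed.

(** Jensen's inequality for the probability density [k]. *)
Lemma mollify_sq_pointwise c rho k f x : mollifier c rho k ->
  lam.-integrable setT (EFin \o f) -> lam.-integrable setT (EFin \o (fun z => f z ^+ 2)) ->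
  mollify k f x ^+ 2 <= mollify k (fun z => f z ^+ 2) x.
Proof.
move=> mk fi f2i; have [sk k0 _ k1] := mk.
set m := mollify k f x.
have i1 := mollify_integrable x sk fi; have i2 := mollify_integrable x sk f2i.
have i0 := mollifier_shift_integrable x mk.
have : 0 <= \int[lam]_z (k (z - x) * (f z - m) ^+ 2).
  by apply: Rintegral_ge0 => z _; rewrite mulr_ge0// sqr_ge0.
have -> : \int[lam]_z (k (z - x) * (f z - m) ^+ 2) = \int[lam]_z
    (k (z - x) * f z ^+ 2 - 2 * m * (k (z - x) * f z) + m ^+ 2 * k (z - x)).
  by apply: eq_Rintegral => z _; ring.
have i3 := integrable_mulr_cst (2 * m) measurableT i1.
have i4 := integrable_mulr_cst (m ^+ 2) measurableT i0.
rewrite (RintegralD measurableT (integrable_subr measurableT i2 i3) i4).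
rewrite (RintegralB measurableT i2 i3) (RintegralZl _ measurableT i1).
rewrite (RintegralZl _ measurableT i0) (mollifier_shift_int x mk) mulr1.
rewrite -/(mollify k f x) -/m -/(mollify k (fun z => f z ^+ 2) x).
rewrite (_ : _ - 2 * m * m + m ^+ 2 = mollify k (fun z => f z ^+ 2) x - m ^+ 2); last by ring.
by rewrite subr_ge0.
Qed.

(** Integrate [mollify_sq_pointwise] and exchange the integrals: [k] has mass 1 in
    either variable. *)
Lemma mollify_sq_le c rho k f : mollifier c rho k ->
  lam.-integrable setT (EFin \o f) -> lam.-integrable setT (EFin \o (fun z => f z ^+ 2)) ->
  (\int[lam]_x (mollify k f x ^+ 2)%:E <= \int[lam]_x (f x ^+ 2)%:E)%E.
Proof.
move=> mk fi f2i; have [sk k0 _ k1] := mk.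
have mf2 : measurable_fun setT (fun z => f z ^+ 2).
  by apply/measurable_EFinP; case/integrableP: f2i.
have mconv g : lam.-integrable setT (EFin \o g) -> measurable_fun setT (mollify k g).
  by move=> /(mollify_lipschitz sk)[C C0 [_ CL]]; exact: lipschitz_measurable CL.
apply: (@le_trans _ _ (\int[lam]_x (mollify k (fun z => f z ^+ 2) x)%:E)%E).
  apply: ge0_le_integral => //.
  - by move=> x _; rewrite lee_fin sqr_ge0.
  - by apply/measurable_EFinP; apply: measurable_funX; exact: mconv.
  - by apply/measurable_EFinP; exact: mconv.
  - by move=> x _; rewrite lee_fin; apply: mollify_sq_pointwise mk _ _.
pose h (q : 'rV[R]_n * 'rV[R]_n) : \bar R := (k (q.2 - q.1) * f q.2 ^+ 2)%:E.
have mh : measurable_fun setT h.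
  apply/measurable_EFinP; apply: measurable_funM; last first.
    exact: (measurableT_comp mf2 measurable_snd).
  apply: (measurableT_comp (Sm_measurable sk)); apply: measurable_fun_addrV.
    exact: measurable_snd.
  by apply: measurable_fun_opprV; exact: measurable_fst.
have h0 q : (0 <= h q)%E by rewrite lee_fin mulr_ge0// sqr_ge0.
have -> : (\int[lam]_x (mollify k (fun z => f z ^+ 2) x)%:E = \int[lam]_x \int[lam]_z h (x, z))%E.
  by apply: eq_integral => x _; rewrite (EFin_Rintegral measurableT (mollify_integrable x sk f2i)).
rewrite (fubini_tonelli h mh h0) le_eqVlt; apply/orP; left; apply/eqP.
apply: eq_integral => z _; rewrite /h /=.
under eq_integral do rewrite mulrC EFinM.
rewrite ge0_integralZl_EFin ?sqr_ge0//; last 2 first.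
- by move=> x _; rewrite lee_fin.
- apply/measurable_EFinP; apply: (measurableT_comp (Sm_measurable sk)).
  by apply: measurable_fun_addrV => //; exact: measurable_fun_opprV.
by rewrite (mollifier_reflect_int z mk) mule1.
Qed.

Lemma mollify_lipschitz_close c rho k f (L : R) x : mollifier c rho k -> 0 <= L ->
  lam.-integrable setT (EFin \o f) -> (forall y z, `|f z - f y| <= L * `|z - y|) ->
  `|mollify k f x - f x| <= L * (`|c| + rho).
Proof.
move=> mk L0 fi fL; have [sk k0 kout k1] := mk.
have i1 := mollify_integrable x sk fi.
have i0 := mollifier_shift_integrable x mk.
have i3 := integrable_mulr_cst (f x) measurableT i0.
have -> : mollify k f x - f x = \int[lam]_z (k (z - x) * f z - f x * k (z - x)).
  by rewrite RintegralB// RintegralZl// (mollifier_shift_int x mk) mulr1.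
have i4 := integrable_subr measurableT i1 i3.
apply: le_trans (le_normr_Rintegral measurableT i4) _.
have -> : L * (`|c| + rho) = \int[lam]_z (L * (`|c| + rho) * k (z - x)).
  by rewrite RintegralZl// (mollifier_shift_int x mk) mulr1.
apply: le_Rintegral => //.
- exact: (integrable_norm i4).
- exact: integrable_mulr_cst.
move=> z _; rewrite (mulrC (f x)) -mulrBr normrM (ger0_norm (k0 _)) mulrC.
have [zx|zx] := leP `|z - x - c| rho; last by rewrite kout// !mulr0.
rewrite ler_wpM2r//; apply: le_trans (fL x z) _; rewrite ler_wpM2l//.
have := ler_normD (z - x - c) c; rewrite subrK; lra.
Qed.

End mollifier.

Section smoothing.
Context {R : realType} {n : nat}.
Local Notation lam := (lebesgue_rV R n).
Variable omega : set 'rV[R]_n.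
Hypothesis omega_open : open omega.
Hypothesis omega_fin : (lam omega < +oo)%E.
Implicit Types f g : 'rV[R]_n -> R.

Let momega : measurable omega := open_measurable_rV omega_open.

Lemma patch_integrable f : lam.-integrable omega (EFin \o f) ->
  lam.-integrable setT (EFin \o (f \_ omega)).
Proof. by move=> /(integrable_mkcond _ momega); rewrite EFin_patch. Qed.

Lemma patch_sq f : (fun x => (f \_ omega) x ^+ 2) = (fun x => f x ^+ 2) \_ omega.
Proof. by apply/funext => x; rewrite !patchE; case: ifP; rewrite ?expr0n. Qed.

Lemma L2_sub f g : L2 lam omega f -> L2 lam omega g -> L2 lam omega (fun x => f x - g x).
Proof.
move=> [mf ff] [mg gf]; split; first exact: measurable_funB.
have m0 : measurable_fun omega (fun=> 0 : R) by [].
have := @l2sq_triangle R n omega omega_open f (fun=> 0) g mf m0 mg.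
rewrite /l2sq => /le_lt_trans; apply.
have E1 : (\int[lam]_(x in omega) ((f x - 0) ^+ 2)%:E = \int[lam]_(x in omega) (f x ^+ 2)%:E)%E.
  by apply: eq_integral => x _; rewrite subr0.
have E2 : (\int[lam]_(x in omega) ((0 - g x) ^+ 2)%:E = \int[lam]_(x in omega) (g x ^+ 2)%:E)%E.
  by apply: eq_integral => x _; rewrite sub0r sqrrN.
by rewrite E1 E2 lte_mul_pinfty// lte_add_pinfty.
Qed.

Lemma Sm_test_L2 phi : Sm_test omega phi -> L2 lam omega phi.
Proof.
move=> [sp _]; have [C C0 [pC _ _ _]] := Sm_bound sp.
have mp : measurable_fun omega phi by apply: measurable_funTS; exact: Sm_measurable.
split => //; apply: integrable_lty => //.
apply: (@bounded_integrable _ _ _ _ _ (fun x => phi x ^+ 2) (C ^+ 2)) => //.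
  exact: measurable_funX.
by move=> x _; rewrite ger0_norm ?sqr_ge0// -real_normK ?num_real// ler_sqr ?nnegrE.
Qed.

Lemma sum3_sq_le (a b c : R) : (a + b + c) ^+ 2 <= 3 * (a ^+ 2 + b ^+ 2 + c ^+ 2).
Proof.
have := sqr_ge0 (a - b); have := sqr_ge0 (b - c); have := sqr_ge0 (a - c); nra.
Qed.

(** Smoothing converges in L^2: true for smooth functions by uniform
    continuity, and in general because smoothing does not increase the norm. *)
Lemma smoothing_L2 f (e : R) : L2 lam omega f -> 0 < e -> exists2 M : R, 0 < M &
  forall c rho k, mollifier c rho k -> `|c| + rho <= M ->
    (l2sq omega (mollify k (f \_ omega)) f <= e%:E)%E.
Proof.
move=> L2f e0; have [mf ff] := L2f.
have e9 : 0 < e / 9 by rewrite divr_gt0.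
have [_ /(_ _ e9) [phi tphi lphi]] := approximable_L2 omega_open omega_fin L2f.
have [sphi [Kp [cKp Kpo phi0]]] := tphi.
have [L L0 [phiB _ phiL _]] := Sm_bound sphi.
pose vol := fine (lam omega).
have volE : lam omega = vol%:E by rewrite /vol fineK// ge0_fin_numE ?measure_ge0.
have vol0 : 0 <= vol by rewrite fine_ge0// measure_ge0.
pose M := Num.min 1 (e / (9 * (L + 1) ^+ 2 * (vol + 1))).
have M0 : 0 < M.
  rewrite lt_min ltr01/= divr_gt0//; apply: mulr_gt0; last by rewrite ltr_wpDl.
  by apply: mulr_gt0 => //; rewrite exprn_gt0// ltr_wpDl.
exists M => // c rho k mk cM.
have [sk k0 kout k1] := mk.
have L2d : L2 lam omega (fun x => f x - phi x) by apply: L2_sub => //; exact: Sm_test_L2.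
pose d := (fun x => f x - phi x) \_ omega.
have di : lam.-integrable setT (EFin \o d).
  by apply: patch_integrable; exact: L2_integrable L2d.
have d2i : lam.-integrable setT (EFin \o (fun x => d x ^+ 2)).
  by rewrite /d patch_sq; apply: patch_integrable; exact: L2_integrable_sqr L2d.
have phii : lam.-integrable setT (EFin \o phi).
  rewrite -(patch_supp (D := omega) (f := phi)); last by move=> x xo; apply: phi0 => /Kpo.
  by apply: patch_integrable; apply: L2_integrable => //; exact: Sm_test_L2.
have split_f x : omega x -> mollify k (f \_ omega) x - f x =
    mollify k d x + (mollify k phi x - phi x) + (phi x - f x).
  move=> ox; have -> : mollify k (f \_ omega) x = mollify k d x + mollify k phi x.
    rewrite /mollify -RintegralD//; try exact: mollify_integrable.
    apply: eq_Rintegral => z _; rewrite /d !patchE; case: ifPn => zo; first by ring.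
    by rewrite phi0 ?mulr0 ?addr0// => /Kpo; move: zo; rewrite notin_setE.
  by ring.
have mconv g : lam.-integrable setT (EFin \o g) -> measurable_fun omega (mollify k g).
  move=> /(mollify_lipschitz sk)[C C0 [_ CL]]; apply: measurable_funTS.
  exact: lipschitz_measurable CL.
have mphi : measurable_fun omega phi by apply: measurable_funTS; exact: Sm_measurable.
have fi : lam.-integrable setT (EFin \o (f \_ omega)).
  by apply: patch_integrable; exact: L2_integrable L2f.
pose T1 x := (mollify k d x ^+ 2)%:E; pose T2 x := ((mollify k phi x - phi x) ^+ 2)%:E.
pose T3 x := ((f x - phi x) ^+ 2)%:E.
have mT1 : measurable_fun omega T1 by apply/measurable_EFinP; apply: measurable_funX; exact: mconv.
have mT2 : measurable_fun omega T2.
  by apply/measurable_EFinP; apply: measurable_funX; apply: measurable_funB => //; exact: mconv.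
have mT3 : measurable_fun omega T3.
  by apply/measurable_EFinP; apply: measurable_funX; exact: measurable_funB.
have T10 x : (0 <= T1 x)%E by rewrite lee_fin sqr_ge0.
have T20 x : (0 <= T2 x)%E by rewrite lee_fin sqr_ge0.
have T30 x : (0 <= T3 x)%E by rewrite lee_fin sqr_ge0.
apply: (@le_trans _ _ (\int[lam]_(x in omega) (3%:E * (T1 x + T2 x + T3 x)))%E).
  apply: ge0_le_integral => //.
  - by move=> x _; rewrite lee_fin sqr_ge0.
  - by apply/measurable_EFinP; apply: measurable_funX; apply: measurable_funB => //; exact: mconv.
  - apply: emeasurable_funM => //; apply: emeasurable_funD => //; exact: emeasurable_funD.
  move=> x ox; rewrite split_f// /T1 /T2 /T3 -!EFinD -EFinM lee_fin.
  apply: le_trans (sum3_sq_le _ _ _) _; rewrite ler_pM2l//.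
  by rewrite -(sqrrN (phi x - f x)) opprB.
rewrite ge0_integralZl_EFin//; last 2 first.
- by move=> x _; rewrite !adde_ge0.
- by apply: emeasurable_funD => //; exact: emeasurable_funD.
rewrite ge0_integralD//; last 2 first.
- by move=> x _; rewrite adde_ge0.
- exact: emeasurable_funD.
rewrite ge0_integralD//.
have h3 : (\int[lam]_(x in omega) T3 x <= (e / 9)%:E)%E by exact: ltW.
have h1 : (\int[lam]_(x in omega) T1 x <= (e / 9)%:E)%E.
  apply: (@le_trans _ _ (\int[lam]_x T1 x)%E).
    apply: ge0_subset_integral => //.
    apply/measurable_EFinP; apply: measurable_funX.
    by have [C C0 [_ CL]] := mollify_lipschitz sk di; exact: lipschitz_measurable CL.
  apply: le_trans (mollify_sq_le mk di d2i) _.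
  rewrite (_ : (\int[lam]_x (d x ^+ 2)%:E = \int[lam]_(x in omega) T3 x)%E)//.
  rewrite [RHS]integral_mkcond; apply: eq_integral => x _.
  by rewrite /d !patchE; case: ifP => _; rewrite ?expr0n.
have h2 : (\int[lam]_(x in omega) T2 x <= (e / 9)%:E)%E.
  apply: (@le_trans _ _ (\int[lam]_(x in omega) (((L + 1) * M) ^+ 2)%:E)%E).
    apply: ge0_le_integral => // x _.
    rewrite lee_fin -real_normK ?num_real// ler_sqr ?nnegrE//; last first.
      by rewrite mulr_ge0// ?addr_ge0// ltW.
    apply: le_trans (mollify_lipschitz_close x mk L0 phii phiL) _.
    apply: (@le_trans _ _ (L * M)); first exact: ler_wpM2l.
    by apply: ler_wpM2r; [exact: ltW|rewrite lerDl].
  have -> : (\int[lam]_(x in omega) (((L + 1) * M) ^+ 2)%:E = (((L + 1) * M) ^+ 2)%:E * lam omega)%E.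
    by rewrite integral_cst.
  rewrite volE -EFinM lee_fin.
  have L1 : 0 < (L + 1) ^+ 2 by rewrite exprn_gt0// ltr_wpDl.
  have v1 : 0 < vol + 1 by rewrite ltr_wpDl.
  have M1 : M <= 1 by rewrite /M ge_min lexx.
  have MM : M ^+ 2 <= M by rewrite expr2 ler_piMr// ltW.
  have Me : M <= e / (9 * (L + 1) ^+ 2 * (vol + 1)) by rewrite /M ge_min lexx orbT.
  rewrite exprMn; apply: (@le_trans _ _ ((L + 1) ^+ 2 * M * (vol + 1))).
    apply: ler_pM => //; first by rewrite mulr_ge0 ?sqr_ge0.
      by apply: ler_wpM2l; first exact: ltW.
    by rewrite lerDl.
  apply: (@le_trans _ _ ((L + 1) ^+ 2 * (e / (9 * (L + 1) ^+ 2 * (vol + 1))) * (vol + 1))).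
    apply: ler_wpM2r; first exact: ltW.
    by apply: ler_wpM2l; first exact: ltW.
  rewrite le_eqVlt; apply/orP; left; apply/eqP; field.
  by rewrite !gt_eqF//= ltr_wpDl.
apply: (@le_trans _ _ (3%:E * ((e / 9)%:E + (e / 9)%:E + (e / 9)%:E))%E).
  by apply: lee_wpmul2l => //; rewrite !leeD.
by rewrite -!EFinD -EFinM lee_fin; lra.
Qed.

Lemma partial_shift (k : 'rV[R]_n -> R) (x : 'rV[R]_n) j z : Sm k ->
  partial j (fun z => k (z - x)) z = partial j k (z - x).
Proof.
move=> sk; have [C C0 [kC kD kL kT]] := Sm_bound sk.
suff t2 : taylor2 setT (fun z => k (z - x)) (fun j z => partial j k (z - x)).
  by have [] := taylor2_derivable t2 z j.
have E (a b : 'rV[R]_n) : b - x - (a - x) = b - a by rewrite opprB addrA subrK.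
split; last by exists C.
split.
- exact: (measurableT_comp (Sm_measurable sk) (measurable_addr x)).
- by move=> i; exact: (measurableT_comp (Sm_measurable (Sm_partial i sk)) (measurable_addr x)).
exists C => //; split=> [a i _|a b _ _|a b _ _].
- exact: kD.
- by rewrite -(E a b); exact: kL.
- by rewrite -(E a b); exact: kT.
Qed.

(** Where the support of the translated mollifier stays in [omega], the
    mollifier itself is an admissible test function. *)
Lemma mollify_weak_gradient u (g : 'rV[R]_n -> 'rV[R]_n) c (rho : R) k x j :
  is_L2_gradient omega u g -> mollifier c rho k ->
  (forall z, `|z - x - c| <= rho -> omega z) ->
  - mollify (partial j k) (u \_ omega) x = mollify k ((fun z => g z ord0 j) \_ omega) x.
Proof.
move=> [_ ug] [sk k0 kout k1] supp.
have tphi : Sm_test omega (fun z => k (z - x)).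
  split; first exact: Sm_shift.
  exists [set z | `|x + c - z| <= rho]; split.
  - exact: compact_ball_rV.
  - by move=> z /= h; apply: supp; rewrite -addrA -opprD -normrN opprB.
  - move=> z /= /negP; rewrite -ltNge => h; apply: kout.
    by rewrite -addrA -opprD -normrN opprB.
have := ug _ (Sm_test_function tphi) j.
have -> : \int[lam]_(z in omega) (u z * partial j (fun z => k (z - x)) z) =
    mollify (partial j k) (u \_ omega) x.
  rewrite /mollify Rintegral_mkcond; apply: eq_Rintegral => z _.
  by rewrite !patchE; case: ifP => _; rewrite ?mulr0// partial_shift// mulrC.
move=> ->; rewrite opprK /mollify Rintegral_mkcond; apply: eq_Rintegral => z _.
by rewrite !patchE; case: ifP => _; rewrite ?mulr0// mulrC.
Qed.

End smoothing.

(** * Approximation up to the boundary *)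

Section density_taylor.
Context {R : realType} {n : nat}.
Local Notation lam := (lebesgue_rV R n).
Variable omega : set 'rV[R]_n.
Hypothesis omega_open : open omega.
Hypothesis omega_fin : (lam omega < +oo)%E.
Implicit Types (u phi : 'rV[R]_n -> R) (g q : 'I_n -> 'rV[R]_n -> R).

Let momega : measurable omega := open_measurable_rV omega_open.

(** The closure in the H^1 norm of the functions with a quadratic Taylor remainder. *)
Definition approx_pair u g := forall e : R, 0 < e -> exists w p, taylor2 omega w p /\
  (l2sq omega w u <= e%:E)%E /\ forall j, (l2sq omega (p j) (g j) <= e%:E)%E.

Lemma l2sq_add (a b c d : 'rV[R]_n -> R) : measurable_fun omega a -> measurable_fun omega b ->
  measurable_fun omega c -> measurable_fun omega d ->
  (l2sq omega (fun x => a x + b x)%R (fun x => c x + d x)%R <=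
   2%:E * (l2sq omega a c + l2sq omega b d))%E.
Proof.
move=> ma mb mc md; rewrite /l2sq.
have m1 := measurable_sqrB ma mc; have m2 := measurable_sqrB mb md.
rewrite -ge0_integralD//; last 2 first.
- by move=> x _; rewrite lee_fin sqr_ge0.
- by move=> x _; rewrite lee_fin sqr_ge0.
rewrite -ge0_integralZl_EFin//; last 2 first.
- by move=> x _; rewrite adde_ge0// lee_fin sqr_ge0.
- exact: emeasurable_funD.
apply: ge0_le_integral => //.
- by move=> x _; rewrite lee_fin sqr_ge0.
- by apply: measurable_sqrB; exact: measurable_funD.
- by apply: emeasurable_funM => //; exact: emeasurable_funD.
- move=> x _; rewrite -EFinD -EFinM lee_fin.
  have := sqr_ge0 ((a x - c x) - (b x - d x)); nra.
Qed.

Lemma approx_pair_add u g v h : measurable_fun omega u -> (forall j, measurable_fun omega (g j)) ->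
  measurable_fun omega v -> (forall j, measurable_fun omega (h j)) ->
  approx_pair u g -> approx_pair v h ->
  approx_pair (fun x => u x + v x) (fun j x => g j x + h j x).
Proof.
move=> mu mg mv mh au av e e0; have e4 : 0 < e / 4 by rewrite divr_gt0.
have [w [p [tw [wu pg]]]] := au _ e4; have [w' [p' [tw' [wv ph]]]] := av _ e4.
have mp i : measurable_fun omega (p i) by case: tw => -[].
have mp' i : measurable_fun omega (p' i) by case: tw' => -[].
have sum2 (a b : \bar R) : (a <= (e / 4)%:E)%E -> (b <= (e / 4)%:E)%E -> (2%:E * (a + b) <= e%:E)%E.
  move=> ha hb; apply: (@le_trans _ _ (2%:E * ((e / 4)%:E + (e / 4)%:E))%E).
    by apply: lee_wpmul2l => //; exact: leeD.
  by rewrite -EFinD -EFinM lee_fin; lra.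
exists (fun x => w x + w' x), (fun j x => p j x + p' j x); split; first exact: taylor2_add.
split.
- apply: le_trans (sum2 _ _ wu wv); apply: l2sq_add => //.
    exact: (taylor2_measurable tw).
  exact: (taylor2_measurable tw').
- by move=> j; apply: le_trans (sum2 _ _ (pg j) (ph j)); exact: l2sq_add.
Qed.

Lemma approx_pair_eq u g v h : {in omega, u =1 v} -> (forall j, {in omega, g j =1 h j}) ->
  approx_pair u g -> approx_pair v h.
Proof.
move=> uv gh au e e0; have [w [p [tw [wu pg]]]] := au e e0.
exists w, p; split => //; split=> [|j].
- by rewrite (_ : l2sq omega w v = l2sq omega w u)//; apply: eq_integral => x xo; rewrite uv.
- rewrite (_ : l2sq omega (p j) (h j) = l2sq omega (p j) (g j))//.
  by apply: eq_integral => x xo; rewrite gh.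
Qed.

(** On an open set the gradient is determined by the values, although the
    definition of the class only asks for some [q] that fits. *)
Lemma taylor_gradient0 phi q x : taylor2 omega phi q -> omega x ->
  (\forall y \near x, phi y = 0) -> forall j, q j x = 0.
Proof.
move=> [[_ _ [C C0 [_ _ rC]]] _] ox phi0 j.
have FF : Filter (nbhs x) := nbhs_filter x.
have ov : \forall y \near x, omega y by exact: open_nbhs_nbhs.
have : \forall y \near x, phi y = 0 /\ omega y by near=> y; split; near: y.
move=> /nbhs_ballP[d /= d0 bd].
have bnd t : 0 < t -> t < d -> `|q j x| <= C * t.
  move=> t0 td; pose y := x + t *: (delta_mx ord0 j : 'rV[R]_n).
  have yx : y - x = t *: delta_mx ord0 j by rewrite /y addrC addKr.
  have nd : `|t *: (delta_mx ord0 j : 'rV[R]_n)| <= t.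
    rewrite normrZ gtr0_norm//; apply: ler_piMr; first exact: ltW.
    apply/(ler_norm_rV _ ler01) => i.
    by rewrite mxE eqxx /=; case: eqP => _; rewrite ?normr1 ?normr0.
  have [py oy] : phi y = 0 /\ omega y.
    by apply: bd; rewrite -ball_normE /= distrC yx; apply: le_lt_trans nd td.
  have [px _] : phi x = 0 /\ omega x by apply: bd; exact: ballxx.
  have := rC x y ox oy; rewrite py px subr0 sub0r normrN yx.
  have -> : lin (q^~ x) (t *: delta_mx ord0 j) = t * q j x.
    rewrite /lin (bigD1 j)//= big1 => [|i ij]; rewrite !mxE.
      by rewrite !eqxx /= mulr1 addr0 mulrC.
    by rewrite (negPf ij) andbF mulr0 mulr0.
  rewrite normrM gtr0_norm// => h.
  have h2 : t * `|q j x| <= C * t ^+ 2.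
    apply: le_trans h _; rewrite ler_wpM2l// ler_sqr ?nnegrE// ltW//.
  by move: h2; rewrite expr2 mulrA mulrC ler_pM2r.
apply/eqP; rewrite -normr_le0; apply/ler_addgt0Pr => e e0; rewrite add0r.
pose t := Num.min (d / 2) (e / (C + 1)).
have C1 : 0 < C + 1 by rewrite ltr_wpDl.
have t0 : 0 < t by rewrite lt_min !divr_gt0.
apply: le_trans (bnd t t0 _) _.
  by apply: (@le_lt_trans _ _ (d / 2)); [rewrite /t ge_min lexx|lra].
apply: (@le_trans _ _ (C * (e / (C + 1)))).
  by rewrite ler_wpM2l// /t ge_min lexx orbT.
rewrite mulrA ler_pdivrMr// mulrC; apply: ler_wpM2l; first exact: ltW.
by rewrite lerDl.
Unshelve. all: by end_near.
Qed.

(** A uniform interior cone condition: the directions within [rho] of [c] point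
    into [omega] at all its points near [x0]. *)
Definition inward_cone (x0 : 'rV[R]_n) (r : R) (c : 'rV[R]_n) (rho : R) :=
  forall x z t, omega x -> `|x - x0| < r -> `|z - c| <= rho -> 0 < t -> t <= r ->
    omega (x + t *: z).

Variables (u : 'rV[R]_n -> R) (gu : 'rV[R]_n -> 'rV[R]_n).
Hypothesis L2u : L2 lam omega u.
Hypothesis gradu : is_L2_gradient omega u gu.

(** Near the support of the cut-off [phi], smoothing with a mollifier supported
    in the cone only uses values inside [omega]. *)
Lemma approx_pair_local phi q x0 (r : R) c (rho : R) :
  taylor2 omega phi q -> 0 < r -> 0 < rho -> inward_cone x0 r c rho ->
  (forall x, omega x -> r <= `|x - x0| -> phi x = 0 /\ forall j, q j x = 0) ->
  approx_pair (fun x => phi x * u x) (fun j x => phi x * gu x ord0 j + u x * q j x).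
Proof.
move=> tphi r0 rho0 cone out e e0.
have [[mphi mq [C C0 [qC _ _]]] [B B0 phiB]] := tphi.
pose A := B + C + 1.
have A0 : 0 < A by rewrite ltr_wpDl// addr_ge0.
have phiA x : omega x -> `|phi x| <= A.
  by move=> ox; apply: le_trans (phiB x ox) _; rewrite /A; lra.
have qA j x : omega x -> `|q j x| <= A.
  by move=> ox; apply: le_trans (qC x j ox) _; rewrite /A; lra.
pose e' := e / (4 * A ^+ 2).
have e'0 : 0 < e' by rewrite divr_gt0// mulr_gt0// exprn_gt0.
have [M0 M00 hM0] := smoothing_L2 omega_open omega_fin L2u e'0.
have /choice [Mj hMj] : forall j, exists M : R, 0 < M /\ forall c rho k, mollifier c rho k ->
    `|c| + rho <= M ->
    (l2sq omega (mollify k ((fun x => gu x ord0 j) \_ omega)) (fun x => gu x ord0 j) <= e'%:E)%E.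
  move=> j; have [M M_gt0 hM] := smoothing_L2 omega_open omega_fin (gradu.1 j) e'0.
  by exists M.
pose M := \big[Num.min/M0]_j Mj j.
have M_gt0 : 0 < M.
  rewrite /M; elim/big_ind : _ => // [a b a0 b0|j _]; first by rewrite lt_min a0.
  by have [] := hMj j.
have MM0 : M <= M0 by exact: bigmin_le_id.
have MMj j : M <= Mj j by exact: bigmin_le_cond.
(* the scale of the cone: short enough to stay in [omega] and for the mollifier
   to be as close to the origin as [smoothing_L2] requires *)
pose t := Num.min r (M / (`|c| + rho)).
have cr0 : 0 < `|c| + rho by rewrite ltr_wpDl.
have t0 : 0 < t by rewrite lt_min r0 divr_gt0.
have tr : t <= r by rewrite ge_min lexx.
have tM : t * (`|c| + rho) <= M.
  by rewrite -ler_pdivlMr// ge_min lexx orbT.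
have trho0 : 0 < t * rho by rewrite mulr_gt0.
have [k mk] := mollifier_exists (t *: c) trho0.
have csum : `|t *: c| + t * rho <= M by rewrite normrZ gtr0_norm// -mulrDr.
have [sk k0 kout k1] := mk.
have ui : lam.-integrable setT (EFin \o (u \_ omega)).
  by apply: patch_integrable => //; exact: L2_integrable L2u.
have gi j : lam.-integrable setT (EFin \o ((fun x => gu x ord0 j) \_ omega)).
  by apply: patch_integrable => //; exact: L2_integrable (gradu.1 j).
pose U := mollify k (u \_ omega).
pose P j x := - mollify (partial j k) (u \_ omega) x.
have tU : taylor2 omega U P.
  exact: (taylor2W measurableT (@subsetT _ _) (mollify_taylor2 sk ui) momega).
have PE x j : omega x -> `|x - x0| < r -> P j x = mollify k ((fun z => gu z ord0 j) \_ omega) x.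
  move=> ox xr; apply: (mollify_weak_gradient j gradu mk) => z zx.
  have -> : z = x + t *: (t^-1 *: (z - x)).
    by rewrite scalerA mulfV ?gt_eqF// scale1r addrC subrK.
  apply: (cone x) => //.
  have -> : t^-1 *: (z - x) - c = t^-1 *: (z - x - t *: c).
    by rewrite [RHS]scalerBr scalerA mulVf ?gt_eqF// scale1r.
  by rewrite normrZ gtr0_norm ?invr_gt0// mulrC ler_pdivrMr// mulrC.
have lU : (l2sq omega U u <= e'%:E)%E by apply: hM0 mk _; exact: le_trans csum MM0.
have lP j : (l2sq omega (mollify k ((fun x => gu x ord0 j) \_ omega)) (fun x => gu x ord0 j) <= e'%:E)%E.
  by have [_] := hMj j; apply; [exact: mk|exact: le_trans csum (MMj j)].
have mU : measurable_fun omega U by exact: (taylor2_measurable tU).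
have mu : measurable_fun omega u := L2u.1.
have mgu j : measurable_fun omega (fun x => gu x ord0 j) := (gradu.1 j).1.
have mconv j : measurable_fun omega (mollify k ((fun x => gu x ord0 j) \_ omega)).
  have [D D0 [_ DL]] := mollify_lipschitz sk (gi j).
  by apply: measurable_funTS; exact: lipschitz_measurable DL.
have mP j : measurable_fun omega (P j) by case: tU => -[].
exists (fun x => phi x * U x), (fun j x => phi x * P j x + U x * q j x).
split; first exact: taylor2_mul.
have A2 : 0 <= A ^+ 2 by exact: sqr_ge0.
have sqle a x : omega x -> `|a| <= A -> a ^+ 2 <= A ^+ 2.
  by move=> ox aA; rewrite -real_normK ?num_real// ler_sqr ?nnegrE// ltW.
split.
  apply: (@le_trans _ _ ((A ^+ 2)%:E * l2sq omega U u)%E).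
    rewrite /l2sq -ge0_integralZl_EFin//; last 2 first.
    - by move=> x _; rewrite lee_fin sqr_ge0.
    - exact: measurable_sqrB.
    apply: ge0_le_integral => //.
    - by move=> x _; rewrite lee_fin sqr_ge0.
    - by apply: measurable_sqrB; exact: measurable_funM.
    - by apply: emeasurable_funM => //; exact: measurable_sqrB.
    - move=> x ox; rewrite -EFinM lee_fin -mulrBr exprMn ler_wpM2r ?sqr_ge0//.
      exact: (sqle _ x ox (phiA x ox)).
  apply: (@le_trans _ _ ((A ^+ 2)%:E * e'%:E)%E); first by apply: lee_wpmul2l.
  rewrite -EFinM lee_fin /e'.
  rewrite (_ : A ^+ 2 * (e / (4 * A ^+ 2)) = e / 4); last by field; rewrite gt_eqF.
  lra.
move=> j; pose Pc := mollify k ((fun x => gu x ord0 j) \_ omega).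
pose S x := ((Pc x - gu x ord0 j) ^+ 2)%:E; pose T x := ((U x - u x) ^+ 2)%:E.
have mS : measurable_fun omega S by exact: (measurable_sqrB (mconv j) (mgu j)).
have mT : measurable_fun omega T by exact: (measurable_sqrB mU mu).
have S0 x : (0 <= S x)%E by rewrite lee_fin sqr_ge0.
have T0 x : (0 <= T x)%E by rewrite lee_fin sqr_ge0.
apply: (@le_trans _ _ (\int[lam]_(x in omega) ((2 * A ^+ 2)%:E * (S x + T x)))%E).
  apply: ge0_le_integral => //.
  - by move=> x _; rewrite lee_fin sqr_ge0.
  - apply: measurable_sqrB; apply: measurable_funD; apply: measurable_funM => //.
  - by apply: emeasurable_funM => //; exact: emeasurable_funD.
  move=> x ox; rewrite -EFinD -EFinM lee_fin.
  have -> : phi x * P j x + U x * q j x - (phi x * gu x ord0 j + u x * q j x) =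
    phi x * (Pc x - gu x ord0 j) + q j x * (U x - u x).
    have [xr|xr] := ltP `|x - x0| r; first by rewrite PE// -/Pc; ring.
    by have [-> ->] := out x ox xr; ring.
  have h1 := sqle _ _ ox (phiA x ox); have h2 := sqle _ _ ox (qA j x ox).
  set a := Pc x - _; set b := U x - _.
  apply: (@le_trans _ _ (2 * (phi x ^+ 2 * a ^+ 2 + q j x ^+ 2 * b ^+ 2))).
    have := sqr_ge0 (phi x * a - q j x * b); rewrite -!exprMn; nra.
  rewrite -[leRHS]mulrA ler_pM2l// mulrDr; apply: lerD; rewrite ler_wpM2r ?sqr_ge0//.
rewrite ge0_integralZl_EFin//; last 3 first.
- by move=> x _; rewrite adde_ge0.
- exact: emeasurable_funD.
- by rewrite mulr_ge0.
rewrite ge0_integralD//.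
apply: (@le_trans _ _ ((2 * A ^+ 2)%:E * (e'%:E + e'%:E))%E).
  apply: lee_wpmul2l; first by rewrite lee_fin mulr_ge0.
  apply: leeD; [exact: lP|exact: lU].
rewrite -EFinD -EFinM lee_fin /e' (_ : 2 * A ^+ 2 * _ = e)//.
by field; rewrite gt_eqF.
Qed.

Lemma taylor2_opp1 phi q : taylor2 omega phi q ->
  taylor2 omega (fun x => 1 - phi x) (fun j x => - q j x).
Proof.
move=> tphi; have := taylor2_add (taylor2_cst 1 momega) (taylor2_scale (-1) momega tphi).
congr taylor2; first by apply/funext => x; rewrite mulN1r.
by apply/funext => j; apply/funext => x; rewrite add0r mulN1r.
Qed.

Lemma measurable_pair_parts phi q : taylor2 omega phi q ->
  measurable_fun omega (fun x => phi x * u x) /\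
  forall j, measurable_fun omega (fun x => phi x * gu x ord0 j + u x * q j x).
Proof.
move=> [[mphi mq _] _]; split; first by apply: measurable_funM => //; exact: L2u.1.
move=> j; apply: measurable_funD; apply: measurable_funM => //; first exact: (gradu.1 j).1.
exact: L2u.1.
Qed.

(** The mollified indicator of the ball of radius [r / 2]. *)
Lemma cutoff_exists x0 (r : R) : 0 < r -> exists psi q, [/\ taylor2 setT psi q,
  forall x, `|x - x0| < r / 4 -> psi x = 1 & forall x, 3 / 4 * r < `|x - x0| -> psi x = 0].
Proof.
move=> r0; have r4 : 0 < r / 4 by rewrite divr_gt0.
have [k mk] := mollifier_exists (0 : 'rV[R]_n) r4; have [sk k0 kout k1] := mk.
pose B := [set x : 'rV[R]_n | `|x0 - x| <= r / 2].
have cB : compact B by exact: compact_ball_rV.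
have mB : measurable B by exact: closed_ball_measurable.
have iB : lam.-integrable setT (EFin \o (\1_B : 'rV[R]_n -> R)).
  apply: (@bounded_supp_integrable _ _ _ _ B _ 1) => //.
  - exact: compact_lebesgue_fin.
  - by move=> x _; rewrite ger0_norm indicE ?lern1 ?leq_b1.
  - by move=> x xB; rewrite indicE memNset.
exists (mollify k \1_B), (fun j x => - mollify (partial j k) \1_B x); split.
- exact: mollify_taylor2.
- move=> x xr; rewrite -(mollifier_shift_int x mk); apply: eq_Rintegral => z _.
  have [zx|zx] := leP `|z - x - 0| (r / 4); last by rewrite kout ?mul0r.
  rewrite indicE mem_set ?mulr1// /B /=; rewrite subr0 in zx.
  rewrite distrC; have := ler_normD (z - x) (x - x0); rewrite addrA subrK; lra.
- move=> x xr; rewrite /mollify (_ : (fun z => _) = fun=> 0); first by rewrite /Rintegral integral0.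
  apply/funext => z; have [zx|zx] := leP `|z - x - 0| (r / 4); last by rewrite kout ?mul0r.
  rewrite indicE memNset ?mulr0// /B /= => zB; rewrite subr0 in zx.
  have := ler_normD (x - z) (z - x0); rewrite addrA subrK distrC => h.
  rewrite distrC in zB; rewrite (distrC z x) in zx *.
  by move: h; rewrite distrC; lra.
Qed.

(** Peeling off one cut-off at a time: whatever is left after the last ball
    vanishes on [omega]. *)
Lemma approx_pair_cover (s : seq 'rV[R]_n) (rad : 'rV[R]_n -> R) phi q :
  (forall x, x \in s -> 0 < rad x /\ exists c rho, 0 < rho /\ inward_cone x (rad x) c rho) ->
  taylor2 omega phi q ->
  (forall y, omega y -> (forall x, x \in s -> rad x / 4 <= `|y - x|) -> phi y = 0) ->
  approx_pair (fun x => phi x * u x) (fun j x => phi x * gu x ord0 j + u x * q j x).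
Proof.
elim: s phi q => [|a s IHs] phi q hs tphi phi0.
  have phi00 x : omega x -> phi x = 0 by move=> ox; apply: phi0.
  have q0 x j : omega x -> q j x = 0.
    move=> ox; apply: (taylor_gradient0 tphi ox); have : nbhs x omega by exact: open_nbhs_nbhs.
    by apply: filterS => y; exact: phi00.
  move=> e e0; exists (fun=> 0), (fun _ _ => 0); split; first exact: taylor2_cst.
  have z (h : 'rV[R]_n -> R) : (forall x, omega x -> h x = 0) -> (l2sq omega (fun=> 0)%R h <= e%:E)%E.
    move=> h0; rewrite /l2sq integral0_eq ?lee_fin ?ltW// => x ox.
    by rewrite h0// subr0 expr0n.
  split=> [|j]; apply: z => x ox; first by rewrite phi00// mul0r.
  by rewrite phi00// q0// mul0r mulr0 addr0.
have [ra [c [rho [rho0 cone]]]] := hs a (mem_head _ _).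
have [psi [qpsi [tpsi psi1 psi0]]] := cutoff_exists a ra.
have tpsi' : taylor2 omega psi qpsi by exact: (taylor2W measurableT (@subsetT _ _) tpsi momega).
have tNpsi := taylor2_opp1 tpsi'.
have t1 := taylor2_mul tphi tpsi'; have t2 := taylor2_mul tphi tNpsi.
pose q1 i x := phi x * qpsi i x + psi x * q i x.
pose q2 i x := phi x * - qpsi i x + (1 - psi x) * q i x.
have ap1 : approx_pair (fun x => (phi x * psi x) * u x)
    (fun j x => (phi x * psi x) * gu x ord0 j + u x * q1 j x).
  apply: (approx_pair_local t1 ra rho0 cone) => x ox xa.
  have xa' : 3 / 4 * rad a < `|x - a| by lra.
  rewrite psi0// mulr0; split => // j; rewrite mul0r addr0.
  rewrite (taylor_gradient0 tpsi' ox) ?mulr0//.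
  apply/nbhs_ballP; exists (rad a / 4) => /=; first by rewrite divr_gt0.
  move=> y; rewrite -ball_normE /= => xy; apply: psi0.
  have := ler_normD (x - y) (y - a); rewrite addrA subrK; lra.
have ap2 : approx_pair (fun x => (phi x * (1 - psi x)) * u x)
    (fun j x => (phi x * (1 - psi x)) * gu x ord0 j + u x * q2 j x).
  apply: (IHs _ _ _ t2) => [x xs|y oy hy]; first by apply: hs; rewrite inE xs orbT.
  have [ya|ya] := ltP `|y - a| (rad a / 4); first by rewrite psi1// subrr mulr0.
  rewrite phi0 ?mul0r// => x; rewrite inE => /predU1P[->//|]; exact: hy.
have [m1 m1'] := measurable_pair_parts t1; have [m2 m2'] := measurable_pair_parts t2.
apply: approx_pair_eq (approx_pair_add m1 m1' m2 m2' ap1 ap2).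
- by move=> x _; ring.
- by move=> j x _; rewrite /q1 /q2; ring.
Qed.

(** Finitely many balls with cones cover the compact closure; start from the
    cut-off 1. *)
Lemma H1_approx_pair : compact (closure omega) ->
  (forall x, closure omega x -> exists r, 0 < r /\ exists c rho, 0 < rho /\ inward_cone x r c rho) ->
  approx_pair u (fun j x => gu x ord0 j).
Proof.
move=> cco cones.
have /choice [rad hrad] : forall x, exists r : R, closure omega x ->
    0 < r /\ exists c rho, 0 < rho /\ inward_cone x r c rho.
  move=> x; have [cx|ncx] := pselect (closure omega x); last by exists 1.
  by have [r hr] := cones x cx; exists r.
have := cco; rewrite compact_cover => /(_ 'rV[R]_n (closure omega) (fun x => ball x (rad x / 4))).
case.
- by move=> x _; exact: ball_open.
- move=> x cx; exists x => //; apply: ballxx; rewrite divr_gt0//.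
  by have [] := hrad x cx.
move=> D Dsub cov.
have ap := @approx_pair_cover (enum_fset D) rad (fun=> 1) (fun _ _ => 0).
apply: (approx_pair_eq _ _ (ap _ _ _)).
- by move=> x _; rewrite mul1r.
- by move=> j x _; rewrite mul1r mulr0 addr0.
- by move=> x xD; apply: hrad; have := Dsub x xD; rewrite inE.
- exact: taylor2_cst.
- move=> y oy hy; exfalso.
  have [x /= xD xy] := cov y (@subset_closure _ omega y oy).
  have := hy x xD; rewrite leNgt => /negP; apply.
  by move: xy; rewrite -ball_normE /= distrC.
Qed.

End density_taylor.

Section cones.
Context {R : realType} {n : nat}.
Variable omega : set 'rV[R]_n.
Hypothesis omega_open : open omega.

Lemma inward_cone_interior x0 : omega x0 -> exists r, 0 < r /\ exists c rho, 0 < rho /\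
  inward_cone omega x0 r c rho.
Proof.
move=> ox; have : nbhs x0 omega by exact: open_nbhs_nbhs.
move=> /nbhs_ballP[d /= d0 bd].
exists (d / 2); split; first by rewrite divr_gt0.
exists 0, 1; split => // x z t _ xr; rewrite subr0 => z1 t0 td.
apply: bd; rewrite -ball_normE /= distrC addrAC.
apply: le_lt_trans (ler_normD _ _) _; rewrite normrZ gtr0_norm//.
have : t * `|z| <= t by rewrite ler_piMr// ltW.
lra.
Qed.

Lemma dot_bound (x y : 'rV[R]_n) : `|dot x y| <= n%:R * `|x| * `|y|.
Proof.
apply: le_trans (ler_norm_sum _ _ _) _.
have -> : n%:R * `|x| * `|y| = \sum_(i < n) `|x| * `|y|.
  by rewrite sumr_const card_ord -mulrA mulr_natl.
by apply: ler_sum => i _; rewrite normrM ler_pM// ler_coord_norm.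
Qed.

Lemma dotDl (x y z : 'rV[R]_n) : dot (x + y) z = dot x z + dot y z.
Proof. by rewrite /dot -big_split; apply: eq_bigr => i _; rewrite mxE mulrDl. Qed.

Lemma dotZl (a : R) (x z : 'rV[R]_n) : dot (a *: x) z = a * dot x z.
Proof. by rewrite /dot big_distrr; apply: eq_bigr => i _; rewrite /= mxE mulrA. Qed.

(** A Lipschitz graph leaves room for a cone of directions around its axis. *)
Lemma inward_cone_boundary x0 : lipschitz_boundary omega -> (closure omega `\` omega°) x0 ->
  exists r, 0 < r /\ exists c rho, 0 < rho /\ inward_cone omega x0 r c rho.
Proof.
move=> lip /lip[e [gamma [e1 glip nearx0]]].
have [L L0 hL] : exists2 L : R, 0 < L & forall a b : 'rV[R]_n, dot a e = 0 -> dot b e = 0 ->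
    `|gamma a - gamma b| <= L * `|a - b|.
  have [L L0 hL] := pinfty_ex_gt0 glip; exists L => // a b ae be.
  exact: (hL (a, b)).
have dee : dot e e = 1.
  by rewrite -[LHS]sqr_sqrtr ?dot_ge0// -/(enorm e) e1 expr1n.
have en1 : `|e| <= 1.
  rewrite -(@ler_sqr R) ?nnegrE//; apply: le_trans (ler_norm_dot e) _.
  by rewrite dee expr1n.
have : \forall x \near x0, omega x <-> gamma (x - dot x e *: e) < dot x e by [].
move=> /nbhs_ballP[d /= d0 bd].
(* small enough for the Lipschitz variation of [gamma] along a direction of the
   cone to stay below the gain in height *)
pose rho : R := ((L + 1) * (n%:R + 1) * 2)^-1.
have n0 : (0 : R) <= n%:R by [].
have L1 : 0 < L + 1 by rewrite addr_gt0.
have n1 : (0 : R) < n%:R + 1 by rewrite ltr_wpDl.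
have rho_gt0 : 0 < rho by rewrite invr_gt0; apply: mulr_gt0 => //; exact: mulr_gt0.
have rhoE : (L + 1) * (n%:R + 1) * rho = 2^-1.
  by rewrite /rho; field; rewrite !gt_eqF.
have rho1 : rho <= 1.
  have : rho <= (L + 1) * (n%:R + 1) * rho.
    rewrite ler_peMl//; first exact: ltW.
    by rewrite -[leLHS]mulr1 ler_pM// lerDr// ltW.
  by rewrite rhoE; lra.
exists (d / 4); split; first by rewrite divr_gt0.
exists e, rho; split => // x z t ox xr ze t0 tr.
set zeta := z - e in ze.
have zE : z = e + zeta by rewrite /zeta addrC subrK.
have z2 : `|z| <= 2 by rewrite zE; apply: le_trans (ler_normD _ _) _; lra.
have bx : ball x0 d x by rewrite -ball_normE /= distrC; lra.
have bx' : ball x0 d (x + t *: z).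
  rewrite -ball_normE /= distrC addrAC.
  apply: le_lt_trans (ler_normD _ _) _; rewrite normrZ gtr0_norm//.
  have : t * `|z| <= d / 4 * 2 by rewrite ler_pM// ltW.
  lra.
apply/(bd _ bx'); have /(bd _ bx) gx := ox.
have dP (y : 'rV[R]_n) : dot (y - dot y e *: e) e = 0.
  by rewrite -scaleNr dotDl dotZl dee mulr1 subrr.
set a := x + t *: z - _; set b := x - _ in gx.
have dz : dot zeta e <= n%:R * rho /\ - (n%:R * rho) <= dot zeta e.
  have h := dot_bound zeta e.
  have h2 : n%:R * `|zeta| * `|e| <= n%:R * rho.
    rewrite -[leRHS]mulr1; apply: ler_pM => //.
    by rewrite ler_wpM2l.
  by have := le_trans h h2; rewrite ler_norml => /andP[h3 h4].
have dxz : dot (x + t *: z) e = dot x e + t * (1 + dot zeta e).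
  by rewrite dotDl dotZl zE dotDl dee.
have ab : a - b = t *: (zeta - dot zeta e *: e).
  rewrite /a /b dxz; rewrite zE.
  by apply/rowP => i; rewrite !mxE; ring.
have nab : `|a - b| <= t * (rho * (n%:R + 1)).
  rewrite ab normrZ gtr0_norm// ler_pM2l//.
  apply: le_trans (ler_normB _ _) _; rewrite normrZ.
  have : `|dot zeta e| * `|e| <= n%:R * rho.
    rewrite -[leRHS]mulr1; apply: ler_pM => //.
    by rewrite ler_norml; apply/andP; split; [exact: dz.2|exact: dz.1].
  lra.
have gab : gamma a <= gamma b + L * (t * (rho * (n%:R + 1))).
  have h := hL a b (dP _) (dP _).
  have h2 : L * `|a - b| <= L * (t * (rho * (n%:R + 1))) by rewrite ler_pM2l.
  have := ler_norm (gamma a - gamma b); lra.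
apply: le_lt_trans gab _; rewrite dxz.
have key : L * (t * (rho * (n%:R + 1))) <= t * (1 + dot zeta e).
  have -> : L * (t * (rho * (n%:R + 1))) = t * (L * (rho * (n%:R + 1))) by ring.
  rewrite ler_pM2l//.
  have : L * (rho * (n%:R + 1)) + n%:R * rho <= 2^-1.
    have E : (L + 1) * (n%:R + 1) * rho = L * (rho * (n%:R + 1)) + n%:R * rho + rho by ring.
    by rewrite -rhoE E lerDl ltW.
  have := dz.2; lra.
lra.
Qed.

End cones.

(** * The recovery sequence *)

Section assembly_tools.
Context {R : realType} {n : nat}.
Local Notation leb := (@lebesgue_measure R).
Local Notation lam := (lebesgue_rV R n).
Local Notation space := (Rsplit R n.+1).

Lemma hausdorff_space_split : hausdorff_space space.
Proof. exact: (@norm_hausdorff _ ('rV[R]_n * R)%type). Qed.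

Lemma integral_rect (K : set 'rV[R]_n) (I : set (measurableTypeR R)) (f : space -> \bar R) :
  measurable K -> measurable I -> measurable_fun setT f -> (forall z, 0 <= f z)%E ->
  (\int[lebesgue_split R n.+1]_(z in K `*` I) f z =
   \int[leb]_(t in I) \int[lam]_(x in K) f (x, t))%E.
Proof.
move=> mK mI mf f0; rewrite integral_mkcond integral_split.
- rewrite [RHS]integral_mkcond; apply: eq_integral => t _; rewrite [RHS]patchE.
  case: ifP => te.
    rewrite [RHS]integral_mkcond; apply: eq_integral => x _; rewrite !patchE.
    by rewrite in_setX /= te andbT.
  by apply: integral0_eq => x _; rewrite patchE in_setX /= te andbF.
- apply/(measurable_restrictT f); last exact: measurable_funTS.
  exact: measurableX.
- by move=> z; rewrite patchE; case: ifP.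
Qed.

Lemma compact_measurable_split (K : set space) : compact K -> measurable K.
Proof.
move=> cK; apply: closed_measurable_rVM; apply: compact_closed cK.
exact: hausdorff_space_split.
Qed.

Lemma limn_esup_le (l : \bar R) (G : nat -> \bar R) :
  (\forall j \near \oo, (G j <= l)%E) -> (limn_esup G <= l)%E.
Proof.
move=> h; rewrite -[limn_esup G]oppeK leeNl -limn_einfN; apply: limn_einf_ge.
by apply: filterS h => j /=; rewrite leeN2.
Qed.

Lemma EFin_ge_lim (x_ : nat -> R) (x : R) (l : \bar R) : x_ k @[k --> \oo] --> x ->
  (forall k, (l <= (x_ k)%:E)%E) -> (l <= x%:E)%E.
Proof.
move=> xx xl; have cv : (x_ k)%:E @[k --> \oo] --> x%:E.
  by apply: cvg_EFin; [exact: nearW|exact: xx].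
have <- : limn (fun k => (x_ k)%:E) = x%:E by exact/cvg_lim.
by apply: lime_ge; [apply/cvg_ex; exists x%:E|exact: nearW].
Qed.

Lemma cvg_eps_at_right (s : R -> R) (s0 : R) (eps : nat -> R) : (forall j, 0 < eps j) ->
  eps j @[j --> \oo] --> 0 -> s e @[e --> 0^'+] --> s0 -> s (eps j) @[j --> \oo] --> s0.
Proof.
move=> e0 ecv scv A hA.
have h : nbhs (0 : R) (fun x => 0 < x -> A (s x)) := scv A hA.
have h2 : \forall j \near \oo, 0 < eps j -> A (s (eps j)) := ecv _ h.
have : \forall j \near \oo, A (s (eps j)) by apply: filterS h2 => j; apply.
exact.
Qed.

(** A diagonal index: [m j] tends to infinity so slowly that the threshold
    [J (m j)] has been passed. *)
Lemma diagonal_index (J : nat -> nat) : exists m : nat -> nat,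
  (forall j, (J 0 <= j)%N -> (J (m j) <= j)%N) /\
  forall M, \forall j \near \oo, (M <= m j)%N.
Proof.
have /choice [m hm] : forall j, exists m, ((exists M, (M <= j)%N && (J M <= j)%N) -> (J m <= j)%N) /\
    forall M, (M <= j)%N && (J M <= j)%N -> (M <= m)%N.
  move=> j; have [ex|nex] := pselect (exists M, (M <= j)%N && (J M <= j)%N); last first.
    by exists 0%N; split => // M hM; exfalso; apply: nex; exists M.
  have bd M : (M <= j)%N && (J M <= j)%N -> (M <= j)%N by case/andP.
  by have [m /andP[_ hm] mmax] := ex_maxnP ex bd; exists m.
exists m; split=> [j J0|M].
  by have [h _] := hm j; apply: h; exists 0%N.
exists (maxn M (J M)) => // j /=; rewrite geq_max => /andP[h1 h2].
by have [_] := hm j; apply; rewrite h1.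
Qed.

End assembly_tools.

Section limsup.
Context {R : realType} {n : nat}.
Local Notation leb := (@lebesgue_measure R).
Local Notation lam := (lebesgue_rV R n).
Local Notation space := (Rsplit R n.+1).
Variable omega : set 'rV[R]_n.
Hypothesis omega_open : open omega.
Hypothesis omega_fin : (lam omega < +oo)%E.
Variables (u : 'rV[R]_n -> R) (g : 'rV[R]_n -> 'rV[R]_n).
Hypothesis L2u : L2 lam omega u.
Hypothesis gradu : is_L2_gradient omega u g.

Let momega : measurable omega := open_measurable_rV omega_open.

(** Young's inequality turns L^2 closeness into almost optimal Dirichlet energy. *)
Lemma approx_energy (d : R) : approx_pair omega u (fun j x => g x ord0 j) -> 0 < d ->
  exists w p, [/\ taylor2 omega w p, grad_int omega p <= grad_sq omega g + d &
    (\int[lam]_(x in omega) `|w x - u x|%:E <= d%:E)%E].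
Proof.
move=> ap d0.
pose vol := fine (lam omega).
have volE : lam omega = vol%:E by rewrite /vol fineK// ge0_fin_numE ?measure_ge0.
have vol0 : 0 <= vol by rewrite fine_ge0// measure_ge0.
have gs0 : 0 <= grad_sq omega g.
  by apply: sumr_ge0 => i _; apply: Rintegral_ge0 => x _; exact: sqr_ge0.
have n0 : (0 : R) <= n%:R by [].
(* |p|^2 <= (1 + tau) |g|^2 + (1 + 1 / tau) |p - g|^2 and
   |a| <= tau + a^2 / tau *)
pose tau : R := Num.min (d / (2 * (grad_sq omega g + 1))) (d / (2 * (vol + 1))).
have tau0 : 0 < tau by rewrite lt_min !divr_gt0// mulr_gt0// ltr_wpDl.
have tau1 : tau * grad_sq omega g <= d / 2.
  apply: (@le_trans _ _ (d / (2 * (grad_sq omega g + 1)) * (grad_sq omega g + 1))).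
    by apply: ler_pM => //; [exact: ltW|rewrite ge_min lexx|rewrite lerDl].
  rewrite le_eqVlt; apply/orP; left; apply/eqP; field.
  by rewrite gt_eqF// ltr_wpDl.
have tau2 : tau * vol <= d / 2.
  apply: (@le_trans _ _ (d / (2 * (vol + 1)) * (vol + 1))).
    by apply: ler_pM => //; [exact: ltW|rewrite ge_min lexx orbT|rewrite lerDl].
  rewrite le_eqVlt; apply/orP; left; apply/eqP; field.
  by rewrite gt_eqF// ltr_wpDl.
pose e : R := Num.min (d / (2 * (n%:R + 1) * (1 + tau^-1))) (d * tau / 2).
have ti0 : 0 < 1 + tau^-1 by rewrite addr_gt0// invr_gt0.
have e0 : 0 < e.
  rewrite lt_min !divr_gt0//; last by rewrite mulr_gt0.
  by apply: mulr_gt0 => //; rewrite mulr_gt0// ltr_wpDl.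
have e1 : n%:R * ((1 + tau^-1) * e) <= d / 2.
  apply: (@le_trans _ _ ((n%:R + 1) * ((1 + tau^-1) * (d / (2 * (n%:R + 1) * (1 + tau^-1)))))).
    apply: ler_pM => //; [by rewrite mulr_ge0 ?ltW|by rewrite lerDl|].
    by rewrite ler_pM2l// ge_min lexx.
  have n1 : 0 < n%:R + 1 :> R by rewrite ltr_wpDl.
  have t1 : 0 < tau + 1 by rewrite addr_gt0.
  rewrite le_eqVlt; apply/orP; left; apply/eqP; field.
  by rewrite (gt_eqF tau0) (gt_eqF n1) (gt_eqF t1).
have e2 : e / tau <= d / 2.
  by rewrite ler_pdivrMr// mulrAC ge_min lexx orbT.
have [w [p [tw [wu pg]]]] := ap e e0; exists w, p; split => //.
- have [[mw mp [C C0 [pC _ _]]] _] := tw.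
  have ip i : lam.-integrable omega (EFin \o (fun x => p i x ^+ 2)).
    apply: (@bounded_integrable _ _ _ _ _ _ (C ^+ 2)) => //; first exact: measurable_funX.
    by move=> x ox; rewrite ger0_norm ?sqr_ge0// -real_normK ?num_real// ler_sqr ?nnegrE// pC.
  have ig i : lam.-integrable omega (EFin \o (fun x => g x ord0 i ^+ 2)).
    exact: L2_integrable_sqr (gradu.1 i).
  have id i : lam.-integrable omega (EFin \o (fun x => (p i x - g x ord0 i) ^+ 2)).
    apply: L2_integrable_sqr => //; apply: L2_sub => //; last exact: gradu.1.
    by split; [exact: mp|rewrite -(EFin_Rintegral momega (ip i)) ltry].
  rewrite /grad_int Rintegral_sum//.
  have -> : grad_sq omega g + d = \sum_(i < n) \int[lam]_(x in omega) (g x ord0 i ^+ 2) + d by [].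
  have step i : \int[lam]_(x in omega) (p i x ^+ 2) <=
     (1 + tau) * \int[lam]_(x in omega) (g x ord0 i ^+ 2) + (1 + tau^-1) * e.
    have dle : \int[lam]_(x in omega) ((p i x - g x ord0 i) ^+ 2) <= e.
      by have := pg i; rewrite /l2sq -(EFin_Rintegral momega (id i)) lee_fin.
    apply: (@le_trans _ _ (\int[lam]_(x in omega) ((1 + tau) * (g x ord0 i ^+ 2) +
        (1 + tau^-1) * ((p i x - g x ord0 i) ^+ 2)))).
      apply: le_Rintegral => //.
        by apply: integrable_addr => //; exact: integrable_mulr_cst.
      move=> x _; set a := g x ord0 i; set b := p i x - a.
      have -> : p i x = a + b by rewrite /b addrC subrK.
      have : 0 <= (tau * a - b) ^+ 2 / tau by rewrite divr_ge0 ?sqr_ge0// ltW.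
      have -> : (tau * a - b) ^+ 2 / tau = tau * a ^+ 2 - 2 * a * b + tau^-1 * b ^+ 2.
        by field; rewrite gt_eqF.
      lra.
    rewrite RintegralD//; try exact: integrable_mulr_cst.
    rewrite !RintegralZl// lerD2l ler_pM2l//.
  apply: (@le_trans _ _ (\sum_(i < n) ((1 + tau) * \int[lam]_(x in omega) (g x ord0 i ^+ 2) +
      (1 + tau^-1) * e))); first exact: ler_sum.
  rewrite big_split /= sumr_const card_ord -mulr_natl -mulr_sumr -/(grad_sq omega g).
  lra.
- pose a x := w x - u x.
  have mw : measurable_fun omega w by exact: (taylor2_measurable tw).
  have ma : measurable_fun omega a by apply: measurable_funB => //; exact: L2u.1.
  apply: (@le_trans _ _ (\int[lam]_(x in omega) (tau%:E + (tau^-1)%:E * (a x ^+ 2)%:E))%E).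
    apply: ge0_le_integral => //.
    - by apply/measurable_EFinP; exact: measurableT_comp.
    - apply: emeasurable_funD => //; apply: emeasurable_funM => //.
      by apply/measurable_EFinP; exact: measurable_funX.
    - move=> x _; rewrite -EFinM -EFinD lee_fin -/(a x).
      rewrite -(real_normK (num_real (a x))); set y := `|a x|.
      have : 0 <= (y - tau) ^+ 2 / tau by rewrite divr_ge0 ?sqr_ge0// ltW.
      have -> : (y - tau) ^+ 2 / tau = tau^-1 * y ^+ 2 - 2 * y + tau.
        by field; rewrite gt_eqF.
      have : 0 <= y by rewrite /y.
      lra.
  have ti : 0 <= tau^-1 by rewrite invr_ge0 ltW.
  have ma2 : measurable_fun omega (fun x => (a x ^+ 2)%:E).
    by apply/measurable_EFinP; exact: measurable_funX.
  rewrite ge0_integralD//; last 3 first.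
  - by move=> x _; rewrite lee_fin ltW.
  - by move=> x _; rewrite mule_ge0 ?lee_fin ?sqr_ge0.
  - exact: emeasurable_funM.
  rewrite ge0_integralZl_EFin//; last by move=> x _; rewrite lee_fin sqr_ge0.
  have -> : (\int[lam]_(x in omega) tau%:E = (tau * vol)%:E)%E.
    by rewrite integral_cst// EFinM -volE.
  apply: (@le_trans _ _ ((tau * vol)%:E + (tau^-1)%:E * e%:E)%E).
    by apply: leeD => //; apply: lee_wpmul2l.
  rewrite -EFinM -EFinD lee_fin; have := e2; rewrite mulrC; lra.
Qed.

End limsup.

Section height_independent.
Context {R : realType} {n : nat}.
Local Notation leb := (@lebesgue_measure R).
Local Notation lam := (lebesgue_rV R n).
Local Notation space := (Rsplit R n.+1).
Variable omega : set 'rV[R]_n.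
Hypothesis omega_open : open omega.
Hypothesis omega_fin : (lam omega < +oo)%E.

Let momega : measurable omega := open_measurable_rV omega_open.

Lemma flat_measurable (f : 'rV[R]_n -> R) (e : R) : measurable_fun omega f ->
  measurable_fun (@thin R n.+1 omega e) (fun z : space => f z.1).
Proof.
move=> mf; have mf' : measurable_fun setT (f \_ omega).
  by apply/(measurable_restrictT f momega).
have mc : measurable_fun (@thin R n.+1 omega e) (fun z : space => (f \_ omega) z.1).
  by apply: measurable_funTS; exact: (measurableT_comp mf' measurable_fst).
apply: (eq_measurable_fun _ _ mc) => z; rewrite inE => -[oz _] /=.
by rewrite patchE mem_set.
Qed.

Lemma integral_flat (f : 'rV[R]_n -> R) (e : R) : 0 < e -> measurable_fun omega f ->
  (forall x, 0 <= f x) ->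
  (\int[lebesgue_split R n.+1]_(z in @thin R n.+1 omega e) (f z.1)%:E =
   e%:E * \int[lam]_(x in omega) (f x)%:E)%E.
Proof.
move=> e0 mf f0; have mf' : measurable_fun setT (f \_ omega).
  by apply/(measurable_restrictT f momega).
pose F (z : space) : \bar R := ((f \_ omega) z.1)%:E.
have F0 z : (0 <= F z)%E by rewrite lee_fin patchE; case: ifP.
have mF : measurable_fun setT F.
  by apply/measurable_EFinP; exact: (measurableT_comp mf' measurable_fst).
transitivity (\int[lebesgue_split R n.+1]_(z in @thin R n.+1 omega e) F z)%E.
  by apply: eq_integral => z; rewrite inE => -[oz _]; rewrite /F patchE mem_set.
rewrite integral_thin//.
have E : (\int[lam]_(x in omega) ((f \_ omega) x)%:E = \int[lam]_(x in omega) (f x)%:E)%E.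
  by apply: eq_integral => x xo; rewrite patchE xo.
under eq_integral => t _ do rewrite /F /= E.
move: (\int[lam]_(x in omega) (f x)%:E)%E => I.
have mI : measurable (`]0%R, e[%classic : set (measurableTypeR R)) by exact: measurable_itv.
have -> := integral_cst leb mI I.
rewrite muleC; apply: (f_equal (fun z => mule z I)).
by apply: etrans (lebesgue_measure_itv _) _; rewrite /= lte_fin e0 oppr0 adde0.
Qed.

Lemma flat_L1 (f : 'rV[R]_n -> R) (K : set space) : measurable_fun omega f ->
  measurable K -> K `<=` @thin R n.+1 omega 1 ->
  (\int[lebesgue_split R n.+1]_(z in K) `|f z.1|%:E <=
   \int[lam]_(x in omega) `|f x|%:E)%E.
Proof.
move=> mf mK Ko; have mf1 : measurable_fun omega (fun x => `|f x|).
  exact: measurableT_comp.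
rewrite -[leRHS]mul1e -(integral_flat ltr01 mf1)//.
apply: ge0_subset_integral => //; first exact: measurable_thin.
by apply/measurable_EFinP; have := flat_measurable (e := 1) mf1; exact.
Qed.

Lemma flat_L1loc (f : 'rV[R]_n -> R) : lam.-integrable omega (EFin \o f) ->
  L1loc (@thin R n.+1 omega 1) (fun z : space => f z.1).
Proof.
move=> /integrableP[/measurable_EFinP mf fi]; split; first exact: flat_measurable.
move=> K Ko cK; apply: le_lt_trans fi; apply: flat_L1 => //.
exact: compact_measurable_split.
Qed.

Lemma flat_energy (w : 'rV[R]_n -> R) (e s : R) : 0 < e -> measurable_fun omega w ->
  ((e `^ (3 - 2 * s))^-1%:E * gagliardo s (@thin R n.+1 omega e) (fun z => w z.1) =
   layer_energy omega e s (fun z => w z.1))%E.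
Proof.
move=> e0 mw; have mw1 := flat_measurable (e := e) mw.
rewrite (energy_layer s e0 momega mw1) /layer_energy.
have E (x : 'rV[R]_n) (t : R) : x \in omega -> t \in `]0%R, 1%R[%classic ->
    layer omega e (fun z => w z.1) (x, t) = w x.
  by move=> xo t1; rewrite /layer patchE in_setX /= xo t1.
apply: (f_equal (mule (e `^ (2 * s - 1))%:E)).
apply: eq_integral => t t1; apply: eq_integral => u u1.
by apply: eq_slice => x xo; rewrite E.
Qed.

Lemma flat_Hs (w : 'rV[R]_n -> R) (e s : R) : 0 < e -> L2 lam omega w ->
  (layer_energy omega e s (fun z : space => w z.1) < +oo)%E ->
  Hs s (@thin R n.+1 omega e) (fun z => w z.1).
Proof.
move=> e0 [mw w2] wE; split; first split; first exact: flat_measurable.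
  have mw2 : measurable_fun omega (fun x => w x ^+ 2) by exact: measurable_funX.
  rewrite (integral_flat e0 mw2); last by move=> x; exact: sqr_ge0.
  by apply: lte_mul_pinfty; rewrite ?lee_fin ?ltW.
rewrite ltNge leye_eq; apply/eqP => gE.
by move: wE; rewrite -flat_energy// gE gt0_muley// lte_fin invr_gt0 powR_gt0.
Qed.

Lemma taylor2_L2 (w : 'rV[R]_n -> R) p : taylor2 omega w p -> L2 lam omega w.
Proof.
move=> tw; have mw := taylor2_measurable tw; have [_ [B B0 wB]] := tw.
have wi : lam.-integrable omega (EFin \o (fun x => w x ^+ 2)).
  apply: (@bounded_integrable _ _ _ _ _ _ (B ^+ 2)) => //; first exact: measurable_funX.
  move=> x ox; rewrite ger0_norm ?sqr_ge0// -real_normK ?num_real//.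
  by rewrite ler_sqr ?nnegrE// wB.
by split => //; rewrite -(EFin_Rintegral momega wi) ltry.
Qed.

Lemma zero_Hs (e s : R) : Hs s (@thin R n.+1 omega e) (fun=> 0).
Proof.
split; first split; first exact: measurable_cst.
  by rewrite integral0_eq// => z _; rewrite expr0n.
by rewrite /gagliardo integral0_eq// => z _; rewrite subrr normr0 expr0n mul0r.
Qed.

End height_independent.

Section recovery.
Context {R : realType} {n : nat}.
Local Notation leb := (@lebesgue_measure R).
Local Notation lam := (lebesgue_rV R n).
Local Notation space := (Rsplit R n.+1).
Variable omega : set 'rV[R]_n.
Hypothesis omega_open : open omega.
Hypothesis omega_fin : (lam omega < +oo)%E.
Variables (u : 'rV[R]_n -> R) (g : 'rV[R]_n -> 'rV[R]_n).
Hypothesis L2u : L2 lam omega u.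
Hypothesis gradu : is_L2_gradient omega u g.
Hypothesis ap : approx_pair omega u (fun j x => g x ord0 j).
Variables (eps s_ : nat -> R) (s0 : R).
Hypothesis eps0 : forall j, 0 < eps j.
Hypothesis eps_cvg : eps j @[j --> \oo] --> 0.
Hypothesis s0_itv : 2^-1 < s0 < 1.
Hypothesis s_cvg : s_ j @[j --> \oo] --> s0.

Let momega : measurable omega := open_measurable_rV omega_open.
Let limit_value : R := height_cst s0 * (moment1 (n := n) s0 / n%:R * grad_sq omega g).

Lemma height_cst_cvg : height_cst (s_ j) @[j --> \oo] --> height_cst s0.
Proof.
have /andP[s02 s01] := s0_itv.
have c k : k - 2 * s_ j @[j --> \oo] --> k - 2 * s0.
  by apply: cvgB; [exact: cvg_cst|apply: cvgM => //; exact: cvg_cst].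
rewrite /height_cst; apply: cvgM; first exact: cvg_cst.
by apply: cvgV; [rewrite mulf_neq0// gt_eqF//; lra|exact: cvgM].
Qed.

(** [energy_upper] applied to a profile from [approx_energy]; the constants of the
    bound converge with the exponents. *)
Lemma recovery_profile (c : R) : 0 < c -> exists w p (J : nat),
  [/\ taylor2 omega w p, (\int[lam]_(x in omega) `|w x - u x|%:E <= c%:E)%E &
    forall j, (J <= j)%N ->
      (layer_energy omega (eps j) (s_ j) (fun z : space => w z.1) <= (limit_value + c)%:E)%E].
Proof.
move=> c0; have /andP[s02 s01] := s0_itv.
pose M : R := height_cst s0 * (moment1 (n := n) s0 / n%:R).
have M0 : 0 <= M.
  apply: mulr_ge0; first by rewrite divr_ge0// mulr_ge0//; lra.
  by rewrite divr_ge0// fine_ge0// mom_ge0.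
pose d := Num.min c (c / (2 * (M + 1))).
have d0 : 0 < d by rewrite lt_min c0 divr_gt0// mulr_gt0// ltr_wpDl.
have Md : M * d <= c / 2.
  apply: (@le_trans _ _ ((M + 1) * (c / (2 * (M + 1))))).
    by apply: ler_pM => //; [exact: ltW|rewrite lerDl|rewrite ge_min lexx orbT].
  rewrite le_eqVlt; apply/orP; left; apply/eqP; field.
  by rewrite gt_eqF// ltr_wpDl.
have [w [p [tw gp wu]]] := approx_energy omega_open omega_fin L2u gradu ap d0.
pose theta := s0 - 2^-1.
have th01 : 0 < theta <= 1 by rewrite /theta; apply/andP; split; lra.
have th0 : 0 < theta by have /andP[] := th01.
have [C C0 hC] := energy_upper momega omega_fin tw th01.
pose B j : R := height_cst (s_ j) * (moment1 (n := n) (s_ j) / n%:R * grad_int omega p +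
       C * eps j `^ theta * fine (mom n (1 + theta / 2) (n.+1%:R / 2 + s_ j))).
have sgcv : n.+1%:R / 2 + s_ j @[j --> \oo] --> n.+1%:R / 2 + s0.
  by apply: cvgD => //; exact: cvg_cst.
have Bcv : B j @[j --> \oo] --> height_cst s0 * (moment1 (n := n) s0 / n%:R * grad_int omega p +
       C * 0 * fine (mom n (1 + theta / 2) (n.+1%:R / 2 + s0))).
  apply: cvgM; first exact: height_cst_cvg.
  apply: cvgD.
    apply: cvgM; last exact: cvg_cst.
    apply: cvgM; last exact: cvg_cst.
    by apply: fine_mom_cvg => //; rewrite -[n.+1%:R]natr1; lra.
  apply: cvgM.
    by apply: cvgM; [exact: cvg_cst|exact: cvg_powR_base].
  apply: fine_mom_cvg => //; first by lra.
  by rewrite -[n.+1%:R]natr1 /theta; lra.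
have Bl : height_cst s0 * (moment1 (n := n) s0 / n%:R * grad_int omega p +
       C * 0 * fine (mom n (1 + theta / 2) (n.+1%:R / 2 + s0))) < limit_value + c.
  rewrite mulr0 mul0r addr0 mulrA -/M.
  have -> : limit_value = M * grad_sq omega g by rewrite /limit_value mulrA.
  apply: (@le_lt_trans _ _ (M * (grad_sq omega g + d))); first by apply: ler_wpM2l.
  by rewrite mulrDr ltrD2l; apply: le_lt_trans Md _; lra.
have [J _ hJ] : \forall j \near \oo, [/\ B j < limit_value + c, eps j < 1,
    2^-1 + theta / 2 < s_ j & s_ j < 1].
  near=> j; split.
  - by near: j; exact: (cvgr_lt _ Bcv).
  - by near: j; exact: (cvgr_lt _ eps_cvg).
  - by near: j; apply: (cvgr_gt _ s_cvg); rewrite /theta; lra.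
  - by near: j; exact: (cvgr_lt _ s_cvg).
exists w, p, J; split => //.
  by apply: le_trans wu _; rewrite lee_fin ge_min lexx.
move=> j /hJ[Bj ej sj1 sj2]; apply: le_trans (hC _ _ _ sj1 sj2) _.
  by rewrite eps0 ltW.
by rewrite lee_fin ltW.
Unshelve. all: by end_near.
Qed.

(** Diagonal choice of the profiles.  The finitely many first indices, for which
    the exponent may be too far from its limit for [energy_upper] to show that the
    energy is finite, are filled with the zero function. *)
Lemma recovery_sequence : exists u_ : nat -> space -> R,
  [/\ forall j, Hs (s_ j) (@thin R n.+1 omega (eps j)) (u_ j),
      @dimred_cvg R n.+1 omega eps u_ u &
      (limn_esup (fun j => ((eps j `^ (3 - 2 * s_ j))^-1%:E *
        gagliardo (s_ j) (@thin R n.+1 omega (eps j)) (u_ j))%E) <= limit_value%:E)%E].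
Proof.
have /choice [w_ /choice [p_ /choice [J hJ]]] :
    forall m : nat, exists w p (J : nat),
  [/\ taylor2 omega w p, (\int[lam]_(x in omega) `|w x - u x|%:E <= (m.+1%:R^-1 : R)%:E)%E &
    forall j, (J <= j)%N -> (layer_energy omega (eps j) (s_ j)
       (fun z : space => w z.1) <= (limit_value + m.+1%:R^-1)%:E)%E].
  by move=> m; apply: recovery_profile; rewrite invr_gt0.
have [m [mJ minf]] := diagonal_index J.
have mle : \forall j \near \oo, (J (m j) <= j)%N.
  by exists (J 0) => // j /=; exact: mJ.
pose W j x := if (J (m j) <= j)%N then w_ (m j) x else 0.
have WE j : (J (m j) <= j)%N -> W j = w_ (m j).
  by move=> h; apply/funext => x; rewrite /W h.
have W0 j : ~~ (J (m j) <= j)%N -> W j = fun=> 0.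
  by move=> /negbTE h; apply/funext => x; rewrite /W h.
have L2W j : L2 lam omega (W j).
  have [h|h] := boolP (J (m j) <= j)%N; last first.
    rewrite W0//; split; first exact: measurable_cst.
    by rewrite integral0_eq// => x _; rewrite expr0n.
  by rewrite WE//; have [tw _ _] := hJ (m j); exact: taylor2_L2 tw.
have ui : lam.-integrable omega (EFin \o u) by exact: L2_integrable.
have mW j : measurable_fun omega (W j) by have [] := L2W j.
exists (fun j z => W j z.1); split.
- move=> j; have [h|h] := boolP (J (m j) <= j)%N; last by rewrite W0//; exact: zero_Hs.
  apply: flat_Hs => //; rewrite WE//.
  by have [_ _ /(_ _ h) hE] := hJ (m j); apply: le_lt_trans hE _; exact: ltry.
- split.
  + by move=> j; apply: flat_L1loc => //; exact: L2_integrable (L2W j).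
  + exact: flat_L1loc.
  + move=> K Ko cK; have mK := compact_measurable_split cK.
    apply/(@squeeze_cvge _ _ _ _ (fun=> 0%E) _ (fun j => ((m j).+1%:R^-1 : R)%:E)).
    * near=> j; apply/andP; split; first by apply: integral_ge0 => z _; rewrite lee_fin.
      have hj : (J (m j) <= j)%N by near: j; exact: mle.
      have [tw hw _] := hJ (m j); apply: le_trans hw.
      rewrite /rescale /= WE//.
      have mwu : measurable_fun omega (fun x => w_ (m j) x - u x).
        by apply: measurable_funB; [rewrite -WE|exact: L2u.1].
      by have := flat_L1 omega_open mwu mK Ko; exact.
    * exact: cvg_cst.
    * apply: cvg_EFin; first exact: nearW.
      apply/cvgrPdist_lt => d d0; near=> j.
      rewrite /= sub0r normrN ger0_norm// invf_plt ?posrE//.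
      apply: (lt_le_trans (truncnS_gt _)); rewrite ler_nat ltnS.
      by near: j; exact: minf.
- apply: (@EFin_ge_lim _ (fun k => limit_value + k.+1%:R^-1)).
    rewrite -[X in _ --> X]addr0; apply: cvgD; first exact: cvg_cst.
    exact: cvg_harmonic.
  move=> k; apply: limn_esup_le.
  near=> j.
  have hj : (J (m j) <= j)%N by near: j; exact: mle.
  have kj : (k <= m j)%N by near: j; exact: minf.
  have [_ _ /(_ _ hj) hE] := hJ (m j).
  rewrite flat_energy// WE//; apply: le_trans hE _.
  by rewrite lee_fin lerD2l lef_pV2 ?posrE// ler_nat.
Unshelve. all: try by end_near.
Qed.

End recovery.

(** * The Gamma-limit *)

Section liminf_bound.
Context {R : realType} {n : nat}.
Local Notation leb := (@lebesgue_measure R).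
Local Notation lam := (lebesgue_rV R n).
Local Notation space := (Rsplit R n.+1).
Variable omega : set 'rV[R]_n.
Hypothesis omega_open : open omega.
Hypothesis omega_fin : (lam omega < +oo)%E.
Variables (u : 'rV[R]_n -> R) (g : 'rV[R]_n -> 'rV[R]_n).
Hypothesis L2u : L2 lam omega u.
Hypothesis gradu : is_L2_gradient omega u g.
Variables (eps s_ : nat -> R) (s0 : R).
Hypothesis eps0 : forall j, 0 < eps j.
Hypothesis eps_cvg : eps j @[j --> \oo] --> 0.
Hypothesis s0_itv : 2^-1 < s0 < 1.
Hypothesis s_cvg : s_ j @[j --> \oo] --> s0.

Let momega : measurable omega := open_measurable_rV omega_open.

(** The L^1 convergence on the compact product of [K] with an interval of heights,
    written slice by slice. *)
Lemma dimred_slice_dist (u_ : nat -> space -> R) : @dimred_cvg R n.+1 omega eps u_ u ->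
  forall K (kappa : R), compact K -> K `<=` omega -> 0 < kappa ->
  (\int[leb]_(t in `]kappa, (1 - kappa)%R[)
     slice_dist K (layer omega (eps j) (u_ j)) u t)%E @[j --> \oo] --> 0%E.
Proof.
move=> [ru _ cv] K kappa cK Ko k0.
have mK : measurable K.
  by apply: closed_measurable_rV; exact: compact_closed (@hausdorff_rV R n) cK.
pose I : set R := `[kappa, 1 - kappa]%classic.
have KI : K `*` I `<=` @thin R n.+1 omega 1.
  move=> [x t] [/= Kx]; rewrite /I /= in_itv /= => /andP[t1 t2].
  split; first exact: Ko.
  by rewrite /= in_itv /=; apply/andP; split; lra.
have cKI : compact (K `*` I : set space).
  by apply: compact_setX => //; exact: segment_compact.
have mI : measurable (I : set (measurableTypeR R)) by exact: measurable_itv.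
apply: (squeeze_cvge _ _ (cv _ KI cKI)); last exact: cvg_cst.
apply: nearW => j; apply/andP; split.
  by apply: integral_ge0 => t _; exact: slice_dist_ge0.
have mv : measurable_fun setT (layer omega (eps j) (u_ j)).
  by apply: measurable_layer => //; have [] := ru j.
pose u' := u \_ omega.
have mu' : measurable_fun setT u' by apply/(measurable_restrictT u momega); exact: L2u.1.
pose F (z : space) : \bar R := `|layer omega (eps j) (u_ j) z - u' z.1|%:E.
have mF : measurable_fun setT F.
  apply/measurable_EFinP; apply: measurableT_comp => //; apply: measurable_funB => //.
  exact: (measurableT_comp mu' measurable_fst).
have F0 z : (0 <= F z)%E by rewrite lee_fin.
have -> : (\int[lebesgue_split R n.+1]_(z in K `*` I) `|rescale (eps j) (u_ j) z - u z.1|%:E =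
  \int[leb]_(t in I) \int[lam]_(x in K) F (x, t))%E.
  rewrite -integral_rect//; apply: eq_integral => z; rewrite inE => zK.
  have zt := KI z zK; rewrite /F /layer /u' !patchE mem_set// mem_set//.
  by case: zt.
apply: (@le_trans _ _ (\int[leb]_(t in `]kappa, (1 - kappa)%R[) \int[lam]_(x in K) F (x, t))%E).
  rewrite le_eqVlt; apply/orP; left; apply/eqP; apply: eq_integral => t _.
  apply: eq_integral => x; rewrite inE => xK.
  by rewrite /F /u' patchE mem_set//; exact: Ko.
apply: ge0_subset_integral => //.
- have := measurable_slice_dist mK mv (measurable_funTS mu' : measurable_fun K u').
  by move=> /(measurable_funS measurableT (@subsetT _ I)).
- by move=> t _; apply: integral_ge0 => x _; exact: F0.
- by move=> t /=; rewrite /I /= !in_itv /= => /andP[/ltW -> /ltW ->].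
Qed.

Lemma liminf_bound (u_ : nat -> space -> R) :
  (forall j, Hs (s_ j) (@thin R n.+1 omega (eps j)) (u_ j)) ->
  @dimred_cvg R n.+1 omega eps u_ u ->
  ((height_cst s0 * (moment1 (n := n) s0 / n%:R * grad_sq omega g))%:E <=
   limn_einf (fun j => ((eps j `^ (3 - 2 * s_ j))^-1%:E *
        gagliardo (s_ j) (@thin R n.+1 omega (eps j)) (u_ j))%E))%E.
Proof.
move=> hs du; have vc := dimred_slice_dist du.
have mv j : measurable_fun setT (layer omega (eps j) (u_ j)).
  by apply: measurable_layer => //; have [ru _ _] := du; have [] := ru j.
have ui : lam.-integrable omega (EFin \o u) by exact: L2_integrable.
have -> : (fun j => ((eps j `^ (3 - 2 * s_ j))^-1%:E *
        gagliardo (s_ j) (@thin R n.+1 omega (eps j)) (u_ j))%E) =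
   (fun j => layer_energy omega (eps j) (s_ j) (layer omega (eps j) (u_ j))).
  apply/funext => j; have [[mu _] _] := hs j.
  exact: (energy_layer (s_ j) (eps0 j) momega mu).

exact: (liminf_dirichlet omega_open eps0 eps_cvg s0_itv s_cvg mv ui vc omega_fin gradu).
Qed.

End liminf_bound.

Section constants.
Context {R : realType} {n : nat}.
Local Notation lam := (lebesgue_rV R n).
Variable omega : set 'rV[R]_n.
Hypothesis omega_open : open omega.
Variables (u : 'rV[R]_n -> R).
Hypothesis huv : H1 omega u.
Let g := weak_gradient omega u.

Let momega : measurable omega := open_measurable_rV omega_open.

Lemma enorm_sqr (x : 'rV[R]_n) : enorm x ^+ 2 = dot x x.
Proof. by rewrite sqr_sqrtr// dot_ge0. Qed.

Lemma weak_gradientP : is_L2_gradient omega u g.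
Proof. exact: getPex huv.2. Qed.

Lemma dirichletE : dirichlet omega u = (grad_sq omega g)%:E.
Proof.
have ig i : lam.-integrable omega (EFin \o (fun x => g x ord0 i ^+ 2)).
  exact: L2_integrable_sqr (weak_gradientP.1 i).
rewrite /dirichlet /grad_sq -(Rintegral_sum _ momega ig) EFin_Rintegral//.
  by apply: eq_integral => x _; rewrite enorm_sqr /dot; under eq_bigr do rewrite -expr2.
by apply: (@integrable_sumr _ _ _ _ _ _ _ (fun i x => g x ord0 i ^+ 2)).
Qed.

(** Of the constant of the heights, [2 / (2 - 2 s0)] is the factor in front of K
    and [1 / (3 - 2 s0)] is part of K. *)
Lemma KconstE (s0 : R) : (0 < n)%N -> 2^-1 < s0 < 1 ->
  ((1 - s0)^-1%:E * Kconst s0 n.+1 = (height_cst s0 * (moment1 (n := n) s0 / n%:R))%:E)%E.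
Proof.
move=> n0 /andP[s02 s01].
have -> : Kconst s0 n.+1 = (((3 - 2 * s0) * n%:R)^-1 * moment1 (n := n) s0)%:E.
  rewrite /Kconst EFinM; congr (_ * _)%E; rewrite /moment1 fineK; last first.
    by rewrite ge0_fin_numE ?mom_ge0// mom_fin// -[n.+1%:R]natr1; lra.
  apply: eq_integral => x _; rewrite enorm_sqr.
  rewrite powRr1 ?dot_ge0// /ker expr1n [1 + _]addrC; reflexivity.
have n1 : (0 : R) < n%:R by rewrite ltr0n.
have a1 : 0 < 1 - s0 by lra.
have a2 : 0 < 3 - 2 * s0 by lra.
have a3 : 0 < 2 - 2 * s0 by lra.
rewrite -EFinM /height_cst; congr EFin; field.
by rewrite (gt_eqF n1) (gt_eqF a1) (gt_eqF a2) (gt_eqF a3).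
Qed.

End constants.

Theorem theorem4p4 (R : realType) (d : nat) (hd : (2 <= d)%N)
    (omega : set 'rV[R]_d.-1) (omega_bounded : bounded_set omega)
    (omega_connected : connected omega) (omega_open : open omega)
    (omega_lipschitz : lipschitz_boundary omega)
    (s : R -> R) (s01 : forall eps, 0 < eps -> 0 < s eps < 1)
    (s0 : R) (hs0 : 2^-1 < s0 < 1)
    (s_cvg : s eps @[eps --> 0^'+] --> s0)
    (u : 'rV[R]_d.-1 -> R) (hu : H1 omega u) :
  gamma_limit_at
    (fun eps => @Hs R d (s eps) (thin omega eps))
    (fun eps w => ((eps `^ (3 - 2 * s eps))^-1%:E *
                   gagliardo (s eps) (thin omega eps) w)%E)
    (dimred_cvg omega) u
    ((1 - s0)^-1%:E * Kconst s0 d * dirichlet omega u)%E.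
Proof.
case: d hd omega omega_bounded omega_connected omega_open omega_lipschitz u hu => // n n1.
rewrite /= => omega obd _ oo olip u hu.
have n0 : (0 < n)%N by [].
have cl : compact (closure omega).
  have [M [_ hM]] := obd; have cB := @compact_ball_rV R n (0 : 'rV[R]_n) (`|M| + 1).
  apply: (subclosed_compact (@closed_closure _ omega) cB).
  have clB := compact_closed (@hausdorff_rV R n) cB.
  rewrite [X in _ `<=` X]((closure_id _).1 clB); apply: closureS => x ox /=.
  by rewrite sub0r normrN; apply: hM ox; rewrite ltr_pwDr// ler_norm.
have omega_fin : (lebesgue_rV R n omega < +oo)%E.
  apply: le_lt_trans (compact_lebesgue_fin cl).
  apply: le_measure; rewrite ?inE; last exact: subset_closure.
    exact: open_measurable_rV.
  by apply: closed_measurable_rV; exact: closed_closure.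
have L2u := hu.1; have gradu := weak_gradientP hu.
have ap : approx_pair omega u (fun j x => weak_gradient omega u x ord0 j).
  apply: (H1_approx_pair oo omega_fin L2u gradu cl) => x cx.
  have [ox|nox] := pselect (omega x); first exact: inward_cone_interior.
  apply: (inward_cone_boundary olip); split => //.
  by move=> /interior_subset.
move=> eps e0 ecv; have scv := cvg_eps_at_right e0 ecv s_cvg.
rewrite (KconstE n0 hs0) (dirichletE oo hu) -EFinM -mulrA.
split=> [u_ hs du|].
  exact: (liminf_bound oo omega_fin L2u gradu e0 ecv hs0 scv hs du).
exact: (recovery_sequence oo omega_fin L2u gradu ap e0 ecv hs0 scv).
Qed.
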